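(* Let $N\ge 1$ and $q>N$ be integers. Let $D_1,\dots,D_q$ be hypersurfaces in $\mathbb{P}^N(\mathbb{C})$ in general position, of degrees $d_1,\dots,d_q$ respectively, and let $Q_j$ be a homogeneous polynomial of degree $d_j$ defining $D_j$, $j=1,\dots,q$. Assume that $n=\mathrm{lcm}(d_1,\dots,d_q)>1$ and that $\sum_{j=1}^{q}Q_j^{n/d_j}\not\equiv 0$. Let $D_{q+1}=\{z\in\mathbb{P}^N(\mathbb{C}): \sum_{j=1}^{q}Q_j^{n/d_j}(z)=0\}$ be the hypersurface of degree $n$ defined by the homogeneous polynomial $\sum_{j=1}^{q}Q_j^{n/d_j}$. Let $f:\mathbb{C}\to\mathbb{P}^N(\mathbb{C})$ be an algebraically nondegenerate holomorphic curve. Then $$\Big\|\quad T_f(r)\le \sum_{j=1}^{q}\frac{1}{d_j}N_f^{q-1}(r,D_j)+\frac{1}{n}N_f^{q-1}(r,D_{q+1})+o(T_f(r)).$$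
   Context: A holomorphic curve $f:\mathbb{C}\to\mathbb{P}^N(\mathbb{C})$ is written in a reduced representation $f=(f_0:\dots:f_N)$, where the $f_i$ are entire functions without common zeros, and $\|f(z)\|=\max\{|f_0(z)|,\dots,|f_N(z)|\}$. The characteristic function is $$T_f(r)=\frac{1}{2\pi}\int_0^{2\pi}\log\|f(re^{i\theta})\|\,d\theta,$$ which is independent of the reduced representation up to an additive constant. The curve $f$ is algebraically nondegenerate if its image is not contained in any proper algebraic subset of $\mathbb{P}^N(\mathbb{C})$. Let $D$ be a hypersurface defined by a homogeneous polynomial $Q$ with $Q(f)=Q(f_0,\dots,f_N)\not\equiv0$. For a positive integer $M$, $n_f^{M}(r,D)$ is the number of zeros of $Q(f)$ in $|z|<r$, where a zero of order $m$ is counted $\min(m,M)$ times, and $$N_f^{M}(r,D)=\int_0^r\frac{n_f^{M}(t,D)-n_f^{M}(0,D)}{t}\,dt+n_f^{M}(0,D)\log r ,$$ where $n_f^M(0,D)$ denotes the contribution of the point $z=0$, i.e. $\min(\mathrm{ord}_0 Q(f),M)$. Hypersurfaces $D_1,\dots,D_q$ ($q>N$) in $\mathbb{P}^N(\mathbb{C})$ are in general position if for any distinct $i_1,\dots,i_{N+1}\in\{1,\dots,q\}$ one has $\bigcap_{k=1}^{N+1}\mathrm{supp}\,D_{i_k}=\varnothing$. The symbol $\|$ before an inequality means that it holds for all $r\in[0,+\infty)$ outside a set of finite Lebesgue measure; $o(T_f(r))$ is understood as $r\to\infty$. *)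

(* Defs.v *)
From HB Require Import structures.
From mathcomp Require Import all_boot all_order all_algebra.
From mathcomp Require Import complex.
(* Its notations clash with those of mathcomp-analysis. *)
From mathcomp Require Import -(notations) mpoly.
From mathcomp Require Import all_classical all_reals all_analysis.

Set Implicit Arguments.
Unset Strict Implicit.
Unset Printing Implicit Defensive.

Import Order.TTheory GRing.Theory Num.Theory.
Import numFieldNormedType.Exports.

Local Open Scope classical_set_scope.
Local Open Scope ring_scope.

(* Packed as a numClosedFieldType, so that the topology and the norm that
   mathcomp-analysis puts on every numFieldType are inferred on it. *)
Definition Cplx (R : realType) : numClosedFieldType :=
  (complex R : numClosedFieldType).

(* The modulus with values in R; the generic norm of a numFieldType takes its
   values in the field itself. *)
Definition cabs (R : realType) (z : Cplx R) : R := ComplexField.Normc.normc z.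

Definition entire (R : realType) (g : Cplx R -> Cplx R) : Prop :=
  forall z, derivable (g : (Cplx R)^o -> (Cplx R)^o) z 1.

(* For g entire and not identically zero exactly one m qualifies; otherwise the
   value is irrelevant. *)
Definition zero_order (R : realType) (g : Cplx R -> Cplx R) (z : Cplx R) : nat :=
  xget 0%N [set m : nat | exists h : Cplx R -> Cplx R,
    [/\ entire h, h z != 0 & forall w, g w = (w - z) ^+ m * h w]].

Notation hpoly R N := (mpoly N.+1 (Cplx R)).

(* This is the predicate written "p \is d.-homog" in mpoly. *)
Definition homogeneous (R : realType) (N d : nat) (P : hpoly R N) : Prop :=
  P \is ishomog1 d (@mdeg N.+1).

(* A point of P^N(C) is represented by its homogeneous coordinates, i.e. by any
   vector of C^(N+1) satisfying is_point. *)
Notation coords R N := ('I_N.+1 -> Cplx R).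

Definition is_point (R : realType) (N : nat) (x : coords R N) : Prop :=
  exists i, x i != 0.

Definition zero_locus (R : realType) (N : nat) (S : set (hpoly R N)) :
    set (coords R N) :=
  [set x | is_point x /\ forall P, S P -> meval x P = 0].

Definition algebraic_subset (R : realType) (N : nat) (V : set (coords R N)) :
    Prop :=
  exists2 S : set (hpoly R N),
    forall P, S P -> exists d : nat, homogeneous d P
    & V = zero_locus S.

Definition proj_space (R : realType) (N : nat) : set (coords R N) :=
  [set x | is_point x].

(* A hypersurface is given by its defining form Q, of degree d. *)
Definition hypersurface (R : realType) (N d : nat) (Q : hpoly R N) : Prop :=
  [/\ (0 < d)%N, Q != 0 & homogeneous d Q].

Definition supp (R : realType) (N : nat) (Q : hpoly R N) : set (coords R N) :=
  zero_locus [set Q].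

Definition general_position (R : realType) (N q : nat)
    (Q : 'I_q -> hpoly R N) : Prop :=
  forall i : 'I_N.+1 -> 'I_q, injective i ->
    \bigcap_(k in [set: 'I_N.+1]) supp (Q (i k)) = set0.

(* A holomorphic curve is given by a reduced representation (f_0 : ... : f_N),
   with f_i = fun z => f z i. *)
Definition holomorphic_curve (R : realType) (N : nat)
    (f : Cplx R -> coords R N) : Prop :=
  (forall i, entire (fun z => f z i)) /\ (forall z, is_point (f z)).

Definition algebraically_nondegenerate (R : realType) (N : nat)
    (f : Cplx R -> coords R N) : Prop :=
  forall V : set (coords R N),
    algebraic_subset V -> V `<` @proj_space R N -> ~ (range f `<=` V).

Definition curve_norm (R : realType) (N : nat) (f : Cplx R -> coords R N)
    (z : Cplx R) : R :=
  \big[Num.max/0]_(i < N.+1) cabs (f z i).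

Definition characteristic (R : realType) (N : nat) (f : Cplx R -> coords R N)
    (r : R) : R :=
  (2 * pi)^-1 *
  \int[lebesgue_measure]_(t in `[0, 2 * pi])
    ln (curve_norm f (Complex (r * cos t) (r * sin t))).

(* The sum has finite support when g is entire and not identically zero. *)
Definition trunc_count (R : realType) (M : nat) (g : Cplx R -> Cplx R) (r : R) :
    R :=
  \sum_(z \in [set z : Cplx R | cabs z < r]) ((minn (zero_order g z) M)%:R : R).

Definition trunc_count0 (R : realType) (M : nat) (g : Cplx R -> Cplx R) : R :=
  (minn (zero_order g 0) M)%:R.

Definition trunc_counting (R : realType) (N M : nat) (f : Cplx R -> coords R N)
    (Q : hpoly R N) (r : R) : R :=
  let g := fun z => meval (f z) Q in
  \int[lebesgue_measure]_(t in `[0, r])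
    ((trunc_count M g t - trunc_count0 M g) / t)
  + trunc_count0 M g * ln r.

Definition lcm_degrees (q : nat) (d : 'I_q -> nat) : nat :=
  \big[lcmn/1%N]_(j < q) d j.

Definition sum_form (R : realType) (N q : nat) (d : 'I_q -> nat)
    (Q : 'I_q -> hpoly R N) : hpoly R N :=
  \sum_(j < q) Q j ^+ (lcm_degrees d %/ d j).

Definition little_o_at_infinity (R : realType) (h T : R -> R) : Prop :=
  forall eps : R, 0 < eps -> \forall r \near +oo, `|h r| <= eps * `|T r|.

(* The inequality A(r) <= B(r) + o(T(r)) preceded by the symbol "||". *)
Definition le_outside_finite_measure (R : realType) (A B T : R -> R) : Prop :=
  exists E : set R, [/\ measurable E, (lebesgue_measure E < +oo)%E &
    exists2 h : R -> R, little_o_at_infinity h T &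
      forall r, 0 <= r -> ~ E r -> A r <= B r + h r].

(* Main.v *)
Require Import Defs.
From mathcomp Require Import all_boot all_order all_algebra.
From mathcomp Require Import complex perm.
From mathcomp Require Import -(notations) mpoly.
From mathcomp Require Import all_classical all_reals all_analysis.
From mathcomp Require Import measurable_realfun ring lra.
Import Order.TTheory GRing.Theory Num.Theory.
Import numFieldNormedType.Exports.
Local Open Scope classical_set_scope.
Local Open Scope ring_scope.
Set Implicit Arguments.
Unset Strict Implicit.
Unset Printing Implicit Defensive.

(** Write [v_j = Q_j ^ (n / d_j)] and [u_j = v_j (f)], and add [u_(q+1)], the sum of the
    [u_j].  General position and the Nullstellensatz give [|x|^n <= C max_j |v_j x|] as
    soon as [j] ranges over at least N+1 indices, and a count of monomials shows that N
    forms in N+1 variables have a common zero, so that every relation between the [u_j],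
    [j <= q], involves more than N+1 of them.  Hence there is a minimally dependent subfamily
    of the [u_j], [j <= q+1], with at most q+1 members, more than N of which have [j <= q],
    and the theorem follows from Cartan's second main theorem for minimally dependent
    families [g_0, ..., g_(m+1)] of entire functions without common zeros: outside a set of
    finite measure the mean of [ln max |g_i|] over the circle of radius r is at most the sum
    of the counting functions of the [g_i], truncated at m, plus [O (ln T)].

    Cartan's theorem compares the product of the [g_i] with the Wronskian of all but one of
    them, which up to a constant does not depend on the omitted function: the truncation is
    the order of the Wronskian at the zeros of the [g_i], and the quotient is a determinant of
    iterated logarithmic derivatives of the [g_i / g_0].  These are estimated without the
    Poisson kernel.  With [X = ln |A|^2] and [Y = ln |B|^2], the circle means of
    [sqrt (1 + (X - Y)^2) + X + Y] form a convex function of [ln r] whose second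
    derivative controls the mean of the squared modulus of [A'/A - B'/B], and a monotone
    function with values in [-1, 0] has derivative at most 1 outside a set of finite measure. *)

(** * Entire functions *)

(** The working coordinate is [w = s + i t] with [z = exp w]: circles become vertical segments,
    Cauchy's theorem says that means of periodic entire functions over them do not depend on [s],
    and the second derivative in [s] of a circle mean is the mean of the Laplacian. The function
    [sqrt (1 + (X - Y)^2) + X + Y] lies between [2 max (X, Y)] and [1 + 2 max (X, Y)], so its mean
    is controlled by the characteristic function, while for harmonic [X] and [Y] its Laplacian is
    [|grad (X - Y)|^2 / S^3], [S] being the root; the factor [S^3] costs only a logarithm. The
    obstacle is the zeros of [A] and [B]: derivatives are taken on circles that avoid them, and
    monotonicity across the other circles comes from a regularisation. Two derivatives have to be
    bounded, so the growth lemma is used twice. The level of truncation is the size of the dependent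
    family: at most q + 1 functions have Wronskians of at most q functions, with derivatives up to
    order q - 1. The error [ln T] is small against T because T_f grows at least like [ln r]. *)

Section ComplexBasics.
Variable R : realType.
Local Notation C := (Cplx R).
Implicit Types (z w : C).

Lemma Cplx_eqP z w : complex.Re z = complex.Re w -> complex.Im z = complex.Im w -> z = w.
Proof. by case: z => a b; case: w => c d /= -> ->. Qed.

Lemma cplxReD z w : complex.Re (z + w : C) = complex.Re z + complex.Re w.
Proof. by case: z; case: w. Qed.

Lemma cplxImD z w : complex.Im (z + w : C) = complex.Im z + complex.Im w.
Proof. by case: z; case: w. Qed.

Lemma cplxReN z : complex.Re (- z : C) = - complex.Re z.
Proof. by case: z. Qed.

Lemma cplxImN z : complex.Im (- z : C) = - complex.Im z.
Proof. by case: z. Qed.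

Lemma cplxReM z w : complex.Re (z * w : C) = complex.Re z * complex.Re w - complex.Im z * complex.Im w.
Proof. by case: z; case: w. Qed.

Lemma cplxImM z w : complex.Im (z * w : C) = complex.Re z * complex.Im w + complex.Im z * complex.Re w.
Proof. by case: z; case: w. Qed.

Definition cplxE := (cplxReD, cplxImD, cplxReN, cplxImN, cplxReM, cplxImM).

Lemma cabs_sqr z : cabs z ^+ 2 = complex.Re z ^+ 2 + complex.Im z ^+ 2.
Proof. case: z => a b /=; rewrite /cabs /= sqr_sqrtr // addr_ge0 ?sqr_ge0 //. Qed.

Lemma cabs_ge0 z : 0 <= cabs z.
Proof. by case: z => a b; rewrite /cabs /= sqrtr_ge0. Qed.

Lemma cabsM z w : cabs (z * w) = cabs z * cabs w.
Proof. exact: ComplexField.Normc.normcM. Qed.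

Lemma cabs0 : cabs (0 : C) = 0.
Proof. exact: ComplexField.Normc.normc0. Qed.

Lemma cabs1 : cabs (1 : C) = 1.
Proof. exact: ComplexField.Normc.normc1. Qed.

Lemma cabsV z : cabs z^-1 = (cabs z)^-1.
Proof. exact: ComplexField.Normc.normcV. Qed.

Lemma cabs_eq0 z : (cabs z == 0) = (z == 0).
Proof.
apply/eqP/eqP => [/ComplexField.Normc.eq0_normc //|->]; exact: cabs0.
Qed.

Lemma cabs_gt0 z : (0 < cabs z) = (z != 0).
Proof. by rewrite lt0r cabs_ge0 andbT cabs_eq0. Qed.

Lemma cabsX z n : cabs (z ^+ n) = cabs z ^+ n.
Proof. by elim: n => [|n IH]; rewrite ?expr0 ?cabs1 // !exprS cabsM IH. Qed.

Lemma cabsN z : cabs (- z) = cabs z.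
Proof. by case: z => a b; rewrite /cabs /= !sqrrN. Qed.

Lemma cabs_triangle z w : cabs (z + w) <= cabs z + cabs w.
Proof. exact: le_normcD. Qed.

Lemma cabs_distC z w : cabs (z - w) = cabs (w - z).
Proof. by rewrite -cabsN opprB. Qed.

Lemma cabs_triangleB z w : cabs (z - w) <= cabs z + cabs w.
Proof. by rewrite -(cabsN w); exact: cabs_triangle. Qed.

Lemma cabs_sub_le z w : cabs z - cabs w <= cabs (z - w).
Proof. by rewrite lerBlDr (le_trans _ (cabs_triangle _ _)) // subrK. Qed.

Lemma cabs_dist z w : `|cabs z - cabs w| <= cabs (z - w).
Proof.
rewrite ler_norml cabs_sub_le andbT lerNl opprB cabs_distC; exact: cabs_sub_le.
Qed.

Lemma cabs_real (x : R) : cabs (Complex x 0 : C) = `|x|.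
Proof. by rewrite /cabs /= expr0n addr0 sqrtr_sqr. Qed.

Lemma Re_le_cabs z : `|complex.Re z| <= cabs z.
Proof.
case: z => a b; rewrite /cabs /= -sqrtr_sqr ler_wsqrtr // lerDl sqr_ge0 //.
Qed.

Lemma Im_le_cabs z : `|complex.Im z| <= cabs z.
Proof.
case: z => a b; rewrite /cabs /= -sqrtr_sqr ler_wsqrtr // lerDr sqr_ge0 //.
Qed.

Lemma cabs_le_ReIm z : cabs z <= `|complex.Re z| + `|complex.Im z|.
Proof.
rewrite -(ler_pXn2r (n := 2)) // ?nnegrE ?cabs_ge0 ?addr_ge0 //.
rewrite cabs_sqr sqrrD !real_normK ?num_real //.
have : 0 <= `|complex.Re z| * `|complex.Im z| by rewrite mulr_ge0.
rewrite mulr2n => h.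
lra.
Qed.

Lemma cabs_sum (I : Type) (r : seq I) (P : pred I) (F : I -> C) :
  cabs (\sum_(i <- r | P i) F i) <= \sum_(i <- r | P i) cabs (F i).
Proof.
elim/big_rec2: _ => [|i y x _ h]; first by rewrite cabs0.
by rewrite (le_trans (cabs_triangle _ _)) // lerD2l.
Qed.

Lemma cabs_prod (I : Type) (r : seq I) (P : pred I) (F : I -> C) :
  cabs (\prod_(i <- r | P i) F i) = \prod_(i <- r | P i) cabs (F i).
Proof.
elim/big_rec2: _ => [|i y x _ h]; first by rewrite cabs1.
by rewrite cabsM h.
Qed.

Lemma cabs_natr (n : nat) : cabs (n%:R : C) = n%:R.
Proof.
have -> : (n%:R : C) = Complex (n%:R : R) 0.
  elim: n => [|n IH] //; rewrite !mulrS IH; apply: Cplx_eqP; rewrite cplxE /=; ring.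
by rewrite cabs_real normr_nat.
Qed.

Lemma norm_cabs z : `|z| = Complex (cabs z) 0 :> C.
Proof. by []. Qed.

Lemma cplx_lt (x y : R) : ((Complex x 0 : C) < Complex y 0) = (x < y).
Proof. by rewrite ltcE /= eqxx. Qed.

Lemma cplx_le (x y : R) : ((Complex x 0 : C) <= Complex y 0) = (x <= y).
Proof. by rewrite lecE /= eqxx. Qed.

Lemma cplx_gt0 z : 0 < z -> z = Complex (complex.Re z) 0 /\ 0 < complex.Re z.
Proof. by case: z => a b; rewrite ltcE /= => /andP[/eqP -> ->]. Qed.

(** The error is measured by the real modulus [cabs]; [derivable] measures it by a norm with values
    in the complex field, which is awkward for real estimates. *)
Definition cderiv (g : C -> C) (z c : C) : Prop :=
  forall e : R, 0 < e -> exists2 d : R, 0 < d &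
    forall h, cabs h < d -> cabs (g (z + h) - g z - c * h) <= e * cabs h.

Lemma is_derive_cderiv (g : C -> C) (z c : C) :
  is_derive (z : C^o) 1 (g : C^o -> C^o) c <-> cderiv g z c.
Proof.
have hE l h : h != 0 :> C ->
   h^-1 * (g (z + h) - g z) - l = h^-1 * (g (z + h) - g z - l * h).
  by move=> h0; rewrite [RHS]mulrBr (mulrC l) mulKf.
split.
- case=> dg <- e e0.
  move: dg => /cvg_ex [l hl].
  have -> : 'D_1 (g : C^o -> C^o) z = l by exact/cvg_lim.
  move/cvgrPdist_le: hl => /(_ (Complex e 0)).
  rewrite cplx_lt => /(_ e0) [] /= r /cplx_gt0 [-> r0] hr.
  exists (complex.Re r) => // h hh.
  have [->|h0] := eqVneq h 0.
    by rewrite mulr0 subr0 addr0 subrr !cabs0 mulr0.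
  have := hr h; rewrite /ball_ /= sub0r normrN norm_cabs cplx_lt => /(_ hh h0).
  rewrite norm_cabs cplx_le -cabsN opprB /GRing.scale /= mulr1 (addrC h).
  rewrite hE // cabsM cabsV ler_pdivrMl ?cabs_gt0 //.
  by rewrite (mulrC e).
- move=> H.
  suff hl : (fun h : C => h^-1 *: ((g : C^o -> C^o) (h *: 1 + z) - g z)) @ 0^' --> (c : C^o).
    split; [by apply/cvg_ex; exists c| exact/cvg_lim].
  apply/cvgrPdist_le => e /cplx_gt0 [-> e0].
  have [d d0 hd] := H _ e0.
  exists (Complex d 0); first by rewrite /= cplx_lt.
  move=> h /=; rewrite sub0r normrN norm_cabs cplx_lt => hh h0.
  rewrite norm_cabs cplx_le -cabsN opprB /GRing.scale /= mulr1 (addrC h).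
  rewrite hE // cabsM cabsV ler_pdivrMl ?cabs_gt0 //.
  by rewrite [leRHS]mulrC; exact: hd.
Qed.

Lemma is_derive_epsdelta (f : R -> R) (x c : R) :
  is_derive x 1 f c <-> forall e : R, 0 < e -> exists2 d : R, 0 < d &
    forall h, `|h| < d -> `|f (x + h) - f x - c * h| <= e * `|h|.
Proof.
have hE l h : h != 0 :> R ->
   h^-1 * (f (x + h) - f x) - l = h^-1 * (f (x + h) - f x - l * h).
  by move=> h0; rewrite [RHS]mulrBr (mulrC l) mulKf.
split.
- case=> dg <- e e0.
  move: dg => /cvg_ex [l hl].
  have -> : 'D_1 f x = l by exact/cvg_lim.
  move/cvgrPdist_le: hl => /(_ e e0) [] /= r r0 hr.
  exists r => // h hh.
  have [->|h0] := eqVneq h 0.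
    by rewrite mulr0 subr0 addr0 subrr !normr0 mulr0.
  have := hr h; rewrite /ball_ /= sub0r normrN => /(_ hh h0).
  rewrite -normrN opprB /GRing.scale /= mulr1 (addrC h).
  rewrite hE // normrM normfV ler_pdivrMl ?normr_gt0 //.
  by rewrite (mulrC e).
- move=> H.
  suff hl : (fun h : R => h^-1 *: (f (h *: 1 + x) - f x)) @ 0^' --> c.
    split; [by apply/cvg_ex; exists c| exact/cvg_lim].
  apply/cvgrPdist_le => e e0.
  have [d d0 hd] := H _ e0.
  exists d => //.
  move=> h /=; rewrite sub0r normrN => hh h0.
  rewrite -normrN opprB /GRing.scale /= mulr1 (addrC h).
  rewrite hE // normrM normfV ler_pdivrMl ?normr_gt0 //.
  by rewrite [leRHS]mulrC; exact: hd.
Qed.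

Definition cder (g : C -> C) : C -> C := fun z => 'D_1 (g : C^o -> C^o) z.

Lemma entireP (g : C -> C) : entire g -> forall z, cderiv g z (cder g z).
Proof. by move=> h z; apply/is_derive_cderiv; split => //; exact: h. Qed.

Lemma entire_of_cderiv (g : C -> C) (g' : C -> C) :
  (forall z, cderiv g z (g' z)) -> entire g /\ cder g = g'.
Proof.
move=> h; split; first by move=> z; have /is_derive_cderiv[] := h z.
by apply/funext => z; have /is_derive_cderiv[] := h z.
Qed.

Lemma cderivD f g z a b : cderiv f z a -> cderiv g z b ->
  cderiv (fun w => f w + g w) z (a + b).
Proof.
move=> /is_derive_cderiv ha /is_derive_cderiv hb.
exact: (proj1 (is_derive_cderiv _ _ _) (is_deriveD ha hb)).
Qed.

Lemma cderivM f g z a b : cderiv f z a -> cderiv g z b ->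
  cderiv (fun w => f w * g w) z (a * g z + f z * b).
Proof.
move=> /is_derive_cderiv ha /is_derive_cderiv hb.
have := proj1 (is_derive_cderiv _ _ _) (is_deriveM ha hb).
by rewrite /GRing.scale /= addrC (mulrC a).
Qed.

Lemma cderiv_cst (a z : C) : cderiv (fun=> a) z 0.
Proof.
move=> e e0; exists 1 => // h _; rewrite subrr mul0r subr0 cabs0 mulr_ge0 ?cabs_ge0 //.
exact: ltW.
Qed.

Lemma cderiv_id z : cderiv (fun w => w) z 1.
Proof.
move=> e e0; exists 1 => // h _; rewrite (addrC z) addrK mul1r subrr cabs0 mulr_ge0 ?cabs_ge0 //.
exact: ltW.
Qed.

Lemma entire_cst (a : C) : entire (fun=> a).
Proof. by apply: (proj1 (entire_of_cderiv (g' := fun=> 0) _)) => z; exact: cderiv_cst. Qed.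

Lemma entire_id : entire (fun w : C => w).
Proof. by apply: (proj1 (entire_of_cderiv (g' := fun=> 1) _)) => z; exact: cderiv_id. Qed.

Lemma entireD (f g : C -> C) : entire f -> entire g -> entire (fun w => f w + g w).
Proof.
move=> hf hg; apply: (proj1 (entire_of_cderiv _)) => z.
by apply: cderivD; exact: entireP.
Qed.

Lemma entireM (f g : C -> C) : entire f -> entire g -> entire (fun w => f w * g w).
Proof.
move=> hf hg; apply: (proj1 (entire_of_cderiv _)) => z.
by apply: cderivM; exact: entireP.
Qed.

Lemma cderD (f g : C -> C) : entire f -> entire g ->
  cder (fun w => f w + g w) = fun z => cder f z + cder g z.
Proof.
move=> hf hg; apply: (proj2 (entire_of_cderiv _)) => z.
by apply: cderivD; exact: entireP.
Qed.

Lemma cderM (f g : C -> C) : entire f -> entire g ->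
  cder (fun w => f w * g w) = fun z => cder f z * g z + f z * cder g z.
Proof.
move=> hf hg; apply: (proj2 (entire_of_cderiv _)) => z.
by apply: cderivM; exact: entireP.
Qed.

Lemma cder_cst (a : C) : cder (fun=> a) = fun=> 0.
Proof. by apply: (proj2 (entire_of_cderiv _)) => z; exact: cderiv_cst. Qed.

Lemma cder_id : cder (fun w : C => w) = fun=> 1.
Proof. by apply: (proj2 (entire_of_cderiv _)) => z; exact: cderiv_id. Qed.

Lemma entireZ (a : C) (g : C -> C) : entire g -> entire (fun w => a * g w).
Proof. by move=> hg; have := entireM (@entire_cst a) hg. Qed.
Arguments entireZ a [g].
Lemma cderZ (a : C) (g : C -> C) : entire g -> cder (fun w => a * g w) = fun z => a * cder g z.
Proof.
move=> hg; rewrite (cderM (@entire_cst a) hg).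
by rewrite cder_cst; apply/funext => z; rewrite mul0r add0r.
Qed.
Arguments cderZ a [g].
Lemma entireN (g : C -> C) : entire g -> entire (fun w => - g w).
Proof. by move=> /(entireZ (-1)); under eq_fun do rewrite mulN1r. Qed.

Lemma cderN (g : C -> C) : entire g -> cder (fun w => - g w) = fun z => - cder g z.
Proof.
move=> /(cderZ (-1)); under eq_fun do rewrite mulN1r.
by move=> ->; apply/funext => z; rewrite mulN1r.
Qed.

Lemma entireB (f g : C -> C) : entire f -> entire g -> entire (fun w => f w - g w).
Proof. by move=> hf hg; exact (entireD hf (entireN hg)). Qed.

Lemma cderB (f g : C -> C) : entire f -> entire g ->
  cder (fun w => f w - g w) = fun z => cder f z - cder g z.
Proof. by move=> hf hg; rewrite (cderD hf (entireN hg)) cderN. Qed.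

Lemma entireX (g : C -> C) n : entire g -> entire (fun w => g w ^+ n).
Proof.
move=> hg; elim: n => [|n IH].
  by under eq_fun do rewrite expr0; exact: entire_cst.
by under eq_fun do rewrite exprS; exact (entireM hg IH).
Qed.

Lemma entire_sum (I : Type) (r : seq I) (P : pred I) (F : I -> C -> C) :
  (forall i, entire (F i)) -> entire (fun w => \sum_(i <- r | P i) F i w).
Proof.
move=> hF; elim: r => [|i r IH].
  have -> : (fun w => \sum_(i <- [::] | P i) F i w) = (fun=> 0).
    by apply/funext => w; rewrite big_nil.
  exact (@entire_cst 0).
have -> : (fun w => \sum_(j <- i :: r | P j) F j w) =
   (fun w => (if P i then F i w else 0) + \sum_(j <- r | P j) F j w).
  by apply/funext => w; rewrite big_cons; case: ifP => //; rewrite add0r.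
case: (P i); first exact (entireD (hF i) IH).
exact (entireD (@entire_cst 0) IH).
Qed.

Lemma entire_prod (I : Type) (r : seq I) (P : pred I) (F : I -> C -> C) :
  (forall i, entire (F i)) -> entire (fun w => \prod_(i <- r | P i) F i w).
Proof.
move=> hF; elim: r => [|i r IH].
  have -> : (fun w => \prod_(i <- [::] | P i) F i w) = (fun=> 1).
    by apply/funext => w; rewrite big_nil.
  exact (@entire_cst 1).
have -> : (fun w => \prod_(j <- i :: r | P j) F j w) =
   (fun w => (if P i then F i w else 1) * \prod_(j <- r | P j) F j w).
  by apply/funext => w; rewrite big_cons; case: ifP => //; rewrite mul1r.
case: (P i); first exact (entireM (hF i) IH).
exact (entireM (@entire_cst 1) IH).
Qed.
End ComplexBasics.
Arguments entire_cst {R} a.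
Arguments cderiv_cst {R} a z.
Arguments cder_cst {R} a.
Arguments entireZ {R} a [g].
Arguments cderZ {R} a [g].
Global Opaque cder.

(** * Bisection of rectangles, in place of compactness *)

Section Bisection.
Variable R : realType.

(** [Pr x y k] speaks of the rectangle with corner [(x, y)] and sides [l / 2 ^+ k] and [m / 2 ^+ k].
    If it failed for the first rectangle, it would fail for one of its quarters, and so on; the
    nested bad rectangles shrink to a point [(s, t)], where the local hypothesis contradicts their
    badness. *)
Lemma bisection (l m : R) (Pr : R -> R -> nat -> Prop) :
  0 <= l -> 0 <= m ->
  (forall x y k,
     Pr x y k.+1 -> Pr (x + l / 2 ^+ k.+1) y k.+1 ->
     Pr x (y + m / 2 ^+ k.+1) k.+1 -> Pr (x + l / 2 ^+ k.+1) (y + m / 2 ^+ k.+1) k.+1 ->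
     Pr x y k) ->
  (forall s t, exists2 d : R, 0 < d & forall x y k,
     x <= s <= x + l / 2 ^+ k -> y <= t <= y + m / 2 ^+ k ->
     l / 2 ^+ k < d -> m / 2 ^+ k < d -> Pr x y k) ->
  forall x y, Pr x y 0.
Proof.
move=> l0 m0 Hsub Hloc x0 y0; apply: contrapT => bad0.
have l2 k : 0 <= l / 2 ^+ k by rewrite divr_ge0 // exprn_ge0.
have m2 k : 0 <= m / 2 ^+ k by rewrite divr_ge0 // exprn_ge0.
have half (c : R) k : c / 2 ^+ k = c / 2 ^+ k.+1 + c / 2 ^+ k.+1.
  by rewrite exprS invfM mulrCA; set u := c * _; lra.
(* The implication stands under the existential so that choosing a bad quarter becomes a total
   function [nxt]. *)
have step (p : R * R) k : exists p' : R * R, ~ Pr p.1 p.2 k ->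
   [/\ ~ Pr p'.1 p'.2 k.+1, p.1 <= p'.1, p.2 <= p'.2,
    p'.1 + l / 2 ^+ k.+1 <= p.1 + l / 2 ^+ k &
    p'.2 + m / 2 ^+ k.+1 <= p.2 + m / 2 ^+ k].
  case: p => x y /=.
  have := half l k; have := half m k; have := l2 k.+1; have := m2 k.+1.
  move=> ? ? ? ?.
  case: (pselect (Pr x y k.+1)) => [p1|p1]; last first.
    by exists (x, y) => /= _; split => //; lra.
  case: (pselect (Pr (x + l / 2 ^+ k.+1) y k.+1)) => [p2|p2]; last first.
    by exists (x + l / 2 ^+ k.+1, y) => /= _; split => //; lra.
  case: (pselect (Pr x (y + m / 2 ^+ k.+1) k.+1)) => [p3|p3]; last first.
    by exists (x, y + m / 2 ^+ k.+1) => /= _; split => //; lra.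
  exists (x + l / 2 ^+ k.+1, y + m / 2 ^+ k.+1) => /= nb; split; try lra.
  by move=> p4; apply: nb; exact: Hsub.
have [nxt hnxt] : {nxt : R * R -> nat -> R * R | forall p k, ~ Pr p.1 p.2 k ->
   [/\ ~ Pr (nxt p k).1 (nxt p k).2 k.+1, p.1 <= (nxt p k).1, p.2 <= (nxt p k).2,
    (nxt p k).1 + l / 2 ^+ k.+1 <= p.1 + l / 2 ^+ k &
    (nxt p k).2 + m / 2 ^+ k.+1 <= p.2 + m / 2 ^+ k]}.
  exists (fun p k => projT1 (cid (step p k))) => p k.
  exact: (projT2 (cid (step p k))).
pose u := fix u k := if k is k'.+1 then nxt (u k') k' else (x0, y0).
have ubad k : ~ Pr (u k).1 (u k).2 k.
  by elim: k => [//|k IH] /=; case: (hnxt _ _ IH).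
have mono1 k j : (u k).1 <= (u (k + j)%N).1 /\
    (u (k + j)%N).1 + l / 2 ^+ (k + j) <= (u k).1 + l / 2 ^+ k.
  elim: j => [|j [IH1 IH2]]; first by rewrite addn0.
  rewrite addnS; have [_ h1 _ h2 _] := hnxt _ _ (ubad (k + j)%N).
  by split; [exact: (le_trans IH1)|exact: (le_trans h2)].
have mono2 k j : (u k).2 <= (u (k + j)%N).2 /\
    (u (k + j)%N).2 + m / 2 ^+ (k + j) <= (u k).2 + m / 2 ^+ k.
  elim: j => [|j [IH1 IH2]]; first by rewrite addn0.
  rewrite addnS; have [_ _ h1 _ h2] := hnxt _ _ (ubad (k + j)%N).
  by split; [exact: (le_trans IH1)|exact: (le_trans h2)].
have squeeze (v : nat -> R) (c : R) : (forall k, 0 <= c / 2 ^+ k) ->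
   (forall k j, v k <= v (k + j)%N /\ v (k + j)%N + c / 2 ^+ (k + j) <= v k + c / 2 ^+ k) ->
   exists s, forall k, v k <= s <= v k + c / 2 ^+ k.
  (* The supremum of the left ends lies in every interval of the nested sequence. *)
  move=> c2 H; exists (sup (range v)) => k.
  have ub j : v j <= v k + c / 2 ^+ k.
    have [jk|/ltnW kj] := leqP j k.
      have [h _] := H j (k - j)%N; rewrite subnKC // in h.
      by rewrite (le_trans h) // lerDl.
    have [_] := H k (j - k)%N; rewrite subnKC //.
    by apply: le_trans; rewrite lerDl.
  apply/andP; split.
    apply: ub_le_sup; last by exists k.
    by exists (v k + c / 2 ^+ k) => _ [j _ <-].
  apply: ge_sup; first by exists (v 0%N); exists 0%N.
  by move=> _ [j _ <-].
have [s hs] := squeeze (fun k => (u k).1) l l2 mono1.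
have [t ht] := squeeze (fun k => (u k).2) m m2 mono2.
have [d d0 hd] := Hloc s t.
have small (c : R) : 0 <= c -> exists k, forall j, (k <= j)%N -> c / 2 ^+ j < d.
  move=> c0.
  pose k := Num.bound (c / d).
  exists k => j kj.
  rewrite ltr_pdivrMr ?exprn_gt0 // mulrC -ltr_pdivrMr //.
  have /archi_boundP /lt_le_trans : 0 <= c / d by rewrite divr_ge0 // ltW.
  apply.
  rewrite -natrX ler_nat (leq_trans _ (leq_pexp2l _ kj)) //.
  by rewrite ltnW // ltn_expl.
have [k1 hk1] := small l l0; have [k2 hk2] := small m m0.
apply: (ubad (maxn k1 k2)); apply: hd => //.
- by apply: hk1; rewrite leq_maxl.
- by apply: hk2; rewrite leq_maxr.
Qed.
End Bisection.

(** * Integrals over segments *)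

Section SegmentIntegral.
Variable R : realType.
Notation mu := (@lebesgue_measure R).
Implicit Types (h : R -> R).

Definition segint (a b : R) h : R := \int[mu]_(t in `[a, b]) h t.

Lemma integrable_segment a b h : {within `[a, b], continuous h} -> mu.-integrable `[a, b] (EFin \o h).
Proof. by move=> ch; apply: continuous_compact_integrable => //; exact: segment_compact. Qed.

Lemma integrable_cont a b h : continuous h -> mu.-integrable `[a, b] (EFin \o h).
Proof. by move=> ch; apply: integrable_segment; exact: continuous_subspaceT. Qed.

Lemma eq_segint a b h k : h =1 k -> segint a b h = segint a b k.
Proof. by move=> e; apply: eq_Rintegral => x _. Qed.

Lemma segintD a b h k : continuous h -> continuous k ->
  segint a b (fun t => h t + k t) = segint a b h + segint a b k.
Proof. by move=> ch ck; apply: RintegralD => //; exact: integrable_cont. Qed.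

Lemma segintB a b h k : continuous h -> continuous k ->
  segint a b (fun t => h t - k t) = segint a b h - segint a b k.
Proof. by move=> ch ck; apply: RintegralB => //; exact: integrable_cont. Qed.

Lemma segintZ a b c h : continuous h ->
  segint a b (fun t => c * h t) = c * segint a b h.
Proof. by move=> ch; apply: RintegralZl => //; exact: integrable_cont. Qed.

Lemma segint_cst a b c : a <= b -> segint a b (fun=> c) = c * (b - a).
Proof.
move=> ab; rewrite /segint Rintegral_cst //.
have := @lebesgue_measure_itv R `[a, b]; rewrite /= lte_fin => ->.
case: ltP => //= ba; have -> : b = a by lra.
by rewrite subrr.
Qed.

Lemma segint_le a b h k : continuous h -> continuous k ->
  (forall t, a <= t <= b -> h t <= k t) -> segint a b h <= segint a b k.
Proof.
move=> ch ck hk; apply: le_Rintegral; [by []|exact: integrable_cont|exact: integrable_cont|].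
by move=> t /=; rewrite in_itv /=; exact: hk.
Qed.

Lemma segint_norm_le a b h M : a <= b -> continuous h ->
  (forall t, a <= t <= b -> `|h t| <= M) -> `|segint a b h| <= M * (b - a).
Proof.
move=> ab ch hM.
have cM (c : R) : continuous (fun _ : R => c) by move=> x; exact: cvg_cst.
rewrite ler_norml -mulNr -!segint_cst //; apply/andP; split; apply: segint_le => // t /hM.
  by rewrite ler_norml => /andP[].
by rewrite ler_norml => /andP[].
Qed.

Lemma segint_split a m b h : a <= m -> m <= b -> continuous h ->
  segint a b h = segint a m h + segint m b h.
Proof.
move=> am mb ch.
have := @Rintegral_itvB R h (BLeft a) (BRight b) m (@integrable_cont a b h ch).
rewrite !bnd_simp => /(_ am mb) e.
rewrite /segint; apply/eqP; rewrite addrC -subr_eq; apply/eqP; rewrite e.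
apply: Rintegral_itv_obnd_cbnd; apply: (integrableS _ _ _ (@integrable_cont m b h ch)) => //.
by move=> x; rewrite /= !in_itv /= => /andP[/ltW -> ->].
Qed.

Lemma segint_FTC (a b : R) h (H : R -> R) : a <= b -> continuous h ->
  (forall t : R, is_derive t 1 H (h t)) -> segint a b h = H b - H a.
Proof.
rewrite le_eqVlt => /orP[/eqP -> ch _|ab ch dH].
  by rewrite subrr /segint set_itv1 Rintegral_set1.
have cH : continuous H.
  by move=> t; apply: differentiable_continuous; apply/derivable1_diffP; case: (dH t).
have := @continuous_FTC2 R h H a b ab (continuous_subspaceT ch).
rewrite /segint /Rintegral => -> //.
- split.
  + by move=> t _; case: (dH t).
  + exact: cvg_at_right_filter (cH a).
  + exact: cvg_at_left_filter (cH b).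
- by move=> t _; rewrite derive1E; case: (dH t).
Qed.
End SegmentIntegral.

(** * The complex exponential and the Cauchy-Riemann equations *)

Section ComplexExp.
Variable R : realType.
Local Notation C := (Cplx R).
Implicit Types (z w : C).

Definition cexp (w : C) : C :=
  Complex (expR (complex.Re w) * cos (complex.Im w)) (expR (complex.Re w) * sin (complex.Im w)).

Lemma cexpD z w : cexp (z + w) = cexp z * cexp w.
Proof.
by apply: Cplx_eqP; rewrite !cplxE /cexp /= !cplxE expRD ?cosD ?sinD; ring.
Qed.

Lemma cexp0 : cexp 0 = 1.
Proof. by apply: Cplx_eqP; rewrite /= expR0 ?cos0 ?sin0 ?mulr1 ?mulr0. Qed.

Lemma cexpN w : cexp (- w) * cexp w = 1.
Proof. by rewrite -cexpD addrC subrr cexp0. Qed.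

Lemma cexp_neq0 w : cexp w != 0.
Proof. by apply/eqP => h; have := cexpN w; rewrite h mulr0 => /esym/eqP; rewrite oner_eq0. Qed.

Lemma cabs_cexp w : cabs (cexp w) = expR (complex.Re w).
Proof.
apply/eqP; rewrite -(eqrXn2 (n := 2)) ?cabs_ge0 ?expR_ge0 // cabs_sqr /=.
by rewrite !exprMn -mulrDr cos2Dsin2 mulr1.
Qed.

Lemma cexp_periodic s t : cexp (Complex s (t + 2 * pi)) = cexp (Complex s t).
Proof. by apply: Cplx_eqP; rewrite /= mulr_natl ?cosD2pi ?sinD2pi. Qed.

Lemma cderiv_cexp0 : cderiv cexp 0 1.
Proof.
move=> e e0.
(* The real part of the error is at most [3 k |h|] and the imaginary part at most [4 k |h|], so
   [k <= e / 8] is enough; [k <= 1] keeps [1 + |h|] below 2. *)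
pose k : R := Num.min (e / 8) 1.
have k0 : 0 < k by rewrite lt_min ltr01 andbT divr_gt0.
have k1 : k <= 1 by rewrite ge_min lexx orbT.
have ke : k <= e / 8 by rewrite ge_min lexx.
clearbody k.
have [d1 d10 h1] := proj1 (is_derive_epsdelta _ _ _) (is_derive_expR (0 : R)) k k0.
have [d2 d20 h2] := proj1 (is_derive_epsdelta _ _ _) (is_derive_cos (0 : R)) k k0.
have [d3 d30 h3] := proj1 (is_derive_epsdelta _ _ _) (is_derive_sin (0 : R)) k k0.
exists (Num.min (Num.min d1 d2) (Num.min d3 k)); first by rewrite !lt_min d10 d20 d30 k0.
move=> h; rewrite !lt_min => /andP[/andP[hd1 hd2] /andP[hd3 hdk]].
rewrite !add0r cexp0 mul1r.
have r1 := Re_le_cabs h; have r2 := Im_le_cabs h.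
move: (h1 (complex.Re h) (le_lt_trans r1 hd1)) (h2 (complex.Im h) (le_lt_trans r2 hd2))
  (h3 (complex.Im h) (le_lt_trans r2 hd3)).
rewrite !add0r expR0 cos0 sin0 oppr0 mul0r !subr0.
move=> a1 a2 a3; apply: (le_trans (cabs_le_ReIm _)); rewrite !cplxE /=; move: a1 a2 a3.
set s := complex.Re h in r1 *; set t := complex.Im h in r2 *; set E := expR s; set c := cos t; set S := sin t.
move: (cabs_ge0 h) hdk r1 r2; set N := cabs h => N0 hdk r1 r2 a1 a2 a3.
rewrite mul1r in a1; rewrite addr0 mul1r in a3.
have c1 : `|c| <= 1 by exact: cos_max.
have e1 : E * c - 1 - s = (E - 1 - s) * c + (1 + s) * (c - 1) by ring.
have e2 : E * S - 0 - t = (E - 1 - s) * S + s * S + (S - t) by ring.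
have kN : k * `|s| <= k * N by rewrite ler_pM2l.
have kT : k * `|t| <= k * N by rewrite ler_pM2l.
have b1 : `|E * c - 1 - s| <= k * N + 2 * (k * N).
  rewrite e1 (le_trans (ler_normD _ _)) // lerD // normrM.
    by rewrite (le_trans (ler_pM _ _ (le_trans a1 kN) c1)) ?mulr1.
  apply: ler_pM => //; last exact: le_trans kT.
  by rewrite (le_trans (ler_normD _ _)) // normr1 lerD2l; lra.
have S1 : `|S| <= 1 by exact: sin_max.
have b2 : `|E * S - 0 - t| <= k * N + 2 * (k * N) + k * N.
  rewrite e2 (le_trans (ler_normD _ _)) // lerD //; last exact: le_trans kT.
  rewrite (le_trans (ler_normD _ _)) // lerD // normrM.
    by rewrite (le_trans (ler_pM _ _ (le_trans a1 kN) S1)) ?mulr1.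
  have -> : 2 * (k * N) = N * (2 * k) by ring.
  apply: ler_pM => //.
  have -> : S = (S - t) + t by ring.
  rewrite (le_trans (ler_normD _ _)) //.
  have : k * N <= k by rewrite -[leRHS]mulr1 ler_pM2l //; lra.
  lra.
have eN : 0 <= e * N by rewrite mulr_ge0 // ltW.
have : k * N <= e / 8 * N by rewrite ler_wpM2r.
by move=> kk; apply: le_trans (lerD b1 b2) _; lra.
Qed.

Lemma cderiv_cexp z : cderiv cexp z (cexp z).
Proof.
move=> e e0.
have p0 : 0 < cabs (cexp z) by rewrite cabs_gt0 cexp_neq0.
have [d d0 hd] := cderiv_cexp0 (divr_gt0 e0 p0).
exists d => // h /hd.
rewrite add0r cexp0 mul1r.
have -> : cexp (z + h) - cexp z - cexp z * h = cexp z * (cexp h - 1 - h).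
  by rewrite cexpD; ring.
move=> H; rewrite cabsM (le_trans (ler_wpM2l (ltW p0) H)) //.
by rewrite mulrA mulrCA divff ?gt_eqF // mulr1.
Qed.

Lemma entire_cexp : entire cexp.
Proof. exact: (proj1 (entire_of_cderiv cderiv_cexp)). Qed.

Lemma cder_cexp : cder cexp = cexp.
Proof. exact: (proj2 (entire_of_cderiv cderiv_cexp)). Qed.

Lemma cderiv_comp (g f : C -> C) z a b : cderiv f z a -> cderiv g (f z) b ->
  cderiv (fun w => g (f w)) z (b * a).
Proof.
move=> hf hg e e0.
pose A := cabs a + 1; have A0 : 0 < A by rewrite ltr_wpDl ?cabs_ge0.
pose B := cabs b + 1; have B0 : 0 < B by rewrite ltr_wpDl ?cabs_ge0.
have e2 : 0 < e / 2 / A by rewrite !divr_gt0.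
have [d1 d10 h1] := hg _ e2.
pose k := Num.min 1 (e / 2 / B).
have k0 : 0 < k by rewrite lt_min ltr01 !divr_gt0.
have [d2 d20 h2] := hf _ k0.
exists (Num.min d2 (d1 / A)); first by rewrite lt_min d20 divr_gt0.
move=> h; rewrite lt_min => /andP[hd2 hd1].
pose u := f (z + h) - f z.
have N0 := cabs_ge0 h.
have r : cabs (u - a * h) <= k * cabs h by exact: h2.
have uA : cabs u <= A * cabs h.
  have -> : u = (u - a * h) + a * h by ring.
  rewrite (le_trans (cabs_triangle _ _)) // cabsM.
  have : k * cabs h <= 1 * cabs h by rewrite ler_wpM2r // ge_min lexx.
  rewrite /A mulrDl; lra.
have ud1 : cabs u < d1 by rewrite (le_lt_trans uA) // mulrC -ltr_pdivlMr.
have := h1 _ ud1; rewrite /u (addrC (f z)) subrK -/u => h3.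
have -> : g (f (z + h)) - g (f z) - b * a * h =
   (g (f (z + h)) - g (f z) - b * u) + b * (u - a * h) by ring.
rewrite (le_trans (cabs_triangle _ _)) //.
have q1 : e / 2 / A * cabs u <= e / 2 * cabs h.
  rewrite -mulrA ler_pM2l ?divr_gt0 // mulrC ler_pdivrMr // mulrC //.
have q2 : cabs (b * (u - a * h)) <= e / 2 * cabs h.
  rewrite cabsM (le_trans (ler_pM _ _ (_ : _ <= B) r)) ?cabs_ge0 //; first by rewrite lerDl.
  rewrite mulrA ler_wpM2r // mulrC -ler_pdivlMr // ge_min lexx orbT //.
lra.
Qed.

Lemma entire_comp (g f : C -> C) : entire g -> entire f -> entire (fun w => g (f w)).
Proof.
move=> hg hf; apply: (proj1 (entire_of_cderiv (g' := fun w => cder g (f w) * cder f w) _)) => z.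
by apply: cderiv_comp; exact: entireP.
Qed.

Lemma cder_comp (g f : C -> C) : entire g -> entire f ->
  cder (fun w => g (f w)) = fun w => cder g (f w) * cder f w.
Proof.
move=> hg hf; apply: (proj2 (entire_of_cderiv _)) => z.
by apply: cderiv_comp; exact: entireP.
Qed.

Lemma cderiv_along_real (F : C -> C) (z v : C) (c : C) : cderiv F z c -> forall e : R, 0 < e ->
  exists2 d : R, 0 < d & forall h : R, `|h| < d ->
    cabs (F (z + Complex h 0 * v) - F z - c * (Complex h 0 * v)) <= e * `|h|.
Proof.
move=> H e e0; pose V := cabs v + 1; have V0 : 0 < V by rewrite ltr_wpDl ?cabs_ge0.
have [d d0 hd] := H _ (divr_gt0 e0 V0).
exists (d / V); first by rewrite divr_gt0.
move=> h hh.
have hv : cabs (Complex h 0 * v) <= `|h| * V.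
  by rewrite cabsM cabs_real ler_wpM2l // lerDl.
apply: le_trans (hd _ _) _; first by rewrite (le_lt_trans hv) // -ltr_pdivlMr.
by rewrite -mulrA ler_pM2l // mulrC ler_pdivrMr // mulrC.
Qed.

Lemma is_derive_Re_s (F : C -> C) (s t : R) : entire F ->
  is_derive s 1 (fun s => complex.Re (F (Complex s t))) (complex.Re (cder F (Complex s t))).
Proof.
move=> hF; apply/is_derive_epsdelta => e e0.
have [d d0 hd] := cderiv_along_real 1 (entireP hF (Complex s t)) e0.
exists d => // h /hd; apply: le_trans; apply: le_trans (Re_le_cabs _).
rewrite mulr1 (_ : Complex s t + Complex h 0 = Complex (s + h) t :> C); last first.
  by apply: Cplx_eqP; rewrite /= ?addr0.
by rewrite !cplxE /= mulr0 subr0.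
Qed.

Lemma is_derive_Im_s (F : C -> C) (s t : R) : entire F ->
  is_derive s 1 (fun s => complex.Im (F (Complex s t))) (complex.Im (cder F (Complex s t))).
Proof.
move=> hF; apply/is_derive_epsdelta => e e0.
have [d d0 hd] := cderiv_along_real 1 (entireP hF (Complex s t)) e0.
exists d => // h /hd; apply: le_trans; apply: le_trans (Im_le_cabs _).
rewrite mulr1 (_ : Complex s t + Complex h 0 = Complex (s + h) t :> C); last first.
  by apply: Cplx_eqP; rewrite /= ?addr0.
by rewrite !cplxE /= mulr0 add0r.
Qed.

(** A step in [t] goes in the direction i, and multiplying the derivative by i exchanges its real
    and imaginary parts up to sign. *)
Lemma is_derive_Re_t (F : C -> C) (s t : R) : entire F ->
  is_derive t 1 (fun t => complex.Re (F (Complex s t))) (- complex.Im (cder F (Complex s t))).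
Proof.
move=> hF; apply/is_derive_epsdelta => e e0.
have [d d0 hd] := cderiv_along_real (Complex 0 1) (entireP hF (Complex s t)) e0.
exists d => // h /hd; apply: le_trans; apply: le_trans (Re_le_cabs _).
have e1 : Complex h 0 * Complex 0 1 = Complex 0 h :> C.
  by apply: Cplx_eqP; rewrite /= ?mulr0 ?mul0r ?mulr1 ?subr0 ?addr0.
rewrite e1 (_ : Complex s t + Complex 0 h = Complex s (t + h) :> C); last first.
  by apply: Cplx_eqP; rewrite /= ?addr0.
by rewrite !cplxE /= mulr0 sub0r mulNr.
Qed.

Lemma is_derive_Im_t (F : C -> C) (s t : R) : entire F ->
  is_derive t 1 (fun t => complex.Im (F (Complex s t))) (complex.Re (cder F (Complex s t))).
Proof.
move=> hF; apply/is_derive_epsdelta => e e0.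
have [d d0 hd] := cderiv_along_real (Complex 0 1) (entireP hF (Complex s t)) e0.
exists d => // h /hd; apply: le_trans; apply: le_trans (Im_le_cabs _).
have e1 : Complex h 0 * Complex 0 1 = Complex 0 h :> C.
  by apply: Cplx_eqP; rewrite /= ?mulr0 ?mul0r ?mulr1 ?subr0 ?addr0.
rewrite e1 (_ : Complex s t + Complex 0 h = Complex s (t + h) :> C); last first.
  by apply: Cplx_eqP; rewrite /= ?addr0.
by rewrite !cplxE /= mulr0 addr0.
Qed.

Lemma cts_epsdelta (T : topologicalType) (f : T -> C) x :
  {for x, continuous f} <-> (forall e : R, 0 < e -> \forall y \near x, cabs (f x - f y) < e).
Proof.
split=> [/cvgrPdist_lt H e e0|H].
  by have := H (Complex e 0); rewrite cplx_lt => /(_ e0); apply: filterS => y; rewrite norm_cabs cplx_lt.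
apply/cvgrPdist_lt => e /cplx_gt0[-> e0].
by apply: filterS (H _ e0) => y; rewrite norm_cabs cplx_lt.
Qed.

Lemma rts_epsdelta (T : topologicalType) (f : T -> R) x :
  {for x, continuous f} <-> (forall e : R, 0 < e -> \forall y \near x, `|f x - f y| < e).
Proof. by split=> [/cvgrPdist_lt|H]; [|apply/cvgrPdist_lt]. Qed.

Lemma near_cabs z (d : R) : 0 < d -> \forall y \near (z : C), cabs (z - y) < d.
Proof.
by move=> d0; have := proj1 (@cts_epsdelta C id z) (@cvg_id _ _) d d0.
Qed.

Lemma continuous_ReC : continuous (fun z : C => complex.Re z).
Proof.
move=> z; apply/rts_epsdelta => e e0; exists (Complex e 0); first by rewrite /= cplx_lt.
move=> y; rewrite /ball_ /= norm_cabs cplx_lt.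
by apply: le_lt_trans; apply: le_trans (Re_le_cabs _); rewrite !cplxE.
Qed.

Lemma continuous_ImC : continuous (fun z : C => complex.Im z).
Proof.
move=> z; apply/rts_epsdelta => e e0; exists (Complex e 0); first by rewrite /= cplx_lt.
move=> y; rewrite /ball_ /= norm_cabs cplx_lt.
by apply: le_lt_trans; apply: le_trans (Im_le_cabs _); rewrite !cplxE.
Qed.

Lemma continuous_cabs : continuous (fun z : C => cabs z).
Proof.
move=> z; apply/rts_epsdelta => e e0; exists (Complex e 0); first by rewrite /= cplx_lt.
move=> y; rewrite /ball_ /= norm_cabs cplx_lt.
by apply: le_lt_trans; exact: cabs_dist.
Qed.

Lemma continuous_Complex (T : topologicalType) (f g : T -> R) x :
  {for x, continuous f} -> {for x, continuous g} -> {for x, continuous (fun y => Complex (f y) (g y) : C)}.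
Proof.
move=> hf hg; apply/cts_epsdelta => e e0.
have e2 : 0 < e / 2 by rewrite divr_gt0.
move/cvgrPdist_lt: hf => /(_ _ e2) hf; move/cvgrPdist_lt: hg => /(_ _ e2) hg.
near=> y; rewrite (le_lt_trans (cabs_le_ReIm _)) // !cplxE /= (splitr e) ltrD //.
  by near: y.
by near: y.
Unshelve. all: by end_near. Qed.

Lemma entire_continuous (g : C -> C) : entire g -> continuous (g : C -> C).
Proof.
move=> hg z; have h := hg z.
by apply: (@differentiable_continuous _ (C^o) (C^o)); apply/derivable1_diffP.
Qed.

Lemma entire_continuous2 (g : C -> C) : entire g -> continuous (fun p : R * R => g (Complex p.1 p.2)).
Proof.
move=> hg p; apply: (@continuous_comp _ _ _ (fun p : R * R => Complex p.1 p.2 : C) g).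
  by apply: continuous_Complex; [exact: cvg_fst|exact: cvg_snd].
exact: entire_continuous.
Qed.

Lemma entire_continuous_t (g : C -> C) s : entire g -> continuous (fun t : R => g (Complex s t)).
Proof.
move=> hg t; apply: (@continuous_comp _ _ _ (fun t : R => Complex s t : C) g).
  by apply: continuous_Complex; [exact: cvg_cst|exact: cvg_id].
exact: entire_continuous.
Qed.

Lemma entire_continuous_s (g : C -> C) t : entire g -> continuous (fun s : R => g (Complex s t)).
Proof.
move=> hg s; apply: (@continuous_comp _ _ _ (fun s : R => Complex s t : C) g).
  by apply: continuous_Complex; [exact: cvg_id|exact: cvg_cst].
exact: entire_continuous.
Qed.

Lemma continuous_Re_comp (T : topologicalType) (f : T -> C) : continuous f -> continuous (fun x => complex.Re (f x)).
Proof. by move=> hf x; apply: (@continuous_comp _ _ _ f (fun z : C => complex.Re z)); [exact: hf|exact: continuous_ReC]. Qed.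

Lemma continuous_Im_comp (T : topologicalType) (f : T -> C) : continuous f -> continuous (fun x => complex.Im (f x)).
Proof. by move=> hf x; apply: (@continuous_comp _ _ _ f (fun z : C => complex.Im z)); [exact: hf|exact: continuous_ImC]. Qed.

Lemma continuous_cabs_comp (T : topologicalType) (f : T -> C) : continuous f -> continuous (fun x => cabs (f x)).
Proof. by move=> hf x; apply: (@continuous_comp _ _ _ f (fun z : C => cabs z)); [exact: hf|exact: continuous_cabs]. Qed.
End ComplexExp.

(** * Cauchy's theorem for rectangles *)

Section Goursat.
Variable R : realType.
Local Notation C := (Cplx R).
Variable F : C -> C.
Hypothesis hF : entire F.

Let p s t := complex.Re (F (Complex s t)).
Let q s t := complex.Im (F (Complex s t)).
(** The imaginary part of the integral of [F] along the boundary of the rectangle [[a, b] x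
    [c, d]]. *)
Let L (a b c d : R) : R := segint c d (fun t => p b t - p a t) - segint a b (fun s => q s d - q s c).

Let ct_p s : continuous (p s). Proof. by apply: continuous_Re_comp; exact: entire_continuous_t. Qed.

Let cs_q t : continuous (q^~ t). Proof. by apply: continuous_Im_comp; exact: entire_continuous_s. Qed.

Let cB (f g : R -> R) : continuous f -> continuous g -> continuous (fun x => f x - g x).
Proof. by move=> hf hg x; apply: continuousB; [exact: hf|exact: hg]. Qed.

Let L_split_s a m b c d : a <= m -> m <= b -> c <= d -> L a b c d = L a m c d + L m b c d.
Proof.
move=> am mb cd; rewrite /L (segint_split am mb (cB (@cs_q d) (@cs_q c))).
rewrite (segintB c d (@ct_p b) (@ct_p a)) (segintB c d (@ct_p m) (@ct_p a)) (segintB c d (@ct_p b) (@ct_p m)).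
set X := segint a m _; set Y := segint m b _; ring.
Qed.

Let L_split_t a b c m d : c <= m -> m <= d -> a <= b -> L a b c d = L a b c m + L a b m d.
Proof.
move=> am mb cd; rewrite /L (segint_split am mb (cB (@ct_p b) (@ct_p a))).
rewrite (segintB a b (@cs_q d) (@cs_q c)) (segintB a b (@cs_q m) (@cs_q c)) (segintB a b (@cs_q d) (@cs_q m)).
set X := segint c m _; set Y := segint m d _; ring.
Qed.

(** Goursat's argument: the boundary integral is additive under subdivision, it is 0 for affine
    functions, and on a small rectangle [F] is affine up to [e] times the size. The other component
    of Cauchy's theorem is the same statement for a multiple of [F]. *)
Lemma goursat_Re (a b c d : R) : a <= b -> c <= d ->
  segint c d (fun t => complex.Re (F (Complex b t)) - complex.Re (F (Complex a t))) =
  segint a b (fun s => complex.Im (F (Complex s d)) - complex.Im (F (Complex s c))).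
Proof.
move=> ab cd; apply/eqP; rewrite -subr_eq0; apply/eqP; rewrite -/(L a b c d).
pose l := b - a; pose m := d - c.
have l0 : 0 <= l by rewrite subr_ge0.
have m0 : 0 <= m by rewrite subr_ge0.
have LE : L a b c d = L a (a + l / 2 ^+ 0) c (c + m / 2 ^+ 0).
  by rewrite expr0 !divr1 /l /m !(addrC _ (_ - _)) !subrK.
suff H e : 0 < e -> `|L a b c d| <= e * (2 * (l + m) ^+ 2).
  apply/eqP; rewrite -normr_le0; apply/ler_addgt0Pr => e e0; rewrite add0r.
  pose K := 2 * (l + m) ^+ 2 + 1.
  have K0 : 0 < K by rewrite ltr_wpDl // mulr_ge0 // exprn_ge0 // addr_ge0.
  apply: le_trans (H (e / K) _) _; first by rewrite divr_gt0.
  by rewrite mulrAC ler_pdivrMr // ler_pM2l // lerDl.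
move=> e0; rewrite LE.
(* This bound is four times smaller on a quarter, so the bounds of the four quarters add up to that
   of the whole. *)
pose Pr x y k := `|L x (x + l / 2 ^+ k) y (y + m / 2 ^+ k)| <= e * (2 * (l / 2 ^+ k + m / 2 ^+ k) ^+ 2).
have := @bisection R l m Pr l0 m0 _ _ a c; rewrite /Pr expr0 !divr1; apply.
- move=> x y k.
  have half (u : R) : u / 2 ^+ k = u / 2 ^+ k.+1 + u / 2 ^+ k.+1.
    by rewrite exprS invfM mulrCA; set v := u * _; lra.
  have l2 : 0 <= l / 2 ^+ k.+1 by rewrite divr_ge0 // exprn_ge0.
  have m2 : 0 <= m / 2 ^+ k.+1 by rewrite divr_ge0 // exprn_ge0.
  rewrite /Pr !half; set u := l / _ in l2 *; set v := m / _ in m2 *.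
  move=> h1 h2 h3 h4.
  rewrite !addrA.
  have xu : x <= x + u by rewrite lerDl.
  have xu2 : x + u <= x + u + u by rewrite lerDl.
  have yv : y <= y + v by rewrite lerDl.
  have yv2 : y + v <= y + v + v by rewrite lerDl.
  rewrite (@L_split_s _ _ _ _ _ xu xu2 (le_trans yv yv2)).
  rewrite (@L_split_t _ _ _ _ _ yv yv2 xu) (@L_split_t _ _ _ _ _ yv yv2 xu2).
  move: h1 h2 h3 h4.
  set A := L _ _ _ _; set A' := L _ _ _ _; set B := L _ _ _ _; set B' := L _ _ _ _.
  move: A A' B B' => A A' B B' h1 h2 h3 h4.
  have t1 := ler_normD (A + B) (A' + B'); have t2 := ler_normD A B.
  have t3 := ler_normD A' B'.
  have -> : e * (2 * (u + u + v + v) ^+ 2) = 4 * (e * (2 * (u + v) ^+ 2)) by ring.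
  move: (e * _) h1 h2 h3 h4 => D *; lra.
- move=> s t.
  have [dl dl0 hd] := entireP hF (Complex s t) e0.
  exists (dl / 2); first by rewrite divr_gt0.
  move=> x y k; set u := l / _; set v := m / _ => /andP[sx1 sx2] /andP[ty1 ty2] ud vd.
  set c0 := cder F (Complex s t) in hd.
  have err s' t' : x <= s' <= x + u -> y <= t' <= y + v ->
     cabs (F (Complex s' t') - F (Complex s t) - c0 * (Complex s' t' - Complex s t)) <= e * (u + v).
    move=> /andP[? ?] /andP[? ?].
    have hh : cabs (Complex s' t' - Complex s t : C) <= u + v.
      apply: le_trans (cabs_le_ReIm _) _; rewrite !cplxE /=; apply: lerD; rewrite ler_norml; apply/andP; split; lra.
    have := hd (Complex s' t' - Complex s t); rewrite (addrC (Complex s t)) subrK => H.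
    apply: le_trans (H _) _; first by lra.
    by rewrite ler_pM2l.
  have u0 : 0 <= u by lra.
  have v0 : 0 <= v by lra.
  have cc (r : R) : continuous (fun _ : R => r) by move=> ?; exact: cvg_cst.
  (* The linear part of [F] contributes [Re c0 * u * v] to both integrals and drops out of their
     difference. *)
  have k1 : `|segint y (y + v) (fun t => p (x + u) t - p x t) - complex.Re c0 * u * v| <= 2 * (e * (u + v)) * v.
    have := @segint_norm_le R y (y + v) (fun t => p (x + u) t - p x t - complex.Re c0 * u) (2 * (e * (u + v))).
    rewrite segintB ?segint_cst //; try lra; last exact: cB.
    rewrite (_ : y + v - y = v); last by ring.
    apply=> //; first by lra.
      by apply: cB => //; exact: cB.
    move=> t' ht'.
    have i1 : x <= x + u <= x + u by rewrite lexx andbT lerDl.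
    have i2 : x <= x <= x + u by rewrite lexx /= lerDl.
    have E1 := err (x + u) t' i1 ht'; have E2 := err x t' i2 ht'.
    have := le_trans (Re_le_cabs _) E1; have := le_trans (Re_le_cabs _) E2.
    rewrite !cplxE /= -/(p s t) -/(p x t') -/(p (x + u) t').
    set X := (X in `|X| <= _ -> _); move=> g1.
    set Y := (X in `|X| <= _ -> _); move=> g2.
    have -> : p (x + u) t' - p x t' - complex.Re c0 * u = Y - X by rewrite /X /Y; ring.
    rewrite (le_trans (ler_normB _ _)) // mulr2n mulrDl !mul1r lerD //.
  have k2 : `|segint x (x + u) (fun s => q s (y + v) - q s y) - complex.Re c0 * u * v| <= 2 * (e * (u + v)) * u.
    rewrite mulrAC.
    have := @segint_norm_le R x (x + u) (fun s => q s (y + v) - q s y - complex.Re c0 * v) (2 * (e * (u + v))).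
    rewrite segintB ?segint_cst //; try lra; last exact: cB.
    rewrite (_ : x + u - x = u); last by ring.
    apply=> //; first by lra.
      by apply: cB => //; exact: cB.
    move=> s' hs'.
    have i1 : y <= y + v <= y + v by rewrite lexx andbT lerDl.
    have i2 : y <= y <= y + v by rewrite lexx /= lerDl.
    have E1 := err s' (y + v) hs' i1; have E2 := err s' y hs' i2.
    have := le_trans (Im_le_cabs _) E1; have := le_trans (Im_le_cabs _) E2.
    rewrite !cplxE /= -/(q s t) -/(q s' y) -/(q s' (y + v)).
    set X := (X in `|X| <= _ -> _); move=> g1.
    set Y := (X in `|X| <= _ -> _); move=> g2.
    have -> : q s' (y + v) - q s' y - complex.Re c0 * v = Y - X by rewrite /X /Y; ring.
    rewrite (le_trans (ler_normB _ _)) // mulr2n mulrDl !mul1r lerD //.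
  rewrite /Pr -/u -/v /L.
  move: k1 k2; set I1 := segint _ _ _; set I2 := segint _ _ _; set K := _ * v.
  move=> k1 k2; have -> : I1 - I2 = (I1 - K) - (I2 - K) by ring.
  apply: le_trans (ler_normB _ _) _; apply: le_trans (lerD k1 k2) _.
  by rewrite le_eqVlt; apply/orP; left; apply/eqP; ring.
Qed.
End Goursat.

(** * Means over a period *)

Section CircleMeans.
Variable R : realType.
Local Notation C := (Cplx R).

Lemma contC_mk (T : topologicalType) (h : T -> C) :
  continuous (fun x => complex.Re (h x)) -> continuous (fun x => complex.Im (h x)) -> continuous h.
Proof.
move=> hr hi x; have := continuous_Complex (hr x) (hi x).
by have -> : (fun y => Complex (complex.Re (h y)) (complex.Im (h y))) = h by apply/funext => y; case: (h y).
Qed.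

Lemma contR_D (T : topologicalType) (f g : T -> R) : continuous f -> continuous g -> continuous (fun x => f x + g x).
Proof. by move=> hf hg x; apply: cvgD; [exact: hf|exact: hg]. Qed.

Lemma contR_N (T : topologicalType) (f : T -> R) : continuous f -> continuous (fun x => - f x).
Proof. by move=> hf x; apply: cvgN; exact: hf. Qed.

Lemma contR_B (T : topologicalType) (f g : T -> R) : continuous f -> continuous g -> continuous (fun x => f x - g x).
Proof. by move=> hf hg x; apply: cvgB; [exact: hf|exact: hg]. Qed.

Lemma contR_M (T : topologicalType) (f g : T -> R) : continuous f -> continuous g -> continuous (fun x => f x * g x).
Proof. by move=> hf hg x; apply: cvgM; [exact: hf|exact: hg]. Qed.

Lemma contC_B (T : topologicalType) (f g : T -> C) : continuous f -> continuous g -> continuous (fun x => f x - g x).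
Proof.
move=> hf hg; apply: contC_mk.
  by under eq_fun do rewrite cplxReD cplxReN; apply: contR_B; apply: continuous_Re_comp.
by under eq_fun do rewrite cplxImD cplxImN; apply: contR_B; apply: continuous_Im_comp.
Qed.

Lemma contC_M (T : topologicalType) (f g : T -> C) : continuous f -> continuous g -> continuous (fun x => f x * g x).
Proof.
move=> hf hg; have [fr fi] := (continuous_Re_comp hf, continuous_Im_comp hf).
have [gr gi] := (continuous_Re_comp hg, continuous_Im_comp hg).
apply: contC_mk.
  under eq_fun do rewrite cplxReM.
  exact: (contR_B (contR_M fr gr) (contR_M fi gi)).
under eq_fun do rewrite cplxImM.
exact: (contR_D (contR_M fr gi) (contR_M fi gr)).
Qed.

Lemma contC_cst (T : topologicalType) (c : C) : continuous (fun _ : T => c).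
Proof. by move=> x; exact: cvg_cst. Qed.

Definition circ_mean (h : R -> R) : R := (2 * pi)^-1 * segint 0 (2 * pi) h.
Definition circ_meanC (h : R -> C) : C :=
  Complex (circ_mean (fun t => complex.Re (h t))) (circ_mean (fun t => complex.Im (h t))).

Lemma twopi_gt0 : 0 < 2 * pi :> R. Proof. by rewrite mulr_gt0 // pi_gt0. Qed.

Lemma twopi_ge0 : 0 <= 2 * pi :> R. Proof. exact: ltW twopi_gt0. Qed.

Implicit Types (h k : R -> R) (c M : R).
Lemma eq_circ_mean h k : h =1 k -> circ_mean h = circ_mean k.
Proof. by move=> e; rewrite /circ_mean (eq_segint _ _ e). Qed.

Lemma circ_meanD h k : continuous h -> continuous k -> circ_mean (fun t => h t + k t) = circ_mean h + circ_mean k.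
Proof. by move=> ch ck; rewrite /circ_mean segintD // mulrDr. Qed.

Lemma circ_meanB h k : continuous h -> continuous k -> circ_mean (fun t => h t - k t) = circ_mean h - circ_mean k.
Proof. by move=> ch ck; rewrite /circ_mean segintB // mulrBr. Qed.

Lemma circ_meanZ c h : continuous h -> circ_mean (fun t => c * h t) = c * circ_mean h.
Proof. by move=> ch; rewrite /circ_mean segintZ // mulrCA. Qed.

Lemma circ_mean_cst c : circ_mean (fun=> c) = c.
Proof. by rewrite /circ_mean segint_cst ?twopi_ge0 // subr0 mulrCA mulVf ?mulr1 // gt_eqF // twopi_gt0. Qed.

Lemma circ_mean_le h k : continuous h -> continuous k -> (forall t, h t <= k t) -> circ_mean h <= circ_mean k.
Proof.
move=> ch ck hk; rewrite /circ_mean ler_pM2l ?invr_gt0 ?twopi_gt0 //.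
by apply: segint_le => // t _.
Qed.

Lemma continuous_cst (T : topologicalType) (c : R) : continuous (fun _ : T => c).
Proof. by move=> x; exact: cvg_cst. Qed.

Lemma circ_mean_norm_le h M : continuous h -> (forall t, `|h t| <= M) -> `|circ_mean h| <= M.
Proof.
move=> ch hM; rewrite ler_norml -{1}(circ_mean_cst (- M)) -{2}(circ_mean_cst M); apply/andP; split.
  by apply: circ_mean_le => // [|t]; [exact: continuous_cst|have := hM t; rewrite ler_norml => /andP[]].
by apply: circ_mean_le => // [|t]; [exact: continuous_cst|have := hM t; rewrite ler_norml => /andP[]].
Qed.

Implicit Types (H K : R -> C).
Lemma circ_meanCB H K : continuous H -> continuous K -> circ_meanC (fun t => H t - K t) = circ_meanC H - circ_meanC K.
Proof.
move=> cH cK.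
have [Hr Hi] := (continuous_Re_comp cH, continuous_Im_comp cH).
have [Kr Ki] := (continuous_Re_comp cK, continuous_Im_comp cK).
apply: Cplx_eqP; rewrite !cplxE /=.
  by rewrite -(circ_meanB Hr Kr); apply: eq_circ_mean => t; rewrite !cplxE.
by rewrite -(circ_meanB Hi Ki); apply: eq_circ_mean => t; rewrite !cplxE.
Qed.

Lemma circ_meanCZ (c : C) H : continuous H -> circ_meanC (fun t => c * H t) = c * circ_meanC H.
Proof.
move=> cH; have [Hr Hi] := (continuous_Re_comp cH, continuous_Im_comp cH).
have cZ (u : R) (f : R -> R) : continuous f -> continuous (fun t => u * f t).
  by move=> cf; apply: contR_M => // x; exact: cvg_cst.
apply: Cplx_eqP; rewrite !cplxE /=.
  rewrite -(circ_meanZ _ Hr) -(circ_meanZ _ Hi) -(circ_meanB (cZ _ _ Hr) (cZ _ _ Hi)).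
  by apply: eq_circ_mean => t; rewrite !cplxE.
rewrite -(circ_meanZ _ Hi) -(circ_meanZ _ Hr) -(circ_meanD (cZ _ _ Hi) (cZ _ _ Hr)).
by apply: eq_circ_mean => t; rewrite !cplxE.
Qed.

Lemma circ_meanC_cst (c : C) : circ_meanC (fun=> c) = c.
Proof. by apply: Cplx_eqP; rewrite /= circ_mean_cst. Qed.

(** The factor 2 comes from estimating the real and the imaginary part separately. *)
Lemma cabs_circ_meanC_le H M : continuous H -> (forall t, cabs (H t) <= M) -> cabs (circ_meanC H) <= 2 * M.
Proof.
move=> cH HM; rewrite (le_trans (cabs_le_ReIm _)) // mulr2n mulrDl mul1r lerD // circ_mean_norm_le //.
- exact: continuous_Re_comp.
- by move=> t; rewrite (le_trans (Re_le_cabs _)).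
- exact: continuous_Im_comp.
- by move=> t; rewrite (le_trans (Im_le_cabs _)).
Qed.

Definition iperiodic (F : C -> C) := forall s t, F (Complex s (t + 2 * pi)) = F (Complex s t).

(** On a rectangle of height 2 pi the two horizontal sides cancel by periodicity; what remains of
    Cauchy's theorem is independence of the radius [exp s]. *)
Lemma circ_meanC_vertical (F : C -> C) s s' : entire F -> iperiodic F ->
  circ_meanC (fun t => F (Complex s t)) = circ_meanC (fun t => F (Complex s' t)).
Proof.
move=> hF pF.
wlog ss : s s' / s' <= s.
  by move=> W; have [/W|/ltW/W] := leP s' s.
have step (G : C -> C) : entire G -> iperiodic G ->
   circ_mean (fun t => complex.Re (G (Complex s t))) = circ_mean (fun t => complex.Re (G (Complex s' t))).
  move=> hG pG; have := goursat_Re hG ss twopi_ge0.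
  have -> : (fun u => complex.Im (G (Complex u (2 * pi))) - complex.Im (G (Complex u 0))) = fun=> 0.
    by apply/funext => u; rewrite -[2 * pi]add0r pG subrr.
  rewrite segint_cst // mul0r segintB; try by apply: continuous_Re_comp; exact: entire_continuous_t.
  by move/eqP; rewrite subr_eq0 /circ_mean => /eqP ->.
apply: Cplx_eqP; rewrite /=; first exact: step.
(* The real part of [- i F] is the imaginary part of [F]. *)
have hG := entireZ (Complex 0 (-1)) hF.
have pG : iperiodic (fun w => Complex 0 (-1) * F w) by move=> ? ?; rewrite pF.
have := step _ hG pG.
have e u : (fun t => complex.Re (Complex 0 (-1) * F (Complex u t) : C)) = fun t => complex.Im (F (Complex u t)).
  by apply/funext => t; rewrite !cplxE /= mul0r sub0r mulN1r opprK.
by rewrite !e.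
Qed.

Lemma circ_meanC_cder_periodic (G : C -> C) s : entire G -> continuous (fun t => cder G (Complex s t)) ->
  iperiodic G -> circ_meanC (fun t => cder G (Complex s t)) = 0.
Proof.
move=> hG cG pG; have cr := continuous_Re_comp cG; have ci := continuous_Im_comp cG.
apply: Cplx_eqP; rewrite /= /circ_mean.
  rewrite (segint_FTC twopi_ge0 cr (fun t => is_derive_Im_t s t hG)).
  by rewrite -[2 * pi]add0r pG subrr mulr0.
have -> : (fun t => complex.Im (cder G (Complex s t))) = (fun t => (-1) * (- complex.Im (cder G (Complex s t)))).
  by apply/funext => t; rewrite mulN1r opprK.
have cn : continuous (fun t => - complex.Im (cder G (Complex s t))).
  exact: contR_N.
rewrite segintZ // (segint_FTC twopi_ge0 cn (fun t => is_derive_Re_t s t hG)).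
by rewrite -[2 * pi]add0r pG subrr !mulr0.
Qed.
End CircleMeans.

(** * Cauchy's formula and its estimates *)

Section Taylor.
Variable R : realType.
Local Notation C := (Cplx R).
Implicit Types (g : C -> C) (a z w : C).

(** With [z = a + cexp w] this is [g z / (z - a) ^+ n], the integrand of Cauchy's coefficient
    formula with respect to the angle. *)
Definition taylor_kernel g a n w := g (a + cexp w) * cexp (- w) ^+ n.
(* The n-th Taylor coefficient of g at a. *)
Definition taylor_coef g a n : C := circ_meanC (fun t => taylor_kernel g a n (Complex 0 t)).

Lemma entire_cexpN : entire (fun w : C => cexp (- w)).
Proof. exact (entire_comp (@entire_cexp R) (entireN (@entire_id R))). Qed.

Lemma entire_shift_cexp g a : entire g -> entire (fun w => g (a + cexp w)).
Proof. move=> hg; exact (entire_comp hg (entireD (entire_cst a) (@entire_cexp R))). Qed.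
Arguments entire_shift_cexp [g] a _.
Lemma entire_taylor_kernel g a n : entire g -> entire (taylor_kernel g a n).
Proof. move=> hg; exact (entireM (entire_shift_cexp a hg) (@entireX R _ n entire_cexpN)). Qed.
Arguments entire_taylor_kernel [g] a n _.
Lemma cexpN_periodic (s t : R) : cexp (- Complex s (t + 2 * pi) : C) = cexp (- Complex s t : C).
Proof.
have h := cexpN (Complex s t : C).
have := cexpN (Complex s (t + 2 * pi) : C); rewrite cexp_periodic -[in RHS]h.
by move/mulIf; apply; exact: cexp_neq0.
Qed.

Lemma taylor_kernel_periodic g a n : iperiodic (taylor_kernel g a n).
Proof. by move=> s t; rewrite /taylor_kernel cexp_periodic cexpN_periodic. Qed.

Lemma taylor_coef_any g a n s : entire g -> taylor_coef g a n = circ_meanC (fun t => taylor_kernel g a n (Complex s t)).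
Proof. by move=> hg; apply: circ_meanC_vertical; [exact: entire_taylor_kernel|exact: taylor_kernel_periodic]. Qed.

Lemma continuous_taylor_kernel g a n s : entire g -> continuous (fun t => taylor_kernel g a n (Complex s t)).
Proof. by move=> hg; apply: entire_continuous_t; exact: entire_taylor_kernel. Qed.

Lemma cabs_cexpN w : cabs (cexp (- w)) = (expR (complex.Re w))^-1.
Proof. by rewrite cabs_cexp cplxReN expRN. Qed.

(** Cauchy's estimate: the mean that defines the coefficient may be taken over any circle about [a],
    here the one of radius [r]. *)
Lemma taylor_coef_bound g a n (r M : R) : entire g -> 0 < r ->
  (forall w, cabs (w - a) = r -> cabs (g w) <= M) -> cabs (taylor_coef g a n) <= 2 * (M / r ^+ n).
Proof.
move=> hg r0 hM; rewrite (taylor_coef_any a n (ln r) hg); apply: cabs_circ_meanC_le; first exact: continuous_taylor_kernel.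
move=> t; rewrite /taylor_kernel cabsM cabsX cabs_cexpN /= lnK ?posrE // exprVn ler_wpM2r ?invr_ge0 ?exprn_ge0 ?(ltW r0) //.
by apply: hM; rewrite addrC addKr cabs_cexp /= lnK.
Qed.

Lemma cabs_small_eq (x y : C) (k : R) : (forall e : R, 0 < e -> cabs (x - y) <= k * e) -> x = y.
Proof.
move=> H; apply/eqP; rewrite -subr_eq0 -cabs_eq0 eq_le cabs_ge0 andbT.
pose K := `|k| + 1; have K0 : 0 < K by rewrite ltr_wpDl.
apply/ler_addgt0Pr => e e0; rewrite add0r.
apply: le_trans (H (e / K) _) _; first by rewrite divr_gt0.
rewrite mulrA ler_pdivrMr // mulrC ler_pM2l // /K (le_trans (ler_norm _)) // lerDl //.
Qed.

(** The mean does not depend on the radius, and it tends to [g a] as the radius tends to 0. *)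
Lemma taylor_coef0 g a : entire g -> taylor_coef g a 0 = g a.
Proof.
move=> hg; apply: (@cabs_small_eq _ _ 2) => e e0.
have [d d0 hd] : exists2 d : R, 0 < d & forall w, cabs (w - a) < d -> cabs (g w - g a) <= e.
  have [d1 d10 h1] := entireP hg a ltr01.
  pose K := cabs (cder g a) + 1; have K0 : 0 < K by rewrite ltr_wpDl ?cabs_ge0.
  exists (Num.min d1 (e / K)); first by rewrite lt_min d10 divr_gt0.
  move=> w; rewrite lt_min => /andP[w1 w2]; have := h1 _ w1.
  rewrite (addrC a) subrK mul1r => h.
  have -> : g w - g a = (g w - g a - cder g a * (w - a)) + cder g a * (w - a) by ring.
  rewrite (le_trans (cabs_triangle _ _)) // cabsM.
  apply: le_trans (lerD h (lexx _)) _.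
  have -> : cabs (w - a) + cabs (cder g a) * cabs (w - a) = cabs (w - a) * K by rewrite /K; ring.
  by rewrite -ler_pdivlMr // ltW.
have d20 : 0 < d / 2 by rewrite divr_gt0.
rewrite (taylor_coef_any a 0 (ln (d / 2)) hg) -(circ_meanC_cst (g a)) -circ_meanCB; first last.
- by move=> x; exact: cvg_cst.
- exact: continuous_taylor_kernel.
apply: cabs_circ_meanC_le.
  by apply: contC_B; [exact: continuous_taylor_kernel|exact: contC_cst].
move=> t; rewrite /taylor_kernel expr0 mulr1 hd // (addrC a) addrK cabs_cexp /= lnK ?posrE //; lra.
Qed.

Lemma circ_meanC_cexpN s : circ_meanC (fun t => cexp (- Complex s t) : C) = 0.
Proof.
have hE := entire_cexpN.
have cE : cder (fun w : C => - cexp (- w)) = fun w => cexp (- w).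
  rewrite (cderN hE) (cder_comp (@entire_cexp R) (entireN (@entire_id R))) cder_cexp (cderN (@entire_id R)) cder_id.
  by apply/funext => w; rewrite mulrN1 opprK.
have := @circ_meanC_cder_periodic R (fun w => - cexp (- w)) s (entireN hE).
rewrite cE => H; apply: H; first exact: (@entire_continuous_t R (fun w => cexp (- w)) s hE).
by move=> u t; rewrite cexpN_periodic.
Qed.

(** Subtracting [g a * cexp (- w)], whose mean is 0, turns the kernel into a difference quotient,
    which tends to the derivative as the radius shrinks. *)
Lemma taylor_coef1 g a : entire g -> taylor_coef g a 1 = cder g a.
Proof.
move=> hg; apply: (@cabs_small_eq _ _ 2) => e e0.
have [d d0 hd] := entireP hg a e0.
have d20 : 0 < d / 2 by rewrite divr_gt0.
pose s := ln (d / 2).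
have cE : continuous (fun t : R => cexp (- Complex s t) : C).
  exact: (@entire_continuous_t R (fun w => cexp (- w)) s entire_cexpN).
rewrite (taylor_coef_any a 1 s hg) -(circ_meanC_cst (cder g a)).
have -> : circ_meanC (fun t : R => taylor_kernel g a 1 (Complex s t)) =
   circ_meanC (fun t : R => taylor_kernel g a 1 (Complex s t) - g a * cexp (- Complex s t)).
  have c0 : continuous (fun t : R => g a * cexp (- Complex s t) : C).
    by apply: contC_M; [exact: contC_cst|exact: cE].
  by rewrite (circ_meanCB (@continuous_taylor_kernel g a 1 s hg) c0) (circ_meanCZ _ cE) circ_meanC_cexpN mulr0 subr0.
have c1 : continuous (fun t : R => taylor_kernel g a 1 (Complex s t) - g a * cexp (- Complex s t)).
  apply: contC_B; first exact: continuous_taylor_kernel.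
  by apply: contC_M; [exact: contC_cst|exact: cE].
rewrite -(circ_meanCB c1 (@contC_cst R R (cder g a))).
apply: cabs_circ_meanC_le.
  by apply: contC_B; [exact: c1|exact: contC_cst].
move=> t; rewrite /taylor_kernel expr1.
set w : C := Complex s t.
have -> : g (a + cexp w) * cexp (- w) - g a * cexp (- w) - cder g a =
  (g (a + cexp w) - g a - cder g a * cexp w) * cexp (- w).
  by rewrite mulrBl mulrBl -(mulrA (cder g a)) (mulrC (cexp w)) cexpN mulr1.
rewrite cabsM cabs_cexpN ler_pdivrMr ?expR_gt0 //.
have := hd (cexp w); rewrite cabs_cexp => -> //.
by rewrite /= lnK ?posrE //; lra.
Qed.

Lemma bounded_on_disc (f : C -> R) : continuous f -> forall r : R, exists M : R, forall z, cabs z <= r -> f z <= M.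
Proof.
move=> cf r.
have [r0|r0] := ltP r 0.
  by exists 0 => z zr; have := cabs_ge0 z; lra.
pose l := 2 * r; have l0 : 0 <= l by rewrite mulr_ge0.
have := @bisection R l l (fun x y k => exists M : R, forall s t,
   x <= s <= x + l / 2 ^+ k -> y <= t <= y + l / 2 ^+ k -> f (Complex s t) <= M) l0 l0 _ _ (- r) (- r).
case.
- move=> x y k [M1 h1] [M2 h2] [M3 h3] [M4 h4].
  exists (Num.max (Num.max M1 M2) (Num.max M3 M4)) => s t.
  have half (u : R) : u / 2 ^+ k = u / 2 ^+ k.+1 + u / 2 ^+ k.+1.
    by rewrite exprS invfM mulrCA; set v := u * _; lra.
  rewrite !half !le_max; set u := l / _ in h1 h2 h3 h4 * => /andP[? ?] /andP[? ?].
  have [sx|sx] := leP s (x + u); have [ty|ty] := leP t (y + u).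
  - by rewrite h1 //; apply/andP; split; lra.
  - by rewrite h3 ?orbT //; apply/andP; split; lra.
  - by rewrite h2 ?orbT //; apply/andP; split; lra.
  - by rewrite h4 ?orbT //; apply/andP; split; lra.
- move=> s t.
  have /cvgrPdist_lt /(_ 1 ltr01) [e /= /cplx_gt0 [-> e0] he] : f z @[z --> (Complex s t : C)] --> f (Complex s t) by exact: cf.
  exists (complex.Re e / 2); first by rewrite divr_gt0.
  move=> x y k /andP[? ?] /andP[? ?] u1 _; exists (f (Complex s t) + 1) => s' t' /andP[? ?] /andP[? ?].
  have /he : ball_ Num.norm (Complex s t : C) (Complex (complex.Re e) 0) (Complex s' t').
    rewrite /ball_ /= norm_cabs cplx_lt (le_lt_trans (cabs_le_ReIm _)) // !cplxE /= (splitr (complex.Re e)) ltrD // ltr_norml; apply/andP; split; lra.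
  by rewrite /= ltr_norml => /andP[]; lra.
- move=> M hM; exists M => -[s t] z0; have a := le_trans (Re_le_cabs _) z0; have b := le_trans (Im_le_cabs _) z0.
  move: a b => /=; rewrite !ler_norml => /andP[? ?] /andP[? ?].
  by apply: hM; rewrite expr0 divr1 /l; apply/andP; split; lra.
Qed.

Lemma mvt_unit (f f' : R -> R) (K : R) : (forall t : R, is_derive t 1 f (f' t)) ->
  (forall t, 0 <= t <= 1 -> `|f' t| <= K) -> `|f 1 - f 0| <= K.
Proof.
move=> hf hK.
have cf : continuous f.
  by move=> t; apply: differentiable_continuous; apply/derivable1_diffP; case: (hf t).
have [c c01 ->] := @MVT R f f' 0 1 ltr01 (fun x _ => hf x) (continuous_subspaceT cf).
rewrite subr0 mulr1; apply: hK.
by move: c01; rewrite in_itv /= => /andP[/ltW -> /ltW ->].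
Qed.

Lemma cmvt_unit (F : C -> C) (K : R) : entire F ->
  (forall t, 0 <= t <= 1 -> cabs (cder F (Complex t 0)) <= K) -> cabs (F 1 - F 0) <= 2 * K.
Proof.
move=> hF hK; rewrite (le_trans (cabs_le_ReIm _)) // mulr2n mulrDl mul1r !cplxE lerD //.
  have := @mvt_unit _ _ K (fun t => is_derive_Re_s t 0 hF); apply.
  by move=> t /hK; exact: le_trans (Re_le_cabs _).
have := @mvt_unit _ _ K (fun t => is_derive_Im_s t 0 hF); apply.
by move=> t /hK; exact: le_trans (Im_le_cabs _).
Qed.

Lemma entire_line g z h : entire g -> entire (fun w => g (z + w * h)).
Proof. move=> hg; exact (entire_comp hg (entireD (entire_cst z) (entireM (@entire_id R) (entire_cst h)))). Qed.
Arguments entire_line [g] z h _.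
Lemma cder_line g z h : entire g -> cder (fun w => g (z + w * h)) = fun w => cder g (z + w * h) * h.
Proof.
move=> hg; rewrite (cder_comp hg (entireD (entire_cst z) (entireM (@entire_id R) (entire_cst h)))).
rewrite (cderD (entire_cst z) (entireM (@entire_id R) (entire_cst h))) (cderM (@entire_id R) (entire_cst h)) cder_id !cder_cst.
by apply/funext => w; rewrite mul1r mulr0 addr0 add0r.
Qed.

Arguments cder_line [g] z h _.
Lemma entire_bounded g (r : R) : entire g -> exists2 M : R, 0 <= M & forall z, cabs z <= r -> cabs (g z) <= M.
Proof.
move=> hg; have [M hM] := bounded_on_disc (continuous_cabs_comp (entire_continuous hg)) r.
exists (Num.max M 0); first by rewrite le_max lexx orbT.
by move=> z /hM h; rewrite le_max h.
Qed.

Lemma cabs_real_unit (t : R) : 0 <= t <= 1 -> cabs (Complex t 0 : C) <= 1.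
Proof. by case/andP => t0 t1; rewrite cabs_real ger0_norm. Qed.

(** Unlike the definition of the derivative, these bounds are uniform over a disc; they rest on
    Cauchy's estimate and make differentiation under the mean possible. *)
Lemma entire_second_order g (r : R) : entire g -> exists2 L : R, 0 <= L & forall z h, cabs z <= r -> cabs h <= 1 ->
  cabs (cder g (z + h) - cder g z) <= L * cabs h /\
  cabs (g (z + h) - g z - cder g z * h) <= L * cabs h ^+ 2.
Proof.
move=> hg.
(* Each of the next three bounds loses 1 in the radius: [cder g] is bounded up to [r + 2], [g] is
   Lipschitz up to [r + 1], and [cder g] up to [r]. *)
have [M M0 hM] := entire_bounded (r + 3) hg.
have d1 z : cabs z <= r + 2 -> cabs (cder g z) <= 2 * M.
  move=> zr; rewrite -taylor_coef1 // -[M]divr1 -[1](expr1n _ 1%N); apply: taylor_coef_bound => // w wz; apply: hM.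
  have -> : w = z + (w - z) by ring.
  by rewrite (le_trans (cabs_triangle _ _)) // wz; lra.
have lip z h : cabs z <= r + 1 -> cabs h <= 1 -> cabs (g (z + h) - g z) <= 4 * M * cabs h.
  move=> zr h1.
  have := @cmvt_unit (fun w => g (z + w * h)) (2 * M * cabs h) (entire_line z h hg).
  rewrite cder_line // mul1r mul0r addr0 => H.
  apply: le_trans (H _) _ => [t t01|]; last by rewrite mulrA mulrA (_ : 2 * 2 = 4) //; ring.
  rewrite cabsM ler_wpM2r ?cabs_ge0 // d1 // (le_trans (cabs_triangle _ _)) // cabsM.
  have := ler_pM (cabs_ge0 _) (cabs_ge0 h) (cabs_real_unit t01) h1; lra.
have lip' z h : cabs z <= r -> cabs h <= 1 -> cabs (cder g (z + h) - cder g z) <= 8 * M * cabs h.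
  move=> zr h1; rewrite -!taylor_coef1 // /taylor_coef -circ_meanCB; try exact: continuous_taylor_kernel.
  have -> : 8 * M * cabs h = 2 * (4 * M * cabs h) by ring.
  apply: cabs_circ_meanC_le.
    by apply: contC_B; exact: continuous_taylor_kernel.
  move=> t; rewrite /taylor_kernel expr1 -mulrBl cabsM cabs_cexpN /= expR0 invr1 mulr1 addrAC lip //.
  rewrite (le_trans (cabs_triangle _ _)) // cabs_cexp /= expR0 lerD2r //.
exists (16 * M); first by rewrite mulr_ge0.
move=> z h zr h1; split.
  apply: le_trans (lip' _ _ zr h1) _; rewrite ler_wpM2r ?cabs_ge0 // ler_wpM2r //; lra.
have eW := entireM (@entire_id R) (entire_cst (cder g z * h)).
have cE : cder (fun w => g (z + w * h) - w * (cder g z * h)) = fun w => (cder g (z + w * h) - cder g z) * h.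
  rewrite (cderB (entire_line z h hg) eW) (cderM (@entire_id R) (entire_cst (cder g z * h))) cder_id cder_cst cder_line //.
  have aux (x y k w : C) : x * k - (1 * (y * k) + w * 0) = (x - y) * k by ring.
  by apply/funext => w; exact: aux.
have := @cmvt_unit (fun w => g (z + w * h) - w * (cder g z * h)) (8 * M * cabs h * cabs h)
   (entireB (entire_line z h hg) eW).
rewrite cE !mul1r !mul0r addr0 subr0 => H.
have -> : g (z + h) - g z - cder g z * h = g (z + h) - cder g z * h - g z by ring.
apply: le_trans (H _) _ => [t t01|]; last by rewrite le_eqVlt; apply/orP; left; apply/eqP; ring.
rewrite cabsM ler_wpM2r ?cabs_ge0 //.
have th : cabs (Complex t 0 * h) <= cabs h.
  by rewrite cabsM -[leRHS]mul1r ler_wpM2r ?cabs_ge0 // cabs_real_unit.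
apply: le_trans (lip' _ _ zr (le_trans th h1)) _.
by rewrite ler_wpM2l // mulr_ge0.
Qed.

(** By [taylor_coef1] the derivative at [a] is a mean of [g] over the unit circle about [a], and
    this mean can be differentiated under the integral. The continuity of [cder g], shown first,
    makes the new integrand integrable. *)
Lemma entire_cder g : entire g -> entire (cder g).
Proof.
move=> hg.
have cc : continuous (cder g : C -> C).
  move=> z; apply/cts_epsdelta => e e0.
  have [L L0 hL] := entire_second_order (cabs z) hg.
  pose d := Num.min 1 (e / (L + 1)).
  have L1 : 0 < L + 1 by rewrite ltr_wpDl.
  have d0 : 0 < d by rewrite lt_min ltr01 divr_gt0.
  have := near_cabs z d0; apply: filterS => y; rewrite cabs_distC lt_min => /andP[y1 y2].
  have [h _] := hL z (y - z) (lexx _) (ltW y1).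
  rewrite cabs_distC; move: h; rewrite (addrC z) subrK => h; apply: le_lt_trans h _.
  rewrite ltr_pdivlMr // in y2; apply: le_lt_trans y2.
  by rewrite mulrC ler_wpM2l ?cabs_ge0 // lerDl.
apply: (proj1 (entire_of_cderiv (g' := fun a => circ_meanC (fun t => cder g (a + cexp (Complex 0 t)) * cexp (- Complex 0 t))) _)) => a e e0.
have [L L0 hL] := entire_second_order (cabs a + 1) hg.
pose d := Num.min 1 (e / (2 * (L + 1))).
have L1 : 0 < L + 1 by rewrite ltr_wpDl.
exists d; first by rewrite lt_min ltr01 divr_gt0 // mulr_gt0.
move=> h; rewrite lt_min => /andP[h1 h2].
rewrite -!taylor_coef1 // /taylor_coef.
have c2 : continuous (fun t => cder g (a + cexp (Complex 0 t)) * cexp (- Complex 0 t)).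
  apply: contC_M; last exact: (@entire_continuous_t R (fun w => cexp (- w)) 0 entire_cexpN).
  move=> x; apply: (@continuous_comp _ _ _ (fun t => a + cexp (Complex 0 t)) (cder g)); last exact: cc.
  exact: (@entire_continuous_t R (fun w => a + cexp w) 0 (entireD (entire_cst a) (@entire_cexp R))).
have c3 : continuous (fun t => h * (cder g (a + cexp (Complex 0 t)) * cexp (- Complex 0 t))).
  by apply: contC_M; [exact: contC_cst|exact: c2].
have c1 z : continuous (fun t => taylor_kernel g z 1 (Complex 0 t)) by exact: continuous_taylor_kernel.
have c4 : continuous (fun t => taylor_kernel g (a + h) 1 (Complex 0 t) - taylor_kernel g a 1 (Complex 0 t)).
  by apply: contC_B; exact: c1.
rewrite mulrC -(circ_meanCZ h c2) -(circ_meanCB (c1 (a + h)) (c1 a)) -(circ_meanCB c4 c3).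
apply: (@le_trans _ _ (2 * (L * cabs h ^+ 2))).
  apply: cabs_circ_meanC_le; first by apply: contC_B; [exact: c4|exact: c3].
  move=> t; rewrite /taylor_kernel expr1 -mulrBl mulrA -mulrBl cabsM cabs_cexpN /= expR0 invr1 mulr1.
  rewrite (addrAC a) (mulrC h); apply: (proj2 (hL _ _ _ (ltW h1))).
  by rewrite (le_trans (cabs_triangle _ _)) // cabs_cexp /= expR0.
have N0 := cabs_ge0 h.
move: h2; rewrite ltr_pdivlMr ?mulr_gt0 // => h2.
rewrite expr2 mulrA mulrA ler_wpM2r //.
have -> : 2 * L * cabs h = cabs h * (2 * (L + 1)) - 2 * cabs h by ring.
lra.
Qed.
End Taylor.

(** * Taylor expansion and factoring out zeros *)

Section TaylorExpansion.
Variable R : realType.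
Local Notation C := (Cplx R).
Implicit Types (g h : C -> C) (a z w : C).

Lemma cder_cexpNX n : cder (fun w : C => cexp (- w) ^+ n) = fun w => - (n%:R * cexp (- w) ^+ n).
Proof.
have hE := @entire_cexpN R.
have cE : cder (fun w : C => cexp (- w)) = fun w => - cexp (- w).
  rewrite (cder_comp (@entire_cexp R) (entireN (@entire_id R))) cder_cexp (cderN (@entire_id R)) cder_id.
  by apply/funext => w; rewrite mulrN1.
elim: n => [|n IH].
  have -> : (fun w : C => cexp (- w) ^+ 0) = fun=> 1 by apply/funext => w; rewrite expr0.
  by rewrite cder_cst; apply/funext => w; rewrite mul0r oppr0.
have -> : (fun w : C => cexp (- w) ^+ n.+1) = fun w => cexp (- w) * cexp (- w) ^+ n.
  by apply/funext => w; rewrite exprS.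
rewrite (cderM hE (@entireX R _ n hE)) IH cE; apply/funext => w.
have aux (x y k : C) : - x * y + x * - (k * y) = - ((1 + k) * (x * y)) by ring.
by rewrite aux exprS -mulrS.
Qed.

(** Integration by parts: the derivative of the kernel of index [n.+1] is the kernel of [cder g] of
    index [n] minus [n.+1] times the former, and its mean over a period is 0. *)
Lemma taylor_coef_cder g a n : entire g -> taylor_coef (cder g) a n = n.+1%:R * taylor_coef g a n.+1.
Proof.
move=> hg; have hg' := entire_cder hg.
have hX := @entireX R _ n.+1 (@entire_cexpN R).
have eG : cder (taylor_kernel g a n.+1) = fun w => taylor_kernel (cder g) a n w - n.+1%:R * taylor_kernel g a n.+1 w.
  rewrite (cderM (@entire_shift_cexp R g a hg) hX).
  rewrite cder_cexpNX (cder_comp hg (entireD (entire_cst a) (@entire_cexp R))).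
  rewrite (cderD (entire_cst a) (@entire_cexp R)) cder_cst cder_cexp.
  apply/funext => w; rewrite /taylor_kernel exprS.
  have e1 := cexpN w.
  have aux (x y k p q u : C) : p * q = 1 -> x * (0 + q) * (p * y) + k * - (u * (p * y)) = x * y - u * (k * (p * y)).
    move=> pq; have -> : x * (0 + q) * (p * y) = x * (p * q) * y by ring.
    by rewrite pq; ring.
  exact: aux.
have := @circ_meanC_cder_periodic R (taylor_kernel g a n.+1) 0 (@entire_taylor_kernel R g a n.+1 hg).
rewrite eG => H.
have c1 := @continuous_taylor_kernel R (cder g) a n 0 hg'.
have c2 := @continuous_taylor_kernel R g a n.+1 0 hg.
have c3 : continuous (fun t : R => n.+1%:R * taylor_kernel g a n.+1 (Complex 0 t)).
  by apply: contC_M; [exact: contC_cst|exact: c2].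
have {H} := H (contC_B c1 c3) (@taylor_kernel_periodic R g a n.+1).
rewrite (circ_meanCB c1 c3) (circ_meanCZ n.+1%:R c2) => /eqP; rewrite subr_eq0 => /eqP.
by [].
Qed.

Lemma entire_iter_cder n g : entire g -> entire (iter n (@cder R) g).
Proof. by move=> hg; elim: n => [//|n IH]; exact: entire_cder. Qed.

Lemma natrC_neq0 n : (n.+1%:R : C) != 0.
Proof. by rewrite pnatr_eq0. Qed.

Lemma taylor_coef_iter g a n : entire g -> taylor_coef g a n = (n`!%:R)^-1 * iter n (@cder R) g a.
Proof.
elim: n g => [|n IH] g hg; first by rewrite taylor_coef0 // fact0 invr1 mul1r.
have := taylor_coef_cder a n hg; rewrite IH; last exact: entire_cder.
move/(congr1 (fun x => n.+1%:R^-1 * x)); rewrite mulKf ?natrC_neq0 // => <-.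
by rewrite -iterSr mulrA factS natrM invfM.
Qed.

Section Remainder.
Variables (g : C -> C) (a b : C).
Hypothesis hg : entire g.
Let c (k : nat) (z : C) : C := (k`!%:R)^-1 * iter k (@cder R) g z.
(** The Taylor polynomial of [g] about [a + w b], evaluated at [a + b]. It passes from the
    polynomial about [a], at [w = 0], to the value [g (a + b)], at [w = 1], and in its derivative
    all terms but the last cancel. *)
Let T n w := \sum_(k < n) c k (a + w * b) * ((1 - w) * b) ^+ k.

Let e1 : entire (fun w : C => 1 - w).
Proof. exact (entireB (entire_cst 1) (@entire_id R)). Qed.

Let eb : entire (fun w : C => (1 - w) * b).
Proof. exact (entireM e1 (entire_cst b)). Qed.

Let deb : cder (fun w : C => (1 - w) * b) = fun=> - b.
Proof.
rewrite (cderM e1 (entire_cst b)) (cderB (entire_cst 1) (@entire_id R)) !cder_cst cder_id.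
by apply/funext => w; rewrite mulr0 addr0 sub0r mulN1r.
Qed.

Let debX n : cder (fun w : C => ((1 - w) * b) ^+ n.+1) = fun w => - (n.+1%:R * b * ((1 - w) * b) ^+ n).
Proof.
elim: n => [|n IH].
  have -> : (fun w : C => ((1 - w) * b) ^+ 1) = fun w => (1 - w) * b by apply/funext => w; rewrite expr1.
  by rewrite deb; apply/funext => w; rewrite expr0 mulr1 mul1r.
have -> : (fun w : C => ((1 - w) * b) ^+ n.+2) = fun w => ((1 - w) * b) * ((1 - w) * b) ^+ n.+1.
  by apply/funext => w; rewrite exprS.
rewrite (cderM eb (@entireX R _ n.+1 eb)) IH deb; apply/funext => w.
rewrite exprS [n.+2%:R]mulrS.
have aux (x p q k : C) : - p * (x * q) + x * - (k * p * q) = - ((1 + k) * p * (x * q)) by ring.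
exact: aux.
Qed.

Let ec k : entire (fun w => c k (a + w * b)).
Proof. exact (entireM (entire_cst _) (@entire_line R _ a b (@entire_iter_cder k g hg))). Qed.

Let dec k : cder (fun w => c k (a + w * b)) = fun w => (k`!%:R)^-1 * (iter k.+1 (@cder R) g (a + w * b) * b).
Proof.
rewrite (cderM (entire_cst _) (@entire_line R _ a b (@entire_iter_cder k g hg))) cder_cst.
rewrite (@cder_line R _ a b (@entire_iter_cder k g hg)); apply/funext => w.
by rewrite mul0r add0r.
Qed.

Let eterm k : entire (fun w => c k (a + w * b) * ((1 - w) * b) ^+ k).
Proof. exact (entireM (@ec k) (@entireX R _ k eb)). Qed.

Let eT n : entire (T n).
Proof. exact (@entire_sum R _ (index_enum _) xpredT _ (fun k : 'I_n => @eterm k)). Qed.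

Let dT n : cder (T n.+1) = fun w => (n`!%:R)^-1 * iter n.+1 (@cder R) g (a + w * b) * (1 - w) ^+ n * b ^+ n.+1.
Proof.
elim: n => [|n IH].
  have -> : T 1 = fun w => c 0 (a + w * b).
    by apply/funext => w; rewrite /T big_ord_recl big_ord0 addr0 expr0 mulr1.
  by rewrite dec; apply/funext => w; rewrite expr0 mulr1 expr1 mulrA.
have -> : T n.+2 = fun w => T n.+1 w + c n.+1 (a + w * b) * ((1 - w) * b) ^+ n.+1.
  by apply/funext => w; rewrite /T big_ord_recr.
rewrite (cderD (@eT n.+1) (@eterm n.+1)) IH (cderM (@ec n.+1) (@entireX R _ n.+1 eb)) dec debX.
apply/funext => w; rewrite /c.
have f0 : n`!%:R^-1 = n.+1%:R * (n.+1)`!%:R^-1 :> C.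
  by rewrite factS natrM invfM mulVKf // natrC_neq0.
rewrite f0 !exprMn !exprS.
set u := _^-1; set k := n.+1%:R; set y := iter n.+1 _ _ _; set x := iter n.+2 _ _ _.
set p := _ ^+ n; set q := b ^+ n; set v := 1 - w.
move: u k y x p q v => u k y x p q v; ring.
Qed.

(** A mean value bound for [T] between 0 and 1; [rho] is the radius of the circles on which Cauchy's
    estimate is applied about the points of the segment. *)
Lemma taylor_remainder n (M rho : R) : 0 < rho ->
  (forall w, cabs (w - a) <= cabs b + rho -> cabs (g w) <= M) ->
  cabs (g (a + b) - \sum_(k < n.+1) (k`!%:R)^-1 * iter k (@cder R) g a * b ^+ k)
   <= 2 * (n.+1%:R * (2 * (M / rho ^+ n.+1)) * cabs b ^+ n.+1).
Proof.
move=> rho0 hM.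
have T1 : T n.+1 1 = g (a + b).
  rewrite /T big_ord_recl big1 ?addr0; last first.
    by move=> i _; rewrite subrr mul0r exprS mul0r mulr0.
  by rewrite expr0 mulr1 mul1r /c fact0 invr1 mul1r.
have T0 : T n.+1 0 = \sum_(k < n.+1) (k`!%:R)^-1 * iter k (@cder R) g a * b ^+ k.
  by apply: eq_bigr => k _; rewrite subr0 mul0r addr0 mul1r.
rewrite -T1 -T0; apply: cmvt_unit; first exact: eT.
move=> t t01; rewrite dT.
set z := a + Complex t 0 * b.
have hz : (n`!%:R)^-1 * iter n.+1 (@cder R) g z = n.+1%:R * taylor_coef g z n.+1.
  by rewrite taylor_coef_iter // factS natrM invfM mulrA mulVKf // natrC_neq0.
rewrite hz cabsM cabsX ler_wpM2r ?exprn_ge0 ?cabs_ge0 // cabsM [in leLHS]cabsM cabs_natr.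
have p1 : cabs ((1 - Complex t 0) ^+ n : C) <= 1.
  have t1 : cabs (1 - Complex t 0 : C) <= 1.
    have -> : 1 - Complex t 0 = Complex (1 - t) 0 :> C by apply: Cplx_eqP; rewrite !cplxE /= ?subr0.
    by apply: cabs_real_unit; case/andP: t01 => *; apply/andP; split; lra.
  by rewrite cabsX exprn_ile1 ?cabs_ge0.
rewrite -[leRHS]mulr1; apply: ler_pM => //; rewrite ?mulr_ge0 ?cabs_ge0 ?ler0n //.
rewrite ler_wpM2l ?ler0n //; apply: taylor_coef_bound => // w wz; apply: hM.
have -> : w - a = Complex t 0 * b + (w - z) by rewrite /z; ring.
rewrite (le_trans (cabs_triangle _ _)) // wz lerD2r // cabsM.
by rewrite -[leRHS]mul1r ler_wpM2r ?cabs_ge0 // cabs_real_unit.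
Qed.
End Remainder.

Lemma identity_theorem g a : entire g -> (forall k, iter k (@cder R) g a = 0) -> forall w, g w = 0.
Proof.
move=> hg h0 w.
pose b := w - a.
have [b0|b0] := eqVneq b 0.
  by have := h0 0%N; move/eqP: b0; rewrite subr_eq0 => /eqP ->.
have B0 : 0 < cabs b by rewrite cabs_gt0.
have [M M0 hM] := entire_bounded (cabs a + 5 * cabs b) hg.
(* With radius [4 |b|] the remainder is at most [4 M (n + 1) / 4 ^ (n + 1)], hence at most
   [4 M / 2 ^ (n + 1)]. *)
have := fun n => @taylor_remainder g a b hg n M (4 * cabs b).
rewrite (_ : a + b = w); last by rewrite /b; ring.
move=> H; apply: (@cabs_small_eq _ _ _ 1) => e e0; rewrite subr0 mul1r.
pose n := Num.bound (4 * M / e).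
apply: le_trans (_ : _ <= 4 * M / 2 ^+ n.+1) _; last first.
  rewrite ler_pdivrMr ?exprn_gt0 // (mulrC e) -ler_pdivrMr //.
  have /archi_boundP /ltW /le_trans : 0 <= 4 * M / e by rewrite divr_ge0 ?mulr_ge0 // ltW.
  apply.
  by rewrite -natrX ler_nat (leq_trans (ltnW (ltn_expl _ (ltnSn 1)))) // leq_exp2l.
have := H n; rewrite big1 ?subr0; last by move=> i _; rewrite h0 mulr0 mul0r.
move=> /(_ _ _)/le_trans; apply; first by rewrite mulr_gt0.
  move=> z zz; apply: hM; have -> : z = a + (z - a) by ring.
  by rewrite (le_trans (cabs_triangle _ _)) // lerD2l; lra.
rewrite exprMn invfM.
have e4 : (4 : R) ^+ n.+1 = 2 ^+ n.+1 * 2 ^+ n.+1.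
  by rewrite -exprMn (_ : 2 * 2 = 4) //; ring.
rewrite e4 invfM.
have bn : (cabs b ^+ n.+1)^-1 * cabs b ^+ n.+1 = 1 by rewrite mulVf // expf_neq0 // gt_eqF.
set u := (2 ^+ n.+1)^-1; set v := _^-1 in bn *; set x := _ ^+ _ in bn *.
have u0 : 0 <= u by rewrite invr_ge0 exprn_ge0.
have nu : n.+1%:R * u <= 1.
  by rewrite ler_pdivrMr ?exprn_gt0 // mul1r -natrX ler_nat ltnW // ltn_expl.
have -> : 2 * (n.+1%:R * (2 * (M * (u * u * v))) * x) = 4 * M * u * (n.+1%:R * u) * (v * x) by ring.
by rewrite bn mulr1 -[leRHS]mulr1 ler_wpM2l // !mulr_ge0.
Qed.

(** The quotient [h] takes the value [cder g a] at [a]; its differentiability there is read off the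
    Taylor expansion of [g] of order 2. *)
Lemma entire_factor g a : entire g -> g a = 0 -> exists2 h, entire h & forall w, g w = (w - a) * h w.
Proof.
move=> hg ga0.
pose h w := if w == a then cder g a else g w / (w - a).
have gh w : g w = (w - a) * h w.
  rewrite /h; case: eqVneq => [->|wa]; first by rewrite subrr mul0r ga0.
  by rewrite mulrC divfK // subr_eq0.
exists h; last exact: gh.
pose c2 := 2^-1 * cder (cder g) a.
pose h' w := if w == a then c2 else (cder g w - h w) / (w - a).
apply: (proj1 (entire_of_cderiv (g' := h') _)) => z e e0.
have [->|za] := eqVneq z a.
  have [M M0 hM] := entire_bounded (cabs a + 2) hg.
  pose K := 2 * (3 * (2 * M)) + 1.
  have K0 : 0 < K by rewrite ltr_wpDl // !mulr_ge0.
  exists (Num.min 1 (e / K)); first by rewrite lt_min ltr01 divr_gt0.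
  move=> k; rewrite lt_min => /andP[k1 k2].
  have -> : h' a = c2 by rewrite /h' eqxx.
  have [->|k0] := eqVneq k 0; first by rewrite addr0 subrr mulr0 subr0 cabs0 mulr0.
  have N0 : 0 < cabs k by rewrite cabs_gt0.
  have -> : h a = cder g a by rewrite /h eqxx.
  have ha : h (a + k) = g (a + k) / k.
    by rewrite /h (addrC a) addrK -subr_eq0 addrK (negbTE k0).
  have := @taylor_remainder g a k hg 2 M 1 ltr01.
  have hMM : forall w, cabs (w - a) <= cabs k + 1 -> cabs (g w) <= M.
    move=> w wa; apply: hM; have -> : w = a + (w - a) by ring.
    by rewrite (le_trans (cabs_triangle _ _)) //; lra.
  move=> /(_ hMM).
  rewrite !big_ord_recl big_ord0 /= fact0 !factS fact0 !muln1 ga0 mulr0 mul0r add0r expr1 invr1 mul1r expr1n divr1 -/c2 addr0.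
  rewrite /bump /= add1n => H.
  have -> : h (a + k) - cder g a - c2 * k = (g (a + k) - (cder g a * k + c2 * k ^+ 2)) / k.
    by rewrite ha; field.
  rewrite cabsM cabsV ler_pdivrMr // (le_trans H) //.
  rewrite !exprS expr0 mulr1.
  have -> : 2 * (3 * (2 * M) * (cabs k * (cabs k * cabs k))) = (2 * (3 * (2 * M)) * cabs k) * (cabs k * cabs k) by ring.
  rewrite -(mulrA e) ler_wpM2r ?mulr_ge0 ?cabs_ge0 //.
  rewrite ltr_pdivlMr // in k2; apply: le_trans (ltW k2).
  by rewrite mulrC ler_wpM2l ?cabs_ge0 // /K lerDl.
have d0 : z - a != 0 by rewrite subr_eq0.
have D0 : 0 < cabs (z - a) by rewrite cabs_gt0.
pose c := (cder g z - h z) / (z - a).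
have -> : h' z = c by rewrite /h' (negbTE za).
pose D := cabs (z - a).
have C1 : 0 < 1 + cabs c by rewrite ltr_pwDl ?cabs_ge0.
have e4 : 0 < e * D / 4 by rewrite divr_gt0 // mulr_gt0.
have [dl dl0 hd] := entireP hg z e4.
exists (Num.min dl (Num.min (D / 2) (e * D / 4 / (1 + cabs c)))).
  by rewrite !lt_min dl0 (divr_gt0 e4 C1) (divr_gt0 D0 (ltr0Sn R 1)).
move=> k; rewrite !lt_min => /andP[k1 /andP[k2 k3]].
have wa : D / 2 <= cabs (z + k - a).
  have -> : z + k - a = (z - a) - (- k) by ring.
  by have := cabs_sub_le (z - a) (- k); rewrite cabsN -/D; lra.
have W0 : 0 < cabs (z + k - a) by apply: lt_le_trans wa; rewrite divr_gt0.
(* Away from [a] the quotient rule is verified after multiplication by [z + k - a], whose modulus is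
   at least half of [|z - a|]. *)
have id : (z + k - a) * (h (z + k) - h z - c * k) = (g (z + k) - g z - cder g z * k) - c * k ^+ 2.
  have g1 := gh (z + k); have g2 := gh z.
  have cE : cder g z = c * (z - a) + h z by rewrite /c divfK // subrK.
  rewrite g1 g2 cE; ring.
rewrite -(ler_pM2l W0) -cabsM id (le_trans (cabs_triangleB _ _)) //.
have := hd _ k1; move=> H1.
have H2 : cabs (c * k ^+ 2) <= e * D / 4 * cabs k.
  rewrite cabsM cabsX expr2 mulrA ler_wpM2r ?cabs_ge0 //.
  rewrite ltr_pdivlMr // in k3.
  apply: le_trans (ltW k3); rewrite mulrC ler_wpM2l ?cabs_ge0 //; lra.
apply: le_trans (lerD H1 H2) _.
rewrite -mulrDl mulrA ler_wpM2r ?cabs_ge0 //.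
have -> : e * D / 4 + e * D / 4 = D / 2 * e by field.
by rewrite ler_pM2r.
Qed.

Lemma iter_cder_factor h a n : entire h ->
  iter n.+1 (@cder R) (fun w => (w - a) * h w) a = n.+1%:R * iter n (@cder R) h a.
Proof.
move=> hh.
suff H k : iter k.+1 (@cder R) (fun w => (w - a) * h w) =
    fun w => (w - a) * iter k.+1 (@cder R) h w + k.+1%:R * iter k (@cder R) h w.
  by rewrite H subrr mul0r add0r.
have ea : entire (fun w : C => w - a) by exact (entireB (@entire_id R) (entire_cst a)).
have da : cder (fun w : C => w - a) = fun=> 1.
  rewrite (cderB (@entire_id R) (entire_cst a)) cder_id cder_cst.
  by apply/funext => w; rewrite subr0.
elim: k => [|k IH].
  rewrite [iter 1 _ _]/= (cderM ea hh) da; apply/funext => w /=.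
  by rewrite !mul1r addrC.
rewrite iterS IH.
have eh j := @entire_iter_cder j h hh.
rewrite (cderD (entireM ea (@eh k.+1)) (@entireZ R k.+1%:R _ (@eh k))) (cderM ea (@eh k.+1)) da.
rewrite (@cderZ R _ _ (@eh k)) -!iterS; apply/funext => w; rewrite [k.+2%:R]mulrS.
set x := iter k.+2 _ _ _; set y := iter k.+1 _ _ _.
move: x y (k.+1%:R) (w - a) => x y u v; ring.
Qed.

(** Dividing by [w - a] a function that vanishes at [a] lowers by one the index of the derivative
    known to be nonzero there. *)
Lemma finite_order g a n : entire g -> iter n (@cder R) g a != 0 ->
  exists m h, [/\ entire h, h a != 0 & forall w, g w = (w - a) ^+ m * h w].
Proof.
elim: n g => [|n IH] g hg hn.
  by exists 0%N, g; split => // w; rewrite expr0 mul1r.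
have [g0|g0] := eqVneq (g a) 0; last by exists 0%N, g; split => // w; rewrite expr0 mul1r.
have [h hh gh] := entire_factor hg g0.
have gE : g = fun w => (w - a) * h w by apply/funext.
move: hn; rewrite gE iter_cder_factor // mulf_eq0 negb_or => /andP[_ hn].
have [m [k [hk ka kk]]] := IH h hh hn.
exists m.+1, k; split => // w.
by rewrite kk exprS mulrA.
Qed.

Lemma order_exists g a : entire g -> (exists w, g w != 0) ->
  exists m h, [/\ entire h, h a != 0 & forall w, g w = (w - a) ^+ m * h w].
Proof.
move=> hg [w gw].
have [n hn] : exists n, iter n (@cder R) g a != 0.
  apply: contrapT => H; move/negP: gw; apply; apply/eqP.
  apply: (identity_theorem hg (a := a)) => k; apply/eqP.
  by apply: contrapT => /negP k0; apply: H; exists k.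
exact: (finite_order hg hn).
Qed.
End TaylorExpansion.

(** * Orders of zeros *)

Section ZeroOrder.
Variable R : realType.
Local Notation C := (Cplx R).
Implicit Types (g h : C -> C) (a z w : C).

Definition nonzero g := exists w, g w != 0.

Lemma entire_zero_off g z : entire g -> (forall w, w != z -> g w = 0) -> g z = 0.
Proof.
move=> hg h0.
have [d d0 hd] := entireP hg z ltr01.
pose c := cder g z; pose K := cabs c + 1.
have K0 : 0 < K by rewrite ltr_wpDl ?cabs_ge0.
have H (e : R) : 0 < e -> e < d -> cabs (g z) <= K * e.
  move=> e0 ed.
  have k0 : Complex e 0 != 0 :> C by rewrite -cabs_gt0 cabs_real gtr0_norm.
  have ke : cabs (Complex e 0 : C) = e by rewrite cabs_real gtr0_norm.
  have := hd (Complex e 0); rewrite ke => /(_ ed).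
  rewrite h0; last by rewrite -subr_eq0 addrC addKr.
  rewrite sub0r mul1r -/c => Hc.
  have -> : g z = - (- g z - c * Complex e 0) - c * Complex e 0 by ring.
  rewrite (le_trans (cabs_triangleB _ _)) // cabsN cabsM ke /K mulrDl mul1r addrC lerD2l //.
apply: (@cabs_small_eq _ _ _ K) => e e0; rewrite subr0.
pose m := Num.min e (d / 2).
have m0 : 0 < m by rewrite lt_min e0 divr_gt0.
apply: le_trans (H m m0 _) _; first by rewrite gt_min [X in _ || X](_ : _ = true) ?orbT //; lra.
by rewrite ler_pM2l // ge_min lexx.
Qed.

Lemma pow_sub_cancel f g z m : entire f -> entire g ->
  (forall w, (w - z) ^+ m * f w = (w - z) ^+ m * g w) -> f =1 g.
Proof.
move=> hf hg H w.
have off v : v != z -> f v - g v = 0.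
  move=> vz; apply/eqP; rewrite subr_eq0; apply/eqP.
  by apply: (mulfI _ (H v)); rewrite expf_neq0 // subr_eq0.
have [->|wz] := eqVneq w z; apply/eqP; rewrite -subr_eq0; apply/eqP; last exact: off.
exact: (@entire_zero_off (fun v => f v - g v) z (entireB hf hg) off).
Qed.

(** Of two factorisations with different exponents, the one with the smaller exponent would have a
    cofactor that vanishes at [z]; so [xget] has only one choice. *)
Lemma zero_order_eq g h z m : entire h -> h z != 0 -> (forall w, g w = (w - z) ^+ m * h w) ->
  zero_order g z = m.
Proof.
move=> hh hz gE; rewrite /zero_order; apply: xget_unique; first by exists h.
move=> n [k [hk kz gk]].
wlog nm : n m h k hh hz gE hk kz gk / (n <= m)%N.
  move=> W; have [nm|/ltnW mn] := leqP n m; first exact: (W n m h k).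
  exact/esym/(W m n k h).
apply/eqP; rewrite eqn_leq nm leqNgt /=; apply/negP => lt.
have e : forall w, (w - z) ^+ n * k w = (w - z) ^+ n * ((w - z) ^+ (m - n) * h w).
  by move=> w; rewrite -gk gE mulrA -exprD subnKC.
have ee : entire (fun w => (w - z) ^+ (m - n) * h w).
  exact (entireM (@entireX R _ (m - n) (entireB (@entire_id R) (entire_cst z))) hh).
have := pow_sub_cancel hk ee e z.
rewrite subrr expr0n subn_eq0 leqNgt lt /= mul0r => kz0.
by rewrite kz0 eqxx in kz.
Qed.

Lemma zero_orderP g z : entire g -> nonzero g ->
  exists h, [/\ entire h, h z != 0 & forall w, g w = (w - z) ^+ zero_order g z * h w].
Proof.
move=> hg nz; have [m [h [hh hz gE]]] := order_exists z hg nz.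
by exists h; split => // w; rewrite (zero_order_eq hh hz gE).
Qed.

Lemma entire_powfactor z m h : entire h -> entire (fun w => (w - z) ^+ m * h w).
Proof. move=> hh; exact (entireM (@entireX R _ m (entireB (@entire_id R) (entire_cst z))) hh). Qed.

Lemma zero_orderM f g z : entire f -> entire g -> nonzero f -> nonzero g ->
  zero_order (fun w => f w * g w) z = (zero_order f z + zero_order g z)%N.
Proof.
move=> hf hg nf ng.
have [h [hh hz fE]] := zero_orderP z hf nf.
have [k [hk kz gE]] := zero_orderP z hg ng.
apply: (@zero_order_eq _ (fun w => h w * k w)).
- exact (entireM hh hk).
- by rewrite mulf_neq0.
- by move=> w; rewrite [in LHS]fE [in LHS]gE exprD mulrACA.
Qed.

Lemma zero_order_ge g h z m : entire g -> nonzero g -> entire h ->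
  (forall w, g w = (w - z) ^+ m * h w) -> (m <= zero_order g z)%N.
Proof.
move=> hg ng hh gE.
have nh : nonzero h.
  by have [w] := ng; rewrite gE mulf_eq0 negb_or => /andP[_ hw]; exists w.
have [k [hk kz hE]] := zero_orderP z hh nh.
rewrite (@zero_order_eq g k z (m + zero_order h z)) ?leq_addr //.
by move=> w; rewrite gE hE exprD mulrA.
Qed.

Lemma zero_order0 g z : entire g -> g z != 0 -> zero_order g z = 0%N.
Proof. by move=> hg gz; apply: (@zero_order_eq g g) => // w; rewrite expr0 mul1r. Qed.

Lemma zero_order_gt0 g z : entire g -> nonzero g -> g z = 0 -> (0 < zero_order g z)%N.
Proof.
move=> hg ng gz; have [h [hh hz gE]] := zero_orderP z hg ng.
rewrite lt0n; apply/eqP => o0; move: (gE z); rewrite gz o0 expr0 mul1r => /esym/eqP.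
by rewrite (negbTE hz).
Qed.

Lemma nonzeroX g n : nonzero g -> nonzero (fun w => g w ^+ n).
Proof. by case=> w gw; exists w; rewrite expf_neq0. Qed.

Lemma nonzero_cst (c : C) : c != 0 -> nonzero (fun=> c). Proof. by exists 0. Qed.

Lemma zero_orderX g z n : entire g -> nonzero g ->
  zero_order (fun w => g w ^+ n) z = (n * zero_order g z)%N.
Proof.
move=> hg ng; have [h [hh hz gE]] := zero_orderP z hg ng.
apply: (@zero_order_eq _ (fun w => h w ^+ n)).
- exact (@entireX R _ n hh).
- by rewrite expf_neq0.
- by move=> w; rewrite [in LHS]gE exprMn -exprM mulnC.
Qed.

Lemma isolated_zeros g z : entire g -> nonzero g ->
  exists2 d : R, 0 < d & forall w, cabs (w - z) < d -> w != z -> g w != 0.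
Proof.
move=> hg ng; have [h [hh hz gE]] := zero_orderP z hg ng.
have [d1 d10 h1] := entireP hh z ltr01.
pose K := 1 + cabs (cder h z); have K0 : 0 < K by rewrite ltr_pwDl ?cabs_ge0.
have N0 : 0 < cabs (h z) by rewrite cabs_gt0.
exists (Num.min d1 (cabs (h z) / K)); first by rewrite lt_min d10 divr_gt0.
move=> w; rewrite lt_min => /andP[w1 w2] wz.
rewrite gE mulf_neq0 ?expf_neq0 ?subr_eq0 //.
apply/eqP => hw0; have := h1 _ w1; rewrite (addrC z) subrK hw0 mul1r => H.
have : cabs (h z) <= K * cabs (w - z).
  have -> : h z = - (0 - h z - cder h z * (w - z)) - cder h z * (w - z) by ring.
  rewrite (le_trans (cabs_triangleB _ _)) // cabsN cabsM /K mulrDl mul1r lerD2r //.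
by move: w2; rewrite ltr_pdivlMr // mulrC => /lt_le_trans h2 /h2; rewrite ltxx.
Qed.

(** Zeros are isolated, so a small square contains at most one; bisection concatenates the lists. *)
Lemma finite_zeros g (r : R) : entire g -> nonzero g ->
  exists s : seq C, forall z, cabs z <= r -> g z = 0 -> z \in s.
Proof.
move=> hg ng.
have [r0|r0] := ltP r 0.
  by exists [::] => z zr; have := le_lt_trans zr r0; rewrite ltNge cabs_ge0.
pose l := 2 * r; have l0 : 0 <= l by rewrite mulr_ge0.
have := @bisection R l l (fun x y k => exists s : seq C, forall u v,
   x <= u <= x + l / 2 ^+ k -> y <= v <= y + l / 2 ^+ k -> g (Complex u v) = 0 -> (Complex u v : C) \in s) l0 l0 _ _ (- r) (- r).
case.
- move=> x y k [s1 h1] [s2 h2] [s3 h3] [s4 h4].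
  exists (s1 ++ s2 ++ s3 ++ s4) => u v.
  have half (c : R) : c / 2 ^+ k = c / 2 ^+ k.+1 + c / 2 ^+ k.+1.
    by rewrite exprS invfM mulrCA; set e := c * _; lra.
  rewrite !half; set c := l / _ in h1 h2 h3 h4 * => /andP[? ?] /andP[? ?] g0; rewrite !mem_cat.
  have [sx|sx] := leP u (x + c); have [ty|ty] := leP v (y + c).
  - by rewrite h1 //; apply/andP; split; lra.
  - by rewrite h3 ?orbT //; apply/andP; split; lra.
  - by rewrite h2 ?orbT //; apply/andP; split; lra.
  - by rewrite h4 ?orbT //; apply/andP; split; lra.
- move=> u v; have [d d0 hd] := @isolated_zeros g (Complex u v) hg ng.
  exists (d / 2); first by rewrite divr_gt0.
  move=> x y k /andP[? ?] /andP[? ?] u1 _; exists [:: Complex u v : C] => u' v' /andP[? ?] /andP[? ?] g0.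
  rewrite inE; apply: contraT => ne.
  have := hd _ _ ne; rewrite g0 eqxx; apply.
  rewrite (le_lt_trans (cabs_le_ReIm _)) // !cplxE /= (splitr d) ltrD // ltr_norml; apply/andP; split; lra.
- move=> s hs; exists s => -[u v] z0; have a := le_trans (Re_le_cabs _) z0; have b := le_trans (Im_le_cabs _) z0.
  move: a b => /=; rewrite !ler_norml => /andP[? ?] /andP[? ?].
  by apply: hs; rewrite expr0 divr1 /l; apply/andP; split; lra.
Qed.

Lemma factor_list g (Z : seq C) : entire g -> nonzero g -> uniq Z ->
  exists h, [/\ entire h, forall w, g w = \prod_(a <- Z) (w - a) ^+ zero_order g a * h w
     & forall a, a \in Z -> h a != 0].
Proof.
move=> hg ng; elim: Z => [|b Z IH] /=.
  by move=> _; exists g; split => // w; rewrite big_nil mul1r.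
case/andP=> bZ uZ; have [h [hh gE hZ]] := IH uZ.
have nh : nonzero h.
  by have [w] := ng; rewrite gE mulf_eq0 negb_or => /andP[_ hw]; exists w.
have [k [hk kb hE]] := zero_orderP b hh nh.
have eP : entire (fun w => \prod_(a <- Z) (w - a) ^+ zero_order g a).
  exact (@entire_prod R _ Z xpredT _ (fun a => @entireX R _ (zero_order g a) (entireB (@entire_id R) (entire_cst a)))).
have oE : zero_order g b = zero_order h b.
  apply: (@zero_order_eq g (fun w => \prod_(a <- Z) (w - a) ^+ zero_order g a * k w)).
  - exact (entireM eP hk).
  - rewrite mulf_neq0 // prodf_seq_neq0; apply/allP => a aZ /=.
    by rewrite expf_neq0 // subr_eq0; apply: contraNneq bZ => ->.
  - by move=> w; rewrite [in LHS]gE [in LHS]hE mulrCA.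
exists k; split => //.
  by move=> w; rewrite big_cons oE [LHS]gE [in LHS]hE mulrCA mulrA.
move=> a; rewrite inE => /predU1P[->//|aZ].
have := hZ _ aZ; rewrite hE mulf_eq0 negb_or => /andP[_]; by [].
Qed.
End ZeroOrder.

(** * Integrals depending on a parameter *)

Section UnderIntegral.
Variable R : realType.
Implicit Types (F v : R -> R -> R).

Definition cont2_at F s t := {for (s, t), continuous (fun p : R * R => F p.1 p.2)}.

Lemma bounded_on_box F (a b c d : R) : a <= b -> c <= d ->
  (forall s t, a <= s <= b -> c <= t <= d -> cont2_at F s t) ->
  exists2 M : R, 0 <= M & forall s t, a <= s <= b -> c <= t <= d -> `|F s t| <= M.
Proof.
move=> ab cd cF.
pose l := b - a; pose m := d - c.
have l0 : 0 <= l by rewrite subr_ge0.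
have m0 : 0 <= m by rewrite subr_ge0.
have := @bisection R l m (fun x y k => exists2 M : R, 0 <= M & forall s t,
   a <= s <= b -> c <= t <= d ->
   x <= s <= x + l / 2 ^+ k -> y <= t <= y + m / 2 ^+ k -> `|F s t| <= M) l0 m0 _ _ a c.
case.
- move=> x y k [M1 p1 h1] [M2 p2 h2] [M3 p3 h3] [M4 p4 h4].
  exists (M1 + M2 + M3 + M4) => [|s t ss tt]; first by rewrite !addr_ge0.
  have half (u : R) : u / 2 ^+ k = u / 2 ^+ k.+1 + u / 2 ^+ k.+1.
    by rewrite exprS invfM mulrCA; set e := u * _; lra.
  rewrite !half; set u := l / _ in h1 h2 h3 h4 *; set w := m / _ in h1 h2 h3 h4 *.
  move=> /andP[? ?] /andP[? ?].
  have [sx|sx] := leP s (x + u); have [ty|ty] := leP t (y + w).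
  - have /le_trans -> // : `|F s t| <= M1 by apply: h1 => //; apply/andP; split; lra.
    lra.
  - have /le_trans -> // : `|F s t| <= M3 by apply: h3 => //; apply/andP; split; lra.
    lra.
  - have /le_trans -> // : `|F s t| <= M2 by apply: h2 => //; apply/andP; split; lra.
    lra.
  - have /le_trans -> // : `|F s t| <= M4 by apply: h4 => //; apply/andP; split; lra.
    lra.
- move=> s t.
  (* Continuity is available inside the box only; near a point outside it small rectangles miss the
     box and the claim is empty. *)
  case: (pselect (a <= s <= b /\ c <= t <= d)) => [[ss tt]|nst]; last first.
    have [as_|sa] := leP a s; last first.
      exists (a - s) => [|x y k /andP[? ?] /andP[? ?] ? ?]; first by rewrite subr_gt0.
      by exists 0 => // s' t' /andP[? ?] /andP[? ?] /andP[? ?] /andP[? ?]; exfalso; lra.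
    have [sb|bs] := leP s b; last first.
      exists (s - b) => [|x y k /andP[? ?] /andP[? ?] ? ?]; first by rewrite subr_gt0.
      by exists 0 => // s' t' /andP[? ?] /andP[? ?] /andP[? ?] /andP[? ?]; exfalso; lra.
    have [ct|taylor_coef] := leP c t; last first.
      exists (c - t) => [|x y k /andP[? ?] /andP[? ?] ? ?]; first by rewrite subr_gt0.
      by exists 0 => // s' t' /andP[? ?] /andP[? ?] /andP[? ?] /andP[? ?]; exfalso; lra.
    have [td|dt] := leP t d; last first.
      exists (t - d) => [|x y k /andP[? ?] /andP[? ?] ? ?]; first by rewrite subr_gt0.
      by exists 0 => // s' t' /andP[? ?] /andP[? ?] /andP[? ?] /andP[? ?]; exfalso; lra.
    by exfalso; apply: nst; rewrite as_ sb ct td.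
  have /cvgrPdist_lt /(_ 1 ltr01) [[/= P Q] [/= [p p0 hp] [q q0 hq]] hPQ] := cF s t ss tt.
  exists (Num.min p q); first by rewrite lt_min p0 q0.
  move=> x y k /andP[? ?] /andP[? ?]; rewrite !lt_min => /andP[? ?] /andP[? ?].
  exists (`|F s t| + 1) => [|s' t' _ _ /andP[? ?] /andP[? ?]]; first by rewrite addr_ge0.
  have := hPQ (s', t'); rewrite /= => H.
  have : `|F s t - F s' t'| < 1.
    apply: H; split; [apply: hp|apply: hq]; rewrite /ball_ /= ltr_norml; apply/andP; split; lra.
  have e : F s' t' = F s t - (F s t - F s' t') by ring.
  by move=> h; rewrite [in leLHS]e (le_trans (ler_normB _ _)) // lerD2l ltW.
- move=> M M0 hM; exists M => // s t ss tt; apply: hM => //.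
    by move: ss; rewrite expr0 divr1 /l addrC subrK.
  by move: tt; rewrite expr0 divr1 /m addrC subrK.
Qed.

Lemma cont2_at_t F s t : cont2_at F s t -> {for t, continuous (F s)}.
Proof.
move=> /rts_epsdelta H; apply/rts_epsdelta => e e0; have [[P Q] [/= hP hQ] h] := H e e0.
apply: filterS hQ => t' qt'; apply: (h (s, t')); split => //=.
exact: nbhs_singleton.
Qed.

Lemma cont2_at_s F s t : cont2_at F s t -> {for s, continuous (F^~ t)}.
Proof.
move=> /rts_epsdelta H; apply/rts_epsdelta => e e0; have [[P Q] [/= hP hQ] h] := H e e0.
apply: filterS hP => s' ps'; apply: (h (s', t)); split => //=.
exact: nbhs_singleton.
Qed.

Notation mu := (@lebesgue_measure R).

Lemma segint_cvg F (a b s c d : R) : a < s < b -> c <= d ->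
  (forall s t, a < s < b -> cont2_at F s t) ->
  segint c d (F s') @[s' --> s] --> segint c d (F s).
Proof.
move=> /andP[as_ sb] cd cF.
(* The closed interval [[u, v]] lies inside the open one, so [F] is bounded over it by a constant,
   which serves as dominating function. *)
pose u := (a + s) / 2; pose v := (s + b) / 2.
have inuv x : u < x < v -> a < x < b by move=> /andP[]; rewrite /u /v => ? ?; apply/andP; split; lra.
have inuv' x : u <= x <= v -> a < x < b by move=> /andP[]; rewrite /u /v => ? ?; apply/andP; split; lra.
have uv : u <= v by rewrite /u /v; lra.
have [M M0 hM] := @bounded_on_box F u v c d uv cd (fun x t xu _ => cF x t (inuv' x xu)).
have cx x : a < x < b -> continuous (F x) by move=> ax t; apply: cont2_at_t; exact: cF.
have hsI : s \in (`]u, v[%classic : set R).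
  by rewrite inE /= in_itv /= /u /v; apply/andP; split; lra.
apply: (@continuity_under_integral R _ _ mu F `[c, d] (measurable_itv _) u v _ _ (cst M) _ _ s hsI).
- by move=> x; rewrite /= in_itv /= => /inuv xab; apply: integrable_cont; exact: cx.
- apply: aeW => y cdy x; rewrite inE /= in_itv /= => /inuv xab; apply: cont2_at_s; exact: cF.
- exact: (@integrable_cont R c d (cst M) (@continuous_cst _ _ M)).
- move=> x; rewrite /= in_itv /= => xuv; apply: aeW => t; rewrite /= in_itv /= => tcd.
  by apply: hM => //; case/andP: xuv => *; apply/andP; split; exact: ltW.
Qed.

Lemma is_derive_segint v v' (a b s c d : R) : a < s < b -> c <= d ->
  (forall s t, a < s < b -> cont2_at v' s t) ->
  (forall s t, a < s < b -> {for t, continuous (v s)}) ->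
  (forall s t, a < s < b -> is_derive s 1 (v^~ t) (v' s t)) ->
  is_derive s 1 (fun s => segint c d (v s)) (segint c d (v' s)).
Proof.
move=> /andP[as_ sb] cd cv' cv dv.
pose u := (a + s) / 2; pose w := (s + b) / 2.
have inuv x : u < x < w -> a < x < b by move=> /andP[]; rewrite /u /w => ? ?; apply/andP; split; lra.
have inuv' x : u <= x <= w -> a < x < b by move=> /andP[]; rewrite /u /w => ? ?; apply/andP; split; lra.
have uw : u <= w by rewrite /u /w; lra.
have [M M0 hM] := @bounded_on_box v' u w c d uw cd (fun x t xu _ => cv' x t (inuv' x xu)).
have Ia : `]u, w[%classic s by rewrite /= in_itv /= /u /w; apply/andP; split; lra.
have hint x : `]u, w[%classic x -> mu.-integrable `[c, d] (EFin \o v x).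
  by rewrite /= in_itv /= => /inuv xab; apply: integrable_cont => t; exact: cv.
have hder x y : `]u, w[%classic x -> `[c, d]%classic y -> derivable (v^~ y) x 1.
  by rewrite /= in_itv /= => /inuv xab _; case: (dv x y xab).
have pE x y : a < x < b -> partial1of2 v x y = v' x y.
  by move=> xab; rewrite partial1of2E; case: (dv x y xab).
have hM0 (y : R) : 0 <= cst M y by [].
have intM := @integrable_cont R c d (cst M) (@continuous_cst _ _ M).
have hub x y : `]u, w[%classic x -> `[c, d]%classic y -> `|partial1of2 v x y| <= cst M y.
  rewrite /= !in_itv /= => xuw ycd; rewrite pE; last exact: inuv.
  by apply: hM => //; case/andP: xuw => *; apply/andP; split; exact: ltW.
split.
  exact: (@derivable_under_integral R _ _ mu v `[c, d] (measurable_itv _) s u w Ia hint hder _ hM0 intM hub).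
have := @differentiation_under_integral R _ _ mu v `[c, d] (measurable_itv _) s u w Ia hint hder _ hM0 intM hub.
rewrite derive1E => ->; apply: eq_Rintegral => y _.
by rewrite pE //; apply/andP.
Qed.
End UnderIntegral.

Section ContAt.
Variable R : realType.
Variables (T : topologicalType) (x : T).
Implicit Types f g : T -> R.
Lemma cont_atD f g : {for x, continuous f} -> {for x, continuous g} -> {for x, continuous (fun y => f y + g y)}.
Proof. by move=> hf hg; apply: cvgD. Qed.

Lemma cont_atB f g : {for x, continuous f} -> {for x, continuous g} -> {for x, continuous (fun y => f y - g y)}.
Proof. by move=> hf hg; apply: cvgB. Qed.

Lemma cont_atM f g : {for x, continuous f} -> {for x, continuous g} -> {for x, continuous (fun y => f y * g y)}.
Proof. by move=> hf hg; apply: cvgM. Qed.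

Lemma cont_atV f : f x != 0 -> {for x, continuous f} -> {for x, continuous (fun y => (f y)^-1)}.
Proof. by move=> f0 hf; apply: cvgV. Qed.

Lemma cont_at_cst (c : R) : {for x, continuous (fun _ : T => c)}.
Proof. exact: cvg_cst. Qed.

Lemma cont_at_ln f : 0 < f x -> {for x, continuous f} -> {for x, continuous (fun y => ln (f y))}.
Proof. by move=> f0 hf; apply: (@continuous_comp _ _ _ f (@ln R)) => //; exact: continuous_ln. Qed.

Lemma cont_at_sqrt f : {for x, continuous f} -> {for x, continuous (fun y => Num.sqrt (f y))}.
Proof. by move=> hf; apply: (@continuous_comp _ _ _ f Num.sqrt) => //; exact: sqrt_continuous. Qed.
End ContAt.

Section DerivAt.
Variable R : realType.
Implicit Types (f g : R -> R) (x a b : R).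
Lemma rderD f g x a b : is_derive x 1 f a -> is_derive x 1 g b -> is_derive x 1 (fun y => f y + g y) (a + b).
Proof. by move=> ha hb; exact: is_deriveD. Qed.

Lemma rderB f g x a b : is_derive x 1 f a -> is_derive x 1 g b -> is_derive x 1 (fun y => f y - g y) (a - b).
Proof. by move=> ha hb; exact: is_deriveB. Qed.

Lemma rderM f g x a b : is_derive x 1 f a -> is_derive x 1 g b -> is_derive x 1 (fun y => f y * g y) (a * g x + f x * b).
Proof.
move=> ha hb; apply: is_derive_eq (is_deriveM ha hb) _.
by rewrite /GRing.scale /= addrC mulrC.
Qed.

Lemma rder_cst (c x : R) : is_derive x 1 (fun=> c) 0.
Proof. exact: is_derive_cst. Qed.

Lemma rderV f x a : f x != 0 -> is_derive x 1 f a -> is_derive x 1 (fun y => (f y)^-1) (- a / (f x * f x)).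
Proof.
move=> f0 ha; apply: is_derive_eq (is_deriveV f0 ha) _.
by rewrite /GRing.scale /= expr2 !mulNr mulrC.
Qed.

Lemma rder_div f g x a b : g x != 0 -> is_derive x 1 f a -> is_derive x 1 g b ->
  is_derive x 1 (fun y => f y / g y) ((a * g x - f x * b) / (g x * g x)).
Proof.
move=> g0 ha hb; apply: is_derive_eq (rderM ha (rderV g0 hb)) _; field; exact: g0.
Qed.

Lemma rder_ln f x a : 0 < f x -> is_derive x 1 f a -> is_derive x 1 (fun y => ln (f y)) (a / f x).
Proof.
move=> f0 ha; have hl := is_derive1_ln f0.
apply: is_derive_eq (@is_derive1_comp R (@ln R) f x _ _ hl ha) _.
by rewrite mulrC.
Qed.

Lemma rder_sqrt f x a : 0 < f x -> is_derive x 1 f a -> is_derive x 1 (fun y => Num.sqrt (f y)) (a / (2 * Num.sqrt (f x))).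
Proof.
move=> f0 ha; have hl := is_derive1_sqrt f0.
apply: is_derive_eq (@is_derive1_comp R Num.sqrt f x _ _ hl ha) _.
by rewrite mulrC.
Qed.

Lemma rderZ (c : R) f x a : is_derive x 1 f a -> is_derive x 1 (fun y => c * f y) (c * a).
Proof. by move=> ha; apply: is_derive_eq (rderM (rder_cst c x) ha) _; rewrite mul0r add0r. Qed.
End DerivAt.

(** * Laplacians and circle means *)

Section Jets.
Variable R : realType.
Local Notation C := (Cplx R).
Implicit Types (X Y Xs Xt Xss Xtt : R -> R -> R).

(** What is needed at a point to differentiate a mean of [X] twice; the Laplacian involves no mixed
    derivative. *)
Definition jet X Xs Xt Xss Xtt (s t : R) : Prop :=
  [/\ is_derive s 1 (X^~ t) (Xs s t), is_derive s 1 (Xs^~ t) (Xss s t),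
      is_derive t 1 (X s) (Xt s t), is_derive t 1 (Xt s) (Xtt s t)
    & [/\ cont2_at X s t, cont2_at Xs s t, cont2_at Xt s t, cont2_at Xss s t & cont2_at Xtt s t]].

Lemma is_derive_circ_mean (v v' : R -> R -> R) (a b s : R) : a < s < b ->
  (forall s t : R, a < s < b -> cont2_at v' s t) ->
  (forall s t : R, a < s < b -> {for t, continuous (v s)}) ->
  (forall s t : R, a < s < b -> is_derive s 1 (v^~ t) (v' s t)) ->
  is_derive s 1 (fun s => circ_mean (v s)) (circ_mean (v' s)).
Proof.
move=> sab c1 c2 d1; apply: rderZ.
exact: (is_derive_segint sab (@twopi_ge0 R) c1 c2 d1).
Qed.

(** The mean of [Xtt] is 0 because [Xt] is periodic. Adding it to the mean of [Xss] shows that the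
    second derivative of the circle mean in [s = ln r] is the mean of the Laplacian. *)
Lemma polar_jet X Xs Xt Xss Xtt (a b s : R) : a < s < b ->
  (forall s t : R, a < s < b -> jet X Xs Xt Xss Xtt s t) ->
  (forall s : R, a < s < b -> Xt s (2 * pi) = Xt s 0) ->
  is_derive s 1 (fun s => circ_mean (X s)) (circ_mean (Xs s)) /\
  is_derive s 1 (fun s => circ_mean (Xs s)) (circ_mean (fun t => Xss s t + Xtt s t)).
Proof.
move=> sab hj per.
have cX s' t : a < s' < b -> cont2_at X s' t by move=> /hj-/(_ t)[_ _ _ _ []].
have cXs s' t : a < s' < b -> cont2_at Xs s' t by move=> /hj-/(_ t)[_ _ _ _ []].
have cXss s' t : a < s' < b -> cont2_at Xss s' t by move=> /hj-/(_ t)[_ _ _ _ []].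
have cXtt s' t : a < s' < b -> cont2_at Xtt s' t by move=> /hj-/(_ t)[_ _ _ _ []].
have dX (s' t : R) : a < s' < b -> is_derive s' 1 (X^~ t) (Xs s' t) by move=> /hj-/(_ t)[].
have dXs (s' t : R) : a < s' < b -> is_derive s' 1 (Xs^~ t) (Xss s' t) by move=> /hj-/(_ t)[].
have cX' (s' t : R) : a < s' < b -> {for t, continuous (X s')} by move=> h; apply: cont2_at_t; exact: cX.
have cXs' (s' t : R) : a < s' < b -> {for t, continuous (Xs s')} by move=> h; apply: cont2_at_t; exact: cXs.
split; first exact: (@is_derive_circ_mean X Xs a b s sab cXs cX' dX).
have css : continuous (Xss s) by move=> t; apply: cont2_at_t; exact: cXss.
have ctt : continuous (Xtt s) by move=> t; apply: cont2_at_t; exact: cXtt.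
have -> : circ_mean (fun t => Xss s t + Xtt s t) = circ_mean (Xss s).
  rewrite (circ_meanD css ctt) [X in _ + X](_ : _ = 0) ?addr0 //.
  have dXt (t : R) : is_derive t 1 (Xt s) (Xtt s t) by have [] := hj s t sab.
  by rewrite /circ_mean (@segint_FTC R 0 (2 * pi) (Xtt s) (Xt s) (@twopi_ge0 R) ctt dXt) per // subrr mulr0.
exact: (@is_derive_circ_mean Xs Xss a b s sab cXss cXs' dXs).
Qed.

Section LogModulus.
Variables (F : C -> C) (e : R).
Hypothesis hF : entire F.
Let p (s t : R) := complex.Re (F (Complex s t)).
Let q (s t : R) := complex.Im (F (Complex s t)).
Let p1 (s t : R) := complex.Re (cder F (Complex s t)).
Let q1 (s t : R) := complex.Im (cder F (Complex s t)).
Let p2 (s t : R) := complex.Re (cder (cder F) (Complex s t)).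
Let q2 (s t : R) := complex.Im (cder (cder F) (Complex s t)).

Definition sqmod (s t : R) := p s t * p s t + q s t * q s t + e.
Definition logsq (s t : R) := ln (sqmod s t).
Definition logsq_s (s t : R) := 2 * (p s t * p1 s t + q s t * q1 s t) / sqmod s t.
Definition logsq_t (s t : R) := 2 * (q s t * p1 s t - p s t * q1 s t) / sqmod s t.
Definition logsq_ss (s t : R) :=
  (2 * (p1 s t * p1 s t + p s t * p2 s t + (q1 s t * q1 s t + q s t * q2 s t)) * sqmod s t
   - 2 * (p s t * p1 s t + q s t * q1 s t) * (2 * (p s t * p1 s t + q s t * q1 s t)))
  / (sqmod s t * sqmod s t).
Definition logsq_tt (s t : R) :=
  (2 * (p1 s t * p1 s t - q s t * q2 s t - (p s t * p2 s t - q1 s t * q1 s t)) * sqmod s t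
   - 2 * (q s t * p1 s t - p s t * q1 s t) * (2 * (q s t * p1 s t - p s t * q1 s t)))
  / (sqmod s t * sqmod s t).

Lemma sqmod_cabs s t : sqmod s t = cabs (F (Complex s t)) ^+ 2 + e.
Proof. by rewrite cabs_sqr !expr2. Qed.

Lemma logsq_jet (s t : R) : 0 < sqmod s t -> jet logsq logsq_s logsq_t logsq_ss logsq_tt s t.
Proof.
move=> D0; have Dn : sqmod s t != 0 by rewrite gt_eqF.
have hF1 := entire_cder hF; have hF2 := entire_cder hF1.
have dps := is_derive_Re_s s t hF; have dqs := is_derive_Im_s s t hF.
have dpt := is_derive_Re_t s t hF; have dqt := is_derive_Im_t s t hF.
have dp1s := is_derive_Re_s s t hF1; have dq1s := is_derive_Im_s s t hF1.
have dp1t := is_derive_Re_t s t hF1; have dq1t := is_derive_Im_t s t hF1.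
have dDs : is_derive s 1 (sqmod^~ t) (2 * (p s t * p1 s t + q s t * q1 s t)).
  apply: is_derive_eq (rderD (rderD (rderM dps dps) (rderM dqs dqs)) (rder_cst e s)) _.
  by rewrite -/(p s t) -/(q s t) -/(p1 s t) -/(q1 s t); ring.
have dDt : is_derive t 1 (sqmod s) (2 * (q s t * p1 s t - p s t * q1 s t)).
  apply: is_derive_eq (rderD (rderD (rderM dpt dpt) (rderM dqt dqt)) (rder_cst e t)) _.
  by rewrite -/(p s t) -/(q s t) -/(p1 s t) -/(q1 s t); ring.
have cc (G : C -> C) : entire G -> continuous (fun r : R * R => G (Complex r.1 r.2)) by exact: entire_continuous2.
have cp := @continuous_Re_comp R _ _ (@cc _ hF) (s, t); have cq := @continuous_Im_comp R _ _ (@cc _ hF) (s, t).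
have cp1 := @continuous_Re_comp R _ _ (@cc _ hF1) (s, t); have cq1 := @continuous_Im_comp R _ _ (@cc _ hF1) (s, t).
have cp2 := @continuous_Re_comp R _ _ (@cc _ hF2) (s, t); have cq2 := @continuous_Im_comp R _ _ (@cc _ hF2) (s, t).
have c2 := @cont_at_cst R _ (s, t) 2; have ce := @cont_at_cst R _ (s, t) e.
have cD := cont_atD (cont_atD (cont_atM cp cp) (cont_atM cq cq)) ce.
have cDi := @cont_atV R _ (s, t) _ Dn cD.
have DDn : sqmod s t * sqmod s t != 0 by rewrite mulf_neq0.
have cDDi := @cont_atV R _ (s, t) (fun r : R * R => sqmod r.1 r.2 * sqmod r.1 r.2) DDn (cont_atM cD cD).
have cU := cont_atM c2 (cont_atD (cont_atM cp cp1) (cont_atM cq cq1)).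
have cV := cont_atM c2 (cont_atB (cont_atM cq cp1) (cont_atM cp cq1)).
split.
- exact: (@rder_ln R (sqmod^~ t) s _ D0 dDs).
- apply: is_derive_eq (@rder_div R _ (sqmod^~ t) s _ _ Dn (rderZ 2 (rderD (rderM dps dp1s) (rderM dqs dq1s))) dDs) _.
  by rewrite /logsq_ss.
- exact: (@rder_ln R (sqmod s) t _ D0 dDt).
- apply: is_derive_eq (@rder_div R _ (sqmod s) t _ _ Dn (rderZ 2 (rderB (rderM dqt dp1t) (rderM dpt dq1t))) dDt) _.
  have aux (a b c d f g D : R) : (2 * (c * c + b * - g - (- d * d + a * f)) * D - 2 * (b * c - a * d) * (2 * (b * c - a * d))) / (D * D)
     = (2 * (c * c - b * g - (a * f - d * d)) * D - 2 * (b * c - a * d) * (2 * (b * c - a * d))) / (D * D).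
    by congr (_ / _); ring.
  exact: aux.
- split.
  + exact: (@cont_at_ln R _ (s, t) (fun r : R * R => sqmod r.1 r.2) D0 cD).
  + exact: (cont_atM cU cDi).
  + exact: (cont_atM cV cDi).
  + exact: (cont_atM (cont_atB (cont_atM (cont_atM c2 (cont_atD (cont_atD (cont_atM cp1 cp1) (cont_atM cp cp2)) (cont_atD (cont_atM cq1 cq1) (cont_atM cq cq2)))) cD) (cont_atM cU cU)) cDDi).
  + exact: (cont_atM (cont_atB (cont_atM (cont_atM c2 (cont_atB (cont_atB (cont_atM cp1 cp1) (cont_atM cq cq2)) (cont_atB (cont_atM cp cp2) (cont_atM cq1 cq1)))) cD) (cont_atM cV cV)) cDDi).
Qed.

(** The second derivatives of [F] cancel by the Cauchy-Riemann equations. The result is 0 for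
    [e = 0], when [ln |F|] is harmonic, and nonnegative for [e > 0]. *)
Lemma logsq_laplace (s t : R) : 0 < sqmod s t ->
  logsq_ss s t + logsq_tt s t = 4 * e * (p1 s t * p1 s t + q1 s t * q1 s t) / (sqmod s t * sqmod s t).
Proof.
move=> D0; rewrite /logsq_ss /logsq_tt -mulrDl; congr (_ / _).
rewrite /sqmod; move: (p s t) (q s t) (p1 s t) (q1 s t) (p2 s t) (q2 s t) => a b c d f g; ring.
Qed.
End LogModulus.
End Jets.

(** * Jensen's formula *)

Section Monotone.
Variable R : realType.
Implicit Types (f : R -> R) (l u x y : R).

Lemma mono_of_derive f (f' : R -> R) l u : (forall x : R, l < x < u -> is_derive x 1 f (f' x)) ->
  (forall x, l < x < u -> 0 <= f' x) -> forall x y, l < x -> x <= y -> y < u -> f x <= f y.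
Proof.
move=> df f0 x y lx; rewrite le_eqVlt => /predU1P[->//|xy] yu.
have dxy z : z \in `]x, y[ -> is_derive z 1 f (f' z).
  by rewrite in_itv /= => /andP[? ?]; apply: df; apply/andP; split; lra.
have cf : {within `[x, y], continuous f}.
  apply: derivable_within_continuous => z; rewrite in_itv /= => /andP[? ?].
  by have [] : is_derive z 1 f (f' z) by apply: df; apply/andP; split; lra.
have [c cxy e] := MVT xy dxy cf.
rewrite -subr_ge0 e mulr_ge0 ?subr_ge0 ?(ltW xy) // f0 //.
by move: cxy; rewrite in_itv /= => /andP[? ?]; apply/andP; split; lra.
Qed.

Lemma cst_of_derive f l u : (forall x : R, l < x < u -> is_derive x 1 f 0) ->
  forall x y, l < x < u -> l < y < u -> f x = f y.
Proof.
move=> df x y /andP[lx xu] /andP[ly yu].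
have h1 := @mono_of_derive f (fun=> 0) l u df (fun _ _ => lexx _).
have dN z : l < z < u -> is_derive z 1 (fun z => 0 - f z) 0.
  by move=> /df h; apply: is_derive_eq (rderB (rder_cst 0 z) h) _; rewrite subrr.
have h2 := @mono_of_derive _ (fun=> 0) l u dN (fun _ _ => lexx _).
have [xy|/ltW yx] := leP x y.
  have := h1 x y lx xy yu; have := h2 x y lx xy yu; lra.
have := h1 y x ly yx xu; have := h2 y x ly yx xu; lra.
Qed.

(** With a slope [c] other than 0, the values of [M] at two points at distance [3 / |c|] would
    differ by 3, whereas far to the left all values lie within 1 of [L]. *)
Lemma affine_bounded (M : R -> R) (S b c L : R) :
  (forall x, x < S -> x < b -> `|M x - L| <= 1) ->
  (forall x y, x < b -> y < b -> M x - c * x = M y - c * y) -> c = 0.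
Proof.
move=> HS aff.
have [x [xS xb]] : exists x, x < S /\ x < b.
  by exists (Num.min S b - 1); rewrite !ltrBlDr !gt_min !ltrDl ltr01 orbT.
apply/eqP; rewrite -normr_le0 leNgt; apply/negP => c0.
have [k k0 kc] : exists2 k, 0 < k & `|c| * k = 3.
  by exists (3 / `|c|); rewrite ?divr_gt0 // mulrCA divff ?mulr1 // gt_eqF.
have xkS : x - k < S by lra.
have xkb : x - k < b by lra.
have h1 := HS x xS xb; have h2 := HS (x - k) xkS xkb; have h3 := aff x (x - k) xb xkb.
have e4 : c * k = (M x - L) - (M (x - k) - L).
  have -> : c * k = c * x - c * (x - k) by ring.
  by move: (M x) (M (x - k)) (c * x) (c * (x - k)) h3 => ? ? ? ? ?; lra.
have : `|c * k| <= 1 + 1 by rewrite e4 (le_trans (ler_normB _ _)) // lerD.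
by rewrite normrM (gtr0_norm k0) kc; lra.
Qed.
End Monotone.

Section Jensen.
Variable R : realType.
Local Notation C := (Cplx R).
Implicit Types (g h : C -> C) (a z w : C).

Definition circ (s t : R) : C := cexp (Complex s t).
Definition logmean g (s : R) : R := circ_mean (fun t => ln (cabs (g (circ s t)))).

Lemma cabs_circ s t : cabs (circ s t) = expR s.
Proof. by rewrite /circ cabs_cexp. Qed.

Lemma continuous_circ g s : entire g -> continuous (fun t => g (circ s t)).
Proof. move=> hg; exact (@entire_continuous_t R _ s (entire_comp hg (@entire_cexp R))). Qed.

Lemma continuous_logcirc g s : entire g -> (forall t, g (circ s t) != 0) ->
  continuous (fun t => ln (cabs (g (circ s t)))).
Proof.
move=> hg g0 t; apply: (@cont_at_ln R _ t (fun t => cabs (g (circ s t)))); first by rewrite cabs_gt0.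
exact: (continuous_cabs_comp (@continuous_circ g s hg)).
Qed.

Lemma ln_sqr (x : R) : 0 < x -> ln (x ^+ 2) = 2 * ln x.
Proof. by move=> x0; rewrite expr2 lnM ?posrE //; ring. Qed.

Lemma logsq_periodic (F : C -> C) e s : (forall s t, F (Complex s (t + 2 * pi)) = F (Complex s t)) ->
  (forall s t, cder F (Complex s (t + 2 * pi)) = cder F (Complex s t)) ->
  logsq_t F e s (2 * pi) = logsq_t F e s 0.
Proof.
move=> h1 h2; rewrite /logsq_t /sqmod; have := h1 s 0; have := h2 s 0; rewrite add0r => -> ->; by [].
Qed.

Lemma circ_comp_periodic g : entire g -> iperiodic (fun w => g (cexp w)) /\ iperiodic (cder (fun w => g (cexp w))).
Proof.
move=> hg; split; first by move=> s t; rewrite cexp_periodic.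
by rewrite (cder_comp hg (@entire_cexp R)) cder_cexp => s t; rewrite cexp_periodic.
Qed.

Lemma circ_logsq g s t : entire g -> g (circ s t) != 0 -> logsq (fun w => g (cexp w)) 0 s t = 2 * ln (cabs (g (circ s t))).
Proof. by move=> hg g0; rewrite /logsq sqmod_cabs addr0 ln_sqr // cabs_gt0. Qed.

(** [ln |h|] is harmonic, so its circle mean is affine in [s]; as [s] tends to minus infinity it
    tends to [ln |h 0|], which forces slope 0 and this constant. *)
Lemma logmean_zerofree h (b s : R) : entire h -> (forall z, cabs z < expR b -> h z != 0) -> s < b ->
  logmean h s = ln (cabs (h 0)).
Proof.
move=> hh h0 sb.
pose F w := h (cexp w).
have hF : entire F by exact (entire_comp hh (@entire_cexp R)).
have [p1 p2] := circ_comp_periodic hh.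
have nz s' t : s' < b -> h (circ s' t) != 0.
  by move=> s'b; apply: h0; rewrite cabs_circ ltr_expR.
have D0 s' t : s' < b -> 0 < sqmod F 0 s' t.
  by move=> s'b; rewrite sqmod_cabs addr0 exprn_gt0 // cabs_gt0 nz.
pose M s' := circ_mean (logsq F 0 s').
have ME s' : s' < b -> M s' = 2 * logmean h s'.
  move=> s'b; rewrite /M /logmean -circ_meanZ; last first.
    by apply: continuous_logcirc => // t; exact: nz.
  by apply: eq_circ_mean => t; rewrite circ_logsq // nz.
pose M1 s' := circ_mean (logsq_s F 0 s').
have rderM l s' : l < s' < b -> is_derive s' 1 M (M1 s') /\ is_derive s' 1 M1 0.
  move=> lsb; have := @polar_jet R _ _ _ _ _ l b s' lsb (fun x t xb => @logsq_jet R F 0 hF x t (D0 x t (proj2 (andP xb)))).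
  case=> [x _|d1 d2]; first exact: logsq_periodic.
  split => //; apply: is_derive_eq d2 _.
  have -> : circ_mean (fun t => logsq_ss F 0 s' t + logsq_tt F 0 s' t) = circ_mean (fun=> 0).
    apply: eq_circ_mean => t; rewrite logsq_laplace ?mulr0 ?mul0r //.
    by apply: D0; case/andP: lsb.
  exact: circ_mean_cst.
have M1c x y : x < b -> y < b -> M1 x = M1 y.
  move=> xb yb; pose l := Num.min x y - 1.
  have lx : l < x by rewrite /l ltrBlDr gt_min ltrDl ltr01.
  have ly : l < y by rewrite /l ltrBlDr gt_min [X in _ || X](_ : _ = true) ?orbT // ltrDl ltr01.
  have lxb : l < x < b by rewrite lx.
  have lyb : l < y < b by rewrite ly.
  have dd (z : R) : l < z < b -> is_derive z 1 M1 0 by move=> /rderM[].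
  exact: (@cst_of_derive R M1 l b dd x y lxb lyb).
pose c := M1 s.
have aff x y : x < b -> y < b -> M x - c * x = M y - c * y.
  move=> xb yb; pose l := Num.min x y - 1.
  have lx : l < x by rewrite /l ltrBlDr gt_min ltrDl ltr01.
  have ly : l < y by rewrite /l ltrBlDr gt_min [X in _ || X](_ : _ = true) ?orbT // ltrDl ltr01.
  have lxb : l < x < b by rewrite lx.
  have lyb : l < y < b by rewrite ly.
  apply: (@cst_of_derive R (fun x => M x - c * x) l b _ x y lxb lyb).
  move=> z lz; have [d1 _] := rderM l z lz; apply: is_derive_eq (rderB d1 (rderZ c (is_derive_id z 1))) _.
  by rewrite mulr1 (M1c z s) ?subrr //; case/andP: lz.
pose L := 2 * ln (cabs (h 0)).
have h00 : h 0 != 0 by apply: h0; rewrite cabs0 expR_gt0.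
have near0 (e : R) : 0 < e -> exists S : R, forall x, x < S -> x < b -> `|M x - L| <= e.
  move=> e0.
  have e20 : 0 < e / 2 by rewrite divr_gt0.
  have cl : {for (0 : C), continuous (fun z : C => ln (cabs (h z)))}.
    apply: (@cont_at_ln R _ (0 : C) (fun z => cabs (h z))); first by rewrite cabs_gt0.
    exact: (continuous_cabs_comp (entire_continuous hh)).
  have [d /= /cplx_gt0 [-> d0] hd] := proj1 (rts_epsdelta _ _) cl _ e20.
  exists (ln (complex.Re d)) => x xS xb.
  have xd t : cabs (circ x t) < complex.Re d by rewrite cabs_circ -[ltRHS]lnK ?posrE // ltr_expR.
  rewrite ME // /L -mulrBr normrM ger0_norm // mulrC -ler_pdivlMr //.
  have cx : continuous (fun t => ln (cabs (h (circ x t)))) by apply: continuous_logcirc => // t; exact: nz.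
  rewrite -[ln (cabs (h 0))]circ_mean_cst -circ_meanB //; last exact: continuous_cst.
  apply: circ_mean_norm_le; first by apply: contR_B => //; exact: continuous_cst.
  move=> t; rewrite distrC; apply/ltW/hd.
  by rewrite /ball_ /= norm_cabs cplx_lt sub0r cabsN.
have [S HS] := near0 1 ltr01.
have c0 : c = 0 := affine_bounded HS aff.
have aux (k u v x y : R) : k = 0 -> u - k * x = v - k * y -> u = v by move=> ->; rewrite !mul0r !subr0.
have Mcst x y : x < b -> y < b -> M x = M y by move=> xb yb; exact: aux c0 (aff x y xb yb).
have : M s = L.
  apply/eqP; rewrite -subr_eq0 -normr_le0; apply/ler_addgt0Pr => e e0; rewrite add0r.
  have [S2 HS2] := near0 e e0; pose x := Num.min S2 b - 1.
  have xS : x < S2 by rewrite /x ltrBlDr gt_min ltrDl ltr01.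
  have xb : x < b by rewrite /x ltrBlDr gt_min [X in _ || X](_ : _ = true) ?orbT // ltrDl ltr01.
  by rewrite (Mcst s x sb xb); exact: HS2.
have two (u v : R) : 2 * u = 2 * v -> u = v by move=> ?; lra.
by rewrite (ME s sb) => /two.
Qed.

Lemma logmeanM f g s : entire f -> entire g -> (forall t, f (circ s t) != 0) -> (forall t, g (circ s t) != 0) ->
  logmean (fun w => f w * g w) s = logmean f s + logmean g s.
Proof.
move=> hf hg f0 g0; rewrite /logmean -circ_meanD; try exact: continuous_logcirc.
by apply: eq_circ_mean => t; rewrite cabsM lnM // posrE cabs_gt0.
Qed.

Lemma entire_lin a : entire (fun w : C => w - a).
Proof. exact (entireB (@entire_id R) (entire_cst a)). Qed.
Arguments entire_lin : clear implicits.

(** On the circle [|r exp (i t) - a|] equals [|r - conj a * exp (i t)|], and [r - conj a * w] has no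
    zero in some disc larger than the unit disc; its mean over the unit circle is therefore
    [ln r = s]. *)
Lemma logmean_lin a s : cabs a < expR s -> logmean (fun w => w - a) s = s.
Proof.
move=> as_.
pose r := expR s; have r0 : 0 < r := expR_gt0 s.
pose ac : C := Complex (complex.Re a) (- complex.Im a).
pose h w : C := Complex r 0 - ac * w.
have hh : entire h by exact (entireB (entire_cst (Complex r 0)) (entireM (entire_cst ac) (@entire_id R))).
have aca : cabs ac = cabs a.
  by apply/eqP; rewrite -(eqrXn2 (n := 2)) ?cabs_ge0 // !cabs_sqr /= sqrrN.
have E t : cabs (circ s t - a) = cabs (h (circ 0 t)).
  apply/eqP; rewrite -(eqrXn2 (n := 2)) ?cabs_ge0 // !cabs_sqr /h /circ /ac /cexp !cplxE /= expR0 !mul1r -/r.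
  have := cos2Dsin2 t; set x := cos t; set y := sin t; move: (complex.Re a) (complex.Im a) => p q e.
  have e1 : y ^+ 2 = 1 - x ^+ 2 by rewrite -e; ring.
  apply/eqP.
  have -> : (r * x + - p) ^+ 2 + (r * y + - q) ^+ 2 = r ^+ 2 * (x ^+ 2 + y ^+ 2) - 2 * r * (x * p + y * q) + p ^+ 2 + q ^+ 2 by ring.
  have -> : (r - (p * x - - q * y)) ^+ 2 + (0 - (p * y + - q * x)) ^+ 2 = r ^+ 2 - 2 * r * (x * p + y * q) + (p ^+ 2 + q ^+ 2) * (x ^+ 2 + y ^+ 2) by ring.
  by rewrite e; ring.
have -> : logmean (fun w => w - a) s = logmean h 0.
  by apply: eq_circ_mean => t; rewrite E.
(* A positive number strictly between [|a|] and [r], also for [a = 0]: the zero-free disc has radius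
   [r / k > 1]. *)
pose k := cabs a + (r - cabs a) / 2.
have k0 : 0 < k by rewrite /k; have := cabs_ge0 a; rewrite -/r in as_; lra.
rewrite (@logmean_zerofree h (ln (r / k)) 0 hh).
- by rewrite /h mulr0 subr0 cabs_real gtr0_norm // /r expRK.
- move=> z; rewrite lnK ?posrE ?divr_gt0 // => zk.
  rewrite -cabs_gt0; apply: lt_le_trans (cabs_sub_le _ _); rewrite subr_gt0 cabs_real gtr0_norm // cabsM aca.
  rewrite ltr_pdivlMr // in zk; apply: le_lt_trans zk; rewrite mulrC ler_wpM2l ?cabs_ge0 // /k.
  rewrite -/r in as_; lra.
- rewrite ln_gt0 // ltr_pdivlMr // mul1r /k; rewrite -/r in as_; lra.
Qed.

Lemma logmean_X g n s : entire g -> (forall t, g (circ s t) != 0) ->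
  logmean (fun w => g w ^+ n) s = n%:R * logmean g s.
Proof.
move=> hg g0; rewrite /logmean -circ_meanZ; last exact: continuous_logcirc.
apply: eq_circ_mean => t; rewrite cabsX lnXn ?cabs_gt0 //.
by rewrite mulr_natl.
Qed.

Lemma circ_neq a s : cabs a < expR s -> forall t, circ s t - a != 0.
Proof.
move=> h t; rewrite -cabs_gt0; apply: lt_le_trans (cabs_sub_le _ _).
by rewrite subr_gt0 cabs_circ.
Qed.

Lemma logmean_prod (Z : seq C) (o : C -> nat) h s : entire h -> (forall t, h (circ s t) != 0) ->
  (forall a, a \in Z -> cabs a < expR s) ->
  logmean (fun w => \prod_(a <- Z) (w - a) ^+ o a * h w) s = \sum_(a <- Z) (o a)%:R * s + logmean h s.
Proof.
move=> hh h0; elim: Z => [|a Z IH] hZ.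
  rewrite big_nil add0r; apply: eq_circ_mean => t; by rewrite big_nil mul1r.
have hZ' b : b \in Z -> cabs b < expR s by move=> bZ; apply: hZ; rewrite inE bZ orbT.
have aE : cabs a < expR s by apply: hZ; rewrite inE eqxx.
have eP : entire (fun w => \prod_(a <- Z) (w - a) ^+ o a).
  exact (@entire_prod R _ Z xpredT _ (fun a => @entireX R _ (o a) (entire_lin a))).
have Pnz t : \prod_(b <- Z) (circ s t - b) ^+ o b * h (circ s t) != 0.
  rewrite mulf_neq0 // prodf_seq_neq0; apply/allP => b bZ /=.
  by rewrite expf_neq0 // circ_neq // hZ'.
have lx : logmean (fun w => (w - a) ^+ o a) s = (o a)%:R * s.
  by rewrite (@logmean_X (fun w => w - a) (o a) s (entire_lin a) (circ_neq aE)) (logmean_lin aE).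
have e1 : logmean (fun w => \prod_(b <- a :: Z) (w - b) ^+ o b * h w) s =
   logmean (fun w => (w - a) ^+ o a * (\prod_(b <- Z) (w - b) ^+ o b * h w)) s.
  by apply: eq_circ_mean => t; rewrite big_cons mulrA.
have an t : (circ s t - a) ^+ o a != 0 by rewrite expf_neq0 // circ_neq.
rewrite e1 big_cons -addrA -(IH hZ') -lx.
exact: (@logmeanM _ _ s (@entireX R _ (o a) (entire_lin a)) (entireM eP hh) an Pnz).
Qed.

Lemma ln_prod (L : seq C) (F G : C -> R) : (forall a, a \in L -> 0 < F a /\ ln (F a) = G a) ->
  0 < \prod_(a <- L) F a /\ ln (\prod_(a <- L) F a) = \sum_(a <- L) G a.
Proof.
elim: L => [|a L IH] hL; first by rewrite !big_nil ln1.
have [p1 p2] : 0 < \prod_(a <- L) F a /\ ln (\prod_(a <- L) F a) = \sum_(a <- L) G a.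
  by apply: IH => b bL; apply: hL; rewrite inE bL orbT.
have [a1 a2] : 0 < F a /\ ln (F a) = G a by apply: hL; rewrite inE eqxx.
by rewrite !big_cons mulr_gt0 // lnM ?posrE // p2 a2.
Qed.

(** Dividing out the zeros leaves a function without zeros in a slightly larger disc, to which
    [logmean_zerofree] applies. The list [Z] may contain points where [g] does not vanish, as their
    order is 0; so one list can serve several functions. *)
Lemma jensen_formula g : entire g -> nonzero g -> exists Cg : R, forall (s : R) (Z : seq C), uniq Z ->
  (forall a, a \in Z -> a != 0 /\ cabs a < expR s) ->
  (forall z, z != 0 -> cabs z <= expR s -> g z = 0 -> z \in Z) ->
  logmean g s = Cg + (zero_order g 0)%:R * s + \sum_(a <- Z) (zero_order g a)%:R * (s - ln (cabs a)).
Proof.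
move=> hg ng; have [k [hk k0 gE]] := zero_orderP 0 hg ng.
exists (ln (cabs (k 0))) => s Z uZ Zin Zall.
have nk : nonzero k by exists 0.
have eX : entire (fun w : C => (w - 0) ^+ zero_order g 0) by exact (@entireX R _ (zero_order g 0) (entire_lin 0)).
have nX : nonzero (fun w : C => (w - 0) ^+ zero_order g 0).
  by exists 1; rewrite subr0 expr1n oner_neq0.
have gE' : g = fun w => (w - 0) ^+ zero_order g 0 * k w by apply/funext.
have ok a : a != 0 -> zero_order g a = zero_order k a.
  move=> a0; rewrite {1}gE' (zero_orderM a eX hk nX nk) (zero_order0 eX) ?add0n //.
  by rewrite expf_neq0 // subr0.
have [h [hh kE hZ]] := factor_list hk nk uZ.
have hnz z : cabs z <= expR s -> h z != 0.
  move=> zs; have [zZ|zZ] := boolP (z \in Z); first exact: hZ.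
  apply/eqP => hz0; have kz : k z = 0 by rewrite kE hz0 mulr0.
  have [z0|z0] := eqVneq z 0; first by rewrite z0 in kz; rewrite kz eqxx in k0.
  by move/negP: zZ; apply; apply: Zall => //; rewrite gE kz mulr0.
(* The finitely many zeros of [h] of modulus up to [exp s + 1] lie beyond the circle; [exp b] is the
   least of their moduli, capped at [exp s + 1]. *)
have [b sb hb] : exists2 b, s < b & forall z, cabs z < expR b -> h z != 0.
  have nh : nonzero h by exists 0; apply: hnz; rewrite cabs0 expR_ge0.
  have [L hL] := finite_zeros (expR s + 1) hh nh.
  pose f (z : C) := if h z == 0 then cabs z else expR s + 1.
  pose m := \big[Num.min/(expR s + 1)]_(z <- L) f z.
  have ms : expR s < m.
    rewrite /m; elim: (L) => [|z L' IH]; first by rewrite big_nil ltrDl.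
    rewrite big_cons lt_min IH andbT /f; case: eqP => [hz|_]; last by rewrite ltrDl.
    by rewrite ltNge; apply/negP => /hnz; rewrite hz eqxx.
  have mz z : z \in L -> m <= f z.
    rewrite /m; elim: (L) => [//|y L' IH]; rewrite inE big_cons ge_min => /predU1P[->|/IH ->]; rewrite ?lexx ?orbT //.
  have m0 : 0 < m by apply: lt_trans ms; exact: expR_gt0.
  exists (ln m); first by rewrite -[ltLHS]expRK ltr_ln ?posrE ?expR_gt0.
  move=> z; rewrite lnK ?posrE // => zm; apply/eqP => hz.
  have m1 : m <= expR s + 1.
    by rewrite /m; elim: (L) => [|y L' IH]; rewrite ?big_nil // big_cons ge_min IH orbT.
  have := mz z (hL z (le_trans (ltW zm) m1) hz); rewrite /f hz eqxx => h1.
  by move: (lt_le_trans zm h1); rewrite ltxx.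
have kc t : k (circ s t) != 0.
  rewrite kE mulf_neq0 ?hnz ?cabs_circ //; rewrite prodf_seq_neq0; apply/allP => a aZ /=.
  by rewrite expf_neq0 // circ_neq // (proj2 (Zin a aZ)).
have hc t : h (circ s t) != 0 by rewrite hnz // cabs_circ.
have s0 : cabs (0 : C) < expR s by rewrite cabs0 expR_gt0.
have e1 : logmean g s = (zero_order g 0)%:R * s + logmean k s.
  have xn t : (circ s t - 0) ^+ zero_order g 0 != 0 by rewrite expf_neq0 // circ_neq.
  rewrite {1}gE' (@logmeanM _ _ s eX hk xn kc); congr (_ + _).
  by rewrite (@logmean_X (fun w => w - 0) _ s (entire_lin 0) (circ_neq s0)) (logmean_lin s0).
have e2 : logmean k s = \sum_(a <- Z) (zero_order k a)%:R * s + ln (cabs (h 0)).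
  rewrite -(logmean_zerofree hh hb sb) -logmean_prod //; last by move=> a /Zin[].
  by apply: eq_circ_mean => t; rewrite [in LHS]kE.
have e3 : ln (cabs (k 0)) = \sum_(a <- Z) (zero_order k a)%:R * ln (cabs a) + ln (cabs (h 0)).
  have h00 : 0 < cabs (h 0) by rewrite cabs_gt0 hnz // cabs0 expR_ge0.
  rewrite [in LHS]kE cabsM cabs_prod.
  have [p1 p2] : 0 < \prod_(a <- Z) cabs ((0 - a) ^+ zero_order k a) /\
     ln (\prod_(a <- Z) cabs ((0 - a) ^+ zero_order k a)) = \sum_(a <- Z) (zero_order k a)%:R * ln (cabs a).
    apply: ln_prod => a aZ; have a0 : 0 < cabs a by rewrite cabs_gt0 (proj1 (Zin a aZ)).
    by rewrite cabsX sub0r cabsN exprn_gt0 // lnXn // mulr_natl.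
  by rewrite lnM ?posrE // p2.
rewrite e1 e2 e3.
have -> : \sum_(a <- Z) (zero_order g a)%:R * (s - ln (cabs a)) =
   \sum_(a <- Z) (zero_order k a)%:R * s - \sum_(a <- Z) (zero_order k a)%:R * ln (cabs a).
  rewrite -sumrB; apply: eq_big_seq => a aZ.
  by rewrite ok ?mulrBr // (proj1 (Zin a aZ)).
set x := \sum_(a <- Z) _; set y := \sum_(a <- Z) _; ring.
Qed.
End Jensen.

(** * The logarithmic derivative lemma *)

Section PhiJets.
Variable R : realType.
Variables X Xs Xt Xss Xtt Y Ys Yt Yss Ytt : R -> R -> R.
(* The convex function [sqrt (1 + (X - Y)^2) + X + Y] and its derivatives along one variable. *)
Definition Phi_diff (s t : R) := X s t - Y s t.
Definition Phi_root (s t : R) := Num.sqrt (1 + Phi_diff s t * Phi_diff s t).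
Definition Phi (s t : R) := Phi_root s t + (X s t + Y s t).
Definition Phi_d1 (U W : R -> R -> R) (s t : R) :=
  Phi_diff s t * (U s t - W s t) / Phi_root s t + (U s t + W s t).
Definition Phi_d2 (U W U' W' : R -> R -> R) (s t : R) :=
  (((U s t - W s t) * (U s t - W s t) + Phi_diff s t * (U' s t - W' s t)) * Phi_root s t
    - Phi_diff s t * (U s t - W s t) * (Phi_diff s t * (U s t - W s t) / Phi_root s t)) / (Phi_root s t * Phi_root s t)
  + (U' s t + W' s t).

Lemma Phi_root_arg_gt0 s t : 0 < 1 + Phi_diff s t * Phi_diff s t.
Proof. by rewrite ltr_pwDl // -expr2 sqr_ge0. Qed.

Lemma Phi_root_gt0 s t : 0 < Phi_root s t.
Proof. by rewrite sqrtr_gt0 Phi_root_arg_gt0. Qed.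

Lemma Phi_root_sqr s t : Phi_root s t * Phi_root s t = 1 + Phi_diff s t * Phi_diff s t.
Proof. by rewrite -expr2 sqr_sqrtr // ltW // Phi_root_arg_gt0. Qed.

Lemma Phi_root_ge s t : `|Phi_diff s t| <= Phi_root s t.
Proof. by rewrite -[leLHS]sqrtr_sqr /Phi_root ler_wsqrtr // expr2 lerDr. Qed.

Lemma Phi_root_le s t : Phi_root s t <= 1 + `|Phi_diff s t|.
Proof.
rewrite /Phi_root -[leRHS]ger0_norm ?addr_ge0 // -sqrtr_sqr ler_wsqrtr //.
rewrite sqrrD expr1n mul1r real_normK ?num_real // expr2 mulr2n.
have := normr_ge0 (Phi_diff s t); move: (Phi_diff s t * Phi_diff s t) `|Phi_diff s t| => a b; lra.
Qed.

Lemma rder_Phi_root_s (s t a : R) : is_derive s 1 (Phi_diff^~ t) a -> is_derive s 1 (Phi_root^~ t) (Phi_diff s t * a / Phi_root s t).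
Proof.
move=> rderZ; have d1 := rderD (rder_cst 1 s) (rderM rderZ rderZ).
apply: is_derive_eq (@rder_sqrt R _ s _ (Phi_root_arg_gt0 s t) d1) _; rewrite -/(Phi_root s t).
have := Phi_root_gt0 s t; move: (Phi_root s t) (Phi_diff s t) => S Z S0; field; rewrite gt_eqF //.
Qed.

Lemma rder_Phi_root_t (s t a : R) : is_derive t 1 (Phi_diff s) a -> is_derive t 1 (Phi_root s) (Phi_diff s t * a / Phi_root s t).
Proof.
move=> rderZ; have d1 := rderD (rder_cst 1 t) (rderM rderZ rderZ).
apply: is_derive_eq (@rder_sqrt R _ t _ (Phi_root_arg_gt0 s t) d1) _; rewrite -/(Phi_root s t).
have := Phi_root_gt0 s t; move: (Phi_root s t) (Phi_diff s t) => S Z S0; field; rewrite gt_eqF //.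
Qed.

Lemma Phi_jet s t : jet X Xs Xt Xss Xtt s t -> jet Y Ys Yt Yss Ytt s t ->
  jet Phi (Phi_d1 Xs Ys) (Phi_d1 Xt Yt) (Phi_d2 Xs Ys Xss Yss) (Phi_d2 Xt Yt Xtt Ytt) s t.
Proof.
move=> [x1 x2 x3 x4 [cx cxs cxt cxss cxtt]] [y1 y2 y3 y4 [cy cys cyt cyss cytt]].
have Sn : Phi_root s t != 0 by rewrite gt_eqF // Phi_root_gt0.
have SSn : Phi_root s t * Phi_root s t != 0 by rewrite mulf_neq0.
have dZs : is_derive s 1 (Phi_diff^~ t) (Xs s t - Ys s t) by exact: rderB x1 y1.
have dZt : is_derive t 1 (Phi_diff s) (Xt s t - Yt s t) by exact: rderB x3 y3.
have dSs := rder_Phi_root_s dZs; have dSt := rder_Phi_root_t dZt.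
have cZ : cont2_at Phi_diff s t by exact: cont_atB cx cy.
have cS : cont2_at Phi_root s t.
  exact: (cont_at_sqrt (cont_atD (@cont_at_cst R _ (s, t) 1) (cont_atM cZ cZ))).
have cSi := @cont_atV R _ (s, t) (fun r : R * R => Phi_root r.1 r.2) Sn cS.
have cSSi := @cont_atV R _ (s, t) (fun r : R * R => Phi_root r.1 r.2 * Phi_root r.1 r.2) SSn (cont_atM cS cS).
have c1 (U W : R -> R -> R) : cont2_at U s t -> cont2_at W s t -> cont2_at (Phi_d1 U W) s t.
  by move=> cu cw; exact: (cont_atD (cont_atM (cont_atM cZ (cont_atB cu cw)) cSi) (cont_atD cu cw)).
have c2 (U W U' W' : R -> R -> R) : cont2_at U s t -> cont2_at W s t -> cont2_at U' s t -> cont2_at W' s t ->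
    cont2_at (Phi_d2 U W U' W') s t.
  move=> cu cw cu' cw'; have cd := cont_atB cu cw; have cd' := cont_atB cu' cw'.
  exact: (cont_atD (cont_atM (cont_atB (cont_atM (cont_atD (cont_atM cd cd) (cont_atM cZ cd')) cS) (cont_atM (cont_atM cZ cd) (cont_atM (cont_atM cZ cd) cSi))) cSSi) (cont_atD cu' cw')).
split.
- exact: (rderD dSs (rderD x1 y1)).
- apply: is_derive_eq (rderD (@rder_div R _ (Phi_root^~ t) s _ _ Sn (rderM dZs (rderB x2 y2)) dSs) (rderD x2 y2)) _.
  by [].
- exact: (rderD dSt (rderD x3 y3)).
- apply: is_derive_eq (rderD (@rder_div R _ (Phi_root s) t _ _ Sn (rderM dZt (rderB x4 y4)) dSt) (rderD x4 y4)) _.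
  by [].
- split; [exact: (cont_atD cS (cont_atD cx cy))|exact: c1|exact: c1|exact: c2|exact: c2].
Qed.

(** The first term stems from [sqrt (1 + x^2)], whose second derivative is the inverse cube of the
    root. The other two vanish for harmonic [X] and [Y], and their coefficients are nonnegative by
    [Phi_root_ge]. *)
Lemma Phi_laplace s t :
  Phi_d2 Xs Ys Xss Yss s t + Phi_d2 Xt Yt Xtt Ytt s t =
  ((Xs s t - Ys s t) ^+ 2 + (Xt s t - Yt s t) ^+ 2) / Phi_root s t ^+ 3
  + (1 + Phi_diff s t / Phi_root s t) * (Xss s t + Xtt s t) + (1 - Phi_diff s t / Phi_root s t) * (Yss s t + Ytt s t).
Proof.
rewrite /Phi_d2; have := Phi_root_gt0 s t; have := Phi_root_sqr s t; move: (Phi_root s t) (Phi_diff s t) => S Z SE S0.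
have Sn : S != 0 by rewrite gt_eqF.
set a := Xs s t - Ys s t; set b := Xt s t - Yt s t.
(* Multiplying by [S * S - Z * Z = 1] turns the claim into an identity of rational functions. *)
have e1 : (a ^+ 2 + b ^+ 2) / S ^+ 3 = (a ^+ 2 + b ^+ 2) * (S * S - Z * Z) / S ^+ 3.
  by rewrite SE addrK mulr1.
by rewrite e1 /a /b; field.
Qed.

Lemma Phi_laplace_ge s t : 0 <= Xss s t + Xtt s t -> 0 <= Yss s t + Ytt s t ->
  ((Xs s t - Ys s t) ^+ 2 + (Xt s t - Yt s t) ^+ 2) / Phi_root s t ^+ 3 <= Phi_d2 Xs Ys Xss Yss s t + Phi_d2 Xt Yt Xtt Ytt s t.
Proof.
move=> x0 y0; rewrite Phi_laplace -addrA lerDl.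
have S0 := Phi_root_gt0 s t; have := Phi_root_ge s t; rewrite ler_norml => /andP[h1 h2].
have i1 : 0 <= 1 + Phi_diff s t / Phi_root s t.
  have : -1 <= Phi_diff s t / Phi_root s t by rewrite ler_pdivlMr // mulN1r.
  by lra.
have i2 : 0 <= 1 - Phi_diff s t / Phi_root s t by rewrite subr_ge0 ler_pdivrMr // mul1r.
by rewrite addr_ge0 // mulr_ge0.
Qed.
End PhiJets.

(** By convexity a slope [- c < 0] persists to the left, and over a length [k] with
    [c * k = 2 * K + 1] it would exceed the oscillation [2 * K]. *)
Lemma convex_bounded_mono (R : realType) (f f' : R -> R) (K : R) :
  (forall z : R, is_derive z 1 f (f' z)) -> (forall x y, x <= y -> f' x <= f' y) ->
  (forall s, s <= 0 -> `|f s| <= K) -> forall x, 0 <= f' x.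
Proof.
move=> dy mono hK x; rewrite leNgt; apply/negP => h.
pose y := Num.min x 0.
have yx : y <= x by rewrite ge_min lexx.
have y0 : y <= 0 by rewrite ge_min lexx orbT.
have [c c0 ec] : exists2 c, 0 < c & f' x = - c by exists (- f' x); rewrite ?oppr_gt0 // opprK.
have K0 : 0 <= K := le_trans (normr_ge0 _) (hK 0 (lexx _)).
have [k k0 ck] : exists2 k, 0 < k & c * k = 2 * K + 1.
  exists ((2 * K + 1) / c); last by rewrite mulrCA divff ?mulr1 // gt_eqF.
  by rewrite divr_gt0 // ltr_wpDl // mulr_ge0.
have yk : y - k < y by rewrite ltrBlDr ltrDl.
have cM : continuous f.
  by move=> z; apply: differentiable_continuous; apply/derivable1_diffP; case: (dy z).
have [z zin ez] := MVT yk (fun z _ => dy z) (continuous_subspaceT cM).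
move: zin; rewrite in_itv /= => /andP[_ zy].
have m1 : f' z <= - c by rewrite -ec; apply: mono; apply: ltW; exact: lt_le_trans yx.
have e1 : y - (y - k) = k by ring.
rewrite e1 in ez.
have h1 : f' z * k <= - c * k by rewrite ler_wpM2r // ltW.
have h2 := hK y y0; have h3 := hK (y - k) (ltW (lt_le_trans yk y0)).
move: h2 h3 h1; rewrite -ez mulNr ck !ler_norml => /andP[? ?] /andP[? ?] ?; lra.
Qed.

(** * Monotonicity of the regularised means *)

Section Green.
Variable R : realType.
Local Notation C := (Cplx R).
Variables (A B : C -> C).
Hypotheses (hA : entire A) (hB : entire B) (nA : nonzero A) (nB : nonzero B).
Let F w := A (cexp w).
Let G w := B (cexp w).
Let hF : entire F. Proof. exact (entire_comp hA (@entire_cexp R)). Qed.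

Let hG : entire G. Proof. exact (entire_comp hB (@entire_cexp R)). Qed.

Definition regular (s : R) := forall z, cabs z = expR s -> A z != 0 /\ B z != 0.

(* [e > 0] regularises [ln |F|^2] to [ln (|F|^2 + e)] at the zeros; then [e] tends to 0. *)
Definition green_mean e s := circ_mean (Phi (logsq F e) (logsq G e) s).
Definition green_mean1 e s := circ_mean (Phi_d1 (logsq F e) (logsq G e) (logsq_s F e) (logsq_s G e) s).
Definition green_mean2 e s := circ_mean (fun t =>
  Phi_d2 (logsq F e) (logsq G e) (logsq_s F e) (logsq_s G e) (logsq_ss F e) (logsq_ss G e) s t +
  Phi_d2 (logsq F e) (logsq G e) (logsq_t F e) (logsq_t G e) (logsq_tt F e) (logsq_tt G e) s t).

Let sqmod_gt0 (H : C -> C) e s t : 0 <= e -> (0 < e \/ H (Complex s t) != 0) -> 0 < sqmod H e s t.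
Proof.
move=> e0 h; rewrite sqmod_cabs; case: h => [e1|h]; first by rewrite ltr_wpDl // sqr_ge0.
by rewrite ltr_pwDl // exprn_gt0 // cabs_gt0.
Qed.

Lemma green_derive e (a b s : R) : 0 <= e -> a < s < b -> (0 < e \/ forall x, a < x < b -> regular x) ->
  is_derive s 1 (green_mean e) (green_mean1 e s) /\ is_derive s 1 (green_mean1 e) (green_mean2 e s).
Proof.
move=> e0 sab H.
have [pF1 pF2] := circ_comp_periodic hA; have [pG1 pG2] := circ_comp_periodic hB.
have DF x t : a < x < b -> 0 < sqmod F e x t.
  move=> xab; apply: sqmod_gt0 => //; case: H => [?|H]; [by left|right].
  by have [] := H x xab (cexp (Complex x t)); rewrite ?cabs_cexp.
have DG x t : a < x < b -> 0 < sqmod G e x t.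
  move=> xab; apply: sqmod_gt0 => //; case: H => [?|H]; [by left|right].
  by have [] := H x xab (cexp (Complex x t)); rewrite ?cabs_cexp.
have J (x t : R) (h : a < x < b) := Phi_jet (@logsq_jet R F e hF x t (DF x t h)) (@logsq_jet R G e hG x t (DG x t h)).
apply: (@polar_jet R _ _ _ _ _ a b s sab) => [x t h|x xab]; first exact: J.
rewrite /Phi_d1 /Phi_diff /Phi_root /Phi_diff (@logsq_periodic R F e x pF1 pF2) (@logsq_periodic R G e x pG1 pG2).
have per (H' : C -> C) : iperiodic H' -> logsq H' e x (2 * pi) = logsq H' e x 0.
  by move=> pH; rewrite /logsq /sqmod; have := pH x 0; rewrite add0r => ->.
by rewrite (per F pF1) (per G pG1).
Qed.

Lemma green_M2_ge0 e s : 0 < e -> 0 <= green_mean2 e s.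
Proof.
move=> e0; rewrite /green_mean2 /circ_mean mulr_ge0 ?invr_ge0 ?twopi_ge0 //; apply: Rintegral_ge0 => t _.
have DF : 0 < sqmod F e s t by apply: sqmod_gt0; [exact: ltW|left].
have DG : 0 < sqmod G e s t by apply: sqmod_gt0; [exact: ltW|left].
apply: le_trans (@Phi_laplace_ge R _ _ _ _ _ _ _ _ _ _ s t _ _).
- by rewrite divr_ge0 ?addr_ge0 ?sqr_ge0 // exprn_ge0 // ltW // Phi_root_gt0.
- by rewrite logsq_laplace // divr_ge0 ?(ltW (mulr_gt0 DF DF)) // !mulr_ge0 ?(ltW e0) // addr_ge0 // -expr2 sqr_ge0.
- by rewrite logsq_laplace // divr_ge0 ?(ltW (mulr_gt0 DG DG)) // !mulr_ge0 ?(ltW e0) // addr_ge0 // -expr2 sqr_ge0.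
Qed.

(** For [s <= 0] both [|F|^2 + e] and [|G|^2 + e] stay between [e] and a constant. With this bound
    near minus infinity, convexity of [green_mean e] yields monotonicity. *)
Lemma green_bounded e : 0 < e -> exists K : R, forall s, s <= 0 -> `|green_mean e s| <= K.
Proof.
move=> e0.
have bnd (H : C -> C) : entire H -> exists2 K : R, 0 <= K & forall s t, s <= 0 -> `|logsq (fun w => H (cexp w)) e s t| <= K.
  move=> hH; have [M M0 hM] := entire_bounded 1 hH.
  exists (`|ln e| + `|ln (M ^+ 2 + e)|) => [|s t s0]; first by rewrite addr_ge0.
  have i1 : e <= sqmod (fun w => H (cexp w)) e s t by rewrite sqmod_cabs lerDr sqr_ge0.
  have i2 : sqmod (fun w => H (cexp w)) e s t <= M ^+ 2 + e.
    rewrite sqmod_cabs lerD2r ler_pXn2r ?nnegrE ?cabs_ge0 // hM // cabs_cexp /= -(@expR0 R) ler_expR //.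
  have p0 : 0 < sqmod (fun w => H (cexp w)) e s t by exact: lt_le_trans i1.
  have j1 : ln e <= logsq (fun w => H (cexp w)) e s t by rewrite /logsq ler_ln ?posrE.
  have j2 : logsq (fun w => H (cexp w)) e s t <= ln (M ^+ 2 + e) by rewrite /logsq ler_ln ?posrE // (lt_le_trans p0).
  have k1 := ler_norm (- ln e); have k2 := ler_norm (ln (M ^+ 2 + e)); rewrite normrN in k1.
  have k3 := normr_ge0 (ln e); have k4 := normr_ge0 (ln (M ^+ 2 + e)).
  by rewrite ler_norml; apply/andP; split; lra.
have [K1 p1 h1] := bnd A hA; have [K2 p2 h2] := bnd B hB.
exists (1 + 2 * (K1 + K2)) => s s0.
have cV : continuous (Phi (logsq F e) (logsq G e) s).
  move=> t; apply: cont2_at_t.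
  have DF : 0 < sqmod F e s t by apply: sqmod_gt0; [exact: ltW|left].
  have DG : 0 < sqmod G e s t by apply: sqmod_gt0; [exact: ltW|left].
  by have [_ _ _ _ []] := Phi_jet (@logsq_jet R F e hF s t DF) (@logsq_jet R G e hG s t DG).
apply: circ_mean_norm_le => // t.
have a1 := h1 s t s0; have a2 := h2 s t s0; rewrite -/F -/G in a1 a2.
have a3 := Phi_root_le (logsq F e) (logsq G e) s t; have a4 := Phi_root_gt0 (logsq F e) (logsq G e) s t.
have a5 : `|Phi_diff (logsq F e) (logsq G e) s t| <= K1 + K2 by rewrite (le_trans (ler_normB _ _)) // lerD.
rewrite /Phi (le_trans (ler_normD _ _)) // (gtr0_norm a4).
have := le_trans (ler_normD (logsq F e s t) (logsq G e s t)) (lerD a1 a2); lra.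
Qed.

Lemma green_M1_mono e x y : 0 < e -> x <= y -> green_mean1 e x <= green_mean1 e y.
Proof.
move=> e0 xy; apply: (@mono_of_derive R (green_mean1 e) (green_mean2 e) (x - 1) (y + 1)); rewrite ?ltrBlDr ?ltrDl ?ltr01 //.
- by move=> z zz; have [] := @green_derive e _ _ z (ltW e0) zz (or_introl e0).
- by move=> z _; exact: green_M2_ge0.
Qed.

Lemma green_M1_ge0 e x : 0 < e -> 0 <= green_mean1 e x.
Proof.
move=> e0; have [K hK] := green_bounded e0.
have rderM (z : R) : is_derive z 1 (green_mean e) (green_mean1 e z).
  have zz : z - 1 < z < z + 1 by rewrite ltrBlDr !ltrDl ltr01.
  by have [] := @green_derive e _ _ z (ltW e0) zz (or_introl e0).
have mono (y z : R) (yz : y <= z) : green_mean1 e y <= green_mean1 e z := green_M1_mono e0 yz.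
exact: (@convex_bounded_mono R (green_mean e) (green_mean1 e) K rderM mono hK x).
Qed.

Lemma green_M_mono e x y : 0 < e -> x <= y -> green_mean e x <= green_mean e y.
Proof.
move=> e0 xy; apply: (@mono_of_derive R (green_mean e) (green_mean1 e) (x - 1) (y + 1)); rewrite ?ltrBlDr ?ltrDl ?ltr01 //.
- by move=> z zz; have [] := @green_derive e _ _ z (ltW e0) zz (or_introl e0).
- by move=> z _; exact: green_M1_ge0.
Qed.

(** The square [e * e] permits a limit from both sides of 0 while the regularising constant stays
    nonnegative. *)
Lemma green_cvg s : regular s ->
  (green_mean (e * e) s @[e --> (0 : R)] --> green_mean 0 s) /\ (green_mean1 (e * e) s @[e --> (0 : R)] --> green_mean1 0 s).
Proof.
move=> rs.
have rF t : F (Complex s t) != 0 by have [] := rs (cexp (Complex s t)); rewrite ?cabs_cexp.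
have rG t : G (Complex s t) != 0 by have [] := rs (cexp (Complex s t)); rewrite ?cabs_cexp.
have i0 : ((-1 : R) < 0) && ((0 : R) < 1) by rewrite ltrN10 ltr01.
have ce (e t : R) : {for (e, t), continuous (fun r : R * R => r.1 * r.1)}.
  by apply: cont_atM; exact: cvg_fst.
have cH (H : C -> C) (e t : R) : entire H -> {for (e, t), continuous (fun r : R * R => H (Complex s r.2))}.
  move=> hH; apply: (@continuous_comp _ _ _ snd (fun t => H (Complex s t))); first exact: cvg_snd.
  exact: entire_continuous_t.
have cLD (H : C -> C) (e t : R) : entire H -> {for (e, t), continuous (fun r : R * R => sqmod H (r.1 * r.1) s r.2)}.
  move=> hH; have cc := cH H e t hH.
  have cr : {for (e, t), continuous (fun r : R * R => complex.Re (H (Complex s r.2)))}.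
    by apply: (@continuous_comp _ _ _ (fun r : R * R => H (Complex s r.2)) (fun z : C => complex.Re z)) => //; exact: continuous_ReC.
  have ci : {for (e, t), continuous (fun r : R * R => complex.Im (H (Complex s r.2)))}.
    by apply: (@continuous_comp _ _ _ (fun r : R * R => H (Complex s r.2)) (fun z : C => complex.Im z)) => //; exact: continuous_ImC.
  exact: (cont_atD (cont_atD (cont_atM cr cr) (cont_atM ci ci)) (ce e t)).
have pLD (H : C -> C) e t : (forall t, H (Complex s t) != 0) -> 0 < sqmod H (e * e) s t.
  by move=> rH; apply: sqmod_gt0; [rewrite -expr2 sqr_ge0|right].
have cLX (H : C -> C) (e t : R) : entire H -> (forall t, H (Complex s t) != 0) ->
    {for (e, t), continuous (fun r : R * R => logsq H (r.1 * r.1) s r.2)}.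
  move=> hH rH; exact: (@cont_at_ln R _ (e, t) (fun r : R * R => sqmod H (r.1 * r.1) s r.2) (pLD H e t rH) (cLD H e t hH)).
have cLXs (H : C -> C) (e t : R) : entire H -> (forall t, H (Complex s t) != 0) ->
    {for (e, t), continuous (fun r : R * R => logsq_s H (r.1 * r.1) s r.2)}.
  move=> hH rH; have Dn : sqmod H (e * e) s t != 0 by rewrite gt_eqF // pLD.
  have cr (K : C -> C) : entire K -> {for (e, t), continuous (fun r : R * R => complex.Re (K (Complex s r.2)))}.
    by move=> hK; apply: (@continuous_comp _ _ _ (fun r : R * R => K (Complex s r.2)) (fun z : C => complex.Re z)); [exact: cH|exact: continuous_ReC].
  have ci (K : C -> C) : entire K -> {for (e, t), continuous (fun r : R * R => complex.Im (K (Complex s r.2)))}.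
    by move=> hK; apply: (@continuous_comp _ _ _ (fun r : R * R => K (Complex s r.2)) (fun z : C => complex.Im z)); [exact: cH|exact: continuous_ImC].
  have hH1 := entire_cder hH.
  have cDi := @cont_atV R _ (e, t) (fun r : R * R => sqmod H (r.1 * r.1) s r.2) Dn (cLD H e t hH).
  exact: (cont_atM (cont_atM (@cont_at_cst R _ (e, t) 2) (cont_atD (cont_atM (cr H hH) (cr _ hH1)) (cont_atM (ci H hH) (ci _ hH1)))) cDi).
have cS (e t : R) : {for (e, t), continuous (fun r : R * R => Phi_root (logsq F (r.1 * r.1)) (logsq G (r.1 * r.1)) s r.2)}.
  have cZ := cont_atB (cLX F e t hF rF) (cLX G e t hG rG).
  exact: (cont_at_sqrt (cont_atD (@cont_at_cst R _ (e, t) 1) (cont_atM cZ cZ))).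
split.
- have := @segint_cvg R (fun e t => Phi (logsq F (e * e)) (logsq G (e * e)) s t) (-1) 1 0 0 (2 * pi) i0 (@twopi_ge0 R).
  rewrite mul0r => H; apply: cvgM; first exact: cvg_cst.
  apply: H => e t _; exact: (cont_atD (cS e t) (cont_atD (cLX F e t hF rF) (cLX G e t hG rG))).
- have := @segint_cvg R (fun e t => Phi_d1 (logsq F (e * e)) (logsq G (e * e)) (logsq_s F (e * e)) (logsq_s G (e * e)) s t) (-1) 1 0 0 (2 * pi) i0 (@twopi_ge0 R).
  rewrite mul0r => H; apply: cvgM; first exact: cvg_cst.
  apply: H => e t _.
  have cZ := cont_atB (cLX F e t hF rF) (cLX G e t hG rG).
  have Sn : Phi_root (logsq F (e * e)) (logsq G (e * e)) s t != 0 by rewrite gt_eqF // Phi_root_gt0.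
  have cSi := @cont_atV R _ (e, t) (fun r : R * R => Phi_root (logsq F (r.1 * r.1)) (logsq G (r.1 * r.1)) s r.2) Sn (cS e t).
  have c1 := cLXs F e t hF rF; have c2 := cLXs G e t hG rG.
  exact: (cont_atD (cont_atM (cont_atM cZ (cont_atB c1 c2)) cSi) (cont_atD c1 c2)).
Qed.

Lemma limit_le (f g : R -> R) (a b : R) : (forall e, e != 0 -> f e <= g e) ->
  f e @[e --> (0 : R)] --> a -> g e @[e --> (0 : R)] --> b -> a <= b.
Proof.
move=> fg /cvgrPdist_le fa /cvgrPdist_le gb; apply/ler_addgt0Pr => e e0.
have e2 : 0 < e / 2 by rewrite divr_gt0.
have [d1 /= d10 h1] := fa _ e2; have [d2 /= d20 h2] := gb _ e2.
pose d := Num.min d1 d2 / 2.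
have d0 : 0 < d by rewrite divr_gt0 // lt_min d10.
have dd1 : d < d1.
  have : Num.min d1 d2 <= d1 by rewrite ge_min lexx.
  by rewrite /d => ?; lra.
have dd2 : d < d2.
  have : Num.min d1 d2 <= d2 by rewrite ge_min lexx orbT.
  by rewrite /d => ?; lra.
have := fg d; rewrite gt_eqF // => /(_ isT) i1.
have := h1 d; rewrite /ball_ /= sub0r normrN gtr0_norm // => /(_ dd1); rewrite ler_norml => /andP[? ?].
have := h2 d; rewrite /ball_ /= sub0r normrN gtr0_norm // => /(_ dd2); rewrite ler_norml => /andP[? ?].
lra.
Qed.

Lemma green_mono x y : regular x -> regular y -> x <= y ->
  [/\ green_mean 0 x <= green_mean 0 y, green_mean1 0 x <= green_mean1 0 y & 0 <= green_mean1 0 x].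
Proof.
move=> rx ry xy; have [x1 x2] := green_cvg rx; have [y1 y2] := green_cvg ry.
have ee (e : R) : e != 0 -> 0 < e * e by move=> e0; rewrite -expr2 exprn_even_gt0.
split.
- by apply: limit_le x1 y1 => e /ee e0; exact: green_M_mono.
- by apply: limit_le x2 y2 => e /ee e0; exact: green_M1_mono.
- by apply: (@limit_le (fun=> 0) _ _ _ _ (@cvg_cst _ _ _ _ _) x2) => e /ee e0; exact: green_M1_ge0.
Qed.
End Green.

(** * Growth of monotone functions *)

Section Growth.
Variable R : realType.
Notation mu := (@lebesgue_measure R).

Section Dyadic.
Variable F : R -> R.
Hypothesis F_mono : forall x y, x <= y -> F x <= F y.
Hypothesis F_bnd : forall x, -1 <= F x <= 0.

(* [E_ k] is the union of the dyadic intervals of length [2^-k] on which F grows by more than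
   [2^-k]; its measure is at most the total growth of F, and a point outside infinitely many
   [E_ k] has derivative at most 1. *)
Let x_ (k j : nat) : R := j%:R / 2 ^+ k.
Let I_ (k j : nat) : set R := `[x_ k j, x_ k j.+1[%classic.
Let bad (k j : nat) : bool := (2 ^+ k)^-1 < F (x_ k j.+1) - F (x_ k j).
Let A_ (k j : nat) : set R := if bad k j then I_ k j else set0.
Let E_ (k : nat) : set R := \bigcup_j A_ k j.

Let mA k j : measurable (A_ k j).
Proof. by rewrite /A_; case: ifP => _ //; exact: measurable_itv. Qed.

Let mE k : measurable (E_ k).
Proof. by apply: bigcup_measurable => j _; exact: mA. Qed.

Let step k j : x_ k j.+1 - x_ k j = (2 ^+ k)^-1.
Proof. by rewrite /x_ -mulrBl -natrB // subSnn mul1r. Qed.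

Let muA k j : (mu (A_ k j) <= (F (x_ k j.+1) - F (x_ k j))%:E)%E.
Proof.
have le : x_ k j <= x_ k j.+1 by rewrite -subr_ge0 step invr_ge0 exprn_ge0.
rewrite /A_ /bad; case: ifP => b; last first.
  by rewrite measure0 lee_fin subr_ge0; exact: F_mono.
rewrite /I_ lebesgue_measure_itv /= lte_fin; case: ifP => _; last by rewrite lee_fin subr_ge0; exact: F_mono.
by rewrite -EFinB lee_fin step ltW.
Qed.

Let muE k : (mu (E_ k) <= 1)%E.
Proof.
have h : (mu (E_ k) <= \sum_(0 <= j <oo) mu (A_ k j))%E.
  by apply: measure_sigma_subadditive => [j||//]; [exact: mA|exact: mE].
apply: (le_trans h).
apply: lime_le; first by apply: is_cvg_nneseries => j _ _; exact: measure_ge0.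
apply: nearW => n /=; apply: le_trans (lee_sum _ (fun j _ => @muA k j)) _.
rewrite sumEFin lee_fin telescope_sumr //.
by have := F_bnd (x_ k n); have := F_bnd (x_ k 0); move=> /andP[? ?] /andP[? ?]; lra.
Qed.

(** The lower limit of the sets [E_ k]. Each of the increasing intersections is contained in one
    [E_ m], so the union has measure at most 1. *)
Let LE : set R := \bigcup_m \bigcap_(k in [set k | (m <= k)%N]) E_ k.

Let mcap m : measurable (\bigcap_(k in [set k | (m <= k)%N]) E_ k).
Proof. by apply: bigcap_measurable => [|k _]; [exists m => /=|exact: mE]. Qed.

Let muLE : (mu LE <= 1)%E.
Proof.
have nd : nondecreasing_seq (fun m => \bigcap_(k in [set k | (m <= k)%N]) E_ k).
  by move=> m n mn; apply/subsetPset => x h k /= nk; apply: h => /=; exact: leq_trans nk.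
have := @nondecreasing_cvg_mu _ _ _ mu _ mcap (bigcup_measurable (fun m _ => mcap m)) nd.
move=> /cvg_lim <- //; apply: lime_le.
  by apply: ereal_nondecreasing_is_cvgn => m n mn; apply: le_measure; rewrite ?inE; [exact: mcap|exact: mcap|exact/subsetPset/nd].
apply: nearW => m; apply: le_trans (muE m); apply: le_measure; rewrite ?inE; [exact: mcap|exact: mE|].
by move=> x; apply => /=.
Qed.

Lemma growth_mono : exists E : set R, [/\ measurable E, (mu E < +oo)%E &
  forall t D, 0 <= t -> ~ E t -> is_derive t 1 F D -> D <= 1].
Proof.
exists LE; split; first by apply: bigcup_measurable => m _; exact: mcap.
  by apply: le_lt_trans muLE _; rewrite ltry.
move=> t D t0 nE dF; rewrite leNgt; apply/negP => D1; apply: nE.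
(* The mean slope of [F] over a short interval around [t] is then at least [D - e > 1], so for all
   large [k] the dyadic interval containing [t] is bad and [t] lies in [LE]. *)
pose e := (D - 1) / 2; have e0 : 0 < e by rewrite divr_gt0 // subr_gt0.
have [d d0 hd] := proj1 (is_derive_epsdelta _ _ _) dF e e0.
pose m := Num.bound (d^-1).
exists m => // k /= mk.
have k2 : (2 ^+ k)^-1 < d.
  rewrite -[ltRHS]invrK ltf_pV2 ?posrE ?exprn_gt0 ?invr_gt0 //.
  have /archi_boundP /lt_le_trans : 0 <= d^-1 by rewrite invr_ge0 ltW.
  apply; rewrite -natrX ler_nat (leq_trans _ (leq_pexp2l _ mk)) //.
  by rewrite ltnW // ltn_expl.
have p0 : (0 : R) < 2 ^+ k by rewrite exprn_gt0.
pose j := Num.truncn (t * 2 ^+ k).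
have tk0 : 0 <= t * 2 ^+ k by rewrite mulr_ge0 // ltW.
have /andP[j1 j2] : (j%:R <= t * 2 ^+ k) && (t * 2 ^+ k < j.+1%:R).
  by rewrite /j; have := truncn_itv tk0.
exists j => //; have i1 : x_ k j <= t by rewrite /x_ ler_pdivrMr.
have i2 : t < x_ k j.+1 by rewrite /x_ ltr_pdivlMr.
suff b : bad k j by rewrite /A_ b /I_ /= in_itv /= i1 i2.
have st := step k j; rewrite /bad -st.
set a := x_ k j in i1 st *; set b := x_ k j.+1 in i2 st *.
have h1 := hd (b - t); have h2 := hd (a - t).
rewrite (addrC t) subrK ger0_norm in h1; last by lra.
rewrite (addrC t) subrK ler0_norm in h2; last by lra.
have := h1 _; have := h2 _; rewrite !ler_norml.
have q2 : - (a - t) < d by lra.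
have q1 : b - t < d by lra.
move=> /(_ q2)/andP[_ u2] /(_ q1)/andP[u1 _].
have ba : 0 < b - a by rewrite st invr_gt0.
have ed : D = 1 + 2 * e by rewrite /e; field.
have : 0 < e * (b - a) by rewrite mulr_gt0.
rewrite ed in u1 u2; nra.
Qed.
End Dyadic.

(** The means are controlled only at radii whose circles avoid the zeros. The extension is a
    supremum over the smaller points of [U]; the value [-1] keeps the set nonempty to the left of
    [U]. *)
Lemma mono_extension (U : set R) (F : R -> R) :
  (forall x y, U x -> U y -> x <= y -> F x <= F y) -> (forall x, U x -> -1 <= F x <= 0) ->
  exists G : R -> R, [/\ forall x y, x <= y -> G x <= G y, forall x, -1 <= G x <= 0 & forall x, U x -> G x = F x].
Proof.
move=> Fm Fb.
pose S t := [set y : R | y = -1 \/ exists2 x, U x & x <= t /\ y = F x].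
have Sub t y : S t y -> y <= 0 by case=> [->|[x Ux [_ ->]]]; [lra|case/andP: (Fb x Ux)].
have S1 t : S t (-1) by left.
have Shs t : has_sup (S t) by split; [exists (-1)|exists 0 => y; exact: Sub].
exists (fun t => sup (S t)); split.
- move=> x y xy; apply: ge_sup; first by exists (-1).
  move=> z Sz; apply: ub_le_sup; first by exists 0 => w; exact: Sub.
  by case: Sz => [->|[v Uv [vx ->]]]; [left|right; exists v => //; split => //; exact: le_trans xy].
- move=> x; apply/andP; split.
    by apply: ub_le_sup => //; exists 0 => w; exact: Sub.
  by apply: ge_sup; [exists (-1)|move=> y; exact: Sub].
- move=> x Ux; apply/eqP; rewrite eq_le; apply/andP; split.
    apply: ge_sup; first by exists (-1).
    by move=> y [->|[v Uv [vx ->]]]; [case/andP: (Fb x Ux)|exact: Fm].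
  apply: ub_le_sup; first by exists 0 => w; exact: Sub.
  by right; exists x.
Qed.

(** [d] is the radius of a neighbourhood inside [U], on which [F] and its monotone extension agree
    and hence have the same derivative. *)
Lemma growth (U : set R) (F : R -> R) :
  (forall x y, U x -> U y -> x <= y -> F x <= F y) -> (forall x, U x -> -1 <= F x <= 0) ->
  exists E : set R, [/\ measurable E, (mu E < +oo)%E &
  forall t D (d : R), 0 < d -> 0 <= t -> (forall x, `|x - t| < d -> U x) -> ~ E t -> is_derive t 1 F D -> D <= 1].
Proof.
move=> Fm Fb; have [G [Gm Gb GF]] := mono_extension Fm Fb.
have [E [mE muE hE]] := growth_mono Gm Gb.
exists E; split => // t D d d0 t0 hU nE dF; apply: (hE t D t0 nE).
apply/is_derive_epsdelta => e e0.
have [d1 d10 h1] := proj1 (is_derive_epsdelta _ _ _) dF e e0.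
exists (Num.min d d1); first by rewrite lt_min d0.
move=> h; rewrite lt_min => /andP[hd hd1].
rewrite !GF ?h1 //; apply: hU; first by rewrite subrr normr0.
by rewrite addrC addKr.
Qed.

(** Jensen's inequality, from the tangent line [ln x <= ln c - 1 + x / c] at the mean [c] of [f]. *)
Lemma circ_mean_ln_le (f : R -> R) : continuous f -> (forall t, 0 < f t) ->
  circ_mean (fun t => ln (f t)) <= ln (circ_mean f).
Proof.
move=> cf f0.
(* A positive lower bound of [f] over a period, from an upper bound of [1 / f]; it makes the mean
   positive. *)
have [m m0 hm] : exists2 m : R, 0 < m & forall t, 0 <= t <= 2 * pi -> m <= f t.
  have cv : forall s t : R, 0 <= s <= 1 -> 0 <= t <= 2 * pi -> cont2_at (fun _ t => (f t)^-1) s t.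
    move=> s t _ _; apply: (@cont_atV R _ (s, t) (fun r : R * R => f r.2)); first by rewrite gt_eqF.
    by apply: (@continuous_comp _ _ _ snd f); [exact: cvg_snd|exact: cf].
  have [M M0 hM] := bounded_on_box ler01 (@twopi_ge0 R) cv.
  exists (M + 1)^-1 => [|t t01]; first by rewrite invr_gt0 ltr_wpDl.
  have z1 : ((0 : R) <= 0) && ((0 : R) <= 1) by rewrite lexx ler01.
  have := hM 0 t z1 t01; rewrite gtr0_norm ?invr_gt0 // => h.
  rewrite -[leRHS]invrK lef_pV2 ?posrE ?invr_gt0 ?ltr_wpDl //; lra.
have mm : m <= circ_mean f.
  rewrite -[m]circ_mean_cst /circ_mean ler_pM2l ?invr_gt0 ?twopi_gt0 //.
  by apply: segint_le => //; exact: continuous_cst.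
have c0 : 0 < circ_mean f by exact: lt_le_trans mm.
have cl : continuous (fun t => ln (f t)) by move=> t; exact: (@cont_at_ln R _ t f (f0 t) (cf t)).
set c := circ_mean f in c0 *.
have cf' : continuous (fun t => c^-1 * f t) by apply: contR_M => //; exact: continuous_cst.
have H t : ln (f t) <= (ln c - 1) + c^-1 * f t.
  have p : 0 < c^-1 * f t by rewrite mulr_gt0 ?invr_gt0.
  have : ln (1 + (c^-1 * f t - 1)) <= c^-1 * f t - 1 by apply: le_ln1Dx; lra.
  rewrite addrC subrK lnM ?posrE ?invr_gt0 // lnV ?posrE //; lra.
have := circ_mean_le cl (contR_D (@continuous_cst R R (ln c - 1)) cf') H.
rewrite circ_meanD ?circ_mean_cst ?circ_meanZ //; last exact: continuous_cst.
by rewrite -/c mulVf ?gt_eqF // subrK.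
Qed.
End Growth.

Lemma finite_measureU (R : realType) (E1 E2 : set R) :
  measurable E1 /\ (@lebesgue_measure R E1 < +oo)%E -> measurable E2 /\ (@lebesgue_measure R E2 < +oo)%E ->
  measurable (E1 `|` E2) /\ (@lebesgue_measure R (E1 `|` E2) < +oo)%E.
Proof.
move=> [m1 f1] [m2 f2]; split; first exact: measurableU.
apply: (le_lt_trans (@measureU2 _ _ _ (@lebesgue_measure R) _ _ m1 m2)).
exact: lte_add_pinfty.
Qed.

Section LogDerivative.
Variable R : realType.
Local Notation C := (Cplx R).
Notation mu := (@lebesgue_measure R).

Lemma logsq_s_quot (H : C -> C) s t (u := cder H (Complex s t) / H (Complex s t)) : H (Complex s t) != 0 ->
  logsq_s H 0 s t = 2 * complex.Re u /\ logsq_t H 0 s t = - (2 * complex.Im u).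
Proof.
move=> H0; have D0 : 0 < sqmod H 0 s t by rewrite sqmod_cabs addr0 exprn_gt0 // cabs_gt0.
have cE : cder H (Complex s t) = u * H (Complex s t) by rewrite /u divfK.
have Dn : sqmod H 0 s t != 0 by rewrite gt_eqF.
rewrite /logsq_s /logsq_t cE !cplxE; move: Dn; rewrite /sqmod addr0.
move: (complex.Re u) (complex.Im u) (complex.Re (H (Complex s t))) (complex.Im (H (Complex s t))) => a b p q Dn.
by split; field.
Qed.

Lemma grad_aux (z x y a b : C) : a != 0 -> b != 0 ->
  (2 * complex.Re (x * z / a) - 2 * complex.Re (y * z / b)) ^+ 2 +
  (- (2 * complex.Im (x * z / a)) - - (2 * complex.Im (y * z / b))) ^+ 2 =
  4 * cabs z ^+ 2 * cabs (x / a - y / b) ^+ 2.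
Proof.
move=> a0 b0.
have -> : 4 * cabs z ^+ 2 * cabs (x / a - y / b) ^+ 2 = 4 * cabs (z * (x / a - y / b)) ^+ 2 by rewrite (cabsM z); ring.
have -> : z * (x / a - y / b) = x * z / a - y * z / b by field; rewrite a0 b0.
rewrite cabs_sqr !cplxReD !cplxImD !cplxReN !cplxImN; ring.
Qed.

Variables (A B : C -> C).
Hypotheses (hA : entire A) (hB : entire B) (nA : nonzero A) (nB : nonzero B).
Let F w := A (cexp w).
Let G w := B (cexp w).

(** The logarithmic derivative of the quotient [A / B]. *)
Definition logder z := cder A z / A z - cder B z / B z.

Lemma regular_nz s t : regular A B s -> A (circ s t) != 0 /\ B (circ s t) != 0.
Proof. by apply; rewrite cabs_circ. Qed.

(** As [F w = A (exp w)], differentiation in the logarithmic coordinate multiplies by [z], whence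
    the factor [(expR s) ^+ 2]; the 4 is due to [ln |F|^2 = 2 ln |F|]. *)
Lemma grad_logder s t : regular A B s ->
  (logsq_s F 0 s t - logsq_s G 0 s t) ^+ 2 + (logsq_t F 0 s t - logsq_t G 0 s t) ^+ 2 =
  4 * (expR s) ^+ 2 * cabs (logder (circ s t)) ^+ 2.
Proof.
move=> rs; have [a0 b0] := regular_nz t rs.
have [-> ->] := @logsq_s_quot F s t a0; have [-> ->] := @logsq_s_quot G s t b0.
rewrite (cder_comp hA (@entire_cexp R)) (cder_comp hB (@entire_cexp R)) cder_cexp -(cabs_circ s t).
exact: (grad_aux (circ s t) (cder A (circ s t)) (cder B (circ s t)) a0 b0).
Qed.

Lemma regular_open s : regular A B s -> exists a b : R, a < s < b /\ forall x, a < x < b -> regular A B x.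
Proof.
move=> rs.
have one (g : C -> C) : entire g -> nonzero g -> (forall z, cabs z = expR s -> g z != 0) ->
    exists2 d : R, 0 < d & forall z, `|cabs z - expR s| < d -> g z != 0.
  move=> hg ng gs; have [L hL] := finite_zeros (expR s + 1) hg ng.
  pose f (z : C) : R := if g z == 0 then `|cabs z - expR s| else 1.
  exists (\big[Num.min/1]_(z <- L) f z).
    elim: L {hL} => [|z L IH]; first by rewrite big_nil.
    rewrite big_cons lt_min IH andbT /f; case: eqP => // gz.
    rewrite normr_gt0 subr_eq0; apply/eqP => e; have := gs z e; rewrite gz eqxx //.
  move=> z zd; apply/eqP => gz.
  have le1 : \big[Num.min/1]_(z <- L) f z <= 1.
    by elim: (L) => [|y L' IH]; rewrite ?big_nil // big_cons ge_min IH orbT.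
  have zL : z \in L.
    apply: hL => //; have := le_trans (ltW zd) le1; rewrite ler_norml => /andP[_]; lra.
  have : \big[Num.min/1]_(z <- L) f z <= f z.
    elim: (L) zL => [//|y L' IH]; rewrite inE big_cons ge_min => /predU1P[->|/IH ->]; rewrite ?lexx ?orbT //.
  by rewrite /f gz eqxx leNgt zd.
have [d1 d10 h1] := one A hA nA (fun z h => proj1 (rs z h)).
have [d2 d20 h2] := one B hB nB (fun z h => proj2 (rs z h)).
pose d := Num.min d1 d2; have d0 : 0 < d by rewrite lt_min d10.
have ce : continuous (@expR R) := @continuous_expR R.
have /cvgrPdist_lt /(_ d d0) [e /= e0 he] := ce s.
exists (s - e), (s + e); split; first by apply/andP; split; lra.
move=> x /andP[x1 x2] z zx.
have : `|expR s - expR x| < d.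
  by apply: he; rewrite /ball_ /= ltr_norml; apply/andP; split; lra.
rewrite lt_min distrC -zx => /andP[? ?]; by split; [apply: h1|apply: h2].
Qed.

(** In Jensen's formula all terms besides the constant are nonnegative once [s >= 0]. *)
Lemma logmean_ge (g : C -> C) : entire g -> nonzero g -> exists K : R, forall s, 0 <= s ->
  (forall z, cabs z = expR s -> g z != 0) -> K <= logmean g s.
Proof.
move=> hg ng; have [Cg hC] := jensen_formula hg ng; exists Cg => s s0 rs.
have [L hL] := finite_zeros (expR s) hg ng.
pose Z := [seq z <- undup L | [&& z != 0, g z == 0 & cabs z < expR s]].
rewrite (hC s Z).
- rewrite -addrA lerDl addr_ge0 ?mulr_ge0 ?ler0n //.
  rewrite big_seq sumr_ge0 // => a; rewrite mem_filter => /andP[/and3P[a0 _ as_] _].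
  rewrite mulr_ge0 ?ler0n // subr_ge0 -[leRHS]expRK ler_ln ?posrE ?cabs_gt0 ?expR_gt0 // ltW //.
- by rewrite filter_uniq // undup_uniq.
- by move=> a; rewrite mem_filter => /andP[/and3P[-> _ ->] _].
- move=> z z0 zs gz; rewrite mem_filter z0 gz eqxx mem_undup hL // andbT /= lt_neqAle zs andbT.
  by apply/eqP => e; have := rs z e; rewrite gz eqxx.
Qed.

(** Plays the part of the characteristic function of [A / B]. *)
Definition maxlog s := circ_mean (fun t => ln (Num.max (cabs (A (circ s t))) (cabs (B (circ s t))))).

Lemma jets0 s t : regular A B s ->
  jet (logsq F 0) (logsq_s F 0) (logsq_t F 0) (logsq_ss F 0) (logsq_tt F 0) s t /\ jet (logsq G 0) (logsq_s G 0) (logsq_t G 0) (logsq_ss G 0) (logsq_tt G 0) s t.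
Proof.
move=> rs; have [a0 b0] := regular_nz t rs.
by split; apply: logsq_jet; [exact (entire_comp hA (@entire_cexp R))|rewrite sqmod_cabs addr0 exprn_gt0 // cabs_gt0|
  exact (entire_comp hB (@entire_cexp R))|rewrite sqmod_cabs addr0 exprn_gt0 // cabs_gt0].
Qed.

Let S_ s t := Phi_root (logsq F 0) (logsq G 0) s t.

Lemma cont_Phi_root s : regular A B s -> continuous (S_ s).
Proof.
move=> rs t; have [[_ _ _ _ [c1 _ _ _ _]] [_ _ _ _ [c2 _ _ _ _]]] := jets0 t rs.
have cZ := cont_atB c1 c2.
exact: (cont2_at_t (cont_at_sqrt (cont_atD (@cont_at_cst R _ (s, t) 1) (cont_atM cZ cZ)))).
Qed.

Lemma cont_logsq s : regular A B s -> continuous (logsq F 0 s) /\ continuous (logsq G 0 s).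
Proof.
move=> rs; split => t; apply: cont2_at_t; have [[_ _ _ _ [c1 _ _ _ _]] [_ _ _ _ [c2 _ _ _ _]]] := jets0 t rs.
  exact: c1.
exact: c2.
Qed.

Lemma green_mean0E s : regular A B s -> green_mean A B 0 s = circ_mean (S_ s) + (2 * logmean A s + 2 * logmean B s).
Proof.
move=> rs; have [c1 c2] := cont_logsq rs.
rewrite /green_mean /Phi (circ_meanD (cont_Phi_root rs) (contR_D c1 c2)) (circ_meanD c1 c2).
congr (_ + (_ + _)); rewrite /logmean -circ_meanZ; try by apply: continuous_logcirc => // t; case: (regular_nz t rs).
  by apply: eq_circ_mean => t; rewrite circ_logsq //; case: (regular_nz t rs).
by apply: eq_circ_mean => t; rewrite circ_logsq //; case: (regular_nz t rs).
Qed.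

Lemma S_ge1 s t : 1 <= S_ s t.
Proof. by rewrite /S_ /Phi_root -[leLHS](@sqrtr1 R) ler_wsqrtr // lerDl -expr2 sqr_ge0. Qed.

Lemma cont_maxlog s : regular A B s -> continuous (fun t => ln (Num.max (cabs (A (circ s t))) (cabs (B (circ s t))))).
Proof.
move=> rs t; have [a0 b0] := regular_nz t rs.
apply: (@cont_at_ln R _ t (fun t => Num.max (cabs (A (circ s t))) (cabs (B (circ s t))))).
  by rewrite lt_max cabs_gt0 a0.
have c1 := @continuous_cabs_comp R _ _ (@continuous_circ R A s hA) t.
have c2 := @continuous_cabs_comp R _ _ (@continuous_circ R B s hB) t.
exact: continuous_max.
Qed.

(** [Phi <= 1 + |X - Y| + X + Y = 1 + 2 max (X, Y)], and [X] and [Y] are twice the logarithms of the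
    moduli. *)
Lemma green_mean_le s : regular A B s -> green_mean A B 0 s <= 1 + 4 * maxlog s.
Proof.
move=> rs; have [c1 c2] := cont_logsq rs; have c3 := cont_maxlog rs.
have c4 : continuous (fun t => 4 * ln (Num.max (cabs (A (circ s t))) (cabs (B (circ s t))))).
  by apply: contR_M => //; exact: continuous_cst.
have <- : circ_mean (fun t => 1 + 4 * ln (Num.max (cabs (A (circ s t))) (cabs (B (circ s t))))) = 1 + 4 * maxlog s.
  by rewrite (circ_meanD (@continuous_cst R R 1) c4) circ_mean_cst (circ_meanZ 4 c3).
apply: circ_mean_le.
- exact: (contR_D (cont_Phi_root rs) (contR_D c1 c2)).
- by apply: contR_D => //; exact: continuous_cst.
move=> t; have [a0 b0] := regular_nz t rs.
have h1 := Phi_root_le (logsq F 0) (logsq G 0) s t.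
rewrite /Phi; apply: le_trans (lerD h1 (lexx _)) _; rewrite /Phi_diff !circ_logsq //.
have x0 : 0 < cabs (A (circ s t)) by rewrite cabs_gt0.
have y0 : 0 < cabs (B (circ s t)) by rewrite cabs_gt0.
move: (cabs (A _)) (cabs (B _)) x0 y0 => x y x0 y0.
have lx : ln x <= ln (Num.max x y) by rewrite ler_ln ?posrE ?lt_max ?x0 // le_max lexx.
have ly : ln y <= ln (Num.max x y) by rewrite ler_ln ?posrE ?lt_max ?x0 // le_max lexx orbT.
move: (ln x) (ln y) (ln (Num.max x y)) lx ly => u v m l1 l2.
have h2 : `|2 * u - 2 * v| <= 4 * m - 2 * u - 2 * v by rewrite ler_norml; apply/andP; split; lra.
lra.
Qed.

Lemma cont_logder s : regular A B s -> continuous (fun t => cabs (logder (circ s t)) ^+ 2).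
Proof.
move=> rs.
have -> : (fun t => cabs (logder (circ s t)) ^+ 2) = (fun t => (4 * (expR s) ^+ 2)^-1 *
   ((logsq_s F 0 s t - logsq_s G 0 s t) ^+ 2 + (logsq_t F 0 s t - logsq_t G 0 s t) ^+ 2)).
  apply/funext => t; rewrite (grad_logder t rs) mulKf //.
  by rewrite mulf_neq0 // expf_neq0 // gt_eqF // expR_gt0.
move=> t; have [[_ _ _ _ [_ c1 d1 _ _]] [_ _ _ _ [_ c2 d2 _ _]]] := jets0 t rs.
have u := @cont2_at_t R (fun s t => logsq_s F 0 s t - logsq_s G 0 s t) s t (cont_atB c1 c2).
have v := @cont2_at_t R (fun s t => logsq_t F 0 s t - logsq_t G 0 s t) s t (cont_atB d1 d2).
exact: (cont_atM (@cont_at_cst R _ t _) (cont_atD (cont_atM u u) (cont_atM v v))).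
Qed.

Lemma green_mean2_logder s : regular A B s ->
  green_mean2 A B 0 s = circ_mean (fun t => 4 * (expR s) ^+ 2 * cabs (logder (circ s t)) ^+ 2 / S_ s t ^+ 3).
Proof.
move=> rs; apply: eq_circ_mean => t; have [a0 b0] := regular_nz t rs.
have DF : 0 < sqmod F 0 s t by rewrite sqmod_cabs addr0 exprn_gt0 // cabs_gt0.
have DG : 0 < sqmod G 0 s t by rewrite sqmod_cabs addr0 exprn_gt0 // cabs_gt0.
have hF : entire F by exact (entire_comp hA (@entire_cexp R)).
have hG : entire G by exact (entire_comp hB (@entire_cexp R)).
have l1 : logsq_ss F 0 s t + logsq_tt F 0 s t = 0 by rewrite (@logsq_laplace R F 0 s t DF) mulr0 !mul0r.
have l2 : logsq_ss G 0 s t + logsq_tt G 0 s t = 0 by rewrite (@logsq_laplace R G 0 s t DG) mulr0 !mul0r.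
have := @Phi_laplace R (logsq F 0) (logsq_s F 0) (logsq_t F 0) (logsq_ss F 0) (logsq_tt F 0) (logsq G 0) (logsq_s G 0) (logsq_t G 0) (logsq_ss G 0) (logsq_tt G 0) s t.
by rewrite l1 l2 grad_logder // !mulr0 !addr0.
Qed.

(* 1 + |l|^2 <= (1 + 4 |l|^2 / S^3) S^3 since S >= 1; then Jensen's inequality for the concave logarithm, twice. *)
Lemma mean_ln_logder s : regular A B s ->
  circ_mean (fun t => ln (1 + cabs (logder (circ s t)) ^+ 2)) <=
  ln (1 + green_mean2 A B 0 s / (expR s) ^+ 2) + 3 * ln (circ_mean (S_ s)).
Proof.
move=> rs; have cl := cont_logder rs; have cS := cont_Phi_root rs.
have S0 t : 0 < S_ s t := Phi_root_gt0 _ _ s t.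
have cSi : continuous (fun t => (S_ s t ^+ 3)^-1).
  move=> t; have n3 : S_ s t ^+ 3 != 0 by rewrite expf_neq0 // gt_eqF.
  exact: (@cont_atV R _ t (fun t => S_ s t ^+ 3) n3 (cont_atM (cS t) (cont_atM (cS t) (cS t)))).
pose f t := 4 * (expR s) ^+ 2 * cabs (logder (circ s t)) ^+ 2 / S_ s t ^+ 3.
pose k := ((expR s) ^+ 2)^-1; have k0 : 0 < k by rewrite invr_gt0 exprn_gt0 // expR_gt0.
have cf : continuous f.
  exact: (contR_M (contR_M (@continuous_cst _ _ (4 * (expR s) ^+ 2)) cl) cSi).
have f0 t : 0 <= f t by rewrite /f divr_ge0 ?exprn_ge0 ?(ltW (S0 t)) // !mulr_ge0 ?exprn_ge0 ?expR_ge0 ?cabs_ge0.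
have ckf : continuous (fun t => 1 + k * f t).
  exact: (contR_D (@continuous_cst _ _ 1) (contR_M (@continuous_cst _ _ k) cf)).
have p1 t : 0 < 1 + k * f t by rewrite ltr_wpDr // mulr_ge0 // ltW.
have e1 : 1 + green_mean2 A B 0 s / (expR s) ^+ 2 = circ_mean (fun t => 1 + k * f t).
  rewrite green_mean2_logder // circ_meanD; try exact: continuous_cst; last exact: (contR_M (@continuous_cst _ _ k) cf).
  by rewrite circ_mean_cst circ_meanZ // mulrC.
rewrite e1.
have c1 : continuous (fun t => ln (1 + k * f t)) by move=> t; exact: (@cont_at_ln R _ t (fun t => 1 + k * f t) (p1 t) (ckf t)).
have c2 : continuous (fun t => ln (S_ s t)) by move=> t; exact: (@cont_at_ln R _ t (S_ s) (S0 t) (cS t)).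
have i1 := circ_mean_ln_le ckf p1.
have i2 := circ_mean_ln_le cS S0.
apply: le_trans (_ : _ <= circ_mean (fun t => ln (1 + k * f t) + 3 * ln (S_ s t))) _; last first.
  rewrite (circ_meanD c1 (contR_M (@continuous_cst _ _ 3) c2)) (circ_meanZ 3 c2) lerD //.
  by rewrite ler_pM2l.
have q1 t : 0 < 1 + cabs (logder (circ s t)) ^+ 2 by rewrite ltr_pwDl // sqr_ge0.
have cq : continuous (fun t => 1 + cabs (logder (circ s t)) ^+ 2).
  exact: (contR_D (@continuous_cst _ _ 1) cl).
apply: circ_mean_le.
- by move=> t; exact: (@cont_at_ln R _ t (fun t => 1 + cabs (logder (circ s t)) ^+ 2) (q1 t) (cq t)).
- exact: (contR_D c1 (contR_M (@continuous_cst _ _ 3) c2)).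
move=> t; have S3 : ln (S_ s t ^+ 3) = 3 * ln (S_ s t) by rewrite lnXn // mulr_natl.
rewrite -S3 -lnM ?posrE ?exprn_gt0 // ler_ln ?posrE ?mulr_gt0 ?exprn_gt0 //.
have S1 : 1 <= S_ s t ^+ 3 by rewrite exprn_ege1 // S_ge1.
have Sn : S_ s t ^+ 3 != 0 by rewrite gt_eqF // exprn_gt0.
have en : (expR s) ^+ 2 != 0 by rewrite gt_eqF // exprn_gt0 // expR_gt0.
have -> : (1 + k * f t) * S_ s t ^+ 3 = S_ s t ^+ 3 + 4 * cabs (logder (circ s t)) ^+ 2.
  by rewrite /k /f; move: (S_ s t ^+ 3) (_ ^+ 2) (cabs _ ^+ 2) Sn en => x y z xn yn; field; rewrite xn yn.
have := sqr_ge0 (cabs (logder (circ s t))); lra.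
Qed.

Lemma ln_prod_aux (m a b : R) : 0 < m -> 0 <= a -> 0 <= b ->
  ln (2 * m * (1 + a) ^+ 2 * (3 * (1 + b) ^+ 2)) = ln 2 + ln m + 2 * ln (1 + a) + (ln 3 + 2 * ln (1 + b)).
Proof.
move=> m0 a0 b0; have pa : 0 < 1 + a by lra.
have pb : 0 < 1 + b by lra.
rewrite lnM ?posrE ?mulr_gt0 ?exprn_gt0 // lnM ?posrE ?mulr_gt0 ?exprn_gt0 // lnM ?posrE //.
by rewrite lnM ?posrE ?exprn_gt0 // !lnXn // !mulr_natl.
Qed.

(** [m], [H] and [P] stand for the shifted mean and its first and second derivatives in [ln r]; the
    last two hypotheses are the growth estimates. Since [(1 + H) / r] is bounded in terms of [m]
    alone, [ln r] survives only inside [ln (1 + ln (1 + H))], where [ln r <= T] makes it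
    harmless. *)
Lemma log_derivative_bound (r m H P T K : R) : 1 < r -> 1 <= m -> 0 <= H -> 0 <= P -> 1 <= T -> ln r <= T -> 0 <= K -> m <= K * T ->
  H / r <= m * (1 + ln m) ^+ 2 -> P / r <= (1 + H) * (1 + ln (1 + H)) ^+ 2 ->
  ln (1 + P / r ^+ 2) + 3 * ln m <= (40 + 20 * ln (1 + K)) * (1 + ln T).
Proof.
move=> r1 m1 H0 P0 T1 rT K0 mK h1 h2.
have r0 : 0 < r by lra.
have m0 : 0 < m by lra.
have lnle (x : R) : 0 < x -> ln x <= x - 1.
  move=> x0; have := expR_ge1Dx (ln x); rewrite lnK ?posrE //; lra.
have lnr0 : 0 <= ln r by rewrite ln_ge0 // ltW.
have lnm0 : 0 <= ln m by rewrite ln_ge0.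
have lnT0 : 0 <= ln T by rewrite ln_ge0.
have K1 : 0 <= ln (1 + K) by rewrite ln_ge0 //; lra.
have lm : ln m <= ln (1 + K) + ln T.
  rewrite -lnM ?posrE; try lra; rewrite ler_ln ?posrE //; [nra|apply: mulr_gt0; lra].
have lllm : ln (1 + ln m) <= ln m by have := lnle (1 + ln m); lra.
have A1 : 1 + H <= r * (2 * m * (1 + ln m) ^+ 2).
  have : H <= r * (m * (1 + ln m) ^+ 2) by rewrite mulrC -ler_pdivrMr.
  have : 1 <= r * (m * (1 + ln m) ^+ 2).
    rewrite -[leLHS]mulr1 ler_pM //; first lra.
    rewrite -[leLHS]mulr1 ler_pM // exprn_ege1 //; lra.
  lra.
have A2 : ln (1 + H) <= ln r + (1 + ln m + 2 * ln m).
  apply: (@le_trans _ _ (ln (r * (2 * m * (1 + ln m) ^+ 2)))).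
    rewrite ler_ln ?posrE //; first lra.
    rewrite !mulr_gt0 ?exprn_gt0 //; lra.
  rewrite !lnM ?posrE ?mulr_gt0 ?exprn_gt0 //; try lra.
  have := lnle 2; lra.
have B1 : 1 + P / r ^+ 2 <= (1 + H) / r * (2 * (1 + ln (1 + H)) ^+ 2) + 1.
  rewrite addrC lerD2r; have -> : P / r ^+ 2 = P / r / r by rewrite expr2 invfM mulrA.
  have -> : (1 + H) / r * (2 * (1 + ln (1 + H)) ^+ 2) = 2 * ((1 + H) * (1 + ln (1 + H)) ^+ 2 / r) by rewrite mulrAC; ring.
  have : P / r / r <= (1 + H) * (1 + ln (1 + H)) ^+ 2 / r by rewrite ler_pM2r ?invr_gt0.
  have : 0 <= (1 + H) * (1 + ln (1 + H)) ^+ 2 / r.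
    apply: divr_ge0; last exact: ltW.
    by apply: mulr_ge0; [lra|exact: sqr_ge0].
  lra.
have HL : 0 <= ln (1 + H) by rewrite ln_ge0 //; lra.
have A1' : (1 + H) / r <= 2 * m * (1 + ln m) ^+ 2 by rewrite ler_pdivrMr // mulrC.
have m2 : 1 <= 2 * m * (1 + ln m) ^+ 2.
  have : 1 * 1 <= m * (1 + ln m) ^+ 2 by rewrite ler_pM // exprn_ege1 //; lra.
  lra.
have s1 : 1 <= (1 + ln (1 + H)) ^+ 2 by rewrite exprn_ege1 //; lra.
have B2 : 1 + P / r ^+ 2 <= 2 * m * (1 + ln m) ^+ 2 * (3 * (1 + ln (1 + H)) ^+ 2).
  apply: le_trans B1 _.
  have : (1 + H) / r * (2 * (1 + ln (1 + H)) ^+ 2) <= 2 * m * (1 + ln m) ^+ 2 * (2 * (1 + ln (1 + H)) ^+ 2).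
    by rewrite ler_pM2r //; lra.
  have : 1 * 1 <= 2 * m * (1 + ln m) ^+ 2 * (1 + ln (1 + H)) ^+ 2 by rewrite ler_pM.
  move: (2 * m * (1 + ln m) ^+ 2) ((1 + ln (1 + H)) ^+ 2) ((1 + H) / r) => a b c.
  by rewrite !(mulrCA a) !(mulrCA c); move: (a * b) (c * b) => x y; lra.
have B3 : ln (1 + P / r ^+ 2) <= 1 + ln m + 2 * ln m + (2 + 2 * ln (1 + ln (1 + H))).
  apply: le_trans (_ : ln (2 * m * (1 + ln m) ^+ 2 * (3 * (1 + ln (1 + H)) ^+ 2)) <= _).
    have p0 : 0 < 1 + P / r ^+ 2 by rewrite ltr_pwDl // divr_ge0 // exprn_ge0 // ltW.
    by rewrite ler_ln ?posrE // (lt_le_trans p0 B2).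
  rewrite ln_prod_aux //; have := lnle 2; have := lnle 3; lra.
have B4 : ln (1 + ln (1 + H)) <= ln (1 + K) + ln T + ln 5.
  rewrite -!lnM ?posrE ?mulr_gt0 //; try lra.
  rewrite ler_ln ?posrE ?mulr_gt0 //; try lra.
  have k1 : ln (1 + K) <= K by have := lnle (1 + K); lra.
  have t1 : ln T <= T - 1 by apply: lnle; lra.
  have kt : K <= K * T by rewrite ler_peMr.
  have -> : (1 + K) * T * 5 = 5 * T + 5 * (K * T) by ring.
  lra.
have := lnle 5; nra.
Qed.

Lemma green_mean2_ge0 s : regular A B s -> 0 <= green_mean2 A B 0 s.
Proof.
move=> rs; have cl := cont_logder rs; have cS := cont_Phi_root rs.
have S0 t : 0 < S_ s t := Phi_root_gt0 _ _ s t.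
have cSi : continuous (fun t => (S_ s t ^+ 3)^-1).
  move=> t; have n3 : S_ s t ^+ 3 != 0 by rewrite expf_neq0 // gt_eqF.
  exact: (@cont_atV R _ t (fun t => S_ s t ^+ 3) n3 (cont_atM (cS t) (cont_atM (cS t) (cS t)))).
rewrite green_mean2_logder // -(circ_mean_cst (0 : R)); apply: circ_mean_le.
- exact: continuous_cst.
- exact: (contR_M (contR_M (@continuous_cst _ _ (4 * (expR s) ^+ 2)) cl) cSi).
- by move=> t; rewrite divr_ge0 ?exprn_ge0 ?(ltW (S0 t)) // !mulr_ge0 ?exprn_ge0 ?expR_ge0 ?cabs_ge0.
Qed.

(* The growth lemma for [- 1 / (1 + ln m)]. *)
Lemma growth_log (U : set R) (m : R -> R) : (forall x, U x -> 1 <= m x) ->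
  (forall x y, U x -> U y -> x <= y -> m x <= m y) ->
  exists E : set R, [/\ measurable E, (mu E < +oo)%E &
  forall t D (d : R), 0 < d -> 0 <= t -> (forall x, `|x - t| < d -> U x) -> ~ E t ->
    is_derive t 1 m D -> D <= m t * (1 + ln (m t)) ^+ 2].
Proof.
move=> m1 mm; pose f x := 1 + ln (m x).
have f1 x : U x -> 1 <= f x by move=> Ux; rewrite /f lerDl ln_ge0 // m1.
have [||E [mE muE hE]] := @growth R U (fun x => - 1 * (f x)^-1).
- move=> x y Ux Uy xy; have := f1 x Ux; have := f1 y Uy => fy fx.
  have : (f y)^-1 <= (f x)^-1.
    rewrite lef_pV2 ?posrE; try lra.
    by rewrite /f lerD2l ler_ln ?posrE ?mm //; [have := m1 x Ux|have := m1 y Uy]; lra.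
  lra.
- move=> x Ux; have fx := f1 x Ux.
  have : (f x)^-1 <= 1 by rewrite invf_le1 //; lra.
  have : 0 <= (f x)^-1 by rewrite invr_ge0; lra.
  by move=> ? ?; apply/andP; split; lra.
exists E; split=> // t D d d0 t0 hU nE dm.
have Ut : U t by apply: hU; rewrite subrr normr0.
have mt := m1 t Ut; have ft := f1 t Ut.
have mt0 : 0 < m t by lra.
have fn : f t != 0 by rewrite gt_eqF //; lra.
have df := rderD (rder_cst 1 t) (@rder_ln R m t D mt0 dm).
have := hE t _ d d0 t0 hU nE (rderZ (- 1) (@rderV R f t _ fn df)).
have -> : - 1 * (- (0 + D / m t) / (f t * f t)) = D / (m t * f t ^+ 2).
  by rewrite add0r; have mn : m t != 0 := lt0r_neq0 mt0; field; rewrite fn mn.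
by rewrite ler_pdivrMr ?mul1r // mulr_gt0 // exprn_gt0 //; lra.
Qed.

(** The exceptional set and [K] depend on [A] and [B] alone; [T] is chosen afterwards, as any number
    not below 1, [ln r] and [maxlog (ln r)]. *)
Lemma log_derivative_lemma : exists2 E : set R, measurable E /\ (mu E < +oo)%E & exists2 K : R, 0 <= K &
  forall r T, 1 < r -> ~ E r -> regular A B (ln r) -> 1 <= T -> ln r <= T -> maxlog (ln r) <= T ->
  circ_mean (fun t => ln (1 + cabs (logder (circ (ln r) t)) ^+ 2)) <= K * (1 + ln T).
Proof.
have [KA hKA] := logmean_ge hA nA; have [KB hKB] := logmean_ge hB nB.
(* For [r > 1] the logarithmic part of the mean is at least [2 * KA + 2 * KB]; adding [K0] makes [m]
   at least the mean of [S_], hence at least 1. *)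
pose K0 := Num.max 0 (- (2 * KA + 2 * KB)).
have K00 : 0 <= K0 by rewrite le_max lexx.
pose U := [set r : R | 1 < r /\ regular A B (ln r)].
pose m r := green_mean A B 0 (ln r) + K0.
pose H r := green_mean1 A B 0 (ln r).
have ln0 (r : R) : 1 < r -> 0 <= ln r by move=> r1; rewrite ln_ge0 // ltW.
have Sm r : U r -> 1 <= circ_mean (S_ (ln r)) <= m r.
  move=> [r1 rr]; apply/andP; split.
    rewrite -(circ_mean_cst (1 : R)); apply: circ_mean_le; [exact: continuous_cst|exact: cont_Phi_root|by move=> t; exact: S_ge1].
  rewrite /m green_mean0E //.
  have := hKA _ (ln0 r r1) (fun z e => proj1 (rr z e)).
  have := hKB _ (ln0 r r1) (fun z e => proj2 (rr z e)).
  have : - (2 * KA + 2 * KB) <= K0 by rewrite le_max lexx orbT.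
  lra.
have mono x y : U x -> U y -> x <= y -> m x <= m y /\ H x <= H y.
  move=> [x1 rx] [y1 ry] xy.
  have lxy : ln x <= ln y by rewrite ler_ln ?posrE //; lra.
  have [h1 h2 _] := green_mono hA hB rx ry lxy.
  by split; [rewrite /m lerD2r; exact: h1|exact: h2].
have H0 x : U x -> 0 <= H x by move=> [x1 rx]; have [] := green_mono hA hB rx rx (lexx _).
(* The growth lemma in the variable [r], first for [m], whose derivative is [H r / r], then for
   [1 + H], whose derivative is the second Green mean over [r]. *)
have [||E1 [mE1 fE1 hE1]] := @growth_log U m.
- by move=> x /Sm /andP[]; exact: le_trans.
- by move=> x y Ux Uy /(mono _ _ Ux Uy)[].
have [||E2 [mE2 fE2 hE2]] := @growth_log U (fun r => 1 + H r).
- by move=> x /H0 h; rewrite lerDl; exact: h.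
- by move=> x y Ux Uy /(mono _ _ Ux Uy)[_ h]; rewrite lerD2l; exact: h.
exists (E1 `|` E2); first exact: finite_measureU.
exists (40 + 20 * ln (1 + (5 + K0))); first by rewrite addr_ge0 // mulr_ge0 // ln_ge0 //; lra.
move=> r T r1 nE rr T1 rT MT.
have r0 : 0 < r by lra.
have [a [b [ab hab]]] := regular_open rr.
(* The radius of a neighbourhood of [r] that stays above 1 and inside the interval where the circles
   avoid the zeros. *)
pose d := Num.min (r - Num.max 1 (expR a)) (expR b - r).
have er : expR (ln r) = r by rewrite lnK.
have d0 : 0 < d.
  case/andP: ab => ra rb.
  by rewrite lt_min !subr_gt0 gt_max r1 -{1 2}er !ltr_expR ra rb.
have dU x : `|x - r| < d -> U x.
  rewrite lt_min !ltr_norml => /andP[/andP[x1 _] /andP[_ x2]].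
  have : Num.max 1 (expR a) < x by lra.
  rewrite gt_max => /andP[x3 x4]; split=> //.
  have x0 : 0 < x by lra.
  by apply: hab; rewrite -[a]expRK -[b]expRK !ltr_ln ?posrE ?expR_gt0 // x4 /=; lra.
have Ur : U r by [].
have [dMs dHs] := green_derive hA hB (lexx 0) ab (or_intror hab).
have dln1 : is_derive r 1 (@ln R) (1 / r) := @rder_ln R id r 1 r0 (is_derive_id _ _).
have dMr : is_derive r 1 m (H r / r).
  have := rderD (is_derive1_comp dMs dln1) (rder_cst K0 r); rewrite addr0 mul1r; exact.
have dHr : is_derive r 1 (fun r => 1 + H r) (green_mean2 A B 0 (ln r) / r).
  have := rderD (rder_cst 1 r) (is_derive1_comp dHs dln1); rewrite add0r mul1r; exact.
have e1 := hE1 r _ d d0 (ltW r0) dU (fun h => nE (or_introl h)) dMr.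
have e2 := hE2 r _ d d0 (ltW r0) dU (fun h => nE (or_intror h)) dHr.
have /andP[s1 sm] := Sm r Ur.
have m1 : 1 <= m r := le_trans s1 sm.
have mK : m r <= (5 + K0) * T.
  have kT : K0 <= K0 * T by rewrite ler_peMr.
  have aux (g M k : R) : g <= 1 + 4 * M -> M <= T -> k <= k * T -> g + k <= (5 + k) * T.
    by move=> *; rewrite mulrDl; lra.
  exact: (aux _ _ _ (green_mean_le rr) MT kT).
have K50 : 0 <= 5 + K0 by rewrite addr_ge0.
apply: le_trans (mean_ln_logder rr) _; rewrite er.
apply: le_trans (log_derivative_bound r1 m1 (H0 r Ur) (green_mean2_ge0 rr) T1 rT K50 mK e1 e2).
by rewrite lerD2l ler_pM2l // ler_ln ?posrE //; [exact: lt_le_trans ltr01 s1|exact: lt_le_trans ltr01 m1].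
Qed.
End LogDerivative.

(** * Wronskians and Cartan's theorem *)

Section Wronskian.
Variable R : realType.
Local Notation C := (Cplx R).
Local Notation dn k := (iter k (@cder R)).
Implicit Types (u v f g al : C -> C) (w : nat -> C).

(* The k-th derivative of [u / al], cleared of its denominator, when [w k] is [k.+1]. *)
Fixpoint twderiv al w (k : nat) u : C -> C :=
  if k is k'.+1 then fun z => al z * cder (twderiv al w k' u) z - w k' * cder al z * twderiv al w k' u z else u.

Lemma entire_twderiv al w k u : entire al -> entire u -> entire (twderiv al w k u).
Proof.
move=> ha hu; elim: k => [|k IH]; first exact hu.
exact (entireB (entireM ha (entire_cder IH)) (entireM (entireZ (w k) (entire_cder ha)) IH)).
Qed.

(** The reason for arbitrary weights: after the first step the remaining ones form a tower with
    shifted weights, to which the induction in [wronskian_neq0] applies. *)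
Lemma twderiv_shift al w k u : twderiv al w k.+1 u = twderiv al (fun j => w j.+1) k (twderiv al w 1 u).
Proof.
elim: k => [//|k IH].
have -> : twderiv al w k.+2 u = fun z => al z * cder (twderiv al w k.+1 u) z - w k.+1 * cder al z * twderiv al w k.+1 u z by [].
by rewrite IH.
Qed.

Lemma twderiv1E al w u z : w 0%N = 1 -> twderiv al w 1 u z = al z * cder u z - cder al z * u z.
Proof. by move=> w0; rewrite /= w0 mul1r. Qed.

Lemma twderiv_self al w k z : w 0%N = 1 -> entire al -> twderiv al w k.+1 al z = 0.
Proof.
move=> w0 ha; elim: k z => [|k IH] z; first by rewrite /= w0 mul1r mulrC subrr.
have e : twderiv al w k.+1 al = fun=> 0 by apply/funext => x; exact: IH.
by rewrite -[twderiv al w k.+2 al z]/(al z * cder (twderiv al w k.+1 al) z - w k.+1 * cder al z * twderiv al w k.+1 al z) e cder_cst !mulr0 subrr.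
Qed.

Lemma cder_sum (I : Type) (s : seq I) (F : I -> C -> C) : (forall i, entire (F i)) ->
  cder (fun z => \sum_(i <- s) F i z) = fun z => \sum_(i <- s) cder (F i) z.
Proof.
move=> hF; elim: s => [|i s IHs].
  have -> : (fun z => \sum_(i <- [::]) F i z) = fun=> 0 by apply/funext => y; rewrite big_nil.
  by rewrite cder_cst; apply/funext => z; rewrite big_nil.
have -> : (fun z => \sum_(i <- i :: s) F i z) = (fun z => F i z + \sum_(i <- s) F i z).
  by apply/funext => y; rewrite big_cons.
rewrite (cderD (hF i) (@entire_sum R _ s xpredT F hF)) IHs.
by apply/funext => z; rewrite big_cons.
Qed.

Lemma twderiv_sum al w k n (c : 'I_n -> C) (u : 'I_n -> C -> C) z : entire al -> (forall i, entire (u i)) ->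
  twderiv al w k (fun z => \sum_i c i * u i z) z = \sum_i c i * twderiv al w k (u i) z.
Proof.
move=> ha hu; elim: k z => [|k IH] z //=.
have -> : twderiv al w k (fun z => \sum_i c i * u i z) = fun z => \sum_i c i * twderiv al w k (u i) z by apply/funext.
have ht i : entire (twderiv al w k (u i)) := @entire_twderiv al w k (u i) ha (hu i).
have hct i : entire (fun z => c i * twderiv al w k (u i) z) by exact (entireZ (c i) (ht i)).
rewrite (cder_sum _ hct) !mulr_sumr -sumrB; apply: eq_bigr => i _; rewrite (cderZ (c i) (ht i)).
have aux (p q r t s : C) : p * (q * r) - t * (q * s) = q * (p * r - t * s) by ring.
exact: aux.
Qed.

(** The coefficient of the [j]-th derivative of [u] in [twderiv al w k u]; the recursion is
    Leibniz's rule. As a matrix in [k] and [j] it is lower triangular with diagonal [al ^ k]. *)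
Fixpoint twcoef al w (k j : nat) : C -> C :=
  if k is k'.+1 then fun z => al z * cder (twcoef al w k' j) z - w k' * cder al z * twcoef al w k' j z
     + al z * (if j is j'.+1 then twcoef al w k' j' z else 0)
  else fun=> (j == 0%N)%:R.

Lemma entire_twcoef al w k j : entire al -> entire (twcoef al w k j).
Proof.
move=> ha; elim: k j => [|k IH] j; first exact (@entire_cst R (j == 0%N)%:R).
have h := entireB (entireM ha (entire_cder (IH j))) (entireM (entireZ (w k) (entire_cder ha)) (IH j)).
case: j h => [|j] h; first exact (entireD h (entireM ha (@entire_cst R 0))).
exact (entireD h (entireM ha (IH j))).
Qed.

Lemma twcoef_gt al w k j : (k < j)%N -> twcoef al w k j = fun=> 0.
Proof.
elim: k j => [|k IH] [|j] //= kj; apply/funext => z.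
by rewrite (IH j.+1 (ltnW kj)) cder_cst !mulr0 subrr add0r (IH j) ?mulr0.
Qed.

Lemma twcoef_diag al w k z : twcoef al w k k z = al z ^+ k.
Proof.
elim: k z => [|k IH] z /=; first by rewrite expr0.
by rewrite (twcoef_gt al w (ltnSn k)) cder_cst !mulr0 subrr add0r IH exprS.
Qed.

Lemma twderiv_derivs al w k n u z : entire al -> entire u -> (k < n)%N ->
  twderiv al w k u z = \sum_(j < n) twcoef al w k j z * dn j u z.
Proof.
move=> ha hu; elim: k n z => [|k IH] [|n] z // kn.
  rewrite big_ord_recl /= mul1r big1 ?addr0 // => i _; by rewrite mul0r.
have -> : twderiv al w k.+1 u z = al z * cder (twderiv al w k u) z - w k * cder al z * twderiv al w k u z by [].
have E : twderiv al w k u = fun z => \sum_(j < n.+1) twcoef al w k j z * dn j u z by apply/funext => x; exact: (IH n.+1 x (ltnW kn)).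
have E2 : cder (twderiv al w k u) z = \sum_(j < n.+1) (cder (twcoef al w k j) z * dn j u z + twcoef al w k j z * dn j.+1 u z).
  have h1 (j : 'I_n.+1) := @entire_twcoef al w k j ha.
  have h2 (j : 'I_n.+1) := @entire_iter_cder R j u hu.
  have ht (j : 'I_n.+1) : entire (fun z => twcoef al w k j z * dn j u z) by exact (entireM (h1 j) (h2 j)).
  rewrite E (cder_sum _ ht); apply: eq_bigr => j _; by rewrite (cderM (h1 j) (h2 j)).
rewrite E2 {E2} E big_split.
have S : \sum_(j < n.+1) twcoef al w k j z * dn j.+1 u z =
    \sum_(j < n.+1) (if (j : nat) is j'.+1 then twcoef al w k j' z else 0) * dn j u z.
  rewrite big_ord_recr [RHS]big_ord_recl /= mul0r add0r (twcoef_gt al w (ltnSE kn)) mul0r addr0.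
  by apply: eq_bigr => i _.
rewrite S mulrDr !mulr_sumr addrAC -sumrB -big_split; apply: eq_bigr => j _.
have aux (a p q r t b : C) : a * (p * q) - r * (t * q) + a * (b * q) = (a * p - r * t + a * b) * q by ring.
exact: aux.
Qed.

Definition wronskian n (u : 'I_n -> C -> C) z : C := \det (\matrix_(i, k < n) dn k (u i) z).

(** Passing from plain to twisted derivatives is a triangular change of columns with diagonal
    entries [al z ^+ k], whatever the weights. *)
Lemma det_twderiv n al w (u : 'I_n -> C -> C) z : entire al -> (forall i, entire (u i)) ->
  \det (\matrix_(i, k < n) twderiv al w k (u i) z) = (\prod_(k < n) al z ^+ k) * wronskian u z.
Proof.
move=> ha hu.
pose B := \matrix_(k, j < n) twcoef al w k j z.
have -> : \matrix_(i, k < n) twderiv al w k (u i) z = (\matrix_(i, k < n) dn k (u i) z) *m B^T.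
  apply/matrixP => i k; rewrite !mxE (@twderiv_derivs al w k n (u i) z ha (hu i) (ltn_ord k)).
  by apply: eq_bigr => j _; rewrite !mxE mulrC.
rewrite det_mulmx det_tr mulrC; congr (_ * _).
rewrite det_trig; first by apply: eq_bigr => k _; rewrite mxE twcoef_diag.
by apply/is_trig_mxP => i j ij; rewrite mxE twcoef_gt.
Qed.

Lemma entire_det n (M : C -> 'M[C]_n) : (forall i j, entire (fun z => M z i j)) -> entire (fun z => \det (M z)).
Proof.
move=> hM; apply: entire_sum => s; apply: entireZ; apply: entire_prod => i; exact: hM.
Qed.

Lemma entire_wronskian n (u : 'I_n -> C -> C) : (forall i, entire (u i)) -> entire (wronskian u).
Proof.
move=> hu; apply: (@entire_det n (fun z => \matrix_(i, k < n) dn k (u i) z)) => i j.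
have -> : (fun z => (\matrix_(i, k < n) dn k (u i) z) i j) = dn j (u i) by apply/funext => z; rewrite mxE.
exact: entire_iter_cder.
Qed.

Definition independent n (u : 'I_n -> C -> C) := forall c : 'I_n -> C,
  (forall z, \sum_i c i * u i z = 0) -> forall i, c i = 0.

Lemma nonzeroPn (g : C -> C) : ~ nonzero g -> forall z, g z = 0.
Proof. by move=> ng z; apply/eqP/negPn/negP => gz; apply: ng; exists z. Qed.

Lemma nonzeroM f g : entire f -> entire g -> nonzero f -> nonzero g -> nonzero (fun z => f z * g z).
Proof.
move=> hf hg nf [z gz].
have [d d0 hd] := isolated_zeros z hf nf.
have gc := isolated_zeros z hg (ex_intro _ z gz); have [d' d'0 hd'] := gc.
pose e := Num.min d d' / 2; have e0 : 0 < e by rewrite divr_gt0 // lt_min d0.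
have m0 : 0 < Num.min d d' by rewrite lt_min d0.
have lte : e < Num.min d d' by rewrite /e; lra.
have ce : cabs (z + Complex e 0 - z) = e by rewrite addrC addKr cabs_real gtr0_norm.
move: lte; rewrite lt_min => /andP[e1 e2].
have zn : z + Complex e 0 != z.
  by rewrite -subr_eq0 -cabs_eq0 ce gt_eqF.
exists (z + Complex e 0); rewrite mulf_neq0 //; [apply: hd|apply: hd'] => //; rewrite ce //.
Qed.

Lemma cderX g n : entire g -> cder (fun x => g x ^+ n.+1) = fun x => n.+1%:R * g x ^+ n * cder g x.
Proof.
move=> hg; elim: n => [|n IH].
  by apply/funext => x; rewrite expr0 mulr1 mul1r.
have -> : (fun x => g x ^+ n.+2) = fun x => g x * g x ^+ n.+1 by apply/funext => x; rewrite exprS.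
rewrite (cderM hg (@entireX R g n.+1 hg)) IH; apply/funext => x; rewrite exprS -[n.+2]addn1 natrD.
have aux (k q r d : C) : d * (k * q) + k * (r * q * d) = (r + 1) * (k * q) * d by ring.
exact: aux.
Qed.

Lemma cder_linX (a : C) n : cder (fun x : C => (x - a) ^+ n.+1) = fun x => n.+1%:R * (x - a) ^+ n.
Proof.
rewrite (cderX n (@entire_lin R a)) (cderB (@entire_id R) (@entire_cst R a)) cder_id cder_cst.
by apply/funext => x; rewrite subr0 mulr1.
Qed.

(** The hypothesis says that [v / al] has derivative 0. To avoid dividing at zeros of [al], the
    constant is fixed at a point [a] with [al a != 0]. If [y = v - c al] were not identically 0, the
    left side of [al y' = al' y] would vanish at [a] to a smaller order than the right side. *)
Lemma proportional al v : entire al -> entire v -> nonzero al ->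
  (forall z, al z * cder v z = cder al z * v z) -> exists c, forall z, v z = c * al z.
Proof.
move=> ha hv [a aa] H; exists (v a / al a) => z; apply/eqP; rewrite -subr_eq0; apply/eqP.
pose c := v a / al a; pose y z := v z - c * al z.
have hy : entire y by exact (entireB hv (entireZ c ha)).
apply: (nonzeroPn (g := y)) => ny.
have Hy z0 : al z0 * cder y z0 = cder al z0 * y z0.
  rewrite /y (cderB hv (entireZ c ha)) (cderZ c ha) !mulrBr H.
  have aux (p q r t : C) : t - p * (q * r) = t - r * (q * p) by ring.
  exact: aux.
have ya : y a = 0 by rewrite /y /c divfK // subrr.
have := zero_order_gt0 hy ny ya; have [h [hh hn hE]] := zero_orderP a hy ny.
move: hE; case: (zero_order y a) => [//|p] hE _.
have yE : y = fun x => (x - a) ^+ p.+1 * h x by apply/funext.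
have e1 : entire (fun x => x - a) := @entire_lin R a.
have dy x : cder y x = (x - a) ^+ p * (p.+1%:R * h x + (x - a) * cder h x).
  rewrite yE (cderM (@entireX R (fun x => x - a) p.+1 e1) hh) cder_linX exprS.
  have aux (r s t k l : C) : r * s * k + t * s * l = s * (r * k + t * l) by ring.
  exact: aux.
have := @pow_sub_cancel R (fun x => al x * (p.+1%:R * h x + (x - a) * cder h x)) (fun x => cder al x * ((x - a) * h x)) a p.
move=> /(_ _ _ _ a) K.
have : al a * (p.+1%:R * h a + (a - a) * cder h a) = cder al a * ((a - a) * h a).
  apply: K.
  - exact (entireM ha (entireD (entireZ _ hh) (entireM e1 (entire_cder hh)))).
  - exact (entireM (entire_cder ha) (entireM e1 hh)).
  move=> x; have := Hy x; rewrite dy hE exprS => q.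
  have aux (t b c' d e k : C) : b * (t * c') = d * (e * t * k) -> t * (b * c') = t * (d * (e * k)).
    by move=> E; rewrite mulrCA E; ring.
  exact: aux q.
rewrite subrr !mul0r addr0 mulr0 => /eqP; rewrite !mulf_eq0 (negbTE aa) (negbTE hn) orbF /=.
by rewrite (negbTE (natrC_neq0 _ p)).
Qed.

(** Induction by dividing by [al = u ord0]. The functions [v i = al^2 (u / al)'] are independent,
    since a relation among them makes a combination of the remaining [u] proportional to [al]. The
    first row of the twisted Wronskian is [al, 0, ..., 0], which reduces it to that of the [v i]. *)
Lemma wronskian_neq0 n (u : 'I_n -> C -> C) : (forall i, entire (u i)) -> independent u -> nonzero (wronskian u).
Proof.
elim: n u => [|n IH] u hu iu; first by exists 0; rewrite /wronskian det_mx00 oner_neq0.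
pose al := u ord0; have ha : entire al := hu ord0.
have na : nonzero al.
  apply: contrapT => /nonzeroPn al0.
  have h := iu (fun i => (i == ord0)%:R) _ ord0.
  have /eqP : (1 : C) = 0.
    rewrite -[LHS]/((ord0 == ord0 :> 'I_n.+1)%:R); apply: h => z.
    by rewrite big_ord_recl /= mul1r -/al al0 add0r big1 // => i _; rewrite mul0r.
  by rewrite oner_eq0.
pose w k : C := k.+1%:R.
pose v (i : 'I_n) := twderiv al w 1 (u (lift ord0 i)).
have hv i : entire (v i) := @entire_twderiv al w 1 _ ha (hu _).
have iv : independent v.
  move=> c cv.
  pose y z := \sum_i c i * u (lift ord0 i) z.
  have hy : entire y by apply: entire_sum => i; exact (entireZ (c i) (hu _)).
  have y1 z : al z * cder y z = cder al z * y z.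
    have e : twderiv al w 1 y z = 0 := etrans (@twderiv_sum al w 1 n c (fun i => u (lift ord0 i)) z ha (fun i => hu _)) (cv z).
    by apply/eqP; rewrite -subr_eq0 -(@twderiv1E al w y z erefl) e.
  have [k hk] := proportional ha hy na y1.
  have h0 := iu (fun i => if unlift ord0 i is Some j then c j else - k) _.
  move=> i; have := h0 _ (lift ord0 i); rewrite liftK; apply => z.
  rewrite big_ord_recl unlift_none.
  under eq_bigr do rewrite liftK.
  by rewrite -/al -[\sum_(i < n) _]/(y z) hk mulNr addNr.
have E z : (\prod_(k < n.+1) al z ^+ k) * wronskian u z = al z * ((\prod_(k < n) al z ^+ k) * wronskian v z).
  rewrite -(@det_twderiv n.+1 al w u z ha hu) -(@det_twderiv n al (fun j => w j.+1) v z ha hv).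
  rewrite (expand_det_row _ ord0) big_ord_recl big1 ?addr0; last first.
    move=> i _; have e : twderiv al w (lift ord0 i) (u ord0) z = 0 := @twderiv_self al w i z erefl ha.
    by rewrite mxE e mul0r.
  rewrite mxE /= /cofactor /= addn0 expr0 mul1r; congr (_ * \det _).
  by apply/matrixP => i k; rewrite !mxE -twderiv_shift.
apply: contrapT => /nonzeroPn W0.
have nv := IH v hv iv.
have hp (m : nat) : entire (fun z => \prod_(k < m) al z ^+ k) by apply: entire_prod => k; exact (@entireX R al k ha).
have np (m : nat) : nonzero (fun z => \prod_(k < m) al z ^+ k).
  by case: na => z az; exists z; apply/prodf_neq0 => k _; exact: expf_neq0.
have [z] := nonzeroM ha (entireM (hp n) (entire_wronskian hv)) na (nonzeroM (hp n) (entire_wronskian hv) (np n) nv).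
by rewrite -E W0 mulr0 eqxx.
Qed.

Lemma cder_powfactor (a : C) b h : entire h -> exists2 h' : C -> C, entire h' &
  cder (fun x => (x - a) ^+ b * h x) = fun x => (x - a) ^+ b.-1 * h' x.
Proof.
move=> hh; case: b => [|b].
  exists (cder h); first exact: entire_cder.
  have -> : (fun x => (x - a) ^+ 0 * h x) = h by apply/funext => x; rewrite expr0 mul1r.
  by apply/funext => x; rewrite expr0 mul1r.
have e1 : entire (fun x => x - a) := @entire_lin R a.
exists (fun x => b.+1%:R * h x + (x - a) * cder h x).
  exact (entireD (entireZ _ hh) (entireM e1 (entire_cder hh))).
rewrite (cderM (@entireX R (fun x => x - a) b.+1 e1) hh) cder_linX; apply/funext => x; rewrite exprS.
have aux (r s t k l : C) : r * s * k + t * s * l = s * (r * k + t * l) by ring.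
exact: aux.
Qed.

Lemma iter_cder_powfactor (a : C) k n u : entire u -> nonzero u -> (k <= n)%N ->
  exists2 h : C -> C, entire h & forall x, dn k u x = (x - a) ^+ (zero_order u a - n) * h x.
Proof.
move=> hu nu; elim: k n => [|k IH] n kn.
  have [h [hh _ hE]] := zero_orderP a hu nu.
  exists (fun x => (x - a) ^+ (zero_order u a - (zero_order u a - n)) * h x); first exact: entire_powfactor.
  by move=> x /=; rewrite mulrA -exprD subnKC ?leq_subr.
case: n kn => // n kn; have [h hh hE] := IH n kn.
have -> : dn k.+1 u = cder (fun x => (x - a) ^+ (zero_order u a - n) * h x) by rewrite iterS; congr cder; apply/funext.
have [h' hh' ->] := cder_powfactor a (zero_order u a - n) hh.
by exists h' => // x; rewrite subnS.
Qed.

(** The row of [u i] contains derivatives up to order [n.-1] only, and each differentiation lowers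
    the order of the zero by at most 1; so the power of [x - a] can be taken out of the row. *)
Lemma wronskian_order n (u : 'I_n -> C -> C) a : (forall i, entire (u i)) -> (forall i, nonzero (u i)) -> nonzero (wronskian u) ->
  (\sum_i (zero_order (u i) a - n.-1) <= zero_order (wronskian u) a)%N.
Proof.
move=> hu nu nw.
have H (i k : 'I_n) : exists2 h : C -> C, entire h & forall x, dn k (u i) x = (x - a) ^+ (zero_order (u i) a - n.-1) * h x.
  by apply: iter_cder_powfactor; rewrite // -ltnS (ltn_predK (ltn_ord k)).
have [h hh] := choice (fun p : 'I_n * 'I_n => let: ex_intro2 h h1 h2 := H p.1 p.2 in ex_intro _ h (conj h1 h2)).
apply: (@zero_order_ge R (wronskian u) (fun x => \det (\matrix_(i, k < n) h (i, k) x)) a) => //.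
- exact: entire_wronskian.
- apply: (@entire_det n (fun x => \matrix_(i, k < n) h (i, k) x)) => i k.
  have -> : (fun x => (\matrix_(i, k < n) h (i, k) x) i k) = h (i, k) by apply/funext => x; rewrite mxE.
  by have [] := hh (i, k).
move=> x; pose D := diag_mx (\row_i (x - a) ^+ (zero_order (u i) a - n.-1)).
have -> : wronskian u x = \det (D *m \matrix_(i, k < n) h (i, k) x).
  congr (\det _); apply/matrixP => i k; rewrite mul_diag_mx !mxE.
  by have [_ ->] := hh (i, k).
rewrite det_mulmx det_diag; congr (_ * _).
by under eq_bigr do rewrite mxE; rewrite prodrXr.
Qed.

Lemma iter_cder_sum0 n (c : 'I_n -> C) (u : 'I_n -> C -> C) k z : (forall i, entire (u i)) ->
  (forall z, \sum_i c i * u i z = 0) -> \sum_i c i * dn k (u i) z = 0.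
Proof.
move=> hu cu; elim: k z => [|k IH] z; first exact: cu.
have h i := @entire_iter_cder R k (u i) (hu i).
have := cder_sum (index_enum 'I_n) (fun i => entireZ (c i) (h i)).
have -> : (fun z => \sum_i c i * dn k (u i) z) = fun=> 0 by apply/funext.
rewrite cder_cst => /(congr1 (@^~ z)) /= e; rewrite [RHS]e.
by apply: eq_bigr => i _; rewrite (cderZ (c i) (h i)).
Qed.

(** The vector [c] annihilates the matrix of the derivatives of order below [m] together with the
    extra column [r]; expanding the zero determinant along that column leaves the two Wronskians
    that omit [u i] and [u j]. *)
Lemma wronskian_circuit m (u : 'I_m.+1 -> C -> C) (c : 'I_m.+1 -> C) i j z : (forall i, entire (u i)) ->
  (forall z, \sum_i c i * u i z = 0) -> c i != 0 ->
  c j * ((-1) ^+ (i + m) * wronskian (fun k => u (lift i k)) z) = c i * ((-1) ^+ (j + m) * wronskian (fun k => u (lift j k)) z).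
Proof.
move=> hu cu ci; apply/eqP; rewrite -subr_eq0; apply/eqP.
(* Orthogonal to [c], with entries at [i] and [j] only. *)
pose r a : C := c j * (a == i)%:R - c i * (a == j)%:R.
pose M := \matrix_(a, b < m.+1) if (b < m)%N then dn b (u a) z else r a.
have S (F : 'I_m.+1 -> C) k : \sum_a F a * (a == k)%:R = F k.
  by rewrite (bigD1 k) //= eqxx mulr1 big1 ?addr0 // => a /negbTE ->; rewrite mulr0.
have : \det M = 0.
  apply/eqP/det0P; exists (\row_a c a).
    by apply/eqP => /matrixP /(_ 0 i); rewrite !mxE => /eqP; rewrite (negbTE ci).
  apply/matrixP => x b; rewrite !mxE; under eq_bigr => a _ do rewrite !mxE.
  case: (b < m)%N; first exact: iter_cder_sum0.
  under eq_bigr do rewrite /r mulrBr !mulrA.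
  by rewrite sumrB !S mulrC subrr.
rewrite (expand_det_col _ ord_max) => <-.
have -> : \sum_a M a ord_max * cofactor M a ord_max = \sum_a r a * ((-1) ^+ (a + m) * wronskian (fun k => u (lift a k)) z).
  apply: eq_bigr => a _; rewrite mxE ltnn; congr (_ * (_ * \det _)).
  by apply/matrixP => x y; rewrite !mxE lift_max ltn_ord.
under eq_bigr do rewrite /r mulrBl !(mulrAC _ (_ == _)%:R).
by rewrite sumrB !S.
Qed.
End Wronskian.

(** * Exceptional sets of finite measure *)

Section Exceptional.
Variable R : realType.
Local Notation C := (Cplx R).
Notation mu := (@lebesgue_measure R).
Implicit Types (P : R -> Prop).

Definition outside P := exists2 E : set R, measurable E /\ (mu E < +oo)%E & forall r, ~ E r -> P r.

Lemma outside_imp P P' : (forall r, P r -> P' r) -> outside P -> outside P'.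
Proof. by move=> h [E mE hE]; exists E => // r /hE; exact: h. Qed.

Lemma outside_true P : (forall r, P r) -> outside P.
Proof. by move=> h; exists set0 => //; split=> //; rewrite measure0 ltry. Qed.

Lemma outside_and P P' : outside P -> outside P' -> outside (fun r => P r /\ P' r).
Proof.
move=> [E mE hE] [E' mE' hE']; exists (E `|` E'); first exact: finite_measureU.
by move=> r nE; split; [apply: hE|apply: hE'] => h; apply: nE; [left|right].
Qed.

Lemma outside_all n (P : 'I_n -> R -> Prop) : (forall i, outside (P i)) -> outside (fun r => forall i, P i r).
Proof.
elim: n P => [|n IH] P h; first by apply: outside_true => r [].
have := outside_and (h ord0) (IH (fun i => P (lift ord0 i)) (fun i => h _)).
apply: outside_imp => r [h0 h1] i; case: (unliftP ord0 i) => [j|] ->; [exact: h1|exact: h0].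
Qed.

(** Each disc contains finitely many zeros, so the excluded radii are countable and of measure 0. *)
Lemma outside_singular (g : C -> C) : entire g -> nonzero g -> outside (fun r => forall z, cabs z = r -> g z != 0).
Proof.
move=> hg ng; pose S := [set r : R | exists2 z, cabs z = r & g z = 0].
have cS : countable S.
  apply: (@sub_countable _ _ _ (\bigcup_n [set cabs z | z in [set z : C | cabs z <= n%:R /\ g z = 0]])); last first.
    apply: bigcup_countable => // n _; apply: finite_set_countable; apply: finite_image.
    have [L hL] := finite_zeros (n%:R) hg ng.
    by apply: (@sub_finite_set _ _ [set` L]) => [z [z1 z2]|]; [exact: hL|exact: finite_seq].
  apply: subset_card_le => r [z zr gz]; exists (Num.bound r) => //; exists z => //; split=> //.
  by rewrite zr; apply: ltW; apply: le_lt_trans (archi_boundP _); rewrite -zr ?cabs_ge0 // lexx.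
exists S.
  split; last by rewrite (countable_lebesgue_measure0 cS) ltry.
  by apply: countable_measurable cS => t; exact: measurable_set1.
by move=> r nS z zr; apply/eqP => gz; apply: nS; exists z.
Qed.

Lemma fsbig_list (D : set C) (Z : seq C) (F : C -> R) : uniq Z -> (forall a, a \in Z -> D a) ->
  (forall a, D a -> F a != 0 -> a \in Z) -> \sum_(a \in D) F a = \sum_(a <- Z) F a.
Proof.
move=> uZ ZD DZ; rewrite (fsbigE Z F uZ) //.
  rewrite big_seq_cond [RHS]big_seq; apply: eq_bigl => a; case: (boolP (a \in Z)) => //= aZ.
  by rewrite mem_set //; exact: ZD.
by move=> a Da; apply: contraNeq; exact: DZ.
Qed.
End Exceptional.

(** * Estimates for iterated logarithmic derivatives *)

Section Tower.
Variable R : realType.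
Local Notation C := (Cplx R).
Local Notation wts := (fun k : nat => k.+1%:R : C).
Local Notation A_ := (fun u al k => twderiv al wts k u).

Lemma continuous_bigmax (T : topologicalType) (I : Type) (s : seq I) (F : I -> T -> R) : (forall i, continuous (F i)) ->
  continuous (fun t => \big[Num.max/0]_(i <- s) F i t).
Proof.
move=> hF; elim: s => [|i s IH].
  have -> : (fun t => \big[Num.max/0]_(i <- [::]) F i t) = (fun=> 0) by apply/funext => t; rewrite big_nil.
  exact: continuous_cst.
have -> : (fun t => \big[Num.max/0]_(i <- i :: s) F i t) = (fun t => Num.max (F i t) (\big[Num.max/0]_(i <- s) F i t)).
  by apply/funext => t; rewrite big_cons.
by move=> t; apply: continuous_max; [exact: hF|exact: IH].
Qed.

Lemma continuous_sumR (T : topologicalType) (I : Type) (s : seq I) (F : I -> T -> R) : (forall i, continuous (F i)) ->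
  continuous (fun t => \sum_(i <- s) F i t).
Proof.
move=> hF; elim: s => [|i s IH].
  have -> : (fun t => \sum_(i <- [::]) F i t) = (fun=> 0) by apply/funext => t; rewrite big_nil.
  exact: continuous_cst.
have -> : (fun t => \sum_(i <- i :: s) F i t) = (fun t => F i t + \sum_(i <- s) F i t).
  by apply/funext => t; rewrite big_cons.
exact: (contR_D (hF i) IH).
Qed.

Lemma circ_mean_sum (I : Type) (s : seq I) (F : I -> R -> R) : (forall i, continuous (F i)) ->
  circ_mean (fun t => \sum_(i <- s) F i t) = \sum_(i <- s) circ_mean (F i).
Proof.
move=> hF; elim: s => [|i s IH].
  rewrite big_nil -[RHS](circ_mean_cst (0 : R)); apply: eq_circ_mean => t; by rewrite big_nil.
rewrite big_cons -IH -(circ_meanD (hF i) (@continuous_sumR _ _ s F hF)).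
by apply: eq_circ_mean => t; rewrite big_cons.
Qed.

Lemma log_growth (k r : R) (K T : R) : 1 <= k -> 1 <= T -> 0 <= K -> K * (1 + ln (k * T)) <= K * (1 + ln k) * (1 + ln T).
Proof.
move=> k1 T1 K0; rewrite -mulrA ler_wpM2l // lnM ?posrE; try lra.
have := ln_ge0 k1; have := ln_ge0 T1; nra.
Qed.

Lemma ln_le_id (T : R) : 1 <= T -> ln T <= T.
Proof. by move=> T1; have := expR_ge1Dx (ln T); rewrite lnK ?posrE; lra. Qed.

Lemma tower_step (u al : C -> C) k z : entire u -> entire al -> al z != 0 -> A_ u al k z != 0 ->
  A_ u al k.+1 z = al z * A_ u al k z * logder (A_ u al k) (fun z => al z ^+ k.+1) z.
Proof.
move=> hu ha az Az; rewrite /logder (cderX k ha).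
have -> : A_ u al k.+1 z = al z * cder (A_ u al k) z - k.+1%:R * cder al z * A_ u al k z by [].
rewrite exprS.
have aux (a d b p q c : C) : a != 0 -> p != 0 -> q != 0 ->
    a * d - c * b * p = a * p * (d / p - c * q * b / (a * q)).
  by move=> a0 p0 q0; field; rewrite a0 p0 q0.
by apply: aux => //; exact: expf_neq0.
Qed.

(** By [tower_step] each step contributes a factor [al] and the logarithmic derivative of
    [A_ u al k] over [al ^+ k.+1]. The function [phi] collects bounds [1 + l ^+ 2] of these factors
    [l], and [log_derivative_lemma] controls the mean of its logarithm. *)
Lemma tower (u al : C -> C) k : entire u -> entire al -> nonzero u -> nonzero al ->
  exists2 K : R, 0 <= K & outside (fun r => 1 < r -> forall T, 1 <= T -> ln r <= T -> maxlog u al (ln r) <= T ->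
   exists phi : R -> R, [/\ continuous phi, forall t, 1 <= phi t,
     forall t, cabs (A_ u al k (circ (ln r) t)) <= cabs (al (circ (ln r) t)) ^+ k * cabs (u (circ (ln r) t)) * phi t
     & circ_mean (fun t => ln (phi t)) <= K * (1 + ln T)]).
Proof.
move=> hu ha nu na; elim: k => [|k [K K0 IH]].
  exists 0 => //; apply: outside_true => r _ T _ _ _; exists (fun=> 1); split.
  - exact: continuous_cst.
  - by [].
  - by move=> t; rewrite expr0 mul1r mulr1.
  - by rewrite mul0r ln1 circ_mean_cst.
have hA : entire (A_ u al k) := @entire_twderiv R al wts k u ha hu.
(* If the iterated derivative vanishes identically, so does the next one, and [phi = 1] will do. *)
case: (EM (nonzero (A_ u al k))) => [nA|/nonzeroPn A0]; last first.
  exists 0 => //; apply: outside_true => r _ T _ _ _; exists (fun=> 1); split.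
  - exact: continuous_cst.
  - by [].
  - move=> t; have -> : A_ u al k.+1 (circ (ln r) t) = 0.
      have -> : A_ u al k.+1 = fun z => al z * cder (A_ u al k) z - k.+1%:R * cder al z * A_ u al k z by [].
      have -> : A_ u al k = fun=> 0 by apply/funext.
      by rewrite cder_cst !mulr0 subrr.
    by rewrite cabs0 mulr1 mulr_ge0 ?exprn_ge0 ?cabs_ge0.
  - by rewrite mul0r ln1 circ_mean_cst.
pose B z := al z ^+ k.+1.
have hB : entire B := @entireX R al k.+1 ha.
have nB : nonzero B := nonzeroX k.+1 na.
have [E mE [K' K'0 hK']] := log_derivative_lemma hA hB nA nB.
(* By induction [maxlog] of the new pair is at most [(k + 1) T + K (1 + ln T)], and
   [1 + ln T <= 2 T]. *)
pose q : R := k.+1%:R + 2 * K.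
have q1 : 1 <= q by have : 1 <= k.+1%:R :> R by [rewrite ler1n]; rewrite /q; lra.
exists (K + K' * (1 + ln q)); first by rewrite addr_ge0 // mulr_ge0 // addr_ge0 // ln_ge0.
have oE : outside (fun r => ~ E r) by exists E.
have := outside_and (outside_and IH oE) (outside_and (outside_singular hu nu) (outside_and (outside_singular ha na) (outside_singular hA nA))).
apply: outside_imp => r [[hIH nE] [su [sa sA]]] r1 T T1 rT MT.
have r0 : 0 < r by lra.
have er : expR (ln r) = r by rewrite lnK.
have [phi [cphi phi1 phib phim]] := hIH r1 T T1 rT MT.
have rg1 : regular u al (ln r) by move=> z; rewrite er => zr; split; [exact: su|exact: sa].
have rg : regular (A_ u al k) B (ln r).
  by move=> z; rewrite er => zr; split; [exact: sA|apply: expf_neq0; exact: sa].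
have phi0 t : 0 < phi t := lt_le_trans ltr01 (phi1 t).
have cln : continuous (fun t => ln (phi t)) by move=> t; exact: (@cont_at_ln R _ t phi (phi0 t) (cphi t)).
have c1 := cont_maxlog hu ha rg1; have c2 := cont_maxlog hA hB rg.
have MT' : maxlog (A_ u al k) B (ln r) <= q * T.
  have kc : continuous (fun t => k.+1%:R * ln (Num.max (cabs (u (circ (ln r) t))) (cabs (al (circ (ln r) t))))).
    exact: (contR_M (@continuous_cst _ _ _) c1).
  apply: le_trans (_ : _ <= circ_mean (fun t => k.+1%:R * ln (Num.max (cabs (u (circ (ln r) t))) (cabs (al (circ (ln r) t)))) + ln (phi t))) _.
    apply: circ_mean_le => //; first exact: (contR_D kc cln).
    move=> t; have := phib t; have := phi1 t; have := phi0 t.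
    have [Az Bz] := regular_nz t rg; have [uz az] := regular_nz t rg1.
    move: Az uz az; rewrite -!cabs_gt0 /B cabsX.
    move: (cabs (A_ u al k (circ (ln r) t))) (cabs (u (circ (ln r) t))) (cabs (al (circ (ln r) t))) (phi t) => A x y p A0 x0 y0 p0 p1 Ab.
    have m0 : 0 < Num.max x y by rewrite lt_max x0.
    rewrite mulr_natl -lnXn // -lnM ?posrE ?exprn_gt0 //.
    rewrite ler_ln ?posrE ?mulr_gt0 ?exprn_gt0 // ?lt_max ?A0 // ge_max; apply/andP; split.
      apply: le_trans Ab _; rewrite ler_pM2r // exprSr ler_pM ?exprn_ge0 ?(ltW x0) ?(ltW y0) //.
        by rewrite lerXn2r ?nnegrE ?(ltW y0) ?(ltW m0) // le_max lexx orbT.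
      by rewrite le_max lexx.
    rewrite -[leLHS]mulr1 ler_pM ?exprn_ge0 ?(ltW y0) //.
    by rewrite lerXn2r ?nnegrE ?(ltW y0) ?(ltW m0) // le_max lexx orbT.
  rewrite (circ_meanD kc cln) (circ_meanZ _ c1) /q mulrDl lerD //; first by rewrite ler_pM2l.
  apply: le_trans phim _; have l := ln_le_id T1; rewrite -mulrA mulrCA ler_wpM2l //; lra.
have T'1 : 1 <= q * T by rewrite -[leLHS]mulr1 ler_pM.
have rT' : ln r <= q * T by apply: le_trans rT _; rewrite ler_peMl //; lra.
have hl := hK' r (q * T) r1 nE rg T'1 rT' MT'.
have cl := cont_logder hA hB rg.
pose L t := 1 + cabs (logder (A_ u al k) B (circ (ln r) t)) ^+ 2.
have L1 t : 1 <= L t by rewrite /L lerDl sqr_ge0.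
have L0 t : 0 < L t := lt_le_trans ltr01 (L1 t).
have cL : continuous L by exact: (contR_D (@continuous_cst _ _ 1) cl).
have clL : continuous (fun t => ln (L t)) by move=> t; exact: (@cont_at_ln R _ t L (L0 t) (cL t)).
exists (fun t => phi t * L t); split.
- exact: (contR_M cphi cL).
- by move=> t; rewrite -[leLHS]mulr1 ler_pM.
- move=> t; have [Az _] := regular_nz t rg; have [uz az] := regular_nz t rg1.
  rewrite (tower_step hu ha az Az) !cabsM.
  have := phib t; rewrite /L.
  have := cabs_ge0 (logder (A_ u al k) B (circ (ln r) t)).
  move: az Az; rewrite -!cabs_gt0.
  move: (cabs (logder _ _ _)) (cabs (twderiv _ _ _ _ _)) (cabs (al _)) (cabs (u _)) (phi t) => l A y x p y0 A0 l0 Ab.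
  rewrite exprS.
  have -> : y * y ^+ k * x * (p * (1 + l ^+ 2)) = y * (y ^+ k * x * p) * (1 + l ^+ 2) by ring.
  apply: ler_pM => //; rewrite ?mulr_ge0 ?(ltW y0) ?(ltW A0) //; first by rewrite ler_pM2l.
  by have := sqr_ge0 (l - 1); have := sqr_ge0 l; rewrite !expr2; nra.
- have -> : circ_mean (fun t => ln (phi t * L t)) = circ_mean (fun t => ln (phi t)) + circ_mean (fun t => ln (L t)).
    by rewrite -(circ_meanD cln clL); apply: eq_circ_mean => t; rewrite lnM ?posrE.
  rewrite mulrDl lerD //; apply: le_trans hl _; exact: log_growth.
Qed.
End Tower.

(** * Cartan's theorem for minimally dependent families *)

Section Cartan.
Variable R : realType.
Local Notation C := (Cplx R).
Local Notation wts := (fun k : nat => k.+1%:R : C).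
Local Notation A_ := (fun u al k => twderiv al wts k u).

(** The truncated counting function with the integral carried out: a zero [a] other than 0
    contributes multiples of [ln (r / |a|)]. *)
Definition counting M (g : C -> C) (r : R) : R := (minn (zero_order g 0) M)%:R * ln r +
  \sum_(a \in [set a : C | a != 0 /\ cabs a < r]) (minn (zero_order g a) M)%:R * (ln r - ln (cabs a)).

Definition logmax n (u : 'I_n.+1 -> C -> C) (s : R) :=
  circ_mean (fun t => ln (\big[Num.max/0]_i cabs (u i (circ s t)))).

Lemma cabs_sign n : cabs ((-1) ^+ n : C) = 1.
Proof. by rewrite cabsX cabsN cabs1 expr1n. Qed.

Lemma prodr_ge1 (I : Type) (s : seq I) (P : pred I) (F : I -> R) : (forall i, 1 <= F i) -> 1 <= \prod_(i <- s | P i) F i.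
Proof.
move=> F1; elim: s => [|i s IH]; rewrite ?big_nil // big_cons; case: (P i) => //.
by rewrite -[leLHS]mulr1 ler_pM.
Qed.

Lemma cabs_det n (M : 'M[C]_n) (a b : 'I_n -> R) : (forall i, 0 <= a i) -> (forall i, 0 <= b i) ->
  (forall i k, cabs (M i k) <= b k * a i) -> cabs (\det M) <= n`!%:R * ((\prod_k b k) * \prod_i a i).
Proof.
move=> a0 b0 Mab; rewrite /determinant; apply: le_trans (cabs_sum _ _ _) _.
apply: le_trans (_ : _ <= \sum_(s : 'S_n) ((\prod_k b k) * \prod_i a i)) _; last first.
  by rewrite sumr_const card_Sn mulr_natl.
apply: ler_sum => s _; rewrite cabsM cabs_sign mul1r cabs_prod.
have -> : \prod_k b k = \prod_i b (s i) by rewrite (reindex_inj (@perm_inj _ s)).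
rewrite -big_split /=; apply: ler_prod => i _.
by rewrite cabs_ge0 Mab.
Qed.

Lemma cartan_aux (L cw w0 Sw Cs u0 Su P lk n0 Sn G N : R) :
  L + (cw + w0 + Sw) <= Cs + (u0 + Su) + (P + lk) -> u0 <= w0 + n0 -> Su <= Sw + Sn -> P <= G ->
  Cs - cw + lk <= N -> L <= n0 + Sn + (N + G).
Proof. by move=> *; lra. Qed.

Variables (m : nat) (u : 'I_m.+2 -> C -> C) (c : 'I_m.+2 -> C).
Hypotheses (hu : forall i, entire (u i)) (iu : @independent R m.+1 (fun j => u (lift ord0 j)))
  (cu : forall z, \sum_i c i * u i z = 0) (c0 : forall i, c i != 0) (nz : forall z, exists i, u i z != 0).

Lemma circuit_nonzero i : nonzero (u i).
Proof.
apply: contrapT => /nonzeroPn ui.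
case: (unliftP ord0 i) ui => [j|] -> ui.
  have h := @iu (fun k => (k == j)%:R) _ j; rewrite eqxx in h.
  have /eqP : (1 : C) = 0; last by rewrite oner_eq0.
  by apply: h => z; rewrite big1 // => k _; case: eqP => [->|_]; rewrite ?ui ?mulr0 ?mul0r.
have h := @iu (fun k => c (lift ord0 k)) _ ord0.
have /eqP : c (lift ord0 ord0) = 0; last by rewrite (negbTE (c0 _)).
by apply: h => z; have := cu z; rewrite big_ord_recl ui mulr0 add0r.
Qed.

Local Notation W i := (wronskian (fun k => u (lift i k))).

Lemma circuit_wronskian i z : W i z = (c i / c ord0 * ((-1) ^+ (i + m.+1) * (-1) ^+ m.+1)) * W ord0 z.
Proof.
have h := wronskian_circuit ord0 z hu cu (c0 i).
have si n : (-1) ^+ n * (-1) ^+ n = 1 :> C by rewrite -expr2 sqrr_sign.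
have aux (s s' x y a b : C) : s * s = 1 -> b != 0 -> b * (s * x) = a * (s' * y) -> x = (a / b * (s * s')) * y.
  move=> ss b0 e; have -> : a / b * (s * s') * y = s * (a * (s' * y)) / b by field.
  by rewrite -e; have -> : s * (b * (s * x)) / b = (s * s) * x by [field]; rewrite ss mul1r.
exact: aux (si _) (c0 _) h.
Qed.

Lemma circuit_wronskian_nonzero i : nonzero (W i).
Proof.
have [z wz] := wronskian_neq0 (fun j => @hu (lift ord0 j)) (@iu); exists z.
by rewrite circuit_wronskian !mulf_neq0 ?invr_neq0 // ?c0 // signr_eq0.
Qed.

Lemma circuit_order i a : zero_order (W i) a = zero_order (W ord0) a.
Proof.
set k : C := c i / c ord0 * ((-1) ^+ (i + m.+1) * (-1) ^+ m.+1).
have k0 : k != 0 by rewrite /k !mulf_neq0 ?invr_neq0 // ?c0 // signr_eq0.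
have -> : W i = fun z => k * W ord0 z by apply/funext => z; exact: circuit_wronskian.
rewrite (zero_orderM a (@entire_cst R k) (entire_wronskian (fun j => @hu _)) (nonzero_cst k0) (circuit_wronskian_nonzero _)).
by rewrite (@zero_order0 R (fun=> k) a (@entire_cst R k) k0).
Qed.

(** Some [u i] does not vanish at [a]. All the Wronskians have the same order there, so the one
    omitting this [u i] may be used: its order is at least the sum of the truncated differences
    [ord - m] of the others, and [ord = min (ord, m) + (ord - m)]. *)
Lemma circuit_trunc a : (\sum_i zero_order (u i) a <= zero_order (W ord0) a + \sum_i minn (zero_order (u i) a) m)%N.
Proof.
have [i ui] := nz a.
have h := wronskian_order a (fun j => @hu (lift i j)) (fun j => circuit_nonzero _) (circuit_wronskian_nonzero i).
rewrite -(circuit_order i); apply: leq_trans (leq_add h (leqnn _)).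
have o0 : zero_order (u i) a = 0%N by exact: zero_order0.
rewrite (bigD1_ord i) //= [X in (_ <= _ + X)%N](bigD1_ord i) //= o0 add0n min0n add0n -big_split /=.
by apply: leq_sum => j _; rewrite minnE subnKC ?leq_subr.
Qed.

(** The index [i] of the largest modulus is omitted: the Wronskian of the others is bounded by their
    product times the [phi], and the factor [|u i|] completes the product. The powers of [|u ord0|]
    from the twisted derivatives cancel those in [det_twderiv]. *)
Lemma circuit_pointwise (phi : 'I_m.+2 -> 'I_m.+1 -> R) z : u ord0 z != 0 ->
  (forall i k, 1 <= phi i k) ->
  (forall i (k : 'I_m.+1), cabs (A_ (u i) (u ord0) k z) <= cabs (u ord0 z) ^+ k * cabs (u i z) * phi i k) ->
  \big[Num.max/0]_i cabs (u i z) * cabs (W ord0 z) <=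
   (\sum_i cabs (c ord0 / c i)) * (m.+1)`!%:R * ((\prod_i cabs (u i z)) * \prod_i \prod_k phi i k).
Proof.
move=> uz phi1 hphi.
rewrite (bigmax_eq_arg 0 ord0) //; last by move=> i _; exact: cabs_ge0.
case: arg_maxP => // i _ _.
have phi0 j k : 0 <= phi j k by apply: le_trans (phi1 j k).
have P1 j : 1 <= \prod_k phi j k by apply: prodr_ge1 => k.
have P0 j : 0 <= \prod_k phi j k by apply: le_trans (P1 j).
have hl (j : 'I_m.+2) (k : 'I_m.+1) : phi j k <= \prod_k phi j k.
  by rewrite (bigD1 k) //= ler_peMr // prodr_ge1.
pose a (l : 'I_m.+1) := cabs (u (lift i l) z) * \prod_k phi (lift i l) k.
have D := @cabs_det _ (\matrix_(l, k < m.+1) A_ (u (lift i l)) (u ord0) k z) a (fun k => cabs (u ord0 z) ^+ k).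
have {}D := D (fun l => mulr_ge0 (cabs_ge0 _) (P0 _)) (fun k => exprn_ge0 k (cabs_ge0 _)) _.
have {}D : cabs (\det (\matrix_(l, k < m.+1) A_ (u (lift i l)) (u ord0) k z)) <=
   (m.+1)`!%:R * ((\prod_(k < m.+1) cabs (u ord0 z) ^+ k) * \prod_l a l).
  apply: D => l k; rewrite mxE; apply: le_trans (hphi _ _) _.
  rewrite /a mulrA ler_wpM2l // ?mulr_ge0 ?exprn_ge0 ?cabs_ge0 //; exact: hl.
rewrite (@det_twderiv R m.+1 (u ord0) wts (fun l => u (lift i l)) z (@hu _) (fun l => @hu _)) cabsM cabs_prod in D.
have pe : \prod_(k < m.+1) cabs (u ord0 z ^+ k) = \prod_(k < m.+1) cabs (u ord0 z) ^+ k by apply: eq_bigr => k _; rewrite cabsX.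
rewrite pe mulrCA in D.
have p0 : 0 < \prod_(k < m.+1) cabs (u ord0 z) ^+ k by apply: prodr_gt0 => k _; rewrite exprn_gt0 // cabs_gt0.
rewrite (ler_pM2l p0) in D.
have wi : cabs (W ord0 z) = cabs (c ord0 / c i) * cabs (W i z).
  rewrite (circuit_wronskian i) !cabsM !cabs_sign !mulr1 !cabsV.
  have ci0 : cabs (c i) != 0 by rewrite gt_eqF // cabs_gt0.
  have cz : cabs (c ord0) != 0 by rewrite gt_eqF // cabs_gt0.
  by move: (cabs (c i)) (cabs (c ord0)) (cabs (W ord0 z)) ci0 cz => x y w x0 y0; field; rewrite x0 y0.
rewrite wi mulrCA -mulrA.
have S1 : cabs (c ord0 / c i) <= \sum_j cabs (c ord0 / c j).
  by rewrite (bigD1 i) //= lerDl sumr_ge0 // => j _; exact: cabs_ge0.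
apply: ler_pM => //; rewrite ?mulr_ge0 ?cabs_ge0 //.
apply: le_trans (ler_wpM2l (cabs_ge0 _) D) _.
rewrite mulrCA ler_wpM2l // (bigD1_ord i) //= [\prod_i0 \prod_k _](bigD1_ord i) //= /a big_split /=.
have a0 : 0 <= \prod_l cabs (u (lift i l) z) by apply: prodr_ge0 => l _; exact: cabs_ge0.
have b0 : 0 <= \prod_l \prod_k phi (lift i l) k by apply: prodr_ge0 => l _.
have aux (x y w p : R) : 0 <= x -> 0 <= y -> 0 <= w -> 1 <= p -> x * (y * w) <= x * y * (p * w).
  move=> x0 y0 w0 p1; rewrite mulrA ler_wpM2l ?mulr_ge0 // ler_peMl //.
by apply: aux => //; exact: cabs_ge0.
Qed.

Lemma cartan : exists2 K : R, 0 <= K & outside (fun r => 1 < r -> forall T, 1 <= T -> ln r <= T -> logmax u (ln r) <= T ->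
  logmax u (ln r) <= \sum_i counting m (u i) r + K * (1 + ln T)).
Proof.
have nu := circuit_nonzero; have nW := circuit_wronskian_nonzero ord0.
have hW : entire (W ord0) := entire_wronskian (fun j => @hu (lift ord0 j)).
have tow (p : 'I_m.+2 * 'I_m.+1) := tower p.2 (@hu p.1) (@hu ord0) (nu p.1) (nu ord0).
have [Kt hKt] := choice (fun p => let: ex_intro2 k k0 hk := tow p in ex_intro _ k (conj k0 hk)).
have [Cu hCu] := choice (fun i => jensen_formula (@hu i) (nu i)).
have [CW hCW] := jensen_formula hW nW.
pose kap : R := (\sum_i cabs (c ord0 / c i)) * (m.+1)`!%:R.
have kap0 : 0 < kap.
  rewrite mulr_gt0 ?ltr0n ?fact_gt0 // (bigD1 ord0) //= ltr_pwDl ?cabs_gt0 ?mulf_neq0 ?invr_neq0 //.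
  by rewrite sumr_ge0 // => j _; exact: cabs_ge0.
(* What is left of the constants in Jensen's formulas for the [u i] and the Wronskian and in the
   pointwise estimate. *)
pose K1 := \sum_i Cu i - CW + ln kap.
have KK0 : 0 <= \sum_i \sum_k Kt (i, k) by apply: sumr_ge0 => i _; apply: sumr_ge0 => k _; case: (hKt (i, k)).
exists (`|K1| + \sum_i \sum_k Kt (i, k)); first by rewrite addr_ge0.
have o1 := outside_all (fun i => outside_all (fun k => proj2 (hKt (i, k)))).
have o2 := outside_all (fun i => outside_singular (@hu i) (nu i)).
have := outside_and (outside_and o1 o2) (outside_singular hW nW).
apply: outside_imp => r [[ho1 ho2] ho3] r1 T T1 rT MT.
have r0 : 0 < r by lra.
have er : expR (ln r) = r by rewrite lnK.
have lr0 : 0 <= ln r by rewrite ln_ge0 // ltW.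
have uc i t : u i (circ (ln r) t) != 0 by apply: ho2; rewrite cabs_circ.
have Wc t : W ord0 (circ (ln r) t) != 0 by apply: ho3; rewrite cabs_circ.
pose Mx t := \big[Num.max/0]_i cabs (u i (circ (ln r) t)).
have cM : continuous Mx.
  exact: (@continuous_bigmax R _ _ (index_enum 'I_m.+2) (fun i t => cabs (u i (circ (ln r) t)))
    (fun i => @continuous_cabs_comp R _ _ (@continuous_circ R (u i) (ln r) (@hu i)))).
have leM i t : cabs (u i (circ (ln r) t)) <= Mx t by exact: le_bigmax.
have M0 t : 0 < Mx t by apply: lt_le_trans (leM ord0 t); rewrite cabs_gt0.
have clM : continuous (fun t => ln (Mx t)) by move=> t; exact: (@cont_at_ln R _ t Mx (M0 t) (cM t)).
have hm i : maxlog (u i) (u ord0) (ln r) <= T.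
  have rg : regular (u i) (u ord0) (ln r) by move=> z; rewrite er => zr; split; exact: ho2.
  apply: le_trans MT; apply: circ_mean_le.
  - exact: (@cont_maxlog R (u i) (u ord0) (@hu i) (@hu ord0) (ln r) rg).
  - exact: clM.
  move=> t; rewrite ler_ln ?posrE; [by rewrite ge_max !leM|by rewrite lt_max cabs_gt0 uc|exact: M0].
have ph (p : 'I_m.+2 * 'I_m.+1) := ho1 p.1 p.2 r1 T T1 rT (hm p.1).
have [phi hphi] := choice ph.
have phi1 p t : 1 <= phi p t by case: (hphi p).
have phi0 p t : 0 < phi p t := lt_le_trans ltr01 (phi1 p t).
have cphi p : continuous (fun t => ln (phi p t)).
  by move=> t; have [cp _ _ _] := hphi p; exact: (@cont_at_ln R _ t (phi p) (phi0 p t) (cp t)).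
have clu i : continuous (fun t => ln (cabs (u i (circ (ln r) t)))) := continuous_logcirc (@hu i) (uc i).
have clW : continuous (fun t => ln (cabs (W ord0 (circ (ln r) t)))) := continuous_logcirc hW Wc.
have c1 : continuous (fun t => \sum_i ln (cabs (u i (circ (ln r) t)))).
  exact: (@continuous_sumR R _ _ (index_enum 'I_m.+2) (fun i t => ln (cabs (u i (circ (ln r) t)))) clu).
have c2' i : continuous (fun t => \sum_k ln (phi (i, k) t)).
  exact: (@continuous_sumR R _ _ (index_enum 'I_m.+1) (fun k t => ln (phi (i, k) t)) (fun k => cphi (i, k))).
have c2 : continuous (fun t => \sum_i \sum_k ln (phi (i, k) t)).
  exact: (@continuous_sumR R _ _ (index_enum 'I_m.+2) (fun i t => \sum_k ln (phi (i, k) t)) c2').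
(* The mean over the circle of the logarithm of [circuit_pointwise]. *)
have step : logmax u (ln r) + logmean (W ord0) (ln r) <=
    \sum_i logmean (u i) (ln r) + (\sum_i \sum_k circ_mean (fun t => ln (phi (i, k) t)) + ln kap).
  have -> : logmax u (ln r) + logmean (W ord0) (ln r) = circ_mean (fun t => ln (Mx t) + ln (cabs (W ord0 (circ (ln r) t)))).
    by rewrite (circ_meanD clM clW).
  have -> : \sum_i logmean (u i) (ln r) + (\sum_i \sum_k circ_mean (fun t => ln (phi (i, k) t)) + ln kap) =
     circ_mean (fun t => \sum_i ln (cabs (u i (circ (ln r) t))) + (\sum_i \sum_k ln (phi (i, k) t) + ln kap)).
    rewrite (circ_meanD c1 (contR_D c2 (@continuous_cst _ _ _))) (circ_meanD c2 (@continuous_cst _ _ _)) circ_mean_cst.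
    rewrite (@circ_mean_sum R _ _ (fun i t => ln (cabs (u i (circ (ln r) t)))) clu); congr (_ + (_ + _)).
    rewrite (@circ_mean_sum R _ _ (fun i t => \sum_k ln (phi (i, k) t)) c2'); apply: eq_bigr => i _.
    by rewrite (@circ_mean_sum R _ _ (fun k t => ln (phi (i, k) t)) (fun k => cphi (i, k))).
  apply: circ_mean_le.
  - exact: (contR_D clM clW).
  - exact: (contR_D c1 (contR_D c2 (@continuous_cst _ _ _))).
  move=> t; have h := @circuit_pointwise (fun i k => phi (i, k) t) (circ (ln r) t) (uc ord0 t) (fun i k => phi1 (i, k) t).
  have {}h := h (fun i k => let: And4 _ _ b _ := hphi (i, k) in b t).
  have pu : 0 < \prod_i cabs (u i (circ (ln r) t)) by apply: prodr_gt0 => i _; rewrite cabs_gt0.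
  have pp : 0 < \prod_i \prod_k phi (i, k) t by do 2!apply: prodr_gt0 => ? _.
  have lnprod n (F : 'I_n -> R) : (forall i, 0 < F i) -> ln (\prod_i F i) = \sum_i ln (F i).
    move=> F0; elim: n F F0 => [|n IH] F F0; first by rewrite !big_ord0 ln1.
    by rewrite !big_ord_recr /= lnM ?posrE // ?IH // prodr_gt0.
  rewrite -lnM ?posrE ?M0 ?cabs_gt0 //.
  have -> : \sum_i ln (cabs (u i (circ (ln r) t))) = ln (\prod_i cabs (u i (circ (ln r) t))).
    by rewrite lnprod // => i; rewrite cabs_gt0.
  have -> : \sum_i \sum_k ln (phi (i, k) t) = ln (\prod_i \prod_k phi (i, k) t).
    rewrite lnprod; first by apply: eq_bigr => i _; rewrite lnprod.
    by move=> i; apply: prodr_gt0.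
  have -> : ln (\prod_i cabs (u i (circ (ln r) t))) + (ln (\prod_i \prod_k phi (i, k) t) + ln kap) =
      ln (kap * (\prod_i cabs (u i (circ (ln r) t)) * \prod_i \prod_k phi (i, k) t)).
    rewrite lnM ?posrE //; last exact: mulr_gt0 pu pp.
    by rewrite (lnM pu pp) [RHS]addrC addrA.
  rewrite ler_ln ?posrE; first exact: h.
    by rewrite mulr_gt0 ?M0 ?cabs_gt0.
  exact: mulr_gt0 kap0 (mulr_gt0 pu pp).
have [Lu hLu] := choice (fun i => finite_zeros r (@hu i) (nu i)).
have [LW hLW] := finite_zeros r hW nW.
(* One list of zeros for all the [u i] and the Wronskian, so that the sums in Jensen's formulas can
   be compared term by term. *)
pose Z := [seq z <- undup (LW ++ flatten [seq Lu i | i <- enum 'I_m.+2]) | (z != 0) && (cabs z < r)].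
have uZ : uniq Z by rewrite filter_uniq // undup_uniq.
have Z1 a : a \in Z -> a != 0 /\ cabs a < expR (ln r).
  by rewrite er mem_filter => /andP[/andP[-> ->]].
have inu i z : z != 0 -> cabs z <= expR (ln r) -> u i z = 0 -> z \in Z.
  rewrite er => z0 zr gz; rewrite mem_filter z0 mem_undup mem_cat; apply/andP; split.
    by rewrite lt_neqAle zr andbT; apply/eqP => e; have := ho2 i z e; rewrite gz eqxx.
  apply/orP; right; apply/flattenP; exists (Lu i); last exact: hLu.
  by apply: map_f; rewrite mem_enum.
have inW z : z != 0 -> cabs z <= expR (ln r) -> W ord0 z = 0 -> z \in Z.
  rewrite er => z0 zr gz; rewrite mem_filter z0 mem_undup mem_cat hLW //= andbT.
  by rewrite lt_neqAle zr andbT; apply/eqP => e; have := ho3 z e; rewrite gz eqxx.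
have NcE i : counting m (u i) r = (minn (zero_order (u i) 0) m)%:R * ln r +
    \sum_(a <- Z) (minn (zero_order (u i) a) m)%:R * (ln r - ln (cabs a)).
  rewrite /counting; congr (_ + _); apply: fsbig_list => //.
    by move=> a /Z1; rewrite er.
  move=> a [a0 ar] Fa; apply: (inu i) => //; first by rewrite er ltW.
  apply/eqP; apply: contraNT Fa => ua; by rewrite (zero_order0 (@hu i) ua) min0n mul0r.
have eu : \sum_i logmean (u i) (ln r) = \sum_i Cu i + ((\sum_i zero_order (u i) 0)%:R * ln r +
    \sum_(a <- Z) (\sum_i zero_order (u i) a)%:R * (ln r - ln (cabs a))).
  rewrite (eq_bigr _ (fun i _ => hCu i (ln r) Z uZ Z1 (inu i))).
  rewrite !big_split /= -addrA; congr (_ + (_ + _)); first by rewrite natr_sum mulr_suml.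
  rewrite exchange_big /=; apply: eq_bigr => a _; by rewrite natr_sum mulr_suml.
have eN : \sum_i counting m (u i) r = (\sum_i minn (zero_order (u i) 0) m)%:R * ln r +
    \sum_(a <- Z) (\sum_i minn (zero_order (u i) a) m)%:R * (ln r - ln (cabs a)).
  rewrite (eq_bigr _ (fun i _ => NcE i)).
  rewrite big_split /=; congr (_ + _); first by rewrite natr_sum mulr_suml.
  rewrite exchange_big /=; apply: eq_bigr => a _; by rewrite natr_sum mulr_suml.
have eW := hCW (ln r) Z uZ Z1 inW.
have tr a : (\sum_i zero_order (u i) a)%:R <= (zero_order (W ord0) a)%:R + (\sum_i minn (zero_order (u i) a) m)%:R :> R.
  by rewrite -natrD ler_nat circuit_trunc.
have t1 : (\sum_i zero_order (u i) 0)%:R * ln r <= (zero_order (W ord0) 0)%:R * ln r + (\sum_i minn (zero_order (u i) 0) m)%:R * ln r.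
  by rewrite -mulrDl ler_wpM2r.
have t2 : \sum_(a <- Z) (\sum_i zero_order (u i) a)%:R * (ln r - ln (cabs a)) <=
    \sum_(a <- Z) (zero_order (W ord0) a)%:R * (ln r - ln (cabs a)) +
    \sum_(a <- Z) (\sum_i minn (zero_order (u i) a) m)%:R * (ln r - ln (cabs a)).
  rewrite -big_split /= big_seq [leRHS]big_seq; apply: ler_sum => a aZ.
  have [a0 ar] := Z1 a aZ; rewrite er in ar.
  by rewrite -mulrDl ler_wpM2r // subr_ge0 ler_ln ?posrE ?cabs_gt0 // ltW.
have t3 : \sum_i \sum_k circ_mean (fun t => ln (phi (i, k) t)) <= (\sum_i \sum_k Kt (i, k)) * (1 + ln T).
  rewrite mulr_suml; apply: ler_sum => i _; rewrite mulr_suml; apply: ler_sum => k _.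
  by case: (hphi (i, k)).
have t4 : K1 <= `|K1| * (1 + ln T).
  by apply: le_trans (ler_norm _) _; rewrite ler_peMr // lerDl ln_ge0.
rewrite eu eW in step; rewrite eN mulrDl.
exact: (cartan_aux step t1 t2 t3 t4).
Qed.
End Cartan.

(** * Common zeros of forms *)

Lemma linear_dependence (F : fieldType) (I J : finType) (M : I -> J -> F) : (#|J| < #|I|)%N ->
  exists2 l : I -> F, (exists i, l i != 0) & forall j, \sum_i l i * M i j = 0.
Proof.
move=> JI; pose A := \matrix_(i < #|I|, j < #|J|) M (enum_val i) (enum_val j).
have : kermx A != 0.
  by rewrite -mxrank_eq0 mxrank_ker -lt0n subn_gt0 (leq_ltn_trans (rank_leq_col A)).
move=> /rowV0Pn[v /sub_kermxP vA v0].
exists (fun i => v 0 (enum_rank i)).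
  move: v0 => /rV0Pn[j vj]; exists (enum_val j); by rewrite enum_valK.
move=> j; have := congr1 (fun B : 'rV_ _ => B 0 (enum_rank j)) vA; rewrite !mxE => e; rewrite -[RHS]e.
rewrite (reindex _ (onW_bij _ (@enum_val_bij I))) /=; apply: eq_bigr => i _.
by rewrite mxE enum_valK enum_rankK.
Qed.

(** * The weak Nullstellensatz *)

Section Nullstellensatz.
Variables (R : realType) (n : nat).
Local Notation C := (Cplx R).
Local Notation mp := (mpoly n C).
Local Notation V i := (mpolyX C (mnm1 i) : mp).
Local Notation K c := (mpolyC n (R := C) c).
Implicit Types (P Q : mp).

Record is_ideal (J : mp -> Prop) : Prop := IsIdeal {
  ideal0 : J 0; idealD : forall P Q, J P -> J Q -> J (P + Q); idealM : forall P Q, J P -> J (Q * P) }.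

Lemma ideal_sum (J : mp -> Prop) (I : Type) (s : seq I) (F : I -> mp) : is_ideal J -> (forall i, J (F i)) -> J (\sum_(i <- s) F i).
Proof.
move=> hJ hF; elim: s => [|i s IH]; first by rewrite big_nil; exact: ideal0.
by rewrite big_cons; apply: idealD.
Qed.

(** Otherwise the complex numbers, and with them the reals, would be countable, against the positive
    measure of the unit interval. *)
Lemma uncountable_C (S : nat -> set C) : (forall c, exists D, S D c) -> exists D, infinite_set (S D).
Proof.
move=> hS; apply: contrapT => /forallNP nf.
have cR : countable [set: R].
  apply: (@sub_countable _ _ _ (\bigcup_D [set complex.Re z | z in S D])); last first.
    by apply: bigcup_countable => // D _; apply: finite_set_countable; apply: finite_image; exact: contrapT (nf D).
  apply: subset_card_le => x _; have [D hD] := hS (Complex x 0); exists D => //; by exists (Complex x 0).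
have : (@lebesgue_measure R `[0%R, 1%R] <= @lebesgue_measure R [set: R])%E by apply: le_measure; rewrite ?inE.
rewrite (countable_lebesgue_measure0 cR) lebesgue_measure_itv /= lte_fin ltr01.
by rewrite oppr0 addr0 lee_fin leNgt ltr01.
Qed.

(** The ideal generated by [J] and [X_k - c]. *)
Definition adjoin (J : mp -> Prop) k c : mp -> Prop := fun Q => exists b, J (Q - (V k - K c) * b).

Lemma adjoin_ideal J k c : is_ideal J -> is_ideal (adjoin J k c).
Proof.
move=> hJ; split.
- by exists 0; rewrite mulr0 subr0; exact: ideal0.
- move=> P Q [b hb] [b' hb']; exists (b + b').
  by rewrite mulrDr opprD addrACA; exact: idealD.
- by move=> P Q [b hb]; exists (Q * b); rewrite mulrCA -mulrBr; exact: idealM.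
Qed.

(* If every [X_k - c] were invertible modulo J, uncountably many of the inverses would lie in a
   finite-dimensional space; a relation between them gives a nonzero polynomial in [X_k] alone. *)
Lemma adjoin_proper J k : is_ideal J -> ~ J 1 -> exists c, ~ adjoin J k c 1.
Proof.
move=> hJ J1; apply: contrapT => /forallNP h.
have {}h c : exists b, J (1 - (V k - K c) * b) by have := contrapT (h c).
have [g hg] := choice h.
have hS c : exists D, (mmeasure mdeg (g c) <= D)%N by exists (mmeasure mdeg (g c)).
(* Infinitely many of the inverses have degrees below a common bound. *)
have [D infD] := @uncountable_C (fun D => [set c | (mmeasure mdeg (g c) <= D)%N]) hS.
have [B BD sB] := infinite_set_fset (#|{: bmultinom n D}|.+1) infD.
pose I : finType := seq_sub (finmap.enum_fset B).
have cI : (#|{: bmultinom n D}| < #|I|)%N by rewrite card_seq_sub ?finmap.fset_uniq.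
have [l [i0 l0] hl] := linear_dependence (fun (i : I) (m : bmultinom n D) => mcoeff m (g (ssval i))) cI.
pose c (i : I) : C := ssval i.
have relg : \sum_i l i *: g (c i) = 0.
  have gE i : g (c i) = \sum_(m : bmultinom n D) mcoeff m (g (c i)) *: mpolyX C m.
    by apply: mpolywE; apply: BD; exact: ssvalP.
  under eq_bigr => i _ do rewrite gE scaler_sumr.
  rewrite exchange_big /= big1 // => m _.
  by under eq_bigr do rewrite scalerA; rewrite -scaler_suml hl scale0r.
(* The numerator of [sum l_i / (X - c_i)]; at [c i0] only one of its terms survives. *)
pose p : {poly C} := \sum_i l i *: \prod_(j | j != i) ('X - (c j)%:P).
have p0 : p != 0.
  have ph i x : (\prod_(j | j != i) ('X - (c j)%:P)).[x] = \prod_(j | j != i) (x - c j).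
    by rewrite horner_prod; apply: eq_bigr => j _; rewrite !hornerE.
  have : p.[c i0] != 0.
    rewrite horner_sum (bigD1 i0) //= [X in _ + X]big1 => [|i ii].
      rewrite addr0 hornerZ ph mulf_neq0 //; apply/prodf_neq0 => j ji.
      rewrite subr_eq0; apply: contraNneq ji => e; apply/eqP/val_inj; exact/esym.
    by rewrite hornerZ ph (bigD1 i0) 1?eq_sym //= subrr mul0r mulr0.
  by apply: contraNneq => ->; rewrite horner0.
pose ev (q : {poly C}) : mp := (map_poly (@mpolyC n C) q).[V k].
have evX r : ev ('X - r%:P) = V k - K r by rewrite /ev rmorphB /= map_polyX map_polyC !hornerE.
have evP (T : Type) (s : seq T) (Pr : pred T) (r : T -> C) : ev (\prod_(t <- s | Pr t) ('X - (r t)%:P)) = \prod_(t <- s | Pr t) (V k - K (r t)).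
  by rewrite /ev rmorph_prod horner_prod; apply: eq_bigr => t _; exact: evX.
have evZ a q : ev (a *: q) = a *: ev q by rewrite /ev map_polyZ /= hornerZ mul_mpolyC.
have Jp : J (ev p).
  have -> : ev p = \sum_i l i *: (\prod_(j | j != i) (V k - K (c j)) * (1 - (V k - K (c i)) * g (c i))).
    have -> : ev p = \sum_i l i *: \prod_(j | j != i) (V k - K (c j)).
      by rewrite /ev /p rmorph_sum horner_sum; apply: eq_bigr => i _; rewrite -/(ev _) evZ evP.
    apply/eqP; rewrite -subr_eq0 -sumrB; apply/eqP.
    under eq_bigr => i _ do rewrite mulrBr mulr1 scalerBr opprB addrC subrK mulrA -(mulrC (V k - K (c i))).
    have e i : (V k - K (c i)) * \prod_(j | j != i) (V k - K (c j)) = \prod_j (V k - K (c j)) by rewrite [RHS](bigD1 i).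
    under eq_bigr => i _ do rewrite e scalerAr.
    by rewrite -mulr_sumr relg mulr0.
  by apply: ideal_sum => // i; rewrite scalerAl; exact: idealM.
(* Every [X_k - r] is invertible modulo [J] and can be cancelled; cancelling all linear factors of
   [p] puts a nonzero constant into [J]. *)
have inv Q r : J (Q * (V k - K r)) -> J Q.
  move=> h1; have -> : Q = Q * (1 - (V k - K r) * g r) + g r * (Q * (V k - K r)).
    by move: (g r) (V k - K r) => b a; ring.
  by apply: idealD => //; apply: idealM => //.
have [rs rsE] := closed_field_poly_normal p.
have : J (K (lead_coef p) * \prod_(z <- rs) (V k - K z)).
  by rewrite mul_mpolyC -(evP _ rs xpredT id) -evZ -rsE.
elim: rs {rsE} => [|z rs IH].
  rewrite big_nil mulr1 => h1; apply: J1.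
  have := idealM hJ (K (lead_coef p)^-1) h1; rewrite -rmorphM mulVf ?rmorph1 // lead_coef_eq0 //.
by rewrite big_cons mulrCA mulrC => /inv.
Qed.

(** Adjoining [X_k - x_k] for one variable after another keeps the ideal proper. Modulo the final
    ideal every polynomial is congruent to its value at [x], so an element of [J] with nonzero value
    would put 1 into it. *)
Lemma weak_nullstellensatz J : is_ideal J -> ~ J 1 -> exists x : 'I_n -> C, forall P, J P -> meval x P = 0.
Proof.
move=> hJ J1.
have [x [J' [hJ' JJ' J'1 hx]]] : exists (x : 'I_n -> C) (J' : mp -> Prop), [/\ is_ideal J', forall P, J P -> J' P, ~ J' 1 &
    forall k, k \in enum 'I_n -> J' (V k - K (x k))].
  elim: (enum 'I_n) => [|k s [x [J' [hJ' JJ' J'1 hx]]]]; first by exists (fun=> 0), J; split.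
  have [c hc] := adjoin_proper k hJ' J'1.
  have sub P : J' P -> adjoin J' k c P by move=> JP; exists 0; rewrite mulr0 subr0.
  case: (boolP (k \in s)) => ks.
    exists x, J'; split=> // i; rewrite inE => /predU1P[->|]; exact: hx.
  exists (fun i => if i == k then c else x i), (adjoin J' k c); split => //.
  - exact: adjoin_ideal.
  - by move=> P /JJ' /sub.
  - move=> i; rewrite inE => /predU1P[->|is_]; first by exists 1; rewrite eqxx mulr1 subrr; exact: ideal0.
    by rewrite ifN; [apply/sub/hx|apply: contraNneq ks => <-].
exists x => P /JJ' J'P.
have cong (Q : mp) : J' (Q - K (meval x Q)).
  elim/mpolyind: Q => [|a m Q _ _ IH]; first by rewrite meval0 rmorph0 subr0; exact: ideal0.
  rewrite mevalD mevalZ rmorphD opprD addrACA; apply: idealD => //.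
  rewrite rmorphM -mul_mpolyC -mulrBr; apply: idealM => //.
  have prodc (s : seq 'I_n) : J' (\prod_(i <- s) V i ^+ m i - K (\prod_(i <- s) x i ^+ m i)).
    elim: s => [|i s IHs]; first by rewrite !big_nil rmorph1 subrr; exact: ideal0.
    rewrite !big_cons rmorphM.
    have -> (A B A' B' : mp) : A * B - A' * B' = A * (B - B') + B' * (A - A') by ring.
    apply: idealD => //; first exact: idealM.
    apply: idealM => //; rewrite rmorphXn /= subrXX mulrC; apply: idealM => //.
    by apply: hx; rewrite mem_enum.
  have := prodc (index_enum _); rewrite mevalX.
  suff -> : \prod_(i : 'I_n) V i ^+ m i = mpolyX C m by [].
  by rewrite [RHS]mpolyXE_id.
apply/eqP; apply: contraPT J'P => Px JP; apply: J'1.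
have J'c : J' (K (meval x P)).
  have -> : K (meval x P) = P + (-1) * (P - K (meval x P)) by ring.
  by apply: idealD => //; exact: idealM.
by have := idealM hJ' (K (meval x P)^-1) J'c; rewrite -rmorphM mulVf ?rmorph1.
Qed.
End Nullstellensatz.

(** * Homogeneous forms without common zeros *)

Section Forms.
Variables (R : realType) (n p e : nat).
Local Notation C := (Cplx R).
Local Notation mp := (mpoly n C).
Local Notation V i := (mpolyX C (mnm1 i) : mp).
Local Notation K c := (mpolyC n (R := C) c).
Local Notation hom d P := (P \is ishomog1 d (@mdeg n)).
Local Notation pi_ d P := (pihomog (@mdeg n) d P).
Implicit Types (P Q : mp).

Lemma form_bound P d : hom d P -> exists2 M : R, 0 <= M & forall (x : 'I_n -> C) (B : R),
  (forall i, cabs (x i) <= B) -> 0 <= B -> cabs (meval x P) <= M * B ^+ d.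
Proof.
move=> hP; exists (\sum_(m <- msupp P) cabs (mcoeff m P)); first by apply: sumr_ge0 => m _; exact: cabs_ge0.
move=> x B xB B0; rewrite mevalE; apply: le_trans (cabs_sum _ _ _) _; rewrite mulr_suml.
move/dhomogP: hP => hd; rewrite big_seq [leRHS]big_seq; apply: ler_sum => m /hd /= md.
rewrite cabsM ler_wpM2l ?cabs_ge0 // cabs_prod -md mdegE -prodrXr.
by apply: ler_prod => i _; rewrite cabs_ge0 cabsX lerXn2r ?nnegrE ?cabs_ge0.
Qed.

Lemma pihomogMr k P Q d : hom d Q -> pi_ k (P * Q) = if (d <= k)%N then pi_ (k - d) P * Q else 0.
Proof.
move=> hQ; pose L := maxn (mmeasure (@mdeg n) P) (k - d).+1.
have PE : P = \sum_(i < L) pi_ i P by apply: pihomog_partitionE; exact: leq_maxl.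
have E (i : nat) : pi_ k (pi_ i P * Q) = if (i + d)%N == k then pi_ i P * Q else 0.
  have h : hom (i + d)%N (pi_ i P * Q) by apply: dhomogM => //; exact: pihomogP.
  by case: eqP => [<-|/eqP ik]; [exact: pihomog_dE|exact: pihomog_ne0 h].
rewrite {1}PE mulr_suml linear_sum /=; under eq_bigr => i _ do rewrite E.
case: leqP => dk; last first.
  by rewrite big1 // => i _; rewrite gtn_eqF // (leq_trans dk) // leq_addl.
have kL : (k - d < L)%N by rewrite leq_maxr.
rewrite (bigD1 (Ordinal kL)) //= subnK // eqxx big1 ?addr0 // => i ik.
by case: eqP => // ik'; case/eqP: ik; apply/val_inj => /=; rewrite -ik' addnK.
Qed.

Variable w : 'I_p -> mp.
Hypothesis hw : forall j, hom e (w j).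
Hypothesis e0 : (0 < e)%N.

Definition combination P := exists a : 'I_p -> mp, P = \sum_j a j * w j.

Lemma combination_ideal : is_ideal combination.
Proof.
split.
- by exists (fun=> 0); rewrite big1 // => j _; rewrite mul0r.
- move=> P Q [a ->] [b ->]; exists (fun j => a j + b j); rewrite -big_split /=; apply: eq_bigr => j _; by rewrite mulrDl.
- by move=> P Q [a ->]; exists (fun j => Q * a j); rewrite mulr_sumr; apply: eq_bigr => j _; rewrite mulrA.
Qed.

Lemma combination_homog P d : (e <= d)%N -> hom d P -> combination P ->
  exists2 a : 'I_p -> mp, forall j, hom (d - e)%N (a j) & P = \sum_j a j * w j.
Proof.
move=> ed hP [a aE]; exists (fun j => pi_ (d - e) (a j)); first by move=> j; exact: pihomogP.
rewrite -[LHS](pihomog_dE hP) {1}aE linear_sum; apply: eq_bigr => j _ /=.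
by rewrite (pihomogMr d (a j) (hw j)) ed.
Qed.

Lemma combination_pihomog P k : combination P -> combination (pi_ k P).
Proof.
move=> [a ->]; exists (fun j => if (e <= k)%N then pi_ (k - e) (a j) else 0).
rewrite linear_sum; apply: eq_bigr => j _ /=; rewrite (pihomogMr k (a j) (hw j)).
by case: ifP => // _; rewrite mul0r.
Qed.

Lemma V_homog i : hom 1%N (V i).
Proof. by rewrite dhomogX /= mdeg1. Qed.

(** The forms have no common zero with [X_i = 1], so 1 is a combination of them plus [(X_i - 1) b].
    Comparing homogeneous parts, that of degree [k] of [b] is congruent to [- X_i ^ k] modulo
    combinations, and it is 0 for large [k]. *)
Lemma power_combination1 i : (forall x, x i = 1 -> (forall j, meval x (w j) = 0) -> False) ->
  exists D, combination (V i ^+ D).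
Proof.
move=> nox; have hI := combination_ideal.
have hJ := adjoin_ideal i 1 hI.
have : adjoin combination i 1 1.
  apply: contrapT => J1; have [x hx] := weak_nullstellensatz hJ J1.
  apply: (nox x).
    have := hx (V i - K 1); rewrite mevalB mevalXU mevalC => h.
    apply/eqP; rewrite -subr_eq0; apply/eqP; apply: h.
    by exists 1; rewrite mulr1 subrr; exact: ideal0.
  move=> j; apply: hx; exists 0; rewrite mulr0 subr0; exists (fun k => (k == j)%:R).
  by rewrite (bigD1 j) //= eqxx mul1r big1 ?addr0 // => k /negbTE ->; rewrite mul0r.
move=> [b]; rewrite rmorph1 => hb.
have hc k : combination (pi_ k (1 - (V i - 1) * b)) := combination_pihomog k hb.
have piV k : pi_ k (V i * b) = if (0 < k)%N then V i * pi_ k.-1 b else 0.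
  by rewrite mulrC (pihomogMr k b (V_homog i)) subn1; case: ifP => // _; rewrite mulrC.
have pi1 k : pi_ k (1 : mp) = (k == 0%N)%:R.
  case: k => [|k]; first exact: pihomog_dE (dhomog1 _ _).
  by rewrite (@pihomog_ne0 _ _ _ 0) ?dhomog1.
have bk k : combination (pi_ k b + V i ^+ k).
  elim: k => [|k IH].
    have := hc 0%N; rewrite mulrBl mul1r opprB addrA linearB linearD /= pi1 piV /= subr0.
    by rewrite expr0 addrC.
  have := hc k.+1; rewrite mulrBl mul1r opprB addrA linearB linearD /= pi1 piV /= add0r => h.
  have -> : pi_ k.+1 b + V i ^+ k.+1 = (pi_ k.+1 b - V i * pi_ k b) + V i * (pi_ k b + V i ^+ k).
    by rewrite mulrDr -exprS addrA subrK.
  by apply: (idealD hI) => //; exact: (idealM hI).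
exists (mmeasure (@mdeg n) b); have := bk (mmeasure (@mdeg n) b).
have -> : pi_ (mmeasure (@mdeg n) b) b = 0; last by rewrite add0r.
rewrite {2}(pihomog_partitionE (leqnn (mmeasure (@mdeg n) b))) linear_sum big1 // => i0 _ /=.
by apply: (@pihomog_ne0 _ _ _ i0); [rewrite ltn_eqF|exact: pihomogP].
Qed.

Hypothesis nozero : forall x : 'I_n -> C, (forall j, meval x (w j) = 0) -> forall i, x i = 0.

Lemma power_combination : exists2 D, (e <= D)%N & forall i, exists2 a : 'I_p -> mp,
  forall j, hom (D - e)%N (a j) & V i ^+ D = \sum_j a j * w j.
Proof.
have h i : exists D, combination (V i ^+ D).
  by apply: power_combination1 => x xi /nozero /(_ i); rewrite xi => /eqP; rewrite oner_eq0.
have [D hD] := choice h; have hI := combination_ideal.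
exists (e + \sum_i D i)%N; first exact: leq_addr.
move=> i; apply: combination_homog; first exact: leq_addr.
  by have := dhomogMn (e + \sum_i D i)%N (V_homog i); rewrite mul1n.
rewrite (bigD1 i) //= addnCA exprD mulrC; apply: (idealM hI); exact: hD.
Qed.

(** At a coordinate of maximal modulus [B], [power_combination] gives
    [B ^ D <= M * W * B ^ (D - e)], with [W] the largest modulus among the forms; then [B ^ (D - e)]
    is cancelled. *)
Lemma norm_le_forms : exists2 M : R, 0 < M & forall x : 'I_n -> C,
  (\big[Num.max/0]_i cabs (x i)) ^+ e <= M * \big[Num.max/0]_j cabs (meval x (w j)).
Proof.
have [D eD hD] := power_combination.
have hM i : exists2 M : R, 0 <= M & forall x, cabs (x i) = \big[Num.max/0]_i cabs (x i) ->
    (\big[Num.max/0]_i cabs (x i)) ^+ e <= M * \big[Num.max/0]_j cabs (meval x (w j)).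
  have [a ha aE] := hD i.
  have [Ma hMa] := choice (fun j => let: ex_intro2 m m0 hm := form_bound (ha j) in ex_intro _ m (conj m0 hm)).
  exists (\sum_j Ma j); first by apply: sumr_ge0 => j _; case: (hMa j).
  move=> x xi; set B := \big[Num.max/0]_i cabs (x i); set W := \big[Num.max/0]_j cabs (meval x (w j)).
  have B0 : 0 <= B by rewrite /B -xi cabs_ge0.
  have W0 : 0 <= W by apply: bigmax_ge_id.
  case: (ltrP 0 B) => Bp; last first.
    have -> : B = 0 by apply/eqP; rewrite eq_le Bp B0.
    by rewrite expr0n gtn_eqF // mulr_ge0 // sumr_ge0 // => j _; case: (hMa j).
  have xB k : cabs (x k) <= B by exact: le_bigmax.
  have : B ^+ D <= (\sum_j Ma j) * W * B ^+ (D - e).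
    have -> : B ^+ D = cabs (meval x (V i ^+ D)) by rewrite (rmorphXn (meval x)) /= mevalXU cabsX xi.
    rewrite aE (raddf_sum (meval x)) /=; apply: le_trans (cabs_sum _ _ _) _.
    rewrite !mulr_suml; apply: ler_sum => j _; rewrite mevalM cabsM mulrAC ler_pM ?cabs_ge0 //.
      by case: (hMa j) => _; apply.
    exact: le_bigmax.
  by rewrite -{1}(subnKC eD) exprD ler_pM2r // exprn_gt0.
have [M hM'] := choice (fun i => let: ex_intro2 m m0 hm := hM i in ex_intro _ m (conj m0 hm)).
exists (1 + \sum_i M i); first by rewrite ltr_pwDl // sumr_ge0 // => i _; case: (hM' i).
move=> x; have W0 : 0 <= \big[Num.max/0]_j cabs (meval x (w j)) by apply: bigmax_ge_id.
have M0 i : 0 <= M i by case: (hM' i).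
case: (pickP (@predT 'I_n)) => [i1 _|none]; last first.
  rewrite big_pred0; first by rewrite expr0n gtn_eqF // mulr_ge0 // addr_ge0 // sumr_ge0.
  by move=> i; have := none i.
have xi : exists i, cabs (x i) = \big[Num.max/0]_i cabs (x i).
  exists [arg max_(i > i1) cabs (x i)]%O.
  by rewrite (bigmax_eq_arg 0 i1) // => i _; exact: cabs_ge0.
have [i {}xi] := xi; have [_ /(_ x xi) h] := hM' i.
apply: le_trans h _; rewrite ler_wpM2r // (bigD1 i) //= addrCA lerDl addr_ge0 // sumr_ge0 // => j _; exact: M0.
Qed.

Let G D d (t : {ffun 'I_n -> 'I_D} * {ffun 'I_p -> 'I_d.+1}) : mp :=
  \prod_i V i ^+ t.1 i * \prod_j w j ^+ t.2 j.
Let spans D d P := exists c : {ffun 'I_n -> 'I_D} * {ffun 'I_p -> 'I_d.+1} -> C, P = \sum_t c t *: G t.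

Let spans_sum D d (I : Type) (s : seq I) (F : I -> mp) (a : I -> C) : (forall i, spans D d (F i)) ->
  spans D d (\sum_(i <- s) a i *: F i).
Proof.
move=> hF; elim: s => [|i s [c cE]].
  by exists (fun=> 0); rewrite big_nil big1 // => t _; rewrite scale0r.
have [b bE] := hF i; exists (fun t => a i * b t + c t).
rewrite big_cons cE bE scaler_sumr -big_split /=; apply: eq_bigr => t _.
by rewrite scalerDl scalerA.
Qed.

Let spans_gen D d (b : 'I_n -> 'I_D) (a : 'I_p -> nat) : (forall j, (a j <= d)%N) ->
  spans D d (\prod_i V i ^+ b i * \prod_j w j ^+ a j).
Proof.
move=> ad; pose t0 := ([ffun i => b i], [ffun j => inord (a j)] : {ffun 'I_p -> 'I_d.+1}).
exists (fun t => (t == t0)%:R); rewrite (bigD1 t0) //= eqxx scale1r [X in _ = _ + X]big1 ?addr0; last first.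
  by move=> t /negbTE ->; rewrite scale0r.
rewrite /G /=; congr (_ * _); apply: eq_bigr => i _; rewrite ffunE // inordK //.
by rewrite ltnS ad.
Qed.

Let spans_mul D d P j : spans D d P -> spans D d.+1 (P * w j).
Proof.
move=> [c ->]; rewrite mulr_suml.
under eq_bigr do rewrite -scalerAl.
apply: spans_sum => t.
have -> : G t * w j = \prod_i V i ^+ t.1 i * \prod_k w k ^+ (t.2 k + (k == j))%N.
  rewrite /G -mulrA; congr (_ * _); rewrite (bigD1 j) //= [RHS](bigD1 j) //= eqxx addn1 exprSr.
  rewrite mulrAC; congr (_ * _); apply: eq_bigr => k /negbTE ->; by rewrite addn0.
apply: spans_gen => k; apply: (@leq_trans (d + 1)%N); last by rewrite addn1.
by apply: leq_add; [rewrite -ltnS; exact: ltn_ord|exact: leq_b1].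
Qed.

(** An exponent that reaches [D] is reduced by writing [X_i ^ D] as a combination of the [w j]: the
    cofactor of each [w j] has degree smaller by [e > 0], while one exponent of the [w j] rises by
    1. Hence [d] can bound both the degree and these exponents. *)
Let spans_monomial D : (e <= D)%N -> (forall i, exists2 a : 'I_p -> mp,
  forall j, hom (D - e)%N (a j) & V i ^+ D = \sum_j a j * w j) ->
  forall d m, (mdeg m <= d)%N -> spans D d (mpolyX C m).
Proof.
move=> eD hD; have small d (m : multinom n) : (forall i, (m i < D)%N) -> spans D d (mpolyX C m).
  move=> mD; have -> : mpolyX C m = \prod_i V i ^+ (Ordinal (mD i)) * \prod_(j < p) w j ^+ 0%N.
    by rewrite mpolyXE_id [X in _ * X]big1 ?mulr1.
  exact: (@spans_gen D d (fun i => Ordinal (mD i)) (fun=> 0%N)).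
elim=> [|d IH] m md; case: (boolP [exists i, (D <= m i)%N]) => [/existsP[i Di]|/existsPn nD];
  try by apply: small => i; rewrite ltnNge nD.
  have mi : (m i <= mdeg m)%N by rewrite mdegE (bigD1 i) //= leq_addr.
  by have := leq_trans (leq_trans (leq_trans e0 eD) Di) (leq_trans mi md).
have [a ha aE] := hD i.
pose m' := mnm_sub m (mnm_muln (mnm1 i) D).
have mE : mnm_add m' (mnm_muln (mnm1 i) D) = m.
  apply: submK; apply/mnm_lepP => k; rewrite mulmnE mnm1E.
  by case: eqP => [<-|_]; rewrite ?mul1n ?mul0n.
have dE : (mdeg m' + D = mdeg m)%N by rewrite -{1}mE mdegD mdegMn mdeg1 mul1n.
have -> : mpolyX C m = \sum_j 1 *: (mpolyX C m' * a j * w j).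
  rewrite -{1}mE mpolyXD -mpolyXn aE mulr_sumr; apply: eq_bigr => j _; by rewrite scale1r mulrA.
apply: spans_sum => j; apply: spans_mul.
have hQ : hom (mdeg m' + (D - e))%N (mpolyX C m' * a j) by apply: dhomogM => //; rewrite dhomogX.
rewrite [_ * a j]mpolyE; move/dhomogP: hQ => hQ.
have -> : \sum_(k <- msupp (mpolyX C m' * a j)) mcoeff k (mpolyX C m' * a j) *: mpolyX C k =
   \sum_(k <- msupp (mpolyX C m' * a j)) mcoeff k (mpolyX C m' * a j) *: (if (mdeg k <= d)%N then mpolyX C k else 0).
  rewrite big_seq [RHS]big_seq; apply: eq_bigr => k /hQ /= kd; rewrite ifT // kd.
  by rewrite addnBA // dE leq_subLR (leq_trans md) // -add1n leq_add2r.
apply: spans_sum => k; case: ifP => [/IH //|_].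
by exists (fun=> 0); rewrite big1 // => t _; rewrite scale0r.
Qed.

(* All monomials lie in the span of the [X^b w^a] with [b < D], and there are too few of these. *)
Lemma forms_variables : (n <= p)%N.
Proof.
rewrite leqNgt; apply/negP => pn.
have [D eD hD] := power_combination.
have D0 : (0 < D)%N := leq_trans e0 eD.
(* There are [(t + 1) ^ n] monomials with exponents up to [t], and the number of generators is [D ^
   n * (n t + 1) ^ p <= t * (t + 1) ^ p < (t + 1) ^ (p + 1)]. *)
pose t := (D ^ n * n ^ p)%N.
pose mon (s : {ffun 'I_n -> 'I_t.+1}) : multinom n := Multinom [tuple (s i : nat) | i < n].
have mons s i : mon s i = s i by rewrite /mon mnmE.
have hm s : spans D (n * t) (mpolyX C (mon s)).
  apply: (spans_monomial eD hD); rewrite mdegE.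
  apply: leq_trans (_ : _ <= \sum_(i < n) t)%N _; last by rewrite sum_nat_const card_ord.
  by apply: leq_sum => i _; rewrite mons -ltnS.
have [c hc] := choice hm.
have card_lt : (#|{: {ffun 'I_n -> 'I_D} * {ffun 'I_p -> 'I_(n * t).+1}}| < #|{: {ffun 'I_n -> 'I_t.+1}}|)%N.
  rewrite card_prod !card_ffun !card_ord.
  apply: (@leq_ltn_trans (D ^ n * (n ^ p * t.+1 ^ p))%N).
    have lx k x y : (x <= y)%N -> (x ^ k <= y ^ k)%N by case: k => // k xy; rewrite leq_exp2r.
    rewrite leq_mul2l -expnMn; apply/orP; right; apply: lx.
    by rewrite mulnS -add1n leq_add2r (leq_ltn_trans _ pn).
  rewrite mulnA -/t; apply: (@leq_trans (t.+1 ^ p.+1)); last exact: leq_pexp2l.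
  by rewrite expnS ltn_pmul2r // expn_gt0.
have [l [s0 l0] hl] := linear_dependence (fun s t => c s t) card_lt.
have : \sum_s l s *: mpolyX C (mon s) = 0.
  under eq_bigr => s _ do rewrite hc scaler_sumr.
  rewrite exchange_big /= big1 // => k _.
  by under eq_bigr do rewrite scalerA; rewrite -scaler_suml hl scale0r.
move/(congr1 (mcoeff (mon s0))); rewrite mcoeff0 raddf_sum (bigD1 s0) //= mcoeffZ mcoeffX eqxx mulr1.
rewrite big1 ?addr0; first by move/eqP; rewrite (negbTE l0).
move=> s ss0; rewrite mcoeffZ mcoeffX; case: eqP => [e1|_]; last by rewrite mulr0.
case/eqP: ss0; apply/ffunP => i; apply/val_inj; rewrite /= -(mons s) e1; exact: mons.
Qed.
End Forms.

(** * The second main theorem *)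

Section CountingFunction.
Variable R : realType.
Local Notation C := (Cplx R).
Notation mu := (@lebesgue_measure R).

Lemma integral_inv_above (a r : R) : 0 < a -> a < r ->
  (measurable_fun [set: R] (fun t => if a < t then t^-1 else 0)) /\
  (\int[mu]_(t in `[0%R, r]) ((if a < t then t^-1 else 0) : R)%:E = (ln r - ln a)%:E)%E.
Proof.
(* A continuous function equal to [1 / t] beyond [a], so that the fundamental theorem of calculus
   applies up to the end [a]. *)
move=> a0 ar; pose h (t : R) := (Num.max t a)^-1.
have hm t : 0 < Num.max t a by rewrite lt_max a0 orbT.
have ch : continuous h.
  move=> t; apply: (@cont_atV R _ t (fun t => Num.max t a)); first by rewrite gt_eqF.
  by apply: (@continuous_max R R (fun t => t) (fun=> a)); [exact: cvg_id|exact: cvg_cst].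
have mh : measurable_fun [set: R] h := continuous_measurable_fun ch.
have he t : a < t -> h t = t^-1 by move=> at_; rewrite /h max_l // ltW.
have E : (fun t => if a < t then t^-1 else 0) = h \_ `]a, +oo[.
  apply/funext => t; rewrite patchE; case: ifPn => at_.
    by rewrite mem_set ?he //= in_itv /= at_.
  by rewrite memNset //= in_itv /= (negbTE at_).
split.
  rewrite E; apply/(measurable_restrictT h); first exact: measurable_itv.
  exact: measurable_funS mh.
have -> : (fun t : R => ((if a < t then t^-1 else 0) : R)%:E) = (EFin \o h) \_ `]a, +oo[.
  by apply/funext => t; have := congr1 (@^~ t) E; rewrite /= !patchE => ->; case: ifP.
rewrite -integral_mkcondr.
have -> : `[0%R, r]%classic `&` `]a, +oo[%classic = `]a, r]%classic :> set R.
  apply/seteqP; split => t /=; rewrite !in_itv /= ?andbT.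
    by move=> [/andP[_ ->] ->].
  by move=> /andP[at_ ->]; split=> //; rewrite andbT; apply: ltW; exact: lt_trans at_.
rewrite integral_itv_obnd_cbnd; last first.
  by apply: measurable_funS (_ : measurable_fun [set: R] (EFin \o h)) => //; apply/measurable_EFinP.
rewrite (@continuous_FTC2 R h (@ln R)) //.
- exact: continuous_subspaceT.
- split.
  + move=> x; rewrite in_itv /= => /andP[ax _].
    by have := @is_derive1_ln R x (lt_trans a0 ax); case.
  + by apply: cvg_at_right_filter; exact: continuous_ln.
  + by apply: cvg_at_left_filter; apply: continuous_ln; exact: lt_trans ar.
- move=> x; rewrite in_itv /= => /andP[ax _]; rewrite he // derive1E.
  by have := @is_derive1_ln R x (lt_trans a0 ax); case.
Qed.

(** The difference of the counts at [t] and at 0 is the sum over the zeros [a != 0] of the truncated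
    order times the indicator of [|a| < t]; each summand divided by [t] integrates to a multiple of
    [ln r - ln |a|]. *)
Lemma trunc_countingE (N M : nat) (f : C -> coords R N) (Q : hpoly R N) (r : R) (g := fun z => meval (f z) Q) :
  entire g -> nonzero g -> 0 < r -> trunc_counting M f Q r = counting M g r.
Proof.
move=> hg ng r0; rewrite /trunc_counting /counting -/g addrC; congr (_ + _).
have [L hL] := finite_zeros r hg ng.
pose Z := [seq z <- undup L | (z != 0) && (cabs z < r)].
have uZ : uniq Z by rewrite filter_uniq // undup_uniq.
have ZP a : a \in Z -> a != 0 /\ cabs a < r by rewrite mem_filter => /andP[/andP[-> ->]].
pose k (a : C) : R := (minn (zero_order g a) M)%:R.
have kz a : k a != 0 -> g a = 0.
  move=> ka; apply/eqP; apply: contraNT ka => ga; by rewrite /k (zero_order0 hg ga) min0n.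
have inZ a : a != 0 -> cabs a < r -> k a != 0 -> a \in Z.
  by move=> a0 ar /kz ga; rewrite mem_filter a0 ar mem_undup hL // ltW.
rewrite (@fsbig_list R _ Z) //; last first.
  by move=> a [a0 ar] ka; apply: inZ => //; apply: contraNneq ka => h; rewrite -/(k a) h mul0r.
pose phi (a : C) (t : R) : R := if cabs a < t then t^-1 else 0.
have cnt t : t \in `[0, r] -> (trunc_count M g t - trunc_count0 M g) / t = \sum_(a <- Z) k a * phi a t.
  rewrite in_itv /= => /andP[t0 tr]; case: (ltrP 0 t) => tp; last first.
    (* At [t = 0] the quotient is 0 by convention, and no zero satisfies [|a| < 0]. *)
    have -> : t = 0 by apply/eqP; rewrite eq_le tp t0.
    rewrite invr0 mulr0 big1 // => a _; by rewrite /phi ifN ?mulr0 // -leNgt cabs_ge0.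
  have e1 : trunc_count M g t = \sum_(a \in [set z : C | cabs z < t]) k a by [].
  have e0 : trunc_count0 M g = k 0 by [].
  rewrite e1 e0.
  pose Zt := [seq z <- Z | cabs z < t].
  rewrite (@fsbig_list R _ (0 :: Zt) k).
  - rewrite big_cons addrAC subrr add0r mulr_suml /Zt big_filter [LHS]big_mkcond /=.
    by apply: eq_bigr => a _; rewrite /phi; case: ifP; rewrite ?mulr0.
  - by rewrite /= filter_uniq // andbT mem_filter; apply/negP => /andP[_ /ZP[]]; rewrite eqxx.
  - move=> a; rewrite inE => /predU1P[->|]; first by change (cabs (0 : C) < t); rewrite cabs0.
    by rewrite mem_filter => /andP[].
  - move=> a /= at_ ka; rewrite inE mem_filter at_; case: eqP => //= /eqP a0.
    by apply: inZ => //; exact: lt_le_trans tr.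
have zI a : a \in Z -> 0 < cabs a /\ cabs a < r by move=> /ZP[a0 ?]; rewrite cabs_gt0.
rewrite /Rintegral (@eq_integral _ _ _ mu `[0%R, r]%classic (fun t => (\sum_(a <- Z) (k a * phi a t)%:E)%E)); last first.
  move=> t; rewrite inE /= => tI; rewrite sumEFin; congr (_%:E); exact: cnt.
(* Extended by 0, so that measurability holds for every [a], as the exchange of sum and integral
   demands. *)
pose phi' (a : C) (t : R) : R := if a \in Z then phi a t else 0.
have phiE t : (\sum_(a <- Z) (k a * phi a t)%:E = \sum_(a <- Z) (k a * phi' a t)%:E)%E.
  by rewrite big_seq [RHS]big_seq; apply: eq_bigr => a aZ; rewrite /phi' aZ.
under eq_integral do rewrite phiE.
have mphi a : measurable_fun [set: R] (phi' a).
  rewrite /phi'; case: (boolP (a \in Z)) => [/zI[a0 ar]|_]; last exact: measurable_cst.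
  by have [] := integral_inv_above a0 ar.
have phi0 a t : 0 <= t -> 0 <= phi' a t.
  by move=> t0; rewrite /phi' /phi; case: ifP => // _; case: ifP => // _; rewrite invr_ge0.
have k0 a : 0 <= k a by rewrite /k ler0n.
rewrite ge0_integral_sum //; first last.
- by move=> a t; rewrite /= in_itv /= => /andP[t0 _]; rewrite lee_fin mulr_ge0 // phi0.
- move=> a; apply/measurable_EFinP; apply: measurable_funM; first exact: measurable_cst.
  exact: measurable_funS (mphi a).
have E a : a \in Z -> (\int[mu]_(t in `[0%R, r]) (k a * phi' a t)%:E = (k a * (ln r - ln (cabs a)))%:E)%E.
  move=> aZ; have [a0 ar] := zI a aZ; have [_ e] := integral_inv_above a0 ar.
  under eq_integral do rewrite EFinM.
  rewrite ge0_integralZl //; first last.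
  - by rewrite lee_fin.
  - by move=> t; rewrite /= in_itv /= => /andP[t0 _]; rewrite lee_fin phi0.
  - apply/measurable_EFinP; exact: measurable_funS (mphi a).
  by rewrite EFinM -e; congr (_ * _)%E; apply: eq_integral => t _; rewrite /phi' aZ.
by rewrite big_seq (eq_bigr _ E) -big_seq sumEFin.
Qed.

Lemma counting_le (M M' k : nat) (g h : C -> C) (r : R) : entire g -> nonzero g -> entire h -> nonzero h -> 1 <= r ->
  (forall a, (minn (zero_order h a) M <= k * minn (zero_order g a) M')%N) -> counting M h r <= k%:R * counting M' g r.
Proof.
move=> hg ng hh nh r1 hk; have r0 : 0 < r := lt_le_trans ltr01 r1.
have [L hL] := finite_zeros r hg ng; have [L' hL'] := finite_zeros r hh nh.
pose Z := [seq z <- undup (L ++ L') | (z != 0) && (cabs z < r)].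
have uZ : uniq Z by rewrite filter_uniq // undup_uniq.
have ZP a : a \in Z -> a != 0 /\ cabs a < r by rewrite mem_filter => /andP[/andP[-> ->]].
have inZ (f : C -> C) M0 : entire f -> (forall z, cabs z <= r -> f z = 0 -> z \in L ++ L') ->
    forall a, (a != 0 /\ cabs a < r) -> (minn (zero_order f a) M0)%:R * (ln r - ln (cabs a)) != 0 -> a \in Z.
  move=> hf hfL a [a0 ar] ka; rewrite mem_filter a0 ar mem_undup hfL ?(ltW ar) //.
  apply/eqP; apply: contraNT ka => fa; by rewrite (zero_order0 hf fa) min0n mul0r.
rewrite /counting (@fsbig_list R _ Z) //; last by apply: inZ => // z z1 z2; rewrite mem_cat hL' // orbT.
rewrite (@fsbig_list R _ Z) //; last by apply: inZ => // z z1 z2; rewrite mem_cat hL.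
rewrite mulrDr mulr_sumr lerD //.
  by rewrite mulrA -natrM ler_wpM2r ?ln_ge0 // ler_nat.
rewrite big_seq [leRHS]big_seq; apply: ler_sum => a /ZP[a0 ar].
rewrite mulrA -natrM ler_wpM2r ?ler_nat //.
by rewrite subr_ge0 ler_ln ?posrE ?cabs_gt0 // ltW.
Qed.
End CountingFunction.

(** * Minimal linear relations *)

Section Circuit.
Variables (R : realType) (T : finType).
Local Notation C := (Cplx R).
Implicit Types (U : T -> C -> C).

Definition relation U (c : T -> C) := forall z, \sum_o c o * U o z = 0.

Definition minimal_relation U (c : T -> C) := relation U c /\ forall b, relation U b ->
  (forall o, c o = 0 -> b o = 0) -> (exists2 o, c o != 0 & b o = 0) -> forall o, b o = 0.

(** A relation among all members of the support but [s ord0] extends by 0 to one that misses a point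
    of the support, so minimality makes it 0. *)
Lemma minimal_relation_enum U c m : minimal_relation U c -> #|[pred o | c o != 0]| = m.+2 ->
  exists s : 'I_m.+2 -> T, [/\ injective s, forall o, c o != 0 -> exists k, o = s k, forall k, c (s k) != 0,
    forall z, \sum_k c (s k) * U (s k) z = 0 & @independent R m.+1 (fun j => U (s (lift ord0 j)))].
Proof.
move=> [rc mc] cm; pose s (k : 'I_m.+2) : T := enum_val (cast_ord (esym cm) k).
have si : injective s by move=> k l /enum_val_inj /cast_ord_inj.
have sc k : c (s k) != 0 by have := enum_valP (cast_ord (esym cm) k); rewrite inE.
have sE o : c o != 0 -> exists k, o = s k.
  move=> co; have oI : o \in [pred o | c o != 0] by rewrite inE.
  by exists (cast_ord cm (enum_rank_in oI o)); rewrite /s cast_ordK enum_rankK_in.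
have reix (F : T -> C) : (forall o, c o = 0 -> F o = 0) -> \sum_o F o = \sum_k F (s k).
  move=> F0; rewrite (bigID (fun o => c o != 0)) /= addrC big1 => [|o /negPn/eqP /F0 //].
  rewrite add0r (eq_bigl [in [pred o | c o != 0]]); last by move=> o; rewrite !inE.
  rewrite big_enum_val (reindex (cast_ord (esym cm))) //.
  by exists (cast_ord cm) => k _; rewrite ?cast_ordK ?cast_ordKV.
exists s; split=> //.
  by move=> z; rewrite -(reix (fun o => c o * U o z)) ?rc // => o ->; rewrite mul0r.
move=> b hb.
pose b' o := \sum_j b j * (o == s (lift ord0 j))%:R.
have b's j : b' (s (lift ord0 j)) = b j.
  rewrite /b' (bigD1 j) //= eqxx mulr1 big1 ?addr0 // => k kj.
  case: eqP => [/si/lift_inj e|_]; last by rewrite mulr0.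
  by rewrite e eqxx in kj.
have b'0 : b' (s ord0) = 0.
  by rewrite /b' big1 // => j _; case: eqP => [/si|_]; rewrite ?mulr0.
have b'n o : c o = 0 -> b' o = 0.
  move=> co; rewrite /b' big1 // => j _; case: eqP => [oE|_]; rewrite ?mulr0 //.
  by have := sc (lift ord0 j); rewrite -oE co eqxx.
have rb : relation U b'.
  move=> z; rewrite (reix (fun o => b' o * U o z)); last by move=> o /b'n ->; rewrite mul0r.
  rewrite big_ord_recl b'0 mul0r add0r -[RHS](hb z); apply: eq_bigr => j _; by rewrite b's.
by move=> j; rewrite -b's; apply: (mc b' rb b'n); exists (s ord0).
Qed.

(** A relation with the least number of nonzero coefficients is minimal. The predicate [A] confines
    the support, so that the added form can be kept out. *)
Lemma minimal_relation_exists U (A : pred T) c0 : relation U c0 -> (forall o, ~~ A o -> c0 o = 0) -> (exists o, c0 o != 0) ->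
  exists c, [/\ minimal_relation U c, forall o, ~~ A o -> c o = 0 & exists o, c o != 0].
Proof.
move=> r0 A0 n0.
pose P k := `[< exists c, [/\ relation U c, forall o, ~~ A o -> c o = 0, exists o, c o != 0 & #|[pred o | c o != 0]| = k] >].
have exP : exists k, P k by exists #|[pred o | c0 o != 0]|; apply/asboolP; exists c0; split.
case: (ex_minnP exP) => k /asboolP[c [rc Ac nc ck]] kmin.
exists c; split=> //; split=> // b rb bc [p1 cp1 bp1] o; apply/eqP/negPn/negP => bo.
have : P #|[pred o | b o != 0]|.
  by apply/asboolP; exists b; split=> //; [move=> o' /Ac /bc|exists o].
move=> /kmin; apply/negP; rewrite -ltnNge -ck; apply: proper_card; apply/properP; split.
  by apply/fintype.subsetP => o'; rewrite !inE; apply: contraNneq => /bc ->.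
by exists p1; rewrite !inE // bp1 eqxx.
Qed.
End Circuit.

(** * Nonvanishing of forms along the curve *)

Section Polynomials.
Variables (R : realType) (N : nat).
Local Notation C := (Cplx R).

Lemma digits_inj B n (a b : nat -> nat) : (forall i, (a i < B)%N) -> (forall i, (b i < B)%N) ->
  (\sum_(i < n) a i * B ^ i = \sum_(i < n) b i * B ^ i)%N -> forall i, (i < n)%N -> a i = b i.
Proof.
elim: n a b => [//|n IH] a b ha hb.
have E (c : nat -> nat) : (\sum_(i < n.+1) c i * B ^ i = c 0%N + (\sum_(i < n) c i.+1 * B ^ i) * B)%N.
  rewrite big_ord_recl expn0 muln1 big_distrl /=; congr (_ + _)%N.
  by apply: eq_bigr => i _; rewrite /bump /= add1n expnSr mulnA.
rewrite !E => e.
have e0 : a 0%N = b 0%N.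
  by have := congr1 (modn^~ B) e; rewrite /= !(addnC _ (_ * B)%N) !modnMDl !modn_small.
have B0 : (0 < B)%N := leq_ltn_trans (leq0n _) (ha 0%N).
have e1 : (\sum_(i < n) a i.+1 * B ^ i = \sum_(i < n) b i.+1 * B ^ i)%N.
  by move: e; rewrite e0 => /addnI /eqP; rewrite eqn_pmul2r // => /eqP.
case=> [//|i] /=; rewrite ltnS => /(IH _ _ (fun i => ha i.+1) (fun i => hb i.+1) e1); done.
Qed.

(* Kronecker substitution [x_i = t ^ (B ^ i)]. *)
Lemma poly_nonvanishing (P : hpoly R N) : P != 0 -> exists x : coords R N, is_point x /\ meval x P != 0.
Proof.
move=> P0; pose B := mmeasure (@mdeg N.+1) P.
have mB m i : m \in msupp P -> (m i < B)%N.
  by move=> /msize_mdeg_lt; apply: leq_ltn_trans; rewrite mdegE (bigD1 i) //= leq_addr.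
pose kap (m : multinom N.+1) := (\sum_(i < N.+1) m i * B ^ i)%N.
have kinj m m' : m \in msupp P -> m' \in msupp P -> kap m = kap m' -> m = m'.
  move=> mP mP' e; apply/mnmP => i.
  pose ex (m : multinom N.+1) (k : nat) := if insub k is Some i then m i else 0%N.
  have exE (m0 : multinom N.+1) (j : 'I_N.+1) : ex m0 j = m0 j by rewrite /ex; case: insubP => [k _ kj|]; [congr (m0 _); exact: val_inj|rewrite ltn_ord].
  have exB m0 k : m0 \in msupp P -> (ex m0 k < B)%N.
    rewrite /ex => m0P; case: insubP => [j _ _|_]; first exact: mB.
    by apply: leq_ltn_trans (mB m0 ord0 m0P).
  have ek m0 : (\sum_(i < N.+1) ex m0 i * B ^ i)%N = kap m0 by apply: eq_bigr => j _; rewrite exE.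
  rewrite -!exE; apply: (@digits_inj B N.+1 (ex m) (ex m')) => //; first by move=> k; exact: exB.
    by move=> k; exact: exB.
  by rewrite !ek.
pose p : {poly C} := \sum_(m <- msupp P) mcoeff m P *: 'X^(kap m).
have p0 : p != 0.
  have [m0 m0P] : exists m, m \in msupp P.
    by case E : (msupp P) => [|m s]; [move: P0; rewrite -msupp_eq0 E|exists m; rewrite inE eqxx].
  apply/eqP => /(congr1 (fun r : {poly C} => r`_(kap m0))); rewrite coef0 coef_sum (bigD1_seq m0) //=.
  rewrite coefZ coefXn eqxx mulr1 big_seq_cond big1 ?addr0; last first.
    move=> m /andP[mP mm]; rewrite coefZ coefXn; case: eqP => [/kinj e|_]; last by rewrite mulr0.
    by rewrite e // eqxx in mm.
  by move/eqP; apply/negP; rewrite -mcoeff_msupp.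
have [t t0 pt] : exists2 t : C, t != 0 & p.[t] != 0.
  (* The natural numbers below the size of [p * 'X] are too many to be all roots, and one that is
     not a root is nonzero as well. *)
  have pX : p * 'X != 0 by rewrite mulf_neq0 // polyX_eq0.
  pose l := [seq (i%:R : C) | i <- iota 0 (size (p * 'X))].
  have [/allP al|/allPn[t _ /negP pt]] := boolP (all (root (p * 'X)) l).
    have := max_poly_roots pX (introT allP al) _; rewrite size_map size_iota ltnn; case/(_ _)/negP => //.
    by rewrite map_inj_uniq ?iota_uniq // => i j /eqP; rewrite eqr_nat => /eqP.
  move: pt => /negP; rewrite rootE hornerM hornerX mulf_eq0 negb_or => /andP[pt t0].
  by exists t.
exists (fun i => t ^+ (B ^ i)); split; first by exists ord0; rewrite expf_neq0.
suff -> : meval (fun i : 'I_N.+1 => t ^+ (B ^ i)) P = p.[t] by [].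
rewrite mevalE horner_sum; apply: eq_bigr => m _; rewrite hornerZ hornerXn; congr (_ * _).
by rewrite /kap -prodrXr; apply: eq_bigr => i _; rewrite -exprM mulnC.
Qed.

Lemma entire_meval (f : C -> coords R N) (P : hpoly R N) : (forall i, entire (fun z => f z i)) -> entire (fun z => meval (f z) P).
Proof.
move=> hf.
have -> : (fun z => meval (f z) P) = fun z => \sum_(m <- msupp P) mcoeff m P * \prod_i f z i ^+ m i.
  by apply/funext => z; rewrite mevalE.
apply: entire_sum => m; apply: entireZ; apply: entire_prod => i; exact: (@entireX R (fun z => f z i) (m i) (hf i)).
Qed.

(** By [poly_nonvanishing] the zero locus of [P] is a proper algebraic subset, so it cannot contain
    the image of the curve. *)
Lemma nondegenerate_form (f : C -> coords R N) (P : hpoly R N) e : holomorphic_curve f -> algebraically_nondegenerate f ->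
  P != 0 -> homogeneous e P -> nonzero (fun z => meval (f z) P).
Proof.
move=> [_ fp] hnd P0 hP; apply: contrapT => /nonzeroPn f0.
apply: (hnd (zero_locus [set P])).
- by exists [set P] => // P' ->; exists e.
- split=> [x []//|h]; have [x [xp xP]] := poly_nonvanishing P0.
  by have [_ /(_ P erefl) xP0] := h x xp; rewrite xP0 eqxx in xP.
- by move=> x [z _ <-]; split=> // P' ->; exact: f0.
Qed.
End Polynomials.

(** For every positive [de], [ln y <= de * y - ln de]. A small [de] brings the linear term below
    [eps / 2 * T], and the other half absorbs the constant once [T] is large. *)
Lemma log_sublinear (R : realType) (a b A k eps : R) : 0 <= a -> 0 <= A -> 0 < k -> 0 < eps ->
  exists T0 : R, forall T, T0 <= T -> 0 < k * T + A -> k^-1 * (a * (1 + ln (k * T + A)) + b) <= eps * T.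
Proof.
move=> a0 A0 k0 e0; pose de := eps / (2 * (a + 1)).
have de0 : 0 < de by rewrite divr_gt0 // mulr_gt0 //; lra.
have ade : a * de <= eps / 2.
  have -> : eps / 2 = (a + 1) * de by rewrite /de; field; lra.
  by rewrite ler_pM2r //; lra.
pose c := k^-1 * (a * (1 + de * A - ln de) + b).
exists (2 * `|c| / eps) => T hT y0.
have lny : ln (k * T + A) <= de * (k * T + A) - ln de.
  have dy : 0 < de * (k * T + A) by rewrite mulr_gt0.
  have := expR_ge1Dx (ln (de * (k * T + A))); rewrite (lnK dy) (lnM de0 y0); lra.
have T0 : 0 <= T by apply: le_trans hT; rewrite divr_ge0 ?mulr_ge0 // ltW.
have cT : `|c| <= eps / 2 * T by move: hT; rewrite ler_pdivrMr //; lra.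
apply: (@le_trans _ _ (a * de * T + c)).
  have -> : a * de * T + c = k^-1 * (a * (1 + (de * (k * T + A) - ln de)) + b).
    by rewrite /c; field; lra.
  by rewrite ler_pM2l ?invr_gt0 // lerD2r ler_wpM2l // lerD2l.
have := ler_wpM2r T0 ade; have := ler_norm c; lra.
Qed.

(** * The curve and its hypersurfaces *)

Section Main.
Variables (R : realType) (N q : nat).
Hypotheses (hN : (1 <= N)%N) (hq : (N < q)%N).
Local Notation C := (Cplx R).
Variables (d : 'I_q -> nat) (Q : 'I_q -> hpoly R N).
Hypothesis hQ : forall j, hypersurface (d j) (Q j).
Hypothesis hgp : general_position Q.
Hypothesis hn : (1 < lcm_degrees d)%N.
Hypothesis hsum : sum_form d Q != 0.
Variable f : C -> coords R N.
Hypothesis hf : holomorphic_curve f.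
Hypothesis hnd : algebraically_nondegenerate f.

Local Notation n := (lcm_degrees d).
Local Notation e j := (n %/ d j)%N.

(** All of degree [n]: the powers of the given forms and, as [None], the added one. *)
Let form (o : option 'I_q) : hpoly R N := if o is Some j then Q j ^+ e j else sum_form d Q.
Let U o z := meval (f z) (form o).

Let n_gt0 : (0 < n)%N. Proof. exact: ltnW. Qed.

Let degree_gt0 j : (0 < d j)%N. Proof. by case: (hQ j). Qed.

Let degree_dvd j : (d j %| n)%N.
Proof. by rewrite /lcm_degrees (bigD1 j) //= dvdn_lcml. Qed.

Let degreeE j : (d j * e j)%N = n.
Proof. by rewrite mulnC divnK. Qed.

Let e_gt0 j : (0 < e j)%N.
Proof. by rewrite divn_gt0 // dvdn_leq. Qed.

Let form_homog o : form o \is ishomog1 n (@mdeg N.+1).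
Proof.
have h j : (Q j ^+ e j) \is ishomog1 n (@mdeg N.+1).
  by have [_ _ hj] := hQ j; have := dhomogMn (e j) hj; rewrite degreeE.
case: o => [j|] /=; first exact: h.
by rewrite /sum_form; apply: rpred_sum => j _; exact: h.
Qed.

Let form_neq0 o : form o != 0.
Proof. by case: o => [j|] //=; apply: expf_neq0; case: (hQ j). Qed.

Let U_entire o : entire (U o).
Proof. by apply: entire_meval; case: hf. Qed.

Let U_nonzero o : nonzero (U o).
Proof. exact: (nondegenerate_form hf hnd (form_neq0 o) (form_homog o)). Qed.

Let general_position_seq (L : seq 'I_q) x : uniq L -> (N < size L)%N -> (forall j, j \in L -> meval x (Q j) = 0) ->
  forall i, x i = 0.
Proof.
case: L => // j0 L uL sL LQ i; apply/eqP/negPn/negP => xi.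
have inj : injective (fun k : 'I_N.+1 => nth j0 (j0 :: L) k).
  by move=> k l /eqP; rewrite nth_uniq ?(leq_trans (ltn_ord _) sL) // => /eqP/val_inj.
have := hgp inj => /(congr1 (@^~ x)) /=; rewrite -[X in _ = X]/False => <- k _.
split; first by exists i.
by move=> _ ->; apply: LQ; rewrite mem_nth // (leq_trans (ltn_ord _) sL).
Qed.

Let form0 x j : meval x (form (Some j)) = 0 -> meval x (Q j) = 0.
Proof. by rewrite /= (rmorphXn (meval x)) /= => /eqP; rewrite expf_eq0 e_gt0 => /eqP. Qed.

(** By nondegeneracy the relation holds between the forms themselves. If its support had at most N +
    1 indices, the others than [j0] could be padded to N indices; their forms have a common zero
    other than the origin, there being N + 1 variables. The relation makes the form of [j0] vanish
    there too, against general position. *)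
Let relation_support (b : 'I_q -> C) j0 : (forall z, \sum_j b j * U (Some j) z = 0) -> b j0 != 0 ->
  (N.+1 < #|[pred j | b j != 0%R]|)%N.
Proof.
move=> rb b0; rewrite ltnNge; apply/negP => cI.
have P0 : \sum_j b j *: form (Some j) = 0.
  apply/eqP/negPn/negP => nP.
  have hP : homogeneous n (\sum_j b j *: form (Some j)).
    by apply: rpred_sum => j _; apply: dhomogZ; exact: form_homog.
  have [z] := nondegenerate_form hf hnd nP hP; rewrite (raddf_sum (meval (f z))) /=.
  under eq_bigr do rewrite mevalZ.
  by have := rb z; rewrite /U /= => ->; rewrite eqxx.
pose I0 := [pred j | (b j != 0) && (j != j0)].
pose A := [pred j | b j == 0].
have cI0 : #|[pred j | b j != 0]| = #|I0|.+1.
  rewrite (cardD1 j0) inE b0 add1n; congr (_.+1); apply: eq_card => j; by rewrite !inE andbC.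
have cA : (#|[pred j | b j != 0%R]| + #|A| = q)%N.
  by rewrite addnC -[RHS]card_ord -(cardC A); congr (_ + _)%N; apply: eq_card => j; rewrite !inE.
(* The support without [j0], filled up to length N by indices outside the support. *)
pose L := enum I0 ++ take (N - #|I0|) (enum A).
have uL : uniq (j0 :: L).
  rewrite /= mem_cat negb_or mem_enum !inE eqxx andbF /=; apply/andP; split.
    by apply/negP => /mem_take; rewrite mem_enum inE (negbTE b0).
  rewrite cat_uniq enum_uniq take_uniq ?enum_uniq // andbT; apply/hasPn => j /mem_take.
  by rewrite mem_enum inE => /eqP bj; rewrite mem_enum !inE bj eqxx.
have sL : size L = N.
  rewrite size_cat size_take -!cardE; move: cI cA; rewrite cI0 => cI cA.
  case: ltnP => h; first by rewrite subnKC.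
  have : (N <= #|I0| + #|A|)%N by have := leq_trans hq (eq_leq (esym cA)); rewrite addSn ltnS.
  by move=> h2; apply/eqP; rewrite eqn_leq h2 andbT -leq_subRL.
pose w (k : 'I_N) := form (Some (nth j0 L k)).
have := @forms_variables R N.+1 N n w (fun k => form_homog _) n_gt0; rewrite ltnn => h.
suff: false by []. apply: h => x hx.
apply: (@general_position_seq (j0 :: L)) => //; first by rewrite /= sL.
have hL j : j \in L -> meval x (form (Some j)) = 0.
  move=> jL; have kN : (index j L < N)%N by rewrite -sL index_mem.
  by have := hx (Ordinal kN); rewrite /w /= nth_index.
move=> j; rewrite inE => /predU1P[->|/hL]; last exact: form0.
apply: form0; have := congr1 (meval x) P0; rewrite meval0 (raddf_sum (meval x)) /= (bigD1 j0) //= big1.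
  by rewrite addr0 mevalZ => /eqP; rewrite mulf_eq0 (negbTE b0) => /eqP.
move=> j1 j1n; rewrite mevalZ; case: (eqVneq (b j1) 0) => [->|bj1]; first by rewrite mul0r.
by rewrite hL ?mulr0 // mem_cat mem_enum !inE bj1 j1n.
Qed.

Let sum_option (F : option 'I_q -> C) : \sum_o F o = F None + \sum_j F (Some j).
Proof.
rewrite (bigD1 None) //=; congr (_ + _).
rewrite (reindex_omap Some id) /=; last by case.
by apply: eq_bigl => j; rewrite eqxx.
Qed.

(** If the [U (Some j)] are independent, the only relation up to scalars is the one defining the
    added form, and all q + 1 functions are taken. Otherwise a minimal relation is chosen among the
    [U (Some j)], and [relation_support] supplies enough members. Both times [m.+2 <= q.+1]. *)
Let circuit_exists : exists m (s : 'I_m.+2 -> option 'I_q) (c : 'I_m.+2 -> C), [/\ (m <= q - 1)%N, injective s,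
  (N < #|[pred j | Some j \in codom s]|)%N, forall k, c k != 0 &
  (forall z, \sum_k c k * U (s k) z = 0) /\ @independent R m.+1 (fun j => U (s (lift ord0 j)))].
Proof.
have cT : #|{: option 'I_q}| = q.+1 by rewrite card_option card_ord.
have Si : injective (@Some 'I_q) by move=> x y [].
have fin c : minimal_relation U c -> (N < #|[pred j | c (Some j) != 0%R]|)%N -> exists m (s : 'I_m.+2 -> option 'I_q) (c : 'I_m.+2 -> C),
    [/\ (m <= q - 1)%N, injective s, (N < #|[pred j | Some j \in codom s]|)%N, forall k, c k != 0 &
    (forall z, \sum_k c k * U (s k) z = 0) /\ @independent R m.+1 (fun j => U (s (lift ord0 j)))].
  move=> mc cN.
  have c2 : (N < #|[pred o | c o != 0%R]|)%N.
    apply: leq_trans cN _; rewrite -(fintype.card_image Si); apply: subset_leq_card.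
    by apply/fintype.subsetP => o /mapP[j]; rewrite mem_enum !inE => ? ->.
  have [m cm] : exists m, #|[pred o | c o != 0]| = m.+2.
    by move: c2 (leq_ltn_trans hN c2); case: #|_| => [|[|m]] // _ _; exists m.
  have [s [si sE sc sr sI]] := minimal_relation_enum mc cm.
  exists m, s, (fun k => c (s k)); split=> //.
    have h : (m.+2 <= q.+1)%N by rewrite -cm -cT max_card.
    by rewrite leq_subRL ?add1n // (leq_ltn_trans (leq0n N) hq).
  apply: leq_trans cN _; apply: subset_leq_card; apply/fintype.subsetP => j; rewrite !inE => /sE[k ->].
  exact: codom_f.
have [iu|] := EM (independent (fun j => U (Some j))).
  (* The added form is the sum of the others. Any relation [b] satisfies [b (Some j) = - b None] for
     all [j] by independence, so one vanishing coefficient makes all of them vanish. *)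
  apply: (fin (fun o => if o is Some _ then 1 else -1)).
    split.
      move=> z; rewrite sum_option mulN1r; under eq_bigr do rewrite mul1r.
      by rewrite /U /= /sum_form (raddf_sum (meval (f z))) addNr.
    move=> b rb _ [p1 _ bp1].
    have hb j : b (Some j) + b None = 0.
      apply: (iu (fun j => b (Some j) + b None)) => z; have := rb z; rewrite sum_option => h; rewrite -[RHS]h.
      under eq_bigr do rewrite mulrDl.
      rewrite big_split /= addrC; congr (_ + _).
      by rewrite -mulr_sumr /U /= /sum_form (raddf_sum (meval (f z))).
    have b0 : b None = 0 by case: p1 bp1 => [j bj|//]; have := hb j; rewrite bj add0r.
    by case=> [j|//]; have := hb j; rewrite b0 addr0.
  apply: leq_trans hq _; rewrite -[leqLHS]card_ord; apply: subset_leq_card.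
  by apply/fintype.subsetP => j _; rewrite inE oner_neq0.
move=> ni.
have [b [rb [j0 bj0]]] : exists b : 'I_q -> C, (forall z, \sum_j b j * U (Some j) z = 0) /\ exists j, b j != 0.
  apply: contrapT => H; apply: ni => b rb j; apply/eqP/negPn/negP => bj; apply: H.
  by exists b; split=> //; exists j.
pose c0 (o : option 'I_q) := if o is Some j then b j else 0.
have r0 : relation U c0 by move=> z; rewrite sum_option /= mul0r add0r.
have A0 : forall o, ~~ isSome o -> c0 o = 0 by case.
have n0 : exists o, c0 o != 0 by exists (Some j0).
have [c [mc cA [p1 co]]] := minimal_relation_exists r0 A0 n0.
have cN : c None = 0 by exact: cA.
case: p1 co => [j1 cj1|]; last by rewrite cN eqxx.
apply: (fin c mc); apply: ltnW; apply: (relation_support (j0 := j1)) => // z.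
by have := mc.1 z; rewrite sum_option cN mul0r add0r.
Qed.

Let norm_gt0 z : 0 < curve_norm f z.
Proof.
have [i fi] := hf.2 z; apply: lt_le_trans (_ : cabs (f z i) <= _); first by rewrite cabs_gt0.
exact: (le_bigmax 0 (fun i => cabs (f z i)) i).
Qed.

Let norm_continuous s : continuous (fun t => ln (curve_norm f (circ s t))).
Proof.
have c : continuous (fun t => curve_norm f (circ s t)).
  exact: (@continuous_bigmax R R _ (index_enum 'I_N.+1) (fun i t => cabs (f (circ s t) i))
    (fun i => @continuous_cabs_comp R _ _ (@continuous_circ R (fun z => f z i) s (hf.1 i)))).
by move=> t; exact: (@cont_at_ln R _ t (fun t => curve_norm f (circ s t)) (norm_gt0 _) (c t)).
Qed.

Let characteristicE r : 0 < r -> characteristic f r = circ_mean (fun t => ln (curve_norm f (circ (ln r) t))).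
Proof.
move=> r0; rewrite /characteristic /circ_mean /segint; congr (_ * _).
have E : (fun t => ln (curve_norm f (Complex (r * cos t) (r * sin t)))) = (fun t => ln (curve_norm f (circ (ln r) t))).
  by apply/funext => t; rewrite /circ /cexp /= lnK.
by rewrite E.
Qed.

Let U_upper o : exists2 M : R, 0 <= M & forall z, cabs (U o z) <= M * curve_norm f z ^+ n.
Proof.
have [M M0 hM] := form_bound (form_homog o); exists M => // z.
apply: hM; last exact: ltW.
by move=> i; exact: (le_bigmax 0 (fun i => cabs (f z i)) i).
Qed.

(* Jensen's formula for a linear form in f that vanishes at the origin. *)
Let characteristic_lower : exists C0 : R, outside (fun r => 1 < r -> ln r <= characteristic f r + C0).
Proof.
have [k fk] := hf.2 0.
have [l lk] : exists l : 'I_N.+1, l != k.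
  have [->|k0] := eqVneq k ord0; last by exists ord0; rewrite eq_sym.
  by exists ord_max; rewrite -val_eqE /= -lt0n.
(* It vanishes at [f 0] by symmetry and is not 0 because [f 0 k != 0]; this needs a second
   coordinate [l], hence N >= 1. *)
pose L : hpoly R N := f 0 k *: mpolyX C (mnm1 l) - f 0 l *: mpolyX C (mnm1 k).
have hL : L \is ishomog1 1 (@mdeg N.+1) by apply: rpredB; apply: dhomogZ; rewrite dhomogX /= mdeg1.
have L0 : L != 0.
  apply/eqP => /(congr1 (mcoeff (mnm1 l))); rewrite mcoeff0 mcoeffB !mcoeffZ !mcoeffX eqxx mulr1.
  case: eqP => [/mnmP /(_ l)|_]; last by rewrite mulr0 subr0 => /eqP; rewrite (negbTE fk).
  by rewrite !mnm1E eqxx eq_sym (negbTE lk).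
pose g z := meval (f z) L.
have hg : entire g by apply: entire_meval; exact: hf.1.
have ng : nonzero g := nondegenerate_form hf hnd L0 hL.
have g0 : g 0 = 0 by rewrite /g mevalB !mevalZ !mevalXU mulrC subrr.
have [M M0 hM] := form_bound hL.
have [Cg hCg] := jensen_formula hg ng.
exists (ln (M + 1) - Cg); have := outside_singular hg ng; apply: outside_imp => r hr r1.
have r0 : 0 < r by lra.
have er : expR (ln r) = r by rewrite lnK.
have lr0 : 0 <= ln r by rewrite ln_ge0 // ltW.
have M1 : 0 < M + 1 by lra.
have [Lz hLz] := finite_zeros r hg ng.
pose Z := [seq z <- undup Lz | (z != 0) && (cabs z < r)].
have e1 : Cg + ln r <= logmean g (ln r).
  rewrite (hCg (ln r) Z).
  - rewrite -addrA lerD2l -[leLHS]addr0 lerD //.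
      by rewrite ler_peMl // ler1n zero_order_gt0.
    rewrite big_seq sumr_ge0 // => a; rewrite mem_filter => /andP[/andP[a0 ar] _].
    by rewrite mulr_ge0 ?ler0n // subr_ge0 ler_ln ?posrE ?cabs_gt0 // ltW.
  - by rewrite filter_uniq // undup_uniq.
  - by move=> a; rewrite er mem_filter => /andP[/andP[-> ->]].
  - rewrite er => z z0 zr gz; rewrite mem_filter z0 mem_undup hLz // andbT /= lt_neqAle zr andbT.
    by apply/eqP => e'; have := hr z e'; rewrite gz eqxx.
have gc t : g (circ (ln r) t) != 0 by apply: hr; rewrite cabs_circ.
have e2 : logmean g (ln r) <= characteristic f r + ln (M + 1).
  rewrite characteristicE // -(circ_mean_cst (ln (M + 1))) -(circ_meanD (@norm_continuous (ln r)) (@continuous_cst _ _ _)).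
  apply: circ_mean_le.
  - exact: continuous_logcirc.
  - exact: (contR_D (@norm_continuous (ln r)) (@continuous_cst _ _ _)).
  move=> t; rewrite -lnM ?posrE // ler_ln ?posrE ?cabs_gt0 ?mulr_gt0 //.
  have h := hM (f (circ (ln r) t)) (curve_norm f (circ (ln r) t)) (fun i => le_bigmax 0 (fun i => cabs (f _ i)) i) (ltW (norm_gt0 _)).
  apply: le_trans h _; rewrite expr1 mulrC ler_pM2l // lerDl //.
lra.
Qed.

(** [min (e k, M) <= e min (k, M)], so passing from the power back to [Q j] costs the factor [e j],
    which becomes [1 / d j] after division by [n]. Injectivity of [s] keeps a function from being
    counted twice. *)
Let counting_sum m (s : 'I_m.+2 -> option 'I_q) r : (m <= q - 1)%N -> injective s -> 1 <= r ->
  \sum_k counting m (U (s k)) r <= \sum_j (e j)%:R * trunc_counting (q - 1) f (Q j) r + trunc_counting (q - 1) f (sum_form d Q) r.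
Proof.
move=> mq si r1; have r0 : 0 < r := lt_le_trans ltr01 r1.
have Nc0 M o : 0 <= counting M (U o) r.
  rewrite /counting addr_ge0 ?mulr_ge0 ?ln_ge0 ?ler0n //.
  apply: fsumr_ge0 => a [a0 ar]; rewrite mulr_ge0 ?ler0n // subr_ge0 ler_ln ?posrE ?cabs_gt0 //; exact: ltW.
apply: (@le_trans _ _ (\sum_o counting (q - 1) (U o) r)).
  apply: (@le_trans _ _ (\sum_k counting (q - 1) (U (s k)) r)).
    apply: ler_sum => k _; rewrite -[leRHS]mul1r.
    apply: (@counting_le R m (q - 1) 1 (U (s k)) (U (s k)) r) => // a.
    by rewrite mul1n leq_min geq_minl (leq_trans (geq_minr _ _)).
  rewrite (bigID (fun o => o \in codom s)) /= ler_wpDr ?sumr_ge0 //.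
  rewrite le_eqVlt; apply/orP; left; apply/eqP.
  rewrite -big_uniq; first by rewrite /codom /image_mem big_map big_enum.
  by rewrite map_inj_uniq // enum_uniq.
have -> : \sum_o counting (q - 1) (U o) r = \sum_j counting (q - 1) (U (Some j)) r + counting (q - 1) (U None) r.
  rewrite (bigD1 None) //= addrC; congr (_ + _).
  rewrite (reindex_omap Some id) /=; last by case.
  by apply: eq_bigl => j; rewrite eqxx.
rewrite lerD //; last by rewrite (@trunc_countingE R N (q - 1) f (sum_form d Q) r (@U_entire None) (@U_nonzero None) r0).
apply: ler_sum => j _.
have ng : nonzero (fun z => meval (f z) (Q j)).
  by have [_ Q0 hj] := hQ j; exact: (nondegenerate_form hf hnd Q0 hj).
have hg : entire (fun z => meval (f z) (Q j)) by apply: entire_meval; exact: hf.1.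
rewrite (@trunc_countingE R N (q - 1) f (Q j) r hg ng r0).
apply: (@counting_le R (q - 1) (q - 1) (e j) (fun z => meval (f z) (Q j)) (U (Some j)) r hg ng (@U_entire _) (@U_nonzero _) r1) => a.
have -> : U (Some j) = fun z => meval (f z) (Q j) ^+ e j by apply/funext => z; rewrite /U /= (rmorphXn (meval (f z))).
rewrite (zero_orderX a (e j) hg ng) minnMr leq_min geq_minl /= (leq_trans (geq_minr _ _)) // leq_pmull //; exact: e_gt0.
Qed.

Lemma second_main_inequality : le_outside_finite_measure (characteristic f)
  (fun r => \sum_(j < q) (d j)%:R^-1 * trunc_counting (q - 1) f (Q j) r
            + n%:R^-1 * trunc_counting (q - 1) f (sum_form d Q) r)
  (characteristic f).
Proof.
have [m [s [c [mq si sN c0 [rc ic]]]]] := circuit_exists.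
have nr0 : 0 < n%:R :> R by rewrite ltr0n.
(* More than N of the chosen forms come from the given hypersurfaces, so only the origin is a common
   zero. This gives both the absence of common zeros for Cartan's theorem and the comparison with
   the norm of [f]. *)
have nz0 x : (forall k, meval x (form (s k)) = 0) -> forall i, x i = 0.
  move=> xs; apply: (@general_position_seq (enum [pred j | Some j \in codom s])) => //.
  - exact: enum_uniq.
  - by rewrite -cardE.
  - by move=> j; rewrite mem_enum inE => /codomP[k jk]; apply: form0; rewrite jk.
have nz z : exists k, U (s k) z != 0.
  apply: contrapT => /forallNP H; case: (hf.2 z) => i; rewrite (nz0 (f z)) ?eqxx // => k.
  by apply/eqP/negPn/negP; exact: H.
have [K K0 hK] := @cartan R m (fun k => U (s k)) c (fun k => @U_entire (s k)) ic rc c0 nz.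
have [M1 M10 hM1] := norm_le_forms (fun k => form_homog (s k)) n_gt0 nz0.
have [Mu hMu] := choice (fun k => let: ex_intro2 M M0 hM := U_upper (s k) in ex_intro _ M (conj M0 hM)).
pose M2 := 1 + \sum_k Mu k.
have M20 : 0 < M2 by rewrite ltr_pwDl // sumr_ge0 // => k _; case: (hMu k).
pose Mx z := \big[Num.max/0]_k cabs (U (s k) z).
have leM k z : cabs (U (s k) z) <= Mx z by exact: (le_bigmax 0 (fun k => cabs (U (s k) z)) k).
have Mx0 z : 0 < Mx z by have [k uk] := nz z; apply: lt_le_trans (leM k z); rewrite cabs_gt0.
have hM2 z : Mx z <= M2 * curve_norm f z ^+ n.
  have p0 : 0 <= curve_norm f z ^+ n by rewrite exprn_ge0 // ltW.
  apply: bigmax_le => [|k _]; first by rewrite mulr_ge0 // ltW.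
  have [Mk0 hk] := hMu k; apply: le_trans (hk z) _; rewrite ler_wpM2r // /M2 (bigD1 k) //= addrCA lerDl.
  by rewrite addr_ge0 // sumr_ge0 // => l _; case: (hMu l).
have cMx t0 : continuous (fun t => ln (Mx (circ t0 t))).
  have cM : continuous (fun t => Mx (circ t0 t)).
    exact: (@continuous_bigmax R R _ (index_enum 'I_m.+2) (fun k t => cabs (U (s k) (circ t0 t)))
      (fun k => @continuous_cabs_comp R _ _ (@continuous_circ R (U (s k)) t0 (@U_entire (s k))))).
  by move=> t; exact: (@cont_at_ln R _ t (fun t => Mx (circ t0 t)) (Mx0 _) (cM t)).
have cst c' : continuous (fun _ : R => c' : R) := @continuous_cst R R c'.
have cn t0 : continuous (fun t => n%:R * ln (curve_norm f (circ t0 t))) := contR_M (cst n%:R) (@norm_continuous t0).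
have nln z : n%:R * ln (curve_norm f z) = ln (curve_norm f z ^+ n) by rewrite lnXn // mulr_natl.
have b1 r : 0 < r -> n%:R * characteristic f r <= logmax (fun k => U (s k)) (ln r) + ln M1.
  move=> r0; rewrite characteristicE // -(circ_meanZ _ (@norm_continuous (ln r))) -[ln M1]circ_mean_cst.
  rewrite -(circ_meanD (cMx (ln r)) (cst _)); apply: circ_mean_le; [exact: cn|exact: (contR_D (cMx _) (cst _))|move=> t].
  rewrite nln -lnM ?posrE ?Mx0 // ler_ln ?posrE ?mulr_gt0 ?Mx0 ?exprn_gt0 // mulrC; exact: hM1.
have b2 r : 0 < r -> logmax (fun k => U (s k)) (ln r) <= n%:R * characteristic f r + ln M2.
  move=> r0; rewrite characteristicE // -(circ_meanZ _ (@norm_continuous (ln r))) -[ln M2]circ_mean_cst.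
  rewrite -(circ_meanD (cn (ln r)) (cst _)); apply: circ_mean_le; [exact: cMx|exact: (contR_D (cn _) (cst _))|move=> t].
  rewrite nln -lnM ?posrE ?exprn_gt0 // ler_ln ?posrE ?mulr_gt0 ?Mx0 ?exprn_gt0 // mulrC; exact: hM2.
have [C0 hC0] := characteristic_lower.
(* The estimates require [r > 1]; the interval [[0, 1]] goes into the exceptional set. *)
have o1 : outside (fun r : R => 0 <= r -> 1 < r).
  exists `[0, 1]%classic.
    by split; [exact: measurable_itv|rewrite lebesgue_measure_itv /= lte_fin ltr01 oppr0 adde0 ltry].
  by move=> r nr r0; rewrite ltNge; apply/negP => r1; apply: nr; rewrite /= in_itv /= r0.
have [E mE hE] := outside_and (outside_and hK hC0) o1.
(* The number [n T_f + A] has to dominate 1, [ln r] and the mean [logmax]; given [ln r <= T_f + C0],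
   the three summands of [A] ensure this. *)
pose A := n%:R * `|C0| + 1 + `|ln M2|.
have n1 : 1 <= n%:R :> R by rewrite ler1n.
have nC0 : 0 <= n%:R * `|C0| by rewrite mulr_ge0 // ltW.
have A0 : 0 <= A by rewrite /A !addr_ge0.
have TE r : ~ E r -> 0 <= r -> [/\ 1 < r, ln r <= characteristic f r + C0,
    1 <= n%:R * characteristic f r + A, ln r <= n%:R * characteristic f r + A &
    logmax (fun k => U (s k)) (ln r) <= n%:R * characteristic f r + A].
  move=> nE r0; have [[_ hl] h1] := hE r nE; have r1 := h1 r0; have {}hl := hl r1.
  have lr0 : 0 <= ln r by rewrite ln_ge0 // ltW.
  have := ler_norm C0; have := ler_norm (ln M2); have := normr_ge0 (ln M2).
  have hb := b2 r (lt_trans ltr01 r1).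
  have hm : n%:R * ln r <= n%:R * characteristic f r + n%:R * C0 by rewrite -mulrDr ler_pM2l.
  have hc : n%:R * C0 <= n%:R * `|C0| by rewrite ler_pM2l // ler_norm.
  have hl2 : ln r <= n%:R * ln r by rewrite ler_peMl.
  rewrite /A; move: (characteristic f r) (ln r) (logmax _ _) (ln M2) (`|ln M2|) (n%:R * C0) (n%:R * `|C0|) hl hb hm hc hl2 nC0 lr0 => *.
  by split=> //; lra.
exists E; split; [exact: mE.1|exact: mE.2|].
(* The error has to be small against T_f for all large [r], also for those in [E], where no lower
   bound of T_f is at hand; it is set to 0 there. *)
exists (fun r => if `[< E r >] then 0 else
    n%:R^-1 * (K * (1 + ln (n%:R * characteristic f r + A)) + `|ln M1|)).
  move=> eps eps0; have [T0 hT0] := log_sublinear `|ln M1| K0 A0 nr0 eps0.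
  (* Beyond this radius [ln r <= T_f + C0] forces T_f above both [T0] and 0. *)
  exists (Num.max 1 (expR (Num.max T0 0 + `|C0|))); split; first exact: num_real.
  move=> r; rewrite gt_max => /andP[r1 rT].
  have r0 : 0 < r by lra.
  case: asboolP => nE; first by rewrite normr0 mulr_ge0 // ltW.
  have [_ hl T1 _ _] := TE r nE (ltW r0).
  have lT : Num.max T0 0 + `|C0| < ln r by rewrite -[ltLHS]expRK ltr_ln ?posrE ?expR_gt0.
  have mT : Num.max T0 0 <= characteristic f r by have := ler_norm C0; lra.
  move: mT; rewrite ge_max => /andP[tT t0].
  have y0 : 0 < n%:R * characteristic f r + A := lt_le_trans ltr01 T1.
  rewrite ger0_norm; first by rewrite (ger0_norm t0); exact: hT0.
  by rewrite mulr_ge0 ?invr_ge0 ?(ltW nr0) // addr_ge0 // mulr_ge0 // addr_ge0 // ln_ge0.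
move=> r r0 nE; rewrite ifN; last exact/asboolPn.
have [r1 _ T1 lT mT] := TE r nE r0; have [[hc _] _] := hE r nE.
have h1 := hc r1 _ T1 lT mT.
have h2 := b1 r (lt_trans ltr01 r1).
have h3 := counting_sum mq si (ltW r1).
have h4 := ler_norm (ln M1).
have -> : \sum_(j < q) (d j)%:R^-1 * trunc_counting (q - 1) f (Q j) r + n%:R^-1 * trunc_counting (q - 1) f (sum_form d Q) r =
    n%:R^-1 * (\sum_j (e j)%:R * trunc_counting (q - 1) f (Q j) r + trunc_counting (q - 1) f (sum_form d Q) r).
  rewrite [RHS]mulrDr mulr_sumr; congr (_ + _); apply: eq_bigr => j _; rewrite mulrA; congr (_ * _).
  have n_prod : n%:R = (d j)%:R * (e j)%:R :> R by rewrite -natrM degreeE.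
  have ej : (e j)%:R != 0 :> R by rewrite pnatr_eq0 -lt0n e_gt0.
  by rewrite n_prod invfM -mulrA mulVf ?mulr1.
rewrite -mulrDr ler_pdivlMl //; lra.
Qed.
End Main.

Theorem theorem3 (R : realType) (N q : nat) (hN : (1 <= N)%N) (hq : (N < q)%N)
  (d : 'I_q -> nat) (Q : 'I_q -> hpoly R N)
  (hQ : forall j, hypersurface (d j) (Q j))
  (hgp : general_position Q)
  (hn : (1 < lcm_degrees d)%N)
  (hsum : sum_form d Q != 0)
  (f : Cplx R -> coords R N)
  (hf : holomorphic_curve f)
  (hnd : algebraically_nondegenerate f) :
  le_outside_finite_measure
    (characteristic f)
    (fun r => \sum_(j < q) (d j)%:R^-1 * trunc_counting (q - 1) f (Q j) r
              + (lcm_degrees d)%:R^-1 * trunc_counting (q - 1) f (sum_form d Q) r)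
    (characteristic f).
Proof. exact: (second_main_inequality hN hq hQ hgp hn hsum hf hnd). Qed.
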